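(* Let $d\ge2$, $0<\lambda_-<\lambda_+<\infty$ and $\mathcal K=\{\Sigma\in\mathcal S^{++}(d):\lambda_- I\preceq\Sigma\preceq\lambda_+ I\}$. Assume that $X_1,X_2,\dots$ are i.i.d. from $\mathrm{HWN}_d(\mu_0,\Sigma_0)$, that $(\mu_0,\Sigma_0)\in\mathbb H^d\times\operatorname{int}(\mathcal K)$, and that the Fisher information matrix $\mathcal I(\vartheta_0)$ is positive definite. Let $(\hat\mu_n,\hat\Sigma_n)$ be any measurable maximizer of $\ell_n$ over $\mathbb H^d\times\mathcal K$ and let $\hat\alpha_n:=\operatorname{Log}_{\mu_0}(\hat\mu_n)\in\mathbb R^d$. Then $$\sqrt n\,\hat\alpha_n=\mathcal I_{\alpha\alpha\cdot\beta}^{-1}\frac1{\sqrt n}\sum_{i=1}^n\tilde{\mathsf s}_\alpha(X_i)+o_p(1)\qquad\text{and}\qquad\sqrt n\,\hat\alpha_n\Rightarrow N\bigl(0,\mathcal I_{\alpha\alpha\cdot\beta}^{-1}\bigr).$$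
   Context: Hyperbolic space (Lorentz model): for $x,y\in\mathbb R^{d+1}$ let $\langle x,y\rangle_L=-x_0y_0+\sum_{j=1}^d x_jy_j$, and $\mathbb H^d=\{x\in\mathbb R^{d+1}:\langle x,x\rangle_L=-1,\ x_0>0\}$ with the Riemannian metric induced by $\langle\cdot,\cdot\rangle_L$ on tangent spaces. Let $o=(1,0,\dots,0)$. $\operatorname{Exp}_\mu:T_\mu\mathbb H^d\to\mathbb H^d$ is the Riemannian exponential map (a global diffeomorphism), $\operatorname{Log}_\mu$ its inverse, $PT_{x\to y}:T_x\mathbb H^d\to T_y\mathbb H^d$ parallel transport along the unique geodesic from $x$ to $y$. $T_o\mathbb H^d$ is identified with $\mathbb R^d$ by $(0,v)\leftrightarrow v$, and $T_{\mu_0}\mathbb H^d$ with $\mathbb R^d$ by a fixed linear isometry. Set $\mathsf T_\mu(x)=PT_{o\to\mu}^{-1}(\operatorname{Log}_\mu(x))\in\mathbb R^d$. $\mathcal S^{++}(d)$ is the set of real symmetric positive definite $d\times d$ matrices; $\preceq$ is the Loewner order. For $\mu\in\mathbb H^d$, $\Sigma\in\mathcal S^{++}(d)$, $\mathrm{HWN}_d(\mu,\Sigma)$ is the law of $\operatorname{Exp}_\mu(PT_{o\to\mu}Z)$ with $Z\sim N_d(0,\Sigma)$. Let $\varphi(v)=\log(\sinh\|v\|/\|v\|)$ for $v\in\mathbb R^d\setminus\{0\}$, $\varphi(0)=0$. The log-density with respect to Riemannian volume, up to the additive constant $-(d/2)\log(2\pi)$, is $$m_{\mu,\Sigma}(x)=-\tfrac12\log\det\Sigma-\tfrac12\mathsf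 T_\mu(x)^\top\Sigma^{-1}\mathsf T_\mu(x)-(d-1)\varphi(\mathsf T_\mu(x)),$$ and $\ell_n(\mu,\Sigma)=\sum_{i=1}^n m_{\mu,\Sigma}(X_i)$. Charts: $\alpha=\operatorname{Log}_{\mu_0}(\mu)\in\mathbb R^d$, $\mu(\alpha)=\operatorname{Exp}_{\mu_0}(\alpha)$; $\beta=\operatorname{vech}(\log\Sigma)\in\mathbb R^{d(d+1)/2}$, $\Sigma(\beta)=\exp(\operatorname{mat}(\beta))$, where $\operatorname{vech}$ is half-vectorization and $\operatorname{mat}$ its inverse onto symmetric matrices. Put $\vartheta=(\alpha,\beta)$, $\vartheta_0=(0,\operatorname{vech}(\log\Sigma_0))$, $m_\vartheta=m_{\mu(\alpha),\Sigma(\beta)}$. The score is $\mathsf s_\vartheta(x)=\partial_\vartheta m_\vartheta(x)$ and the Fisher information is $\mathcal I(\vartheta)=\mathbb E_\vartheta[\mathsf s_\vartheta(X)\mathsf s_\vartheta(X)^\top]$, with $X\sim\mathrm{HWN}_d(\mu(\alpha),\Sigma(\beta))$ under $\mathbb E_\vartheta$. Partition $\mathsf s_{\vartheta_0}=(\mathsf s_\alpha,\mathsf s_\beta)$ and $\mathcal I(\vartheta_0)=\begin{pmatrix}\mathcal I_{\alpha\alpha}&\mathcal I_{\alpha\beta}\\ \mathcal I_{\beta\alpha}&\mathcal I_{\beta\beta}\end{pmatrix}$ according to $\vartheta=(\alpha,\beta)$. Efficient information: $\mathcal I_{\alpha\alpha\cdot\beta}=\mathcal I_{\alpha\alpha}-\mathcal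 I_{\alpha\beta}\mathcal I_{\beta\beta}^{-1}\mathcal I_{\beta\alpha}$. Efficient score: $\tilde{\mathsf s}_\alpha(x)=\mathsf s_\alpha(x)-\mathcal I_{\alpha\beta}\mathcal I_{\beta\beta}^{-1}\mathsf s_\beta(x)$. $\Rightarrow$ is convergence in distribution. *)

(* Defs.v *)
From HB Require Import structures.
From mathcomp Require Import all_boot all_order all_algebra finmap.
From mathcomp Require Import all_classical all_reals all_analysis.

Set Implicit Arguments.
Unset Strict Implicit.
Unset Printing Implicit Defensive.

Import Order.TTheory GRing.Theory Num.Theory.
Import numFieldNormedType.Exports.

Local Open Scope classical_set_scope.
Local Open Scope ring_scope.

Section Matrices.
Context {R : realType}.

Definition dot n (v w : 'cV[R]_n) : R := \sum_i v i 0 * w i 0.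
Definition enorm n (v : 'cV[R]_n) : R := Num.sqrt (dot v v).

Definition qform n (M : 'M[R]_n) (v : 'cV[R]_n) : R := dot v (M *m v).

Definition psd n : set 'M[R]_n :=
  [set M | M^T = M /\ forall v, 0 <= qform M v].

Definition spd n : set 'M[R]_n :=
  [set M | M^T = M /\ forall v, v != 0 -> 0 < qform M v].

Definition loewner n (M N : 'M[R]_n) : Prop := psd (N - M).

(* the unique positive semidefinite square root of M, when M is psd *)
Definition sqrtmx n (M : 'M[R]_n) : 'M[R]_n :=
  xget 0 [set A | psd A /\ A *m A = M].

Definition expmx n (A : 'M[R]_n) : 'M[R]_n :=
  limn (series (fun k => (k`!%:R)^-1 *: A ^+ k)).

(* the unique symmetric logarithm of M, when M is in spd *)
Definition logmx n (M : 'M[R]_n) : 'M[R]_n :=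
  xget 0 [set A | A^T = A /\ expmx A = M].

End Matrices.

Section HalfVectorization.

(* positions (i, j) with j <= i, column after column *)
Definition lower_seq d : seq ('I_d * 'I_d) :=
  [seq (i, j) | j : 'I_d <- enum 'I_d,
                i : 'I_d <- [seq i : 'I_d <- enum 'I_d | (j <= i)%N]].

Definition vech_dim d : nat := ((d * d.+1)./2)%N.

Lemma size_lower_seq d : size (lower_seq d) == vech_dim d.
Proof.
rewrite /lower_seq size_allpairs_dep sumnE big_map big_enum /=.
rewrite (eq_bigr (fun j : 'I_d => (rev_ord j).+1)); last first.
  move=> j _; rewrite size_filter.
  rewrite -(count_map val (fun i => (j <= i)%N)) val_enum_ord.
  have -> : iota 0 d = iota 0 j ++ iota j (d - j).
    by rewrite -{2}[nat_of_ord j]add0n -iotaD subnKC // ltnW.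
  rewrite count_cat.
  rewrite (_ : count _ (iota 0 j) = 0)%N; last first.
    apply/eqP; rewrite -leqn0 leqNgt -has_count -all_predC; apply/allP => x.
    by rewrite mem_iota add0n /= -ltnNge.
  rewrite add0n (_ : count _ _ = d - j)%N; last first.
    rewrite -[RHS](size_iota j); apply/eqP; rewrite -all_count.
    by apply/allP => x; rewrite mem_iota => /andP[].
  by rewrite /= subnSK.
rewrite (reindex_inj rev_ord_inj).
rewrite (eq_bigr (fun j : 'I_d => j.+1)); last by move=> j _; rewrite rev_ordK.
rewrite (eq_bigl xpredT) // (_ : (\sum_(j < d) j.+1 = \sum_(j < d.+1) j)%N).
  by rewrite -(big_mkord xpredT id) bin2_sum bin2 mulnC.
by rewrite big_ord_recl.
Qed.

Definition lower_idx d (k : 'I_(vech_dim d)) : 'I_d * 'I_d :=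
  tnth (Tuple (size_lower_seq d)) k.

Context {R : realType}.

Definition vech d (A : 'M[R]_d) : 'cV[R]_(vech_dim d) :=
  \col_k A (lower_idx k).1 (lower_idx k).2.

(* for given (i, j) exactly one k satisfies the condition *)
Definition mat d (b : 'cV[R]_(vech_dim d)) : 'M[R]_d :=
  \matrix_(i, j)
    \sum_(k | (lower_idx k == (i, j)) || (lower_idx k == (j, i))) b k 0.

End HalfVectorization.

Section Gaussian.
Context {R : realType}.
(* R with the Borel sigma-algebra that carries lebesgue_measure and
   normal_prob *)
Local Notation BR := (measurableTypeR R).

Definition cons_pair n (p : BR * n.-tuple BR) : n.+1.-tuple BR :=
  [tuple of p.1 :: p.2].

Lemma measurable_cons_pair n : measurable_fun setT (@cons_pair n).
Proof. exact: measurable_cons. Qed.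

HB.instance Definition _ n :=
  isMeasurableFun.Build _ _ _ _ (@cons_pair n) (@measurable_cons_pair n).

(* N(0, 1) ^ n *)
Fixpoint stdgauss n : probability (n.-tuple BR) R :=
  match n return probability (n.-tuple BR) R with
  | 0 => \d_([tuple] : 0.-tuple BR)
  | n'.+1 => distribution (normal_prob 0 1 \x stdgauss n')%E (@cons_pair n')
  end.

(* Under stdgauss n, the vector gauss_vec S has law N_n(0, S). *)
Definition gauss_vec n (S : 'M[R]_n) (t : n.-tuple BR) : 'cV[R]_n :=
  sqrtmx S *m \col_i tnth t i.

End Gaussian.

Section Hyperbolic.
Context {R : realType} {d : nat}.
Local Notation E := 'cV[R]_(1 + d).

Definition lform (x y : E) : R := - (x 0 0 * y 0 0) + dot (dsubmx x) (dsubmx y).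

Definition hyperboloid : set E := [set x | lform x x = -1 /\ 0 < x 0 0].

Definition origin : E := col_mx (const_mx 1) 0.

Definition embed (v : 'cV[R]_d) : E := col_mx 0 v.

Definition tangent (x : E) : set E := [set v | lform x v = 0].

(* lform-orthogonal projection onto the tangent space at a point x of the
   hyperboloid, where lform x x = -1 *)
Definition tanproj (x w : E) : E := w + lform x w *: x.

(* The Levi-Civita connection of the metric induced by lform is the tangential
   part of the flat connection of the ambient space. *)
Definition covderiv (g V : R -> E) (t : R) : E := tanproj (g t) (derive1 V t).

Definition parallel (g V : R -> E) : Prop :=
  forall t, [/\ tangent (g t) (V t), derivable V t 1 & covderiv g V t = 0].

Definition geodesic (g : R -> E) : Prop :=
  [/\ forall t, hyperboloid (g t), forall t, derivable g t 1 & parallel g (derive1 g)].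

Definition Exp (x v : E) : E :=
  xget 0 [set y | exists g, [/\ geodesic g, g 0 = x, derive1 g 0 = v & g 1 = y]].

Definition Log (x y : E) : E := xget 0 [set v | tangent x v /\ Exp x v = y].

Definition PT (x y v : E) : E :=
  xget 0 [set w | exists g V, [/\ geodesic g, g 0 = x & g 1 = y] /\
                              [/\ parallel g V, V 0 = v & V 1 = w]].

(* PT_{o -> mu}^-1 (Log_mu x), with the tangent space at o read in R^d *)
Definition Tmap (mu x : E) : 'cV[R]_d :=
  xget 0 [set v | PT origin mu (embed v) = Log mu x].

(* J identifies R^d with the tangent space at x *)
Definition tangent_isometry (x : E) (J : 'cV[R]_d -> E) : Prop :=
  (forall v w, lform (J v) (J w) = dot v w) /\
  (forall u, tangent x u <-> exists v, J v = u).

End Hyperbolic.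

Section Model.
Context {R : realType} {d : nat}.
Local Notation E := 'cV[R]_(1 + d).

(* Under stdgauss d, the vector hwn_vec mu S has law HWN_d(mu, S). *)
Definition hwn_vec (mu : E) (S : 'M[R]_d) (t : d.-tuple (measurableTypeR R)) : E :=
  Exp mu (PT origin mu (embed (gauss_vec S t))).

Definition hwn (mu : E) (S : 'M[R]_d) (A : set E) : \bar R :=
  stdgauss d (hwn_vec mu S @^-1` A).

Definition sinh (x : R) : R := (expR x - expR (- x)) / 2.

Definition phi (v : 'cV[R]_d) : R :=
  if v == 0 then 0 else ln (sinh (enorm v) / enorm v).

Definition logdens (mu : E) (S : 'M[R]_d) (x : E) : R :=
  - 2^-1 * ln (\det S) - 2^-1 * qform (invmx S) (Tmap mu x)
  - d.-1%:R * phi (Tmap mu x).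

Definition covset (lm lp : R) : set 'M[R]_d :=
  [set S | [/\ spd S, loewner lm%:M S & loewner S lp%:M]].

(* interior relative to spd: in the space of all square matrices the set has
   empty interior, its elements being symmetric *)
Definition covset_int (lm lp : R) : set 'M[R]_d :=
  [set S | spd S /\ within (@spd R d) (nbhs S) (covset lm lp)].

End Model.

Section Information.
Context {R : realType} {d : nat}.
Variables (mu0 : 'cV[R]_(1 + d)) (J : 'cV[R]_d -> 'cV[R]_(1 + d)).
Local Notation E := 'cV[R]_(1 + d).
Local Notation Theta := 'cV[R]_(d + vech_dim d).

Definition alpha_of (mu : E) : 'cV[R]_d := xget 0 [set a | J a = Log mu0 mu].

Definition mu_of (th : Theta) : E := Exp mu0 (J (usubmx th)).
Definition Sigma_of (th : Theta) : 'M[R]_d := expmx (mat (dsubmx th)).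

Definition theta0 (Sigma0 : 'M[R]_d) : Theta := col_mx 0 (vech (logmx Sigma0)).

Definition score (th : Theta) (x : E) : Theta :=
  \col_i 'D_(delta_mx i 0) (fun th' => logdens (mu_of th') (Sigma_of th') x) th.

Definition fisher (th : Theta) : 'M[R]_(d + vech_dim d) :=
  \matrix_(i, j) fine 'E_(stdgauss d)[(fun t =>
    let s := score th (hwn_vec (mu_of th) (Sigma_of th) t) in s i 0 * s j 0)%R]%E.

Definition eff_info (th : Theta) : 'M[R]_d :=
  let I := fisher th in
  ulsubmx I - ursubmx I *m invmx (drsubmx I) *m dlsubmx I.

Definition eff_score (th : Theta) (x : E) : 'cV[R]_d :=
  let I := fisher th in
  usubmx (score th x) - ursubmx I *m invmx (drsubmx I) *m dsubmx (score th x).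

End Information.

Section RandomVectors.
Context {R : realType} {dd : measure_display} {Omega : measurableType dd}.
Variable P : probability Omega R.

Definition borel_mx m n := g_sigma_algebraType (@open 'M[R]_(m, n)).

Definition random_mx m n (X : Omega -> 'M[R]_(m, n)) : Prop :=
  measurable_fun setT (X : Omega -> borel_mx m n).

Definition has_law m n (X : Omega -> 'M[R]_(m, n))
    (nu : set 'M[R]_(m, n) -> \bar R) : Prop :=
  forall A, measurable (A : set (borel_mx m n)) -> P (X @^-1` A) = nu A.

Definition mutually_independent m n (X : nat -> Omega -> 'M[R]_(m, n)) : Prop :=
  forall (F : {fset nat}) (A : nat -> set 'M[R]_(m, n)),
    (forall i, measurable (A i : set (borel_mx m n))) ->
    P (\bigcap_(i in [set` F]) (X i @^-1` A i)) =
    (\prod_(i <- F) P (X i @^-1` A i))%E.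

Definition loglik d (X : nat -> Omega -> 'cV[R]_(1 + d)) (n : nat)
    (mu : 'cV[R]_(1 + d)) (S : 'M[R]_d) (w : Omega) : R :=
  \sum_(i < n) logdens mu S (X i w).

Definition is_op1 k (Y : nat -> Omega -> 'cV[R]_k) : Prop :=
  forall e : R, 0 < e ->
    P [set w | e < enorm (Y n w)] @[n --> \oo] --> 0%E.

(* Y n => N_k(0, V) *)
Definition cvg_to_gaussian k (Y : nat -> Omega -> 'cV[R]_k) (V : 'M[R]_k) : Prop :=
  forall f : 'cV[R]_k -> R, continuous f -> (exists M : R, forall y, `|f y| <= M) ->
    'E_P[fun w => f (Y n w)]%E @[n --> \oo] -->
    'E_(stdgauss k)[fun t => f (gauss_vec V t)]%E.

End RandomVectors.

(* Main.v *)
Require Import Defs.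
From HB Require Import structures.
From mathcomp Require Import all_boot all_order all_algebra finmap.
From mathcomp Require Import all_classical all_reals all_analysis.

From mathcomp Require Import measurable_realfun.
From mathcomp Require Import complex spectral ring lra.

Set Implicit Arguments.
Unset Strict Implicit.
Unset Printing Implicit Defensive.

Import Order.TTheory GRing.Theory Num.Theory.
Import numFieldNormedType.Exports.

Local Open Scope classical_set_scope.
Local Open Scope ring_scope.

(* The chart [(alpha, beta)] makes the log-density [m_theta(x)] admit, at
   [theta0], a second-order expansion whose cubic remainder is bounded by
   [N x * |h| ^ 3] with [N x = C * (1 + dist(mu0, x)) ^ 2].  As [N] has an
   exponential moment, expanding the identity [E exp (m_theta - m_theta0) = 1]
   to second order gives the two score identities.  This identity also makes
   the mean of [m_theta - m_theta0] negative for [theta <> theta0]; recentring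
   the chart at each parameter turns the expansions into local upper bounds, and
   Wald's covering argument yields consistency, the non-compact directions of
   [mu] being excluded by the triangle inequality.  Comparing the likelihood at
   the maximizer with its value at [theta0 + I^-1 S_n / sqrt n], where [S_n] is
   the normalized score sum, gives the linear expansion; the block inverse of
   [I] produces the efficient score, and the central limit theorem is proved by
   Trotter's operator method. *)

(** * Matrices *)

(** The log-density is not differentiated by formula. At [alpha = 0] it contains [enorm alpha], and
    at [x = mu] it contains [acosh] at 1, so naive derivative formulas break down exactly where they
    are wanted. Third-order expansions with one explicit bound survive sums, products, compositions
    and convergent series, and the partial derivatives in [score] are read off at the end.
    Uniformity in [x] comes from dividing by the hyperbolic cosine of the distance to [mu0]:
    relative increments of [- lform mu x] stay bounded on the whole hyperboloid, and
    [acosh s / sqrt (s ^ 2 - 1)], an integral of rational functions of [s], expands in relative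
    increments with absolute constants. Normalizing the density at every parameter requires one
    reference volume. The changes of variables behind it are all reduced to substitutions on the
    line by Tonelli: elimination for linear maps, rays for the radial map, one axis for Lorentz
    boosts. *)

Section DotProduct.
Context {R : realType} {n : nat}.
Implicit Types (u v w : 'cV[R]_n) (a : R).

Lemma dotE v w : dot v w = (v^T *m w) 0 0.
Proof. by rewrite mxE; apply: eq_bigr => i _; rewrite mxE. Qed.

Lemma dotC v w : dot v w = dot w v.
Proof. by apply: eq_bigr => i _; rewrite mulrC. Qed.

Lemma dotDl u v w : dot (u + v) w = dot u w + dot v w.
Proof. by rewrite -big_split; apply: eq_bigr => i _; rewrite mxE mulrDl. Qed.

Lemma dotDr u v w : dot w (u + v) = dot w u + dot w v.
Proof. by rewrite dotC dotDl !(dotC w). Qed.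

Lemma dotZl a v w : dot (a *: v) w = a * dot v w.
Proof. by rewrite mulr_sumr; apply: eq_bigr => i _; rewrite mxE mulrA. Qed.

Lemma dotZr a v w : dot v (a *: w) = a * dot v w.
Proof. by rewrite dotC dotZl dotC. Qed.

Lemma dotNl v w : dot (- v) w = - dot v w.
Proof. by rewrite -scaleN1r dotZl mulN1r. Qed.

Lemma dotNr v w : dot v (- w) = - dot v w.
Proof. by rewrite dotC dotNl dotC. Qed.

Lemma dotBl u v w : dot (u - v) w = dot u w - dot v w.
Proof. by rewrite dotDl dotNl. Qed.

Lemma dotBr u v w : dot w (u - v) = dot w u - dot w v.
Proof. by rewrite dotDr dotNr. Qed.

Lemma dot0l v : dot 0 v = 0.
Proof. by rewrite -(scale0r v) dotZl mul0r. Qed.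

Lemma dot0r v : dot v 0 = 0.
Proof. by rewrite dotC dot0l. Qed.

Lemma dot_ge0 v : 0 <= dot v v.
Proof. by apply: sumr_ge0 => i _; rewrite -expr2 sqr_ge0. Qed.

Lemma dot_eq0 v : (dot v v == 0) = (v == 0).
Proof.
apply/eqP/eqP => [h|->]; last by rewrite dot0l.
apply/colP => i; rewrite [RHS]mxE; apply/eqP; rewrite -sqrf_eq0 expr2.
have := psumr_eq0P _ h; move=> -> // j _; by rewrite -expr2 sqr_ge0.
Qed.

Lemma dot_gt0 v : (0 < dot v v) = (v != 0).
Proof. by rewrite lt_def dot_ge0 andbT dot_eq0. Qed.

Lemma dot_delta v i : dot v (delta_mx i 0) = v i 0.
Proof.
rewrite /dot (bigD1 i)//= mxE !eqxx mulr1 big1 ?addr0// => j ji.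
by rewrite mxE (negPf ji) mulr0.
Qed.

Lemma dot_mulmxr (M : 'M[R]_n) v w : dot v (M *m w) = dot (M^T *m v) w.
Proof. by rewrite !dotE trmx_mul trmxK mulmxA. Qed.

Lemma dot_CS v w : dot v w ^+ 2 <= dot v v * dot w w.
Proof.
have [->|w0] := eqVneq w 0; first by rewrite !dot0r mulr0 expr0n.
have w1 : 0 < dot w w by rewrite dot_gt0.
have := dot_ge0 (dot w w *: v - dot v w *: w).
rewrite !(dotBl, dotBr, dotZl, dotZr) (dotC w v) => h.
have : 0 <= dot w w * (dot v v * dot w w - dot v w ^+ 2) by lra.
by rewrite pmulr_rge0// subr_ge0.
Qed.

Lemma enorm_ge0 v : 0 <= enorm v.
Proof. exact: sqrtr_ge0. Qed.

Lemma sqr_enorm v : enorm v ^+ 2 = dot v v.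
Proof. by rewrite sqr_sqrtr ?dot_ge0. Qed.

Lemma enorm_eq0 v : (enorm v == 0) = (v == 0).
Proof. by rewrite -sqrf_eq0 sqr_enorm dot_eq0. Qed.

Lemma enorm_gt0 v : (0 < enorm v) = (v != 0).
Proof. by rewrite lt_def enorm_ge0 andbT enorm_eq0. Qed.

Lemma enorm0 : enorm (0 : 'cV[R]_n) = 0.
Proof. by apply/eqP; rewrite enorm_eq0. Qed.

Lemma ler_enorm v a : 0 <= a -> (enorm v <= a) = (dot v v <= a ^+ 2).
Proof. by move=> a0; rewrite -sqr_enorm ler_pXn2r// nnegrE ?enorm_ge0. Qed.

Lemma enormZ a v : enorm (a *: v) = `|a| * enorm v.
Proof.
by rewrite /enorm dotZl dotZr mulrA -expr2 sqrtrM ?sqr_ge0// sqrtr_sqr.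
Qed.

Lemma ler_dot v w : `|dot v w| <= enorm v * enorm w.
Proof.
rewrite -(@ler_pXn2r _ 2)// ?nnegrE ?mulr_ge0 ?enorm_ge0//.
by rewrite real_normK ?num_real// exprMn !sqr_enorm dot_CS.
Qed.

Lemma ler_coord_enorm v i : `|v i 0| <= enorm v.
Proof.
rewrite -dot_delta; apply: le_trans (ler_dot _ _) _.
rewrite [X in _ * X](_ : _ = 1) ?mulr1//.
by rewrite /enorm dot_delta mxE !eqxx sqrtr1.
Qed.

Lemma ler_enorm_sum v : enorm v <= \sum_i `|v i 0|.
Proof.
have h : 0 <= \sum_i `|v i 0| by apply: sumr_ge0 => i _.
rewrite ler_enorm// expr2 /dot mulr_suml; apply: ler_sum => i _.
rewrite -expr2 -[v i 0 ^+ 2]real_normK ?num_real//.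
by rewrite expr2 ler_wpM2l// (bigD1 i)//= lerDl; exact: sumr_ge0.
Qed.

End DotProduct.

(** * Householder reflections and the spectral theorem *)

Section Householder.
Context {R : realType} {n : nat}.
Implicit Types (u v w : 'cV[R]_n).

Lemma outer_mul u v w : (u *m v^T) *m w = dot v w *: u.
Proof.
by rewrite -mulmxA [v^T *m w]mx11_scalar -dotE mul_mx_scalar.
Qed.

(** The reflection in the hyperplane orthogonal to [u - w]. It deflates an eigenvector in the
    spectral theorem, and later it turns the space part of a point of the hyperboloid onto the first
    axis. *)
Lemma householder u w : dot u u = dot w w ->
  exists H : 'M[R]_n, [/\ H^T = H, H *m H = 1%:M & H *m u = w].
Proof.
move=> uw; have [->|neq] := eqVneq u w.
  by exists 1%:M; rewrite trmx1 !mul1mx.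
pose e := u - w.
have e0 : dot e e != 0 by rewrite dot_eq0 subr_eq0.
pose c := 2 / dot e e.
have symE : (e *m e^T)^T = e *m e^T by rewrite trmx_mul trmxK.
exists (1%:M - c *: (e *m e^T)); split.
- by rewrite linearB /= trmx1 linearZ /= symE.
- have EE : (e *m e^T) *m (e *m e^T) = dot e e *: (e *m e^T).
    by rewrite mulmxA outer_mul -scalemxAl.
  rewrite mulmxBl mul1mx mulmxBr mulmx1 -scalemxAr -scalemxAl EE !scalerA.
  have -> : c * c * dot e e = c + c by rewrite /c; field.
  by rewrite scalerDl opprB addrK subrK.
- rewrite mulmxBl mul1mx -scalemxAl outer_mul scalerA.
  (* Equality of the lengths of [u] and [w] makes [dot e u] half of [dot e e]. *)
  have -> : c * dot e u = 1.
    have -> : dot e u = dot e e / 2.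
      by rewrite /e !(dotBl, dotBr) -uw (dotC w u); field.
    by rewrite /c; field.
  by rewrite scale1r /e opprB addrCA subrr addr0.
Qed.
End Householder.

Section Spectral.
Context {R : realType}.

(** Complexification makes [M] Hermitian, so its spectral diagonal is real. A real root of the
    characteristic polynomial is an eigenvalue over [R] itself, which is what provides a real
    eigenvector. *)
Lemma sym_eigenvector n (M : 'M[R]_n.+1) : M^T = M ->
  exists a (v : 'cV[R]_n.+1), v != 0 /\ M *m v = a *: v.
Proof.
move=> symM.
pose MC := map_mx (real_complex R) M.
have MCh : MC \is hermsymmx.
  apply: realsym_hermsym.
    by apply/is_hermitianmxP; rewrite expr0 scale1r; apply/matrixP => i j; rewrite !mxE -{1}symM mxE.
  by apply/mxOverP => i j; rewrite mxE /= complex_real.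
have ed := hermitian_normalmx MCh.
have dr := hermitian_spectral_diag_real MCh.
move/orthomx_spectralP: ed => ME.
set P := spectralmx MC in ME; set D := spectral_diag MC in ME dr.
have Pu : P \in unitmx by exact: spectral_unit.
have PM : P *m MC = diag_mx D *m P by rewrite [in LHS]ME -!mulmxA mulKVmx.
(* A row of the unitary diagonalizer is a left eigenvector, and it is nonzero by invertibility. *)
pose r := row 0 P.
have r0 : r != 0.
  apply: contraL Pu => /eqP r0; rewrite -row_free_unit.
  apply/negP => /row_freeP [B PB].
  have := congr1 (row 0) PB; rewrite row_mul -/r r0 mul0mx => /matrixP/(_ 0 0).
  by rewrite !mxE eqxx => /eqP; rewrite eq_sym oner_eq0.
have : eigenvalue MC (D 0 0).
  apply/eigenvalueP; exists r => //.
  by rewrite /r -row_mul PM row_mul row_diag_mx -scalemxAl -rowE.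
have /mxOverP /(_ 0 0) := dr.
case: (D 0 0) => x y /CrealP /= [] /eqP; rewrite eq_sym -addr_eq0 -mulr2n mulrn_eq0 /=.
move=> /eqP y0; subst y.
set a := x => h.
have : eigenvalue M a.
  move: h; rewrite !eigenvalue_root_char /MC -map_char_poly /=.
  by rewrite fmorph_root.
case/eigenvalueP => v vM v0; exists a, v^T; split.
  by apply: contra v0 => /eqP vT0; rewrite -[v]trmxK vT0 trmx0.
by rewrite -[M in LHS]symM -trmx_mul vM linearZ.
Qed.

(** Deflation: the reflection taking the first basis vector to a unit eigenvector conjugates [M] to
    a block diagonal matrix with a scalar corner, and the induction hypothesis diagonalizes the
    other block. *)
Lemma spectral_sym n (M : 'M[R]_n) : M^T = M ->
  exists (Q : 'M[R]_n) (d : 'rV[R]_n),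
    [/\ Q *m Q^T = 1%:M, Q^T *m Q = 1%:M & M = Q *m diag_mx d *m Q^T].
Proof.
elim: n M => [M _|n IH M symM].
  by exists 1%:M, 0; split; apply/matrixP => -[].
have [a [v [v0 Mv]]] := sym_eigenvector symM.
pose e : 'cV[R]_(1 + n) := delta_mx 0 0.
have := @householder R (1 + n) e ((enorm v)^-1 *: v).
rewrite {1}/e dot_delta mxE !eqxx dotZl dotZr -sqr_enorm /=.
have ev : enorm v != 0 by rewrite enorm_eq0.
case; first by field.
move=> H [HT HH He].
pose N : 'M[R]_(1 + n) := H *m M *m H.
have NT : N^T = N by rewrite /N !trmx_mul HT symM mulmxA.
have Ne : N *m e = a *: e.
  rewrite /N -!mulmxA He -scalemxAr Mv scalerA mulrC -scalerA -scalemxAr -He.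
  by rewrite mulmxA HH mul1mx.
have col0 i : N i 0 = (a *: e) i 0.
  by rewrite -Ne /e -colE !mxE.
have l0 : lshift n (0 : 'I_1) = 0 by exact: val_inj.
have dlN : dlsubmx N = 0.
  by apply/colP => i; rewrite 2!mxE l0 col0 !mxE /= mulr0.
have urN : ursubmx N = 0.
  by rewrite -[N]NT -trmx_dlsub dlN trmx0.
have ulN : ulsubmx N = a%:M.
  by apply/matrixP => i j; rewrite !ord1 2!mxE l0 col0 !mxE /= mulr1.
have [|Q' [d' [QQ QQ' N'E]]] := IH (drsubmx N).
  by rewrite -{1}NT -trmx_drsub trmxK.
pose B : 'M[R]_(1 + n) := block_mx 1%:M 0 0 Q'.
have BB : B *m B^T = 1%:M.
  by rewrite /B tr_block_mx mulmx_block !trmx0 trmx1 !(mulmx0, mul0mx, mul1mx, addr0, add0r) QQ -scalar_mx_block.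
have BB' : B^T *m B = 1%:M.
  by rewrite /B tr_block_mx mulmx_block !trmx0 trmx1 !(mulmx0, mul0mx, mul1mx, addr0, add0r) QQ' -scalar_mx_block.
exists (H *m B), (row_mx a%:M d'); split.
- by rewrite trmx_mul HT mulmxA -(mulmxA H) BB mulmx1.
- by rewrite trmx_mul HT mulmxA -(mulmxA B^T) HH mulmx1.
have -> : diag_mx (row_mx a%:M d') = block_mx a%:M 0 0 (diag_mx d') :> 'M[R]_(1 + n).
  rewrite diag_mx_row; congr (block_mx _ _ _ _).
  by apply/matrixP => i j; rewrite !ord1 !mxE eqxx.
have NE : N = B *m block_mx a%:M 0 0 (diag_mx d') *m B^T.
  rewrite /B tr_block_mx !mulmx_block !trmx0 trmx1.
  rewrite !(mulmx0, mul0mx, mul1mx, mulmx1, addr0, add0r) -N'E -[LHS]submxK.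
  by rewrite dlN urN ulN.
rewrite trmx_mul HT -!mulmxA (mulmxA B) (mulmxA _ B^T) -NE /N.
by rewrite -!mulmxA HH mulmx1 mulmxA HH mul1mx.
Qed.
End Spectral.

Section MatrixConvergence.
Context {R : realType}.

Lemma cvg_mx T (F : set_system T) (FF : Filter F) m n (f : T -> 'M[R]_(m, n)) (l : 'M[R]_(m, n)) :
  (forall i j, (fun t => f t i j) @ F --> l i j) -> f @ F --> l.
Proof.
move=> h; apply/cvg_ballP => e e0.
have : \forall t \near F, forall i j, ball (l i j) e (f t i j).
  by apply: filter_forall => i; apply: filter_forall => j; exact: (cvg_ball (h i j)).
by apply: filterS => t ht; split.
Qed.

Lemma cvg_coord T (F : set_system T) (FF : Filter F) m n (f : T -> 'M[R]_(m, n)) (l : 'M[R]_(m, n)) i j :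
  f @ F --> l -> (fun t => f t i j) @ F --> l i j.
Proof.
move=> h; exact: (cvg_comp _ _ h (@coord_continuous _ _ _ i j l)).
Qed.

Lemma continuous_mx (T : topologicalType) m n (f : T -> 'M[R]_(m, n)) :
  (forall i j, continuous (fun t => f t i j)) -> continuous f.
Proof. by move=> h t; apply: cvg_mx => i j; exact: h. Qed.

Lemma cvg_bigsum T (F : set_system T) (FF : Filter F) (I : Type) (r : seq I) (P : pred I) (f : I -> T -> R) (l : I -> R) :
  (forall i, P i -> f i @ F --> l i) ->
  (fun t => \sum_(i <- r | P i) f i t) @ F --> \sum_(i <- r | P i) l i.
Proof.
move=> h; elim: r => [|i r IH].
  under eq_fun do rewrite big_nil; rewrite big_nil; exact: cvg_cst.
under eq_fun do rewrite big_cons; rewrite big_cons; case: ifP => // Pi.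
by apply: cvgD => //; exact: h.
Qed.

End MatrixConvergence.

(** * Exponential, logarithm and square root of symmetric matrices *)

Section MatrixExponential.
Context {R : realType}.

Lemma expr_conj n (Q : 'M[R]_n) (d : 'rV[R]_n) k : Q^T *m Q = 1%:M -> Q *m Q^T = 1%:M ->
  (Q *m diag_mx d *m Q^T) ^+ k = Q *m diag_mx (\row_i d 0 i ^+ k) *m Q^T.
Proof.
move=> QQ QQ'; elim: k => [|k IH].
  rewrite expr0 (_ : diag_mx _ = 1%:M) ?mulmx1 ?QQ'//.
  by apply/matrixP => i j; rewrite !mxE expr0.
rewrite exprS IH -mulmxE -!mulmxA (mulmxA Q^T) QQ mul1mx; congr (_ *m _).
rewrite !mulmxA; congr (_ *m _); rewrite mulmx_diag; congr diag_mx.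
by apply/rowP => i; rewrite !mxE exprS.
Qed.

Lemma conj_diagE n (Q : 'M[R]_n) (d : 'rV[R]_n) i j :
  (Q *m diag_mx d *m Q^T) i j = \sum_k Q i k * d 0 k * Q j k.
Proof.
rewrite mxE; apply: eq_bigr => k _; rewrite [_^T _ _]mxE; congr (_ * _).
rewrite mxE (bigD1 k)//= big1 ?addr0 => [|l lk]; rewrite mxE ?eqxx//.
by rewrite (negPf lk) mulr0n mulr0.
Qed.

Lemma series_coordE (m n : nat) (u : nat -> 'M[R]_(m, n)) k i j : series u k i j = series (fun k => u k i j) k.
Proof. by rewrite /series /= summxE. Qed.

Lemma cvg_expmx n (Q : 'M[R]_n) (d : 'rV[R]_n) : Q^T *m Q = 1%:M -> Q *m Q^T = 1%:M ->
  let A := Q *m diag_mx d *m Q^T in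
  series (fun k => (k`!%:R)^-1 *: A ^+ k) @ \oo --> Q *m diag_mx (map_mx expR d) *m Q^T.
Proof.
move=> QQ QQ' A; apply: cvg_mx => i j; rewrite conj_diagE.
have -> : (fun t => series (fun k => (k`!%:R)^-1 *: A ^+ k) t i j) =
    (fun t => \sum_k Q i k * series (exp_coeff (d 0 k)) t * Q j k).
  apply/funext => t; rewrite series_coordE /series /=.
  under eq_bigr do rewrite mxE expr_conj// conj_diagE mulr_sumr.
  rewrite exchange_big /=; apply: eq_bigr => k _.
  rewrite -[RHS]mulrA mulr_suml mulr_sumr; apply: eq_bigr => l _.
  by rewrite /exp_coeff /= mxE; ring.
apply: cvg_bigsum => k _; apply: cvgM; last exact: cvg_cst.
apply: cvgM; first exact: cvg_cst.
rewrite mxE; exact: is_cvg_series_exp_coeff.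
Qed.

Lemma expmx_conj n (Q : 'M[R]_n) (d : 'rV[R]_n) : Q^T *m Q = 1%:M -> Q *m Q^T = 1%:M ->
  expmx (Q *m diag_mx d *m Q^T) = Q *m diag_mx (map_mx expR d) *m Q^T.
Proof. by move=> h h'; apply/cvg_lim => //; exact: cvg_expmx. Qed.

Lemma cvg_expmx_sym n (A : 'M[R]_n) : A^T = A ->
  series (fun k => (k`!%:R)^-1 *: A ^+ k) @ \oo --> expmx A.
Proof.
move=> /spectral_sym [Q [d [h1 h2 ->]]].
by rewrite expmx_conj//; exact: cvg_expmx.
Qed.

Lemma qform_conj n (Q : 'M[R]_n) (d : 'rV[R]_n) v :
  qform (Q *m diag_mx d *m Q^T) v = \sum_k d 0 k * ((Q^T *m v) k 0) ^+ 2.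
Proof.
rewrite /qform -!mulmxA dot_mulmxr /dot; apply: eq_bigr => k _.
set w := Q^T *m v.
by rewrite mul_diag_mx [X in _ * X]mxE; ring.
Qed.

Lemma conj_sym n (Q : 'M[R]_n) (d : 'rV[R]_n) :
  (Q *m diag_mx d *m Q^T)^T = Q *m diag_mx d *m Q^T.
Proof. by rewrite !trmx_mul trmxK tr_diag_mx mulmxA. Qed.

Lemma psd_conj n (Q : 'M[R]_n) (d : 'rV[R]_n) : (forall k, 0 <= d 0 k) ->
  psd (Q *m diag_mx d *m Q^T).
Proof.
move=> d0; split; first exact: conj_sym.
by move=> v; rewrite qform_conj; apply: sumr_ge0 => k _; rewrite mulr_ge0 ?sqr_ge0.
Qed.

Lemma spd_conj n (Q : 'M[R]_n) (d : 'rV[R]_n) : Q *m Q^T = 1%:M -> (forall k, 0 < d 0 k) ->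
  spd (Q *m diag_mx d *m Q^T).
Proof.
move=> QQ d0; split; first exact: conj_sym.
move=> v v0; rewrite qform_conj.
have w0 : Q^T *m v != 0.
  by apply: contra v0 => /eqP h; rewrite -[v]mul1mx -QQ -mulmxA h mulmx0.
have [k wk] : exists k, (Q^T *m v) k 0 != 0.
  apply/existsP; apply: contraNT w0; rewrite negb_exists => /forallP h.
  by apply/eqP/colP => i; rewrite [RHS]mxE; apply/eqP; rewrite -[_ == _]negbK h.
rewrite (bigD1 k)//= ltr_pwDl//; first by rewrite mulr_gt0// exprn_even_gt0.
by apply: sumr_ge0 => i _; rewrite mulr_ge0 ?sqr_ge0// ltW.
Qed.

Lemma qform_col n (Q : 'M[R]_n) (d : 'rV[R]_n) k : Q^T *m Q = 1%:M ->
  qform (Q *m diag_mx d *m Q^T) (col k Q) = d 0 k.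
Proof.
move=> QQ; rewrite qform_conj (bigD1 k)//= big1 ?addr0 => [|j jk].
  by rewrite colE mulmxA QQ mul1mx mxE !eqxx expr1n mulr1.
by rewrite colE mulmxA QQ mul1mx mxE (negPf jk) expr0n mulr0.
Qed.

Lemma psd_diag n (Q : 'M[R]_n) (d : 'rV[R]_n) : Q^T *m Q = 1%:M ->
  psd (Q *m diag_mx d *m Q^T) -> forall k, 0 <= d 0 k.
Proof. by move=> QQ [_ h] k; rewrite -(qform_col d k QQ). Qed.

Lemma spd_diag n (Q : 'M[R]_n) (d : 'rV[R]_n) : Q^T *m Q = 1%:M ->
  spd (Q *m diag_mx d *m Q^T) -> forall k, 0 < d 0 k.
Proof.
move=> QQ [_ h] k; rewrite -(qform_col d k QQ); apply: h.
apply/negP => /eqP c0; have := congr1 (mulmx Q^T) c0.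
rewrite colE mulmxA QQ mul1mx mulmx0 => /colP/(_ k); rewrite !mxE !eqxx => /eqP.
by rewrite oner_eq0.
Qed.

Lemma mulmx_conj n (Q : 'M[R]_n) (d e : 'rV[R]_n) : Q^T *m Q = 1%:M ->
  (Q *m diag_mx d *m Q^T) *m (Q *m diag_mx e *m Q^T) =
  Q *m diag_mx (\row_k (d 0 k * e 0 k)) *m Q^T.
Proof.
move=> QQ; rewrite -!mulmxA (mulmxA Q^T) QQ mul1mx (mulmxA (diag_mx d)) mulmx_diag.
by congr (_ *m (diag_mx _ *m _)); apply/rowP => k; rewrite !mxE.
Qed.

Lemma sqrtmxP n (M : 'M[R]_n) : psd M -> psd (sqrtmx M) /\ sqrtmx M *m sqrtmx M = M.
Proof.
move=> pM; rewrite /sqrtmx; case: xgetP => [A _ [] //|noex].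
have [Q [d [QQ QQ' E]]] := spectral_sym (proj1 pM).
have d0 : forall k, 0 <= d 0 k by apply: (psd_diag QQ'); rewrite -E.
exfalso; apply: (noex (Q *m diag_mx (map_mx Num.sqrt d) *m Q^T)); split.
  by apply: psd_conj => k; rewrite mxE sqrtr_ge0.
rewrite mulmx_conj// E; congr (_ *m diag_mx _ *m _).
by apply/rowP => k; rewrite !mxE -expr2 sqr_sqrtr.
Qed.

Lemma logmxP n (M : 'M[R]_n) : spd M -> (logmx M)^T = logmx M /\ expmx (logmx M) = M.
Proof.
move=> pM; rewrite /logmx; case: xgetP => [A _ [] //|noex].
have [Q [d [QQ QQ' E]]] := spectral_sym (proj1 pM).
have d0 : forall k, 0 < d 0 k by apply: (spd_diag QQ'); rewrite -E.
exfalso; apply: (noex (Q *m diag_mx (map_mx (@ln R) d) *m Q^T)); split.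
  exact: conj_sym.
rewrite expmx_conj// E; congr (_ *m diag_mx _ *m _).
by apply/rowP => k; rewrite !mxE lnK// posrE.
Qed.

Lemma spd_expmx n (A : 'M[R]_n) : A^T = A -> spd (expmx A).
Proof.
move=> /spectral_sym [Q [d [h1 h2 ->]]]; rewrite expmx_conj//.
by apply: spd_conj => // k; rewrite mxE expR_gt0.
Qed.

Lemma spd_unitmx n (A : 'M[R]_n) : spd A -> A \in unitmx.
Proof.
move=> [sA pA]; rewrite -row_free_unit -kermx_eq0; apply/eqP/row_matrixP => i.
rewrite row0; apply/eqP; apply: contraT => k0.
have := pA (row i (kermx A))^T.
have -> : (row i (kermx A))^T != 0.
  by apply: contra k0 => /eqP h; rewrite -[row _ _]trmxK h trmx0.
move=> /(_ isT); rewrite /qform -[A *m _]trmxK trmx_mul trmxK sA -row_mul mulmx_ker row0 trmx0.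
by rewrite dot0r ltxx.
Qed.

Lemma expmxN n (A : 'M[R]_n) : A^T = A -> invmx (expmx A) = expmx (- A).
Proof.
move=> sA; have uA := spd_unitmx (spd_expmx sA).
have [Q [d [h1 h2 E]]] := spectral_sym sA.
suff h : expmx A *m expmx (- A) = 1%:M by rewrite -[RHS](mulKmx uA) h mulmx1.
have -> : - A = Q *m diag_mx (- d) *m Q^T.
  by rewrite E linearN /= mulmxN mulNmx.
rewrite E !expmx_conj// mulmx_conj//.
rewrite (_ : diag_mx _ = 1%:M) ?mulmx1//.
by apply/matrixP => i j; rewrite !mxE expRN divff// gt_eqF// expR_gt0.
Qed.

Lemma det_expmx n (A : 'M[R]_n) : A^T = A -> \det (expmx A) = expR (\tr A).
Proof.
move=> /spectral_sym [Q [d [h1 h2 ->]]]; rewrite expmx_conj//.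
rewrite !det_mulmx mulrAC -det_mulmx h1 det1 mul1r det_diag mxtrace_mulC mulmxA h2 mul1mx mxtrace_diag.
rewrite expR_sum; apply: eq_bigr => i _; by rewrite mxE.
Qed.

(** If [Q] and [P] diagonalize the two matrices, [Q^T *m P] intertwines the exponentiated diagonals:
    an entry of it is nonzero only where two exponentials, hence two eigenvalues, agree. So it
    intertwines the diagonals themselves. *)
Lemma expmx_inj n (A B : 'M[R]_n) : A^T = A -> B^T = B -> expmx A = expmx B -> A = B.
Proof.
move=> /spectral_sym [Q [d [q1 q2 ->]]] /spectral_sym [P [e [p1 p2 ->]]].
rewrite !expmx_conj// => E.
have W : diag_mx (map_mx expR d) *m (Q^T *m P) = (Q^T *m P) *m diag_mx (map_mx expR e).
  have := congr1 (fun X => Q^T *m X *m P) E.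
  by rewrite -!mulmxA p2 mulmx1 (mulmxA Q^T Q) q2 mul1mx.
have W' : diag_mx d *m (Q^T *m P) = (Q^T *m P) *m diag_mx e.
  apply/matrixP => i j; move/matrixP/(_ i j): W.
  rewrite !mul_diag_mx !mul_mx_diag !mxE.
  set s := (\sum_j0 _); have [->|w0] := eqVneq s 0; first by rewrite !mulr0 !mul0r.
  rewrite mulrC => /(mulfI w0) h; rewrite mulrC; congr (_ * _).
  exact: expR_inj.
have := congr1 (fun X => Q *m X *m P^T) W'.
by rewrite -!mulmxA p1 mulmx1 (mulmxA Q Q^T) q1 mul1mx.
Qed.

(** The Loewner bounds, tested on the columns of [Q], put each eigenvalue of [A] between [ln l] and
    [ln u], and the entries of an orthogonal matrix are at most 1 in absolute value. This confines
    the logarithms of the admissible covariances to a bounded box. *)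
Lemma expmx_bound n (A : 'M[R]_n) l u : 0 < l -> A^T = A ->
  loewner l%:M (expmx A) -> loewner (expmx A) u%:M ->
  forall i j, `|A i j| <= n%:R * (`|ln l| + `|ln u|).
Proof.
move=> l0 /spectral_sym [Q [d [q1 q2 ->]]]; rewrite expmx_conj// => -[_ hl] [_ hu] i j.
have dl k : l <= expR (d 0 k) <= u.
  have c1 : dot (col k Q) (col k Q) = 1.
    have := qform_col (const_mx 1) k q2; rewrite diag_const_mx mulmx1 q1 /qform mul1mx => ->.
    by rewrite mxE.
  have := hl (col k Q); have := hu (col k Q).
  rewrite /qform !mulmxBl !dotBr -!/(qform _ _) !(qform_col _ _ q2) /qform !mul_scalar_mx !dotZr c1 mxE.
  by rewrite !mulr1 !subr_ge0 => -> ->.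
have dk k : `|d 0 k| <= `|ln l| + `|ln u|.
  have /andP[h1 h2] := dl k.
  have u0 : 0 < u by apply: lt_le_trans h2; exact: expR_gt0.
  have g1 : ln l <= d 0 k by rewrite -[leRHS]expRK ler_ln ?posrE ?expR_gt0.
  have g2 : d 0 k <= ln u by rewrite -[leLHS]expRK ler_ln ?posrE ?expR_gt0.
  have := ler_norm (ln u); have := ler_norm (- ln l); rewrite normrN => n1 n2.
  have := normr_ge0 (ln u); have := normr_ge0 (ln l).
  by rewrite ler_norml => n3 n4; apply/andP; split; lra.
have Q1 a b : `|Q a b| <= 1.
  rewrite -(@ler_pXn2r _ 2)// ?nnegrE// expr1n real_normK ?num_real//.
  have <- : \sum_k Q a k * Q^T k a = 1.
    by have /matrixP/(_ a a) := q1; rewrite !mxE eqxx.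
  rewrite (bigD1 b)//= mxE -expr2 lerDl; apply: sumr_ge0 => k _.
  by rewrite mxE -expr2 sqr_ge0.
rewrite conj_diagE; apply: le_trans (ler_norm_sum _ _ _) _.
rewrite mulr_natl.
have -> : (`|ln l| + `|ln u|) *+ n = \sum_(k < n) (`|ln l| + `|ln u|) by rewrite sumr_const card_ord.
apply: ler_sum => k _.
rewrite !normrM -[leRHS]mul1r -[leRHS]mulr1.
by rewrite !ler_pM ?mulr_ge0.
Qed.

End MatrixExponential.

(** * Hyperbolic space *)

Section HyperbolicFunctions.
Context {R : realType}.
Implicit Types x y r s : R.

Definition cosh x : R := (expR x + expR (- x)) / 2.

Lemma expRVE x : expR (- x) = (expR x)^-1. Proof. exact: expRN. Qed.

Lemma coshD_sinh x : cosh x + sinh x = expR x.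
Proof. by rewrite /cosh /sinh; field. Qed.

Lemma coshB_sinh x : cosh x - sinh x = expR (- x).
Proof. by rewrite /cosh /sinh; field. Qed.

Lemma cosh2_sinh2 x : cosh x ^+ 2 = 1 + sinh x ^+ 2.
Proof.
have : (cosh x + sinh x) * (cosh x - sinh x) = 1.
  by rewrite coshD_sinh coshB_sinh expRVE divff// gt_eqF ?expR_gt0.
by lra.
Qed.

Lemma cosh0 : cosh 0 = 1.
Proof. by rewrite /cosh oppr0 expR0; field. Qed.

Lemma sinh0 : sinh (0 : R) = 0.
Proof. by rewrite /sinh oppr0 expR0 subrr mul0r. Qed.

Lemma cosh_gt0 x : 0 < cosh x.
Proof. by rewrite /cosh divr_gt0 ?addr_gt0 ?expR_gt0. Qed.

Lemma cosh_ge1 x : 1 <= cosh x.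
Proof.
rewrite -(@ler_pXn2r _ 2)// ?nnegrE ?(ltW (cosh_gt0 _))//.
by rewrite cosh2_sinh2 expr1n lerDl sqr_ge0.
Qed.

Lemma is_derive_cosh x : is_derive x 1 cosh (sinh x).
Proof.
rewrite /cosh; apply: is_derive_eq; rewrite /sinh /GRing.scale /=; ring.
Qed.

Lemma is_derive_sinh x : is_derive x 1 (@sinh R) (cosh x).
Proof.
rewrite /sinh; apply: is_derive_eq; rewrite /cosh /GRing.scale /=; ring.
Qed.

Lemma sinh_gt0 x : 0 < x -> 0 < sinh x.
Proof.
by move=> x0; rewrite /sinh divr_gt0// subr_gt0 ltr_expR; lra.
Qed.

Lemma sinh_ge0 x : 0 <= x -> 0 <= sinh x.
Proof. by rewrite le_eqVlt => /predU1P[<-|/sinh_gt0/ltW//]; rewrite sinh0. Qed.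

Lemma sinh_ge_id x : 0 <= x -> x <= sinh x.
Proof.
move=> x0; rewrite -subr_ge0.
pose g (y : R) := sinh y - y.
have g0 : g 0 = 0 by rewrite /g sinh0 subrr.
rewrite -/(g x) -g0.
have dg (y : R) : is_derive y 1 g (cosh y - 1).
  by have := is_derive_sinh y => ?; rewrite /g; apply: is_derive_eq.
rewrite -subr_ge0.
have [|y _ ->] := @MVT_segment R g (fun y => cosh y - 1) 0 x x0.
  apply/continuous_subspaceT => y.
  by apply/differentiable_continuous/derivable1_diffP; have [] := dg y.
by rewrite subr0 mulr_ge0// subr_ge0 cosh_ge1.
Qed.

Lemma cosh_lt x y : 0 <= x -> x < y -> cosh x < cosh y.
Proof.
move=> x0 xy; rewrite -subr_gt0 /cosh.
rewrite !expRVE.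
have A1 : 1 <= expR x by rewrite -expR0 ler_expR.
have AB : expR x < expR y by rewrite ltr_expR.
set a := expR x in A1 AB *; set b := expR y in AB *.
have -> : (b + b^-1) / 2 - (a + a^-1) / 2 = (b - a) * (1 - (a * b)^-1) / 2.
  by field; rewrite !gt_eqF//; lra.
have ab : 1 < a * b by rewrite -[ltLHS]mulr1 (le_lt_trans (y := a * 1)) ?ler_pM2r// ltr_pM2l//; lra.
by rewrite divr_gt0// mulr_gt0 ?subr_gt0// invf_lt1//; lra.
Qed.

Lemma cosh_inj x y : 0 <= x -> 0 <= y -> cosh x = cosh y -> x = y.
Proof.
move=> x0 y0 h; have [xy|yx|//] := ltgtP x y.
- by have := cosh_lt x0 xy; rewrite h ltxx.
- by have := cosh_lt y0 yx; rewrite h ltxx.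
Qed.

Definition acosh s : R := ln (s + Num.sqrt (s ^+ 2 - 1)).

Lemma coshK r : 0 <= r -> acosh (cosh r) = r.
Proof.
move=> r0; rewrite /acosh cosh2_sinh2 (addrC 1) addrK sqrtr_sqr ger0_norm ?sinh_ge0//.
by rewrite coshD_sinh expRK.
Qed.

Lemma acosh_ge0 s : 1 <= s -> 0 <= acosh s.
Proof. by move=> s1; apply: ln_ge0; rewrite -[leLHS]addr0 lerD// sqrtr_ge0. Qed.

Lemma acoshK s : 1 <= s -> cosh (acosh s) = s.
Proof.
move=> s1; rewrite /cosh expRVE /acosh.
have h : 0 <= s ^+ 2 - 1 by rewrite subr_ge0 exprn_ege1.
have sq := sqr_sqrtr h.
have q0 := sqrtr_ge0 (s ^+ 2 - 1).
set q := Num.sqrt _ in sq q0 *.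
rewrite lnK ?posrE; last by lra.
have -> : (s + q)^-1 = s - q.
  have e : (s + q) * (s - q) = 1 by lra.
  by rewrite -[RHS](mulKf (x := s + q)) ?e ?mulr1//; rewrite gt_eqF//; lra.
by field.
Qed.

Definition sinhc r : R := if r == 0 then 1 else sinh r / r.

Lemma sinhcE r : sinhc r * r = sinh r.
Proof.
by rewrite /sinhc; case: eqVneq => [->|r0]; rewrite ?mulr0 ?sinh0 ?divfK.
Qed.

Lemma sinhc_ge1 r : 0 <= r -> 1 <= sinhc r.
Proof.
rewrite /sinhc; case: eqVneq => // r0 h; rewrite ler_pdivlMr ?mul1r ?sinh_ge_id//.
by rewrite lt_def r0.
Qed.

Lemma sinhc_gt0 r : 0 <= r -> 0 < sinhc r.
Proof. by move=> /sinhc_ge1; apply: lt_le_trans. Qed.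

(** The ratio [r / sinh r] as a function of [s = cosh r]. At [s = - lform mu x] it is the factor in
    the Riemannian logarithm, and minus its logarithm is the volume term [phi] of the density. *)
Definition Fc s : R := (sinhc (acosh s))^-1.

Lemma Fc_gt0 s : 1 <= s -> 0 < Fc s.
Proof. by move=> s1; rewrite invr_gt0 sinhc_gt0// acosh_ge0. Qed.

Lemma sinh_acosh s : 1 <= s -> sinh (acosh s) ^+ 2 = s ^+ 2 - 1.
Proof. by move=> s1; rewrite -{2}(acoshK s1) cosh2_sinh2 addrC addKr. Qed.

Lemma Fc_acosh s : 1 <= s -> Fc s * sinh (acosh s) = acosh s.
Proof. by move=> s1; rewrite -sinhcE mulrA mulVf ?mul1r// gt_eqF// sinhc_gt0// acosh_ge0. Qed.

End HyperbolicFunctions.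

Section VectorDerivative.
Context {R : realType}.

Lemma is_derive_mxP m n (g : R -> 'M[R]_(m, n)) (t : R) l :
  is_derive t 1 g l <-> forall i j, is_derive t 1 (fun s => g s i j) (l i j).
Proof.
split=> [[dg <-] i j|h].
  have dgij := (derivable_mxP g t 1).1 dg i j.
  by apply: DeriveDef => //; rewrite derive_mx// mxE.
have dg : derivable g t 1 by apply/derivable_mxP => i j; have [] := h i j.
apply: DeriveDef => //; rewrite derive_mx//; apply/matrixP => i j; rewrite mxE.
by have [] := h i j.
Qed.

Lemma is_derive_derive1 (V : normedModType R) (g : R -> V) (t : R) l : is_derive t 1 g l -> derive1 g t = l.
Proof. by move=> [_ <-]; rewrite derive1E. Qed.

Lemma derivable_is_derive (V : normedModType R) (g : R -> V) (t : R) : derivable g t 1 -> is_derive t 1 g (derive1 g t).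
Proof. by move=> dg; apply: DeriveDef => //; rewrite derive1E. Qed.

Lemma is_derive_scale m n (f : R -> R) (t : R) l (v : 'M[R]_(m, n)) :
  is_derive t 1 f l -> is_derive t 1 (fun s => f s *: v) (l *: v).
Proof.
move=> df; apply/is_derive_mxP => i j; rewrite mxE.
under eq_fun do rewrite mxE.
by apply: is_derive_eq; rewrite scaler0 add0r mulrC.
Qed.

(* Factor the second-order equation as (D + c)(D - c) h = 0. *)
Lemma ode_unique (c : R) (h h' : R -> R) :
  (forall t : R, is_derive t 1 h (h' t)) -> (forall t : R, is_derive t 1 h' (c ^+ 2 * h t)) ->
  h 0 = 0 -> h' 0 = 0 -> forall t, h t = 0.
Proof.
move=> dh dh' h0 h'0.
have ex (a : R) (u : R -> R) : (forall t : R, is_derive t 1 u (a * u t)) -> u 0 = 0 -> forall t, u t = 0.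
  move=> du u0 t.
  have k (s : R) : is_derive s 1 (fun s : R => expR (- (a * s)) * u s) 0.
    have ds := du s.
    have de : is_derive s 1 (fun s : R => expR (- (a * s))) (expR (- (a * s)) * - a).
      apply: (@is_derive1_comp _ (@expR R) (fun s => - (a * s)) s).
      by apply: is_derive_eq; rewrite /GRing.scale /=; ring.
    apply: is_derive_eq; rewrite /GRing.scale /=; ring.
  have := is_derive_0_is_cst t 0 k; rewrite u0 mulr0 => /eqP.
  by rewrite mulf_eq0 gt_eqF ?expR_gt0//= => /eqP.
have z t : h' t - c * h t = 0.
  apply: (ex (- c) (fun t => h' t - c * h t)); last by rewrite h0 h'0 mulr0 subrr.
  move=> s; have ? := dh s; have ? := dh' s.
  by apply: is_derive_eq; rewrite /GRing.scale /=; ring.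
apply: (ex c h) => // s; have := dh s.
by have /eqP := z s; rewrite subr_eq0 => /eqP ->.
Qed.

End VectorDerivative.

(** * Lorentz form, geodesics and parallel transport *)

Section Lorentz.
Context {R : realType} {d : nat}.
Local Notation E := 'cV[R]_(1 + d).
Implicit Types (x y v w : E) (a : R).

Lemma lformC x y : lform x y = lform y x.
Proof. by rewrite /lform dotC mulrC. Qed.

Lemma lformDl x y v : lform (x + y) v = lform x v + lform y v.
Proof. by rewrite /lform linearD /= dotDl mxE; ring. Qed.

Lemma lformZl a x v : lform (a *: x) v = a * lform x v.
Proof. have e : dsubmx (a *: x) = a *: dsubmx x by apply/colP => i; rewrite !mxE.
by rewrite /lform e dotZl mxE; ring. Qed.

Lemma lformDr x y v : lform v (x + y) = lform v x + lform v y.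
Proof. by rewrite lformC lformDl !(lformC v). Qed.

Lemma lformZr a x v : lform v (a *: x) = a * lform v x.
Proof. by rewrite lformC lformZl lformC. Qed.

Lemma lformNl x v : lform (- x) v = - lform x v.
Proof. by rewrite -scaleN1r lformZl mulN1r. Qed.

Lemma lformNr x v : lform v (- x) = - lform v x.
Proof. by rewrite lformC lformNl lformC. Qed.

Lemma lform0l v : lform 0 v = 0.
Proof. by rewrite -(scale0r v) lformZl mul0r. Qed.

Lemma lform0r v : lform v 0 = 0.
Proof. by rewrite lformC lform0l. Qed.

Definition lformE := (lformDl, lformDr, lformZl, lformZr, lformNl, lformNr, lform0l, lform0r).

Lemma timeD x y : (x + y) 0 0 = x 0 0 + y 0 0. Proof. by rewrite mxE. Qed.

Lemma timeZ a x : (a *: x) 0 0 = a * x 0 0. Proof. by rewrite mxE. Qed.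

Lemma spaceD x y : dsubmx (x + y) = dsubmx x + dsubmx y.
Proof. by apply/colP => i; rewrite !mxE. Qed.

Lemma spaceZ a x : dsubmx (a *: x) = a *: dsubmx x.
Proof. by apply/colP => i; rewrite !mxE. Qed.

Lemma lshift0 : lshift d (0 : 'I_1) = 0 :> 'I_(1 + d).
Proof. exact: val_inj. Qed.

Lemma time_col_mx (a : 'cV[R]_1) (v : 'cV[R]_d) : (col_mx a v) 0 0 = a 0 0.
Proof. by rewrite -lshift0 col_mxEu. Qed.

Lemma eqE x y : x 0 0 = y 0 0 -> dsubmx x = dsubmx y -> x = y.
Proof.
move=> h1 h2; rewrite -[x]vsubmxK -[y]vsubmxK h2; congr col_mx.
by apply/colP => i; rewrite ord1 !mxE !lshift0.
Qed.

Lemma is_derive_dot n (f g : R -> 'cV[R]_n) (t : R) f' g' : is_derive t 1 f f' -> is_derive t 1 g g' ->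
  is_derive t 1 (fun s => dot (f s) (g s)) (dot f' (g t) + dot (f t) g').
Proof.
move=> /is_derive_mxP df /is_derive_mxP dg; rewrite /dot.
have -> : (fun s => \sum_i f s i 0 * g s i 0) = \sum_(i < n) (fun s => f s i 0 * g s i 0).
  by apply/funext => s; rewrite fct_sumE.
rewrite -big_split /=; apply: is_derive_sum => i.
have ? := df i 0; have ? := dg i 0.
by apply: is_derive_eq; rewrite /GRing.scale /=; ring.
Qed.

Lemma is_derive_lform (f g : R -> E) (t : R) f' g' : is_derive t 1 f f' -> is_derive t 1 g g' ->
  is_derive t 1 (fun s => lform (f s) (g s)) (lform f' (g t) + lform (f t) g').
Proof.
move=> df dg.
have sub (h : R -> E) h' : is_derive t 1 h h' -> is_derive t 1 (fun s => dsubmx (h s)) (dsubmx h').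
  move=> /is_derive_mxP dh; apply/is_derive_mxP => i j; rewrite mxE.
  by under eq_fun do rewrite mxE; exact: dh.
have ? := is_derive_dot (sub _ _ df) (sub _ _ dg).
have ? := (is_derive_mxP _ _ _).1 df 0 0; have ? := (is_derive_mxP _ _ _).1 dg 0 0.
by rewrite /lform; apply: is_derive_eq; rewrite /GRing.scale /=; ring.
Qed.

Section Points.
Variables x : E.
Hypothesis hx : hyperboloid x.

Lemma hyp_time : x 0 0 ^+ 2 = 1 + dot (dsubmx x) (dsubmx x).
Proof. by case: hx; rewrite /lform => h _; rewrite expr2; lra. Qed.

Lemma hyp_gt0 : 0 < x 0 0. Proof. by case: hx. Qed.

Lemma hyp_self : lform x x = -1. Proof. by case: hx. Qed.

(** Cauchy-Schwarz for the space parts, after orthogonality to [x] has eliminated the time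
    coordinate of [v]. This is why the Lorentz form is positive definite on tangent spaces. *)
Lemma tangent_ge v : lform x v = 0 -> dot (dsubmx v) (dsubmx v) / x 0 0 ^+ 2 <= lform v v.
Proof.
move=> xv; rewrite ler_pdivrMr ?exprn_gt0 ?hyp_gt0//.
have h := dot_CS (dsubmx x) (dsubmx v).
move: xv; rewrite /lform => /eqP; rewrite addrC subr_eq0 => /eqP e; rewrite e in h.
set q := dot (dsubmx v) _ in h *.
have e2 : q * x 0 0 ^+ 2 = q + dot (dsubmx x) (dsubmx x) * q by rewrite hyp_time; ring.
by lra.
Qed.

Lemma tangent_ge0 v : lform x v = 0 -> 0 <= lform v v.
Proof. by move=> /tangent_ge; apply: le_trans; rewrite divr_ge0 ?dot_ge0 ?sqr_ge0. Qed.

Lemma tangent_eq0 v : lform x v = 0 -> lform v v = 0 -> v = 0.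
Proof.
move=> xv vv; have := tangent_ge xv; rewrite vv => h.
have v'0 : dsubmx v = 0.
  apply/eqP; rewrite -dot_eq0 eq_le dot_ge0 andbT.
  by move: h; rewrite ler_pdivrMr ?exprn_gt0 ?hyp_gt0// mul0r.
apply: eqE; last by rewrite v'0 linear0.
move: vv; rewrite /lform v'0 dot0l addr0 mxE => /eqP; rewrite oppr_eq0 mulf_eq0 orbb.
by move=> /eqP.
Qed.

(** The reversed Cauchy-Schwarz inequality. With time coordinates [s] and [t] it reduces to [(s ^ 2
    - 1) * (t ^ 2 - 1) <= (s * t - 1) ^ 2], that is, to [0 <= (s - t) ^ 2]. It makes
    [acosh (- lform x y)], the distance, meaningful. *)
Lemma hyp_lform_ge1 y : hyperboloid y -> 1 <= - lform x y.
Proof.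
move=> hy; have y2 : y 0 0 ^+ 2 = 1 + dot (dsubmx y) (dsubmx y).
  by case: hy; rewrite /lform => h _; rewrite expr2; lra.
have y0 : 0 < y 0 0 by case: hy.
have CS := dot_CS (dsubmx x) (dsubmx y).
have x2 := hyp_time; have x0 := hyp_gt0; rewrite /lform.
set a := dot (dsubmx x) (dsubmx y) in CS *.
set p := dot _ _ in CS x2; set q := dot _ _ in CS y2.
have p0 : 0 <= p by exact: dot_ge0.
have q0 : 0 <= q by exact: dot_ge0.
move: (x 0 0) (y 0 0) x0 y0 x2 y2 => s t s0 t0 s2 t2.
have s1 : 1 <= s by nra.
have t1 : 1 <= t by nra.
have st1 : 1 <= s * t by rewrite -[leLHS]mulr1 ler_pM.
suff : a <= s * t - 1 by lra.
have [a0|a0] := leP a 0; first by lra.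
have a0' := ltW a0; have st2 : 0 <= s * t - 1 by lra.
rewrite -(@ler_pXn2r _ 2)//.
apply: le_trans CS _.
have -> : p = s ^+ 2 - 1 by lra.
have -> : q = t ^+ 2 - 1 by lra.
have := sqr_ge0 (s - t); rewrite !sqrrB !expr1n !exprMn; lra.
Qed.

End Points.

Definition lnorm v : R := Num.sqrt (lform v v).

(** The geodesic from [x] with initial velocity [v]; writing it with [sinhc] includes the constant
    geodesic [v = 0]. Its velocity is [geo']. *)
Definition geo x v (t : R) : E := cosh (t * lnorm v) *: x + (t * sinhc (t * lnorm v)) *: v.
Definition geo' x v (t : R) : E := (lnorm v * sinh (t * lnorm v)) *: x + cosh (t * lnorm v) *: v.

Lemma origin_hyp : hyperboloid (origin : E).
Proof.
rewrite /hyperboloid /= /lform /origin time_col_mx mxE col_mxKd dot0l; split; [ring|done].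
Qed.

Section Geodesics.
Variables (x v : E).
Hypotheses (hx : hyperboloid x) (hv : tangent x v).

Let c := lnorm v.

Lemma lnorm_sqr : lform v v = c ^+ 2.
Proof. by rewrite sqr_sqrtr//; exact: (tangent_ge0 hx). Qed.

Lemma lnorm_eq0 : c = 0 -> v = 0.
Proof. by move=> c0; apply: (tangent_eq0 hx) => //; rewrite lnorm_sqr c0 expr0n. Qed.

Lemma is_derive_cosh_mul (t : R) : is_derive t 1 (fun t : R => cosh (t * c)) (c * sinh (t * c)).
Proof.
have h : is_derive t 1 (fun t : R => t * c) c.
  by apply: is_derive_eq; rewrite /GRing.scale /= mulr1 mulr0 add0r.
have := @is_derive1_comp _ (@cosh R) (fun t => t * c) t _ _ (is_derive_cosh _) h.
by rewrite mulrC.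
Qed.

Lemma is_derive_sinh_mul (t : R) : is_derive t 1 (fun t : R => sinh (t * c)) (c * cosh (t * c)).
Proof.
have h : is_derive t 1 (fun t : R => t * c) c.
  by apply: is_derive_eq; rewrite /GRing.scale /= mulr1 mulr0 add0r.
have := @is_derive1_comp _ (@sinh R) (fun t => t * c) t _ _ (is_derive_sinh _) h.
by rewrite mulrC.
Qed.

(** The form that is convenient to differentiate. When [c = 0] the tangent vector itself is 0, so
    the division by zero is harmless. *)
Lemma geoE t : geo x v t = cosh (t * c) *: x + (sinh (t * c) / c) *: v.
Proof.
rewrite /geo -/c -sinhcE; have [c0|c0] := eqVneq c 0; first by rewrite (lnorm_eq0 c0) !scaler0.
by congr (_ + _ *: _); field.
Qed.

Lemma is_derive_geo (t : R) : is_derive t 1 (geo x v) (geo' x v t).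
Proof.
have -> : geo x v = (fun t : R => cosh (t * c) *: x + (sinh (t * c) / c) *: v).
  by apply/funext => s; rewrite geoE.
have h1 := is_derive_scale x (is_derive_cosh_mul t).
have ? := is_derive_sinh_mul t.
have h2 : is_derive t 1 (fun t : R => (sinh (t * c) / c) *: v) (cosh (t * c) *: v).
  have [c0|c0] := eqVneq c 0.
    rewrite (lnorm_eq0 c0) scaler0; under eq_fun do rewrite scaler0; exact: is_derive_cst.
  apply: is_derive_scale; apply: is_derive_eq.
  by rewrite /GRing.scale /=; field.
exact: is_derive_eq.
Qed.

Lemma is_derive_geo' (t : R) : is_derive t 1 (geo' x v) (c ^+ 2 *: geo x v t).
Proof.
have ? := is_derive_sinh_mul t.
have h1 : is_derive t 1 (fun t : R => (c * sinh (t * c)) *: x) ((c ^+ 2 * cosh (t * c)) *: x).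
  by apply: is_derive_scale; apply: is_derive_eq; rewrite /GRing.scale /=; ring.
have h2 := is_derive_scale v (is_derive_cosh_mul t).
rewrite /geo'; apply: is_derive_eq; rewrite geoE scalerDr !scalerA; congr (_ + _ *: _).
by have [->|c0] := eqVneq c 0; [ring|field].
Qed.

Lemma geo_hyp t : hyperboloid (geo x v t).
Proof.
have xx := hyp_self hx; have vv := lnorm_sqr; have xv : lform x v = 0 by [].
have self s : lform (geo x v s) (geo x v s) = -1.
  rewrite geoE !lformE (lformC v x) xx xv vv.
  have := cosh2_sinh2 (s * c).
  have [c0|c0] := eqVneq c 0.
    rewrite c0. rewrite mulr0 sinh0 cosh0 => _; ring.
  by move=> h; apply: (etrans (y := - cosh (s * c) ^+ 2 + sinh (s * c) ^+ 2)); [field|lra].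
split; first exact: self.
rewrite lt_def; apply/andP; split.
  apply/negP => /eqP h; have := self t; rewrite /lform h mul0r oppr0 add0r => e.
  by have := dot_ge0 (dsubmx (geo x v t)); rewrite e; lra.
have h1 : - lform x (geo x v t) = cosh (t * c).
  by rewrite geoE !lformE xx xv; ring.
rewrite leNgt; apply/negP => neg.
(* On the lower sheet the antipode would lie on the upper one, and [hyp_lform_ge1] would make
   [- cosh (t * c)] at least 1. *)
have hm : hyperboloid (- geo x v t).
  split; first by rewrite lformNl lformNr opprK self.
  by rewrite mxE oppr_gt0.
have := hyp_lform_ge1 hx hm; rewrite lformNr opprK => h2.
by have := cosh_gt0 (t * c); lra.
Qed.

Lemma lform_geo_geo' t : lform (geo x v t) (geo' x v t) = 0.
Proof.
have xx := hyp_self hx; have vv := lnorm_sqr; have xv : lform x v = 0 by [].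
rewrite geoE /geo' -/c !lformE (lformC v x) xx xv vv.
by have [->|c0] := eqVneq c 0; [rewrite mulr0 sinh0; ring|field].
Qed.

Lemma geodesic_geo : geodesic (geo x v).
Proof.
split; first exact: geo_hyp.
  by move=> t; have [] := is_derive_geo t.
have e : derive1 (geo x v) = geo' x v.
  by apply/funext => t; exact: is_derive_derive1 (is_derive_geo t).
move=> t; rewrite e; split.
- exact: lform_geo_geo'.
- by have [] := is_derive_geo' t.
rewrite /covderiv /tanproj (is_derive_derive1 (is_derive_geo' t)) lformZr.
by rewrite (hyp_self (geo_hyp t)) mulrN1 scaleNr subrr.
Qed.

Lemma geo0 : geo x v 0 = x.
Proof. by rewrite /geo !mul0r cosh0 scale1r scale0r addr0. Qed.

Lemma geo'0 : geo' x v 0 = v.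
Proof. by rewrite /geo' !mul0r cosh0 scale1r sinh0 mulr0 scale0r add0r. Qed.

(** The geodesic equation makes the acceleration a multiple [k t] of the position. The speed is then
    constant, and differentiating [lform g g' = 0] identifies [k] with [c ^ 2]. Every coordinate
    thus solves [h'' = c ^ 2 * h] with prescribed initial data. *)
Lemma geodesic_unique (g : R -> E) : geodesic g -> g 0 = x -> derive1 g 0 = v -> g = geo x v.
Proof.
move=> [gh gd gp] g0 g'0.
have dg t := derivable_is_derive (gd t).
have dg' (t : R) : is_derive t 1 (derive1 g) (derive1 (derive1 g) t).
  by apply: derivable_is_derive; have [] := gp t.
have tg t : lform (g t) (derive1 g t) = 0 by have [] := gp t.
pose k t := - lform (g t) (derive1 (derive1 g) t).
have g'' t : derive1 (derive1 g) t = k t *: g t.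
  by have [_ _ /eqP] := gp t; rewrite /covderiv /tanproj addr_eq0 => /eqP ->; rewrite scaleNr.
have nrm t : lform (derive1 g t) (derive1 g t) = c ^+ 2.
  rewrite -lnorm_sqr -g'0.
  apply: (@is_derive_0_is_cst _ (fun t => lform (derive1 g t) (derive1 g t))) => s.
  apply: is_derive_eq; first exact: (is_derive_lform (dg' s) (dg' s)).
  by rewrite g'' !lformE (lformC _ (g s)) tg mulr0 addr0.
have kc t : k t = c ^+ 2.
  have D := is_derive_lform (dg t) (dg' t).
  have e : (fun s => lform (g s) (derive1 g s)) = cst 0 by apply/funext => s; exact: tg.
  rewrite e in D.
  have := is_derive_derive1 D; rewrite (is_derive_derive1 (is_derive_cst 0 t 1)) nrm.
  by rewrite -[lform (g t) _]opprK -/(k t) => /esym/eqP; rewrite subr_eq0 => /eqP ->.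
apply/funext => t; apply/matrixP => i j; apply/eqP; rewrite -subr_eq0; apply/eqP.
apply: (@ode_unique _ c (fun t => g t i j - geo x v t i j) (fun t => derive1 g t i j - geo' x v t i j)).
- move=> s.
  have ? := (is_derive_mxP _ _ _).1 (dg s) i j; have ? := (is_derive_mxP _ _ _).1 (is_derive_geo s) i j.
  exact: is_derive_eq.
- move=> s.
  have ? := (is_derive_mxP _ _ _).1 (dg' s) i j; have ? := (is_derive_mxP _ _ _).1 (is_derive_geo' s) i j.
  by apply: is_derive_eq; rewrite g'' kc !mxE mulrBr.
- by rewrite g0 geo0 subrr.
- by rewrite g'0 geo'0 subrr.
Qed.

Lemma ExpE : Exp x v = cosh c *: x + sinhc c *: v.
Proof.
rewrite /Exp; case: xgetP => [y _ [g [gg g0 g'0 <-]]|].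
  by rewrite (geodesic_unique gg g0 g'0) /geo !mul1r.
move=> /(_ (geo x v 1)) []; exists (geo x v); split => //; first exact: geodesic_geo.
  exact: geo0.
by rewrite (is_derive_derive1 (is_derive_geo 0)) geo'0.
Qed.

Lemma Exp_hyp : hyperboloid (Exp x v).
Proof. by have := geo_hyp 1; rewrite ExpE /geo !mul1r. Qed.

Lemma lform_Exp : - lform x (Exp x v) = cosh c.
Proof. by rewrite ExpE !lformE (hyp_self hx) (hv : lform x v = 0); ring. Qed.

End Geodesics.

Lemma geodesic_geoE (g : R -> E) x : geodesic g -> g 0 = x ->
  exists v, [/\ hyperboloid x, tangent x v & g = geo x v].
Proof.
move=> gg g0; have [gh gd gp] := gg.
have hx : hyperboloid x by rewrite -g0.
have tv : tangent x (derive1 g 0) by rewrite -g0; have [] := gp 0.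
by exists (derive1 g 0); split => //; exact: geodesic_unique.
Qed.

Section LogPT.
Variables (x y : E).
Hypotheses (hx : hyperboloid x) (hy : hyperboloid y).
Let c := - lform x y.

Lemma hyp_dist_ge1 : 1 <= c. Proof. exact: hyp_lform_ge1. Qed.

Definition logv : E := Fc c *: (y - c *: x).

Lemma logv_tangent : tangent x logv.
Proof.
rewrite /tangent /= /logv !lformE (hyp_self hx).
by rewrite -[lform x y]opprK -/c; ring.
Qed.

Lemma lform_sub : lform (y - c *: x) (y - c *: x) = c ^+ 2 - 1.
Proof.
rewrite !lformE (hyp_self hx) (hyp_self hy) (lformC y).
by rewrite -[lform x y]opprK -/c; ring.
Qed.

Lemma lnorm_logv : lnorm logv = acosh c.
Proof.
have c1 := hyp_dist_ge1; rewrite /lnorm /logv lformZl lformZr lform_sub -sinh_acosh//.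
rewrite mulrA -expr2 -exprMn Fc_acosh// sqrtr_sqr ger0_norm//; exact: acosh_ge0.
Qed.

Lemma Exp_logv : Exp x logv = y.
Proof.
have c1 := hyp_dist_ge1.
rewrite ExpE ?lnorm_logv ?acoshK//; last exact: logv_tangent.
by rewrite /logv scalerA /Fc mulfV ?gt_eqF ?sinhc_gt0 ?acosh_ge0// scale1r addrC subrK.
Qed.

Lemma Exp_inj v : tangent x v -> Exp x v = y -> v = logv.
Proof.
move=> tv e; have := lform_Exp hx tv; rewrite e -/c => cE.
have n0 : 0 <= lnorm v by exact: sqrtr_ge0.
have ac : acosh c = lnorm v by rewrite cE coshK.
rewrite /logv -[X in _ *: (X - _)]e ExpE// -cE addrC addKr scalerA /Fc ac mulVf ?scale1r//.
by rewrite gt_eqF// sinhc_gt0.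
Qed.

Lemma LogE : Log x y = logv.
Proof.
rewrite /Log; case: xgetP => [v _ [tv ev]|]; first exact: Exp_inj.
by move=> /(_ logv) []; split; [exact: logv_tangent|exact: Exp_logv].
Qed.

(** Closed form of parallel transport from [x] to [y]: the multiple of [x + y] is the one that
    restores orthogonality to [y]. *)
Definition transport w : E := w + (lform y w / (1 + c)) *: (x + y).

Lemma transport_lform w : tangent x w -> lform (transport w) (transport w) = lform w w.
Proof.
move=> xw; have c1 := hyp_dist_ge1; have xw' : lform x w = 0 by [].
rewrite /transport !lformE (hyp_self hx) (hyp_self hy) (lformC w x) xw' (lformC w y) (lformC y x).
rewrite -[lform x y]opprK -/c; field; rewrite gt_eqF//; lra.
Qed.

Lemma transport_tangent w : tangent x w -> tangent y (transport w).
Proof.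
move=> xw; have c1 := hyp_dist_ge1.
rewrite /tangent /= /transport !lformE (hyp_self hy) (lformC y x).
rewrite -[lform x y]opprK -/c; field; rewrite gt_eqF//; lra.
Qed.

Section Field.
Variables (v w : E).
Hypotheses (tv : tangent x v) (tw : tangent x w).

(** The component of [w] along [v] follows the velocity of the geodesic, and the orthogonal
    component stays constant. For [lnorm v = 0] the quotient is 0 and the field is constant. *)
Definition pfield (t : R) : E := w + (lform v w / lnorm v ^+ 2) *: (geo' x v t - v).

Lemma parallel_pfield : parallel (geo x v) pfield.
Proof.
have xw : lform x w = 0 by []; have xv : lform x v = 0 by [].
have vv := lnorm_sqr hx tv; have xx := hyp_self hx.
have dP (t : R) : is_derive t 1 pfield ((lform v w / lnorm v ^+ 2) *: (lnorm v ^+ 2 *: geo x v t)).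
  have dg := is_derive_geo' hx tv t.
  have [G GE] : exists G, G = geo' x v by eexists.
  rewrite -GE in dg; have -> : pfield = fun t => w + (lform v w / lnorm v ^+ 2) *: (G t - v) by rewrite GE.
  apply/is_derive_mxP => i j.
  have ? := (is_derive_mxP _ _ _).1 dg i j.
  under eq_fun do rewrite !mxE.
  apply: is_derive_eq; rewrite [RHS]mxE [X in _ = _ * X]mxE.
  by rewrite /GRing.scale /= add0r mul1r subr0 [in LHS]mxE.
move=> t; split; last 2 first.
- by have [] := dP t.
- rewrite /covderiv (is_derive_derive1 (dP t)) /tanproj !lformZr (hyp_self (geo_hyp hx tv t)).
  by rewrite scalerA -scalerDl !mulrN1 !mulrN subrr scale0r.
rewrite /tangent /= /pfield lformDr lformZr lformDr (lform_geo_geo' hx tv) lformNr.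
rewrite (geoE hx tv) !lformDl !lformZl xw xv vv.
have [c0|c0] := eqVneq (lnorm v) 0.
  by rewrite c0 invr0; ring.
by field.
Qed.

Lemma pfield0 : pfield 0 = w.
Proof. by rewrite /pfield geo'0 subrr scaler0 addr0. Qed.

Lemma pfield1 : geo x v 1 = y -> pfield 1 = transport w.
Proof.
move=> gy; have c1 := hyp_dist_ge1.
have xw : lform x w = 0 by []; have xv : lform x v = 0 by [].
rewrite /pfield /transport -gy /geo' (geoE hx tv) mul1r.
have cE : c = cosh (lnorm v).
  by rewrite /c -gy (geoE hx tv) mul1r !lformDr !lformZr xv (hyp_self hx); ring.
have [c0|c0] := eqVneq (lnorm v) 0.
  have v0 := lnorm_eq0 hx tv c0.
  by rewrite v0 !lformE xw !(mulr0, mul0r, addr0, scale0r).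
rewrite cE !lformDl !lformZl xw mulr0 add0r.
have C2 := cosh2_sinh2 (lnorm v); have C1 := cosh_ge1 (lnorm v).
set C := cosh _ in C1 C2 *; set S := sinh _ in C2 *; set n := lnorm v in c0 *.
set p := lform v w.
rewrite -[X in _ = _ + _ *: (X + _)]scale1r addrA -scalerDl !scalerDr !scalerN !scalerA; congr (_ + _).
rewrite -addrA -scalerBl; congr (_ *: _ + _ *: _).
  by field; rewrite c0 gt_eqF//; lra.
rewrite -[X in _ - X]mulr1 -mulrBr.
have -> : S / n * p / (1 + C) * (S / n) = p / n ^+ 2 * (S ^+ 2 / (1 + C)).
  by field; rewrite c0 gt_eqF//; lra.
congr (_ * _); have -> : S ^+ 2 = (C - 1) * (1 + C) by lra.
by rewrite mulfK// gt_eqF//; lra.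
Qed.
End Field.

(** The difference of two parallel fields is tangent while its derivative is a multiple of the base
    point, hence normal. Its Lorentz square is therefore constant, and it is 0 at time 0. *)
Lemma parallel_unique v (V W : R -> E) : tangent x v -> parallel (geo x v) V -> parallel (geo x v) W ->
  V 0 = W 0 -> V = W.
Proof.
move=> tv pV pW VW0; apply/funext => t; apply/eqP; rewrite -subr_eq0; apply/eqP.
have gh := geo_hyp hx tv.
have tg s : lform (geo x v s) (V s - W s) = 0.
  by have [+ _ _] := pV s; have [+ _ _] := pW s; rewrite /tangent /= lformDr lformNr => -> ->; rewrite subrr.
apply: (tangent_eq0 (gh t) (tg t)).
transitivity (lform (V 0 - W 0) (V 0 - W 0)); last by rewrite VW0 subrr lform0l.
apply: (@is_derive_0_is_cst _ (fun t => lform (V t - W t) (V t - W t))) => s.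
have [_ dV cV] := pV s; have [_ dW cW] := pW s.
have d' (U : R -> E) : covderiv (geo x v) U s = 0 -> exists k, derive1 U s = k *: geo x v s.
  move/eqP; rewrite /covderiv /tanproj addr_eq0 => /eqP ->.
  by exists (- lform (geo x v s) (derive1 U s)); rewrite scaleNr.
have [k kE] := d' _ cV; have [l lE] := d' _ cW.
have dVW : is_derive s 1 (fun s => V s - W s) ((k - l) *: geo x v s).
  have := derivable_is_derive dV; have := derivable_is_derive dW; rewrite kE lE => ? ?.
  by apply: is_derive_eq; rewrite scalerBl.
apply: is_derive_eq; first exact: (is_derive_lform dVW dVW).
by rewrite lformZl lformZr (lformC (V s - W s)) tg mulr0 addr0.
Qed.

Lemma PTE w : tangent x w -> PT x y w = transport w.
Proof.
move=> tw; rewrite /PT; case: xgetP => [u _ [g [V [[gg g0 g1] [pV V0 <-]]]]|].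
  have [v [_ tv gE]] := geodesic_geoE gg g0.
  rewrite gE in pV g1; rewrite -(pfield1 tv tw g1); congr (_ 1).
  by apply: (parallel_unique tv pV (parallel_pfield tv tw)); rewrite V0 pfield0.
move=> /(_ (transport w)) []; exists (geo x logv), (pfield logv w).
have tl := logv_tangent.
have g1 : geo x logv 1 = y.
  by rewrite -[RHS]Exp_logv (ExpE hx tl) /geo !mul1r.
split; split => //.
- exact: geodesic_geo.
- exact: geo0.
- exact: parallel_pfield.
- exact: pfield0.
- exact: pfield1.
Qed.

End LogPT.

(** * The wrapped chart at a point and the density in closed form *)

Section TangentMap.
Variable (mu : E).
Hypothesis hmu : hyperboloid mu.

(** The space part of [x] after the Lorentz boost that moves [mu] to the origin; equivalently, the
    tangential part of [x] at [mu] transported back to the origin. It is linear in [x] and rational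
    in [mu], so that [Fc] carries all the transcendental part of [Tmap]. *)
Definition boost (x : E) : 'cV[R]_d :=
  dsubmx x - ((x 0 0 - lform mu x) / (1 + mu 0 0)) *: dsubmx mu.

Lemma tangent_embed (v : 'cV[R]_d) : tangent (origin : E) (embed v).
Proof.
by rewrite /tangent /= /lform /origin /embed !time_col_mx !col_mxKd dot0l !mxE mulr0 oppr0 addr0.
Qed.

Lemma lform_embed (v : 'cV[R]_d) : lform (embed v) (embed v) = dot v v.
Proof. by rewrite /lform /embed time_col_mx !col_mxKd mxE mulr0 oppr0 add0r. Qed.

Lemma lform_origin x : - lform (origin : E) x = x 0 0.
Proof. by rewrite /lform /origin time_col_mx col_mxKd dot0l mxE addr0 mul1r opprK. Qed.

Lemma PT_embed (v : 'cV[R]_d) : PT origin mu (embed v) =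
  embed v + (dot (dsubmx mu) v / (1 + mu 0 0)) *: (origin + mu).
Proof.
rewrite (PTE origin_hyp hmu (tangent_embed v)) /transport lform_origin.
by rewrite {1}/lform /embed time_col_mx col_mxKd mxE mulr0 oppr0 add0r.
Qed.

Lemma PT_embed_lform (v : 'cV[R]_d) : lform (PT origin mu (embed v)) (PT origin mu (embed v)) = dot v v.
Proof.
rewrite (PTE origin_hyp hmu (tangent_embed v)) (transport_lform origin_hyp hmu (tangent_embed v)).
exact: lform_embed.
Qed.

Lemma PT_embed_tangent (v : 'cV[R]_d) : tangent mu (PT origin mu (embed v)).
Proof.
rewrite (PTE origin_hyp hmu (tangent_embed v)).
exact: (transport_tangent origin_hyp hmu (tangent_embed v)).
Qed.

Lemma PT_embed_inj (v w : 'cV[R]_d) : PT origin mu (embed v) = PT origin mu (embed w) -> v = w.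
Proof.
have m0 := hyp_gt0 hmu.
rewrite !PT_embed => e.
(* The time coordinate of a transported vector reveals [dot (dsubmx mu) u], hence the whole
   correction term. *)
have t u : (embed u + (dot (dsubmx mu) u / (1 + mu 0 0)) *: (origin + mu) : E) 0 0 = dot (dsubmx mu) u.
  by rewrite !(timeD, timeZ) /embed /origin !time_col_mx !mxE; field; rewrite gt_eqF//; lra.
have dE : dot (dsubmx mu) v = dot (dsubmx mu) w by rewrite -t e t.
by move: e; rewrite dE => /addIr /(congr1 (@dsubmx R 1 d 1)); rewrite /embed !col_mxKd.
Qed.

Lemma PT_boost x : PT origin mu (embed (boost x)) = x + lform mu x *: mu.
Proof.
have m0 := hyp_gt0 hmu; have m2 := hyp_time hmu.
rewrite PT_embed.
have -> : dot (dsubmx mu) (boost x) = x 0 0 + lform mu x * mu 0 0.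
  rewrite /boost dotBr dotZr.
  have -> : dot (dsubmx mu) (dsubmx x) = lform mu x + mu 0 0 * x 0 0 by rewrite /lform; ring.
  have -> : dot (dsubmx mu) (dsubmx mu) = mu 0 0 ^+ 2 - 1 by lra.
  by field; rewrite gt_eqF//; lra.
apply: eqE.
  by rewrite !(timeD, timeZ) /embed /origin !time_col_mx !mxE; field; rewrite gt_eqF//; lra.
rewrite !(spaceD, spaceZ) /embed /origin !col_mxKd add0r /boost -addrA -scaleNr -scalerDl.
by congr (_ + _ *: _); field; rewrite gt_eqF//; lra.
Qed.

Lemma dot_boost x : hyperboloid x -> dot (boost x) (boost x) = lform mu x ^+ 2 - 1.
Proof.
move=> hx; rewrite -PT_embed_lform PT_boost !lformDl !lformDr !lformZl !lformZr.
by rewrite (hyp_self hx) (hyp_self hmu) (lformC x mu); ring.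
Qed.

Lemma TmapE x : hyperboloid x -> Tmap mu x = Fc (- lform mu x) *: boost x.
Proof.
move=> hx; have e : PT origin mu (embed (Fc (- lform mu x) *: boost x)) = Log mu x.
  rewrite LogE// /logv scaleNr opprK -PT_boost !PT_embed.
  rewrite [RHS]scalerDr dotZr -mulrA -scalerA; congr (_ + _).
  by rewrite /embed scale_col_mx scaler0.
rewrite /Tmap; case: xgetP => [v _ h|]; last by move=> /(_ _ e).
by apply: PT_embed_inj; rewrite h.
Qed.

Lemma enorm_Tmap x : hyperboloid x -> enorm (Tmap mu x) = acosh (- lform mu x).
Proof.
move=> hx; have c1 := hyp_lform_ge1 hmu hx.
rewrite TmapE// /enorm dotZl dotZr dot_boost// -sqrrN -sinh_acosh//.
by rewrite mulrA -expr2 -exprMn Fc_acosh// sqrtr_sqr ger0_norm//; exact: acosh_ge0.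
Qed.

Lemma phi_Tmap x : hyperboloid x -> phi (Tmap mu x) = - ln (Fc (- lform mu x)).
Proof.
move=> hx; have c1 := hyp_lform_ge1 hmu hx.
have e := enorm_Tmap hx.
rewrite /phi -enorm_eq0 e /Fc lnV ?posrE ?sinhc_gt0 ?acosh_ge0// opprK /sinhc.
by case: ifP => // _; rewrite ln1.
Qed.

Lemma logdensE (S : 'M[R]_d) x : hyperboloid x ->
  logdens mu S x = - 2^-1 * ln (\det S)
   - 2^-1 * (Fc (- lform mu x) ^+ 2 * qform (invmx S) (boost x)) + d.-1%:R * ln (Fc (- lform mu x)).
Proof.
move=> hx; rewrite /logdens phi_Tmap// mulrN opprK TmapE//.
by rewrite /qform -scalemxAr dotZl dotZr expr2 mulrA.
Qed.

Definition wexp (v : 'cV[R]_d) : E := Exp mu (PT origin mu (embed v)).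

Lemma wexpE (v : 'cV[R]_d) : wexp v = cosh (enorm v) *: mu + sinhc (enorm v) *: PT origin mu (embed v).
Proof. by rewrite /wexp (ExpE hmu (PT_embed_tangent v)) /lnorm PT_embed_lform. Qed.

Lemma wexp_hyp (v : 'cV[R]_d) : hyperboloid (wexp v).
Proof. exact: (Exp_hyp hmu (PT_embed_tangent v)). Qed.

Lemma lform_wexp (v : 'cV[R]_d) : - lform mu (wexp v) = cosh (enorm v).
Proof. by rewrite /wexp (lform_Exp hmu (PT_embed_tangent v)) /lnorm PT_embed_lform. Qed.

Lemma Tmap_wexp (v : 'cV[R]_d) : Tmap mu (wexp v) = v.
Proof.
have e : PT origin mu (embed v) = Log mu (wexp v).
  rewrite LogE//; last exact: wexp_hyp.
  by apply: Exp_inj => //; exact: PT_embed_tangent.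
rewrite /Tmap; case: xgetP => [w _ h|]; last by move=> /(_ _ e).
by apply: PT_embed_inj; rewrite h.
Qed.

End TangentMap.
End Lorentz.

(** * The function acosh s / sqrt (s ^ 2 - 1) *)

Section StieltjesFormula.
Context {R : realType}.
Implicit Types s t r e : R.

Definition kern s t : R := (1 + 2 * s * t + t ^+ 2)^-1.
(** Minus the logarithmic derivative of [kern] in [s], times [s]. It lies between 0 and 1 for
    nonnegative arguments, which makes expansions in the relative increment of [s] uniform in
    [s]. *)
Definition wkern s t : R := 2 * s * t * kern s t.

Lemma kern_den_gt0 s t : 0 <= s -> 0 <= t -> 0 < 1 + 2 * s * t + t ^+ 2.
Proof. by move=> s0 t0; rewrite ltr_pwDl ?sqr_ge0// ltr_pwDl// !mulr_ge0. Qed.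

Lemma kern_gt0 s t : 0 <= s -> 0 <= t -> 0 < kern s t.
Proof. by move=> s0 t0; rewrite invr_gt0 kern_den_gt0. Qed.

Lemma wkern_itv s t : 0 <= s -> 0 <= t -> 0 <= wkern s t <= 1.
Proof.
move=> s0 t0; rewrite /wkern mulr_ge0 ?(ltW (kern_gt0 _ _))// ?mulr_ge0//=.
by rewrite ler_pdivrMr ?kern_den_gt0// mul1r addrAC lerDr addr_ge0// sqr_ge0.
Qed.

Definition int01 (f : R -> R) : R := \int[lebesgue_measure]_(t in `[0, 1]) f t.

Lemma integrable01 (f : R -> R) : {within `[0, 1], continuous f} ->
  lebesgue_measure.-integrable `[0, 1] (EFin \o f).
Proof. by move=> cf; apply: continuous_compact_integrable => //; exact: segment_compact. Qed.

Lemma int01D (f g : R -> R) : {within `[0, 1], continuous f} -> {within `[0, 1], continuous g} ->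
  int01 (fun t => f t + g t) = int01 f + int01 g.
Proof. by move=> cf cg; rewrite /int01 RintegralD//; exact: integrable01. Qed.

Lemma int01Z (f : R -> R) a : {within `[0, 1], continuous f} ->
  int01 (fun t => a * f t) = a * int01 f.
Proof. by move=> cf; rewrite /int01 RintegralZl//; exact: integrable01. Qed.

Lemma int01_le (f g : R -> R) : {within `[0, 1], continuous f} -> {within `[0, 1], continuous g} ->
  (forall t, 0 <= t <= 1 -> f t <= g t) -> int01 f <= int01 g.
Proof.
by move=> cf cg h; apply: le_Rintegral => //; exact: integrable01.
Qed.

Lemma continuous_kern s : 0 <= s -> {within `[0, 1], continuous (kern s)}.
Proof.
move=> s0; apply: continuous_in_subspaceT => t; rewrite inE/= in_itv/= => /andP[t0 _].
apply: cvgV; first by rewrite gt_eqF// kern_den_gt0.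
apply: cvgD; last by apply: cvgM; exact: cvg_id.
by apply: cvgD; [exact: cvg_cst|apply: cvgM; [exact: cvg_cst|exact: cvg_id]].
Qed.

Lemma within01M (f g : R -> R) : {within `[0, 1], continuous f} -> {within `[0, 1], continuous g} ->
  {within `[0, 1], continuous (fun t => f t * g t)}.
Proof. by move=> cf cg t; apply: cvgM; [exact: cf|exact: cg]. Qed.

Lemma continuous_wkern s : 0 <= s -> {within `[0, 1], continuous (wkern s)}.
Proof.
move=> s0; apply: within01M; last exact: continuous_kern.
by apply: continuous_subspaceT => t; apply: cvgM; [exact: cvg_cst|exact: cvg_id].
Qed.

(** The denominator factors as [(t + expR r) * (t + expR (- r))], so partial fractions give a
    logarithmic antiderivative. *)
Lemma int01_kern r : 0 < r -> int01 (kern (cosh r)) = r / (2 * sinh r).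
Proof.
move=> r0; have S0 := sinh_gt0 r0.
pose G t := (ln (t + expR (- r)) - ln (t + expR r)) / (2 * sinh r).
have e1 := expR_gt0 r; have e2 := expR_gt0 (- r).
have ee : expR r * expR (- r) = 1 by rewrite -expRD subrr expR0.
have dG t : 0 <= t -> is_derive t 1 G (kern (cosh r) t).
  move=> t0.
  have h a : 0 < a -> is_derive t 1 (fun t => ln (t + a)) (t + a)^-1.
    move=> a0; have ta : 0 < t + a by rewrite ltr_wpDl.
    have l := is_derive1_ln ta.
    have ? : is_derive t 1 (fun t : R => t + a) 1 by apply: is_derive_eq; rewrite addr0.
    have := @is_derive1_comp _ (@ln R) (fun t => t + a) t _ _ l _.
    by move=> /(_ 1 _); rewrite mulr1; apply.
  have ? := h _ e1; have ? := h _ e2.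
  rewrite /G; apply: is_derive_eq.
  rewrite /GRing.scale /= /kern.
  have -> : 1 + 2 * cosh r * t + t ^+ 2 = (t + expR r) * (t + expR (- r)).
    rewrite /cosh; apply: (etrans (y := expR r * expR (- r) + (expR r + expR (- r)) * t + t ^+ 2)).
      by rewrite ee; field.
    by ring.
  have : 0 < t + expR r by rewrite ltr_wpDl.
  have : 0 < t + expR (- r) by rewrite ltr_wpDl.
  move: S0; rewrite /sinh; move: (expR r) (expR (- r)) => a b S0 h1 h2.
  by field; rewrite !gt_eqF//=; lra.
have cG t : 0 <= t -> {for t, continuous G}.
  by move=> /dG [dGt _]; apply/differentiable_continuous/derivable1_diffP.
have := @continuous_FTC2 R (kern (cosh r)) G 0 1 ltr01 (continuous_kern (ltW (cosh_gt0 r))).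
move=> FT; rewrite /int01 /Rintegral FT; last 2 first.
- split.
  + by move=> t; rewrite in_itv/= => /andP[t0 _]; have [] := dG t (ltW t0).
  + by apply: cvg_at_right_filter; exact: cG.
  + by apply: cvg_at_left_filter; exact: cG.
- move=> t; rewrite in_itv/= => /andP[t0 _]; rewrite derive1E.
  by have [_ ->] := dG t (ltW t0).
rewrite -EFinB /= /G !add0r !expRK -mulrBl.
have -> : ln (1 + expR (- r)) = ln (1 + expR r) - r.
  rewrite -{3}(expRK r) -ln_div ?posrE ?addr_gt0//; congr ln.
  have -> : expR (- r) = (expR r)^-1 by rewrite -expRN.
  by field; rewrite gt_eqF.
by congr (_ / _); ring.
Qed.

Lemma int01_kern1 : int01 (kern 1) = 2^-1.
Proof.
pose G t : R := - (1 + t)^-1.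
have dG t : 0 <= t -> is_derive t 1 G (kern 1 t).
  move=> t0; have t1 : 1 + t != 0 by rewrite gt_eqF// ltr_pwDl.
  have ? : is_derive t 1 (fun t : R => 1 + t) 1 by apply: is_derive_eq; rewrite /GRing.scale /=; ring.
  have ? := @is_deriveV R (fun t => 1 + t) t 1 1 t1 _.
  rewrite /G; apply: is_derive_eq.
  rewrite /GRing.scale /= /kern.
  have -> : 1 + 2 * 1 * t + t ^+ 2 = (1 + t) ^+ 2 by ring.
  by field.
have cG t : 0 <= t -> {for t, continuous G}.
  by move=> /dG [dGt _]; apply/differentiable_continuous/derivable1_diffP.
have := @continuous_FTC2 R (kern 1) G 0 1 ltr01 (continuous_kern ler01).
move=> FT; rewrite /int01 /Rintegral FT; last 2 first.
- split.
  + by move=> t; rewrite in_itv/= => /andP[t0 _]; have [] := dG t (ltW t0).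
  + by apply: cvg_at_right_filter; exact: cG.
  + by apply: cvg_at_left_filter; exact: cG.
- move=> t; rewrite in_itv/= => /andP[t0 _]; rewrite derive1E.
  by have [_ ->] := dG t (ltW t0).
by rewrite -EFinB /= /G; field.
Qed.

(* acosh s / sqrt (s^2 - 1) is a Stieltjes transform; this removes the apparent singularity at s = 1. *)
Lemma Fc_int s : 1 <= s -> Fc s = 2 * int01 (kern s).
Proof.
move=> s1; have a0 := acosh_ge0 s1; rewrite /Fc /sinhc; case: eqVneq => [e|n0].
  have -> : s = 1 by rewrite -(acoshK s1) e cosh0.
  by rewrite int01_kern1 divff// invr1.
have ag : 0 < acosh s by rewrite lt_def n0.
rewrite -{3}(acoshK s1) int01_kern//.
by have := sinh_gt0 ag => h; field; rewrite n0 gt_eqF.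
Qed.

(** Multiplying [s] by [1 + e] divides [kern] by [1 + e * wkern s t]. The geometric series has the
    exact remainder [e ^ 3 * w ^ 3 / (1 + e * w)] up to sign, and its denominator is at least one
    half. *)
Lemma kern_expand s t e : 1 <= s -> 0 <= t -> `|e| <= 2^-1 ->
  `|kern (s * (1 + e)) t - (kern s t - e * (wkern s t * kern s t) + e ^+ 2 * (wkern s t * wkern s t * kern s t))|
    <= 2 * `|e| ^+ 3 * kern s t.
Proof.
move=> s1 t0 e2; have s0 : 0 <= s by lra.
have k0 := kern_gt0 s0 t0; have /andP[w0 w1] := wkern_itv s0 t0.
have := e2; rewrite ler_norml => /andP[e3 e4].
have we : 2^-1 <= 1 + e * wkern s t by nra.
have -> : kern (s * (1 + e)) t = kern s t / (1 + e * wkern s t).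
  have D := kern_den_gt0 s0 t0.
  rewrite /wkern in we *; rewrite /kern in we *.
  set D0 := 1 + 2 * s * t + t ^+ 2 in D we *.
  rewrite -invfM; congr (_^-1).
  rewrite /D0 in D *; field; rewrite gt_eqF//.
set w := wkern s t in w0 w1 we *.
have -> : kern s t / (1 + e * w) - (kern s t - e * (w * kern s t) + e ^+ 2 * (w * w * kern s t)) =
   - (e ^+ 3 * (w ^+ 3 / (1 + e * w)) * kern s t).
  by field; rewrite gt_eqF//; lra.
rewrite normrN normrM (gtr0_norm k0) normrM normrX ler_wpM2r ?(ltW k0)// mulrC ler_wpM2r// ?exprn_ge0//.
rewrite ger0_norm; last by rewrite divr_ge0 ?exprn_ge0//; lra.
rewrite ler_pdivrMr; last by lra.
have : w ^+ 3 <= 1 by rewrite exprn_ile1.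
by lra.
Qed.

(** Integrating [kern_expand] gives constants independent of [s]. They hold up to the boundary point
    [s = 1], which is reached when an observation coincides with the location parameter. *)
Lemma Fc_expand s : 1 <= s -> exists a b : R, [/\ `|a| <= 1, `|b| <= 1 &
  forall e, `|e| <= 2^-1 -> 1 <= s * (1 + e) ->
    `|Fc (s * (1 + e)) / Fc s - (1 + a * e + b * e ^+ 2)| <= 2 * `|e| ^+ 3].
Proof.
move=> s1; have s0 : 0 <= s by lra.
pose g1 t := wkern s t * kern s t; pose g2 t := wkern s t * wkern s t * kern s t.
have ck := continuous_kern s0; have cw := continuous_wkern s0.
have c1 : {within `[0, 1], continuous g1} by exact: within01M.
have c2 : {within `[0, 1], continuous g2} by do 2 apply: within01M => //.
have F0 := Fc_gt0 s1.
have i0 : int01 (fun=> 0) = 0.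
  by rewrite /int01 /Rintegral integral0.
have c0 : {within `[0, 1], continuous (fun _ : R => 0 : R)} by apply: continuous_subspaceT => ?; exact: cvg_cst.
have b1 : 0 <= int01 g1 <= int01 (kern s).
  rewrite -{1}i0 !int01_le// => t /andP[t0 _].
    have /andP[w0 w1] := wkern_itv s0 t0; have k0 := kern_gt0 s0 t0.
    by rewrite /g1 mulr_ge0// ltW.
  have /andP[w0 w1] := wkern_itv s0 t0; have k0 := kern_gt0 s0 t0.
  by rewrite /g1 ler_piMl// ltW.
have b2 : 0 <= int01 g2 <= int01 (kern s).
  rewrite -{1}i0 !int01_le// => t /andP[t0 _].
    have /andP[w0 w1] := wkern_itv s0 t0; have k0 := kern_gt0 s0 t0.
    by rewrite /g2 !mulr_ge0// ltW.
  have /andP[w0 w1] := wkern_itv s0 t0; have k0 := kern_gt0 s0 t0.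
  by rewrite /g2 ler_piMl//; [exact: ltW|exact: mulr_ile1].
have I0 : 0 < int01 (kern s) by move: F0; rewrite Fc_int// pmulr_rgt0.
exists (- (int01 g1 / int01 (kern s))), (int01 g2 / int01 (kern s)).
have ab x : 0 <= x <= int01 (kern s) -> `|x / int01 (kern s)| <= 1.
  move=> /andP[x0 x1]; rewrite ger0_norm ?divr_ge0//; last exact: ltW.
  by rewrite ler_pdivrMr// mul1r.
split; [by rewrite normrN ab|by rewrite ab|].
move=> e e2 se1; have se0 : 0 <= s * (1 + e) by lra.
have cse := continuous_kern se0.
have key : `|int01 (kern (s * (1 + e))) - (int01 (kern s) - e * int01 g1 + e ^+ 2 * int01 g2)|
    <= 2 * `|e| ^+ 3 * int01 (kern s).
  pose q t := kern s t + (- e * g1 t + e ^+ 2 * g2 t).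
  have cZ a (f : R -> R) : {within `[0, 1], continuous f} -> {within `[0, 1], continuous (fun t => a * f t : R)}.
    by move=> cf; apply: within01M => //; apply: continuous_subspaceT => ?; exact: cvg_cst.
  have cD (f g : R -> R) : {within `[0, 1], continuous f} -> {within `[0, 1], continuous g} ->
      {within `[0, 1], continuous (fun t => f t + g t : R)}.
    by move=> cf cg t; apply: cvgD; [exact: cf|exact: cg].
  have cq : {within `[0, 1], continuous q} by exact: (cD _ _ ck (cD _ _ (cZ _ _ c1) (cZ _ _ c2))).
  have iq : int01 q = int01 (kern s) - e * int01 g1 + e ^+ 2 * int01 g2.
    rewrite /q int01D ?int01D ?int01Z//; last 3 first.
    - exact: cZ.
    - exact: cZ.
    - by apply: cD; exact: cZ.
    by ring.
  have cK := cZ (2 * `|e| ^+ 3) _ ck.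
  have h1 : int01 (kern (s * (1 + e))) <= int01 q + 2 * `|e| ^+ 3 * int01 (kern s).
    rewrite -int01Z// -int01D//; apply: int01_le => //; first exact: (cD _ _ cq cK).
    move=> t /andP[t0 _]; have := kern_expand s1 t0 e2.
    by rewrite ler_norml /q /g1 /g2 => /andP[]; lra.
  have h2 : int01 q <= int01 (kern (s * (1 + e))) + 2 * `|e| ^+ 3 * int01 (kern s).
    rewrite -int01Z// -int01D//; apply: int01_le => //; first exact: (cD _ _ cse cK).
    move=> t /andP[t0 _]; have := kern_expand s1 t0 e2.
    by rewrite ler_norml /q /g1 /g2 => /andP[]; lra.
  by rewrite -iq ler_norml; apply/andP; split; [rewrite lerNl opprB lerBlDl|rewrite lerBlDl].
rewrite (Fc_int se1) (Fc_int s1).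
set I := int01 (kern s) in I0 key *.
have -> : 2 * int01 (kern (s * (1 + e))) / (2 * I) - (1 + - (int01 g1 / I) * e + int01 g2 / I * e ^+ 2) =
  (int01 (kern (s * (1 + e))) - (I - e * int01 g1 + e ^+ 2 * int01 g2)) / I.
  by field; rewrite gt_eqF.
by rewrite normrM normfV (gtr0_norm I0) ler_pdivrMr.
Qed.

End StieltjesFormula.

(** * Second-order expansions *)

Section Jets.
Context {R : realType} {p : nat}.
Implicit Types (h a : 'cV[R]_p) (Q : 'M[R]_p) (f g : 'cV[R]_p -> R).

(** The l1 norm lets a bound on all coefficients pass to [dot] and [qform] without dimensional
    constants. *)
Definition nrm1 h : R := \sum_i `|h i 0|.

Lemma nrm1_ge0 h : 0 <= nrm1 h. Proof. exact: sumr_ge0. Qed.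

Lemma nrm10 : nrm1 0 = 0.
Proof. by rewrite /nrm1 big1// => i _; rewrite mxE normr0. Qed.

Lemma nrm1Z k h : nrm1 (k *: h) = `|k| * nrm1 h.
Proof. by rewrite /nrm1 mulr_sumr; apply: eq_bigr => i _; rewrite mxE normrM. Qed.

Lemma coord_le_nrm1 h i : `|h i 0| <= nrm1 h.
Proof. by rewrite /nrm1 (bigD1 i)//= lerDl sumr_ge0. Qed.

Lemma dot_bound N a h : (forall i, `|a i 0| <= N) -> `|dot a h| <= N * nrm1 h.
Proof.
move=> aN; rewrite /dot mulr_sumr; apply: le_trans (ler_norm_sum _ _ _) _.
by apply: ler_sum => i _; rewrite normrM ler_wpM2r.
Qed.

Lemma qform_bound N Q h : (forall i j, `|Q i j| <= N) -> `|qform Q h| <= N * nrm1 h ^+ 2.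
Proof.
move=> QN; rewrite /qform dotC expr2 mulrA; apply: dot_bound => i.
rewrite mxE -[nrm1 h]/(\sum_j _) mulr_sumr; apply: le_trans (ler_norm_sum _ _ _) _.
by apply: ler_sum => j _; rewrite normrM ler_wpM2r.
Qed.

(** A second-order expansion whose coefficients and cubic remainder share one bound [N]. In the
    applications [N] depends on the observation and has to be integrated, so it is tracked through
    every operation. *)
Definition jet (de N : R) f := exists c a Q,
  [/\ `|c| <= N, forall i, `|a i 0| <= N, forall i j, `|Q i j| <= N &
   forall h, nrm1 h <= de -> `|f h - (c + dot a h + qform Q h)| <= N * nrm1 h ^+ 3].

Lemma qformDl Q Q' h : qform (Q + Q') h = qform Q h + qform Q' h.
Proof. by rewrite /qform mulmxDl dotDr. Qed.

Lemma qformZl k Q h : qform (k *: Q) h = k * qform Q h.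
Proof. by rewrite /qform -scalemxAl dotZr. Qed.

Lemma qform0l h : qform (0 : 'M[R]_p) h = 0.
Proof. by rewrite /qform mul0mx dot0r. Qed.

Lemma qform0r Q : qform Q 0 = 0.
Proof. by rewrite /qform dot0l. Qed.

Lemma qform_outer a b h : qform (a *m b^T) h = dot a h * dot b h.
Proof. by rewrite /qform outer_mul dotZr mulrC (dotC h). Qed.

Lemma jet_ext de N f g : (forall h, nrm1 h <= de -> f h = g h) -> jet de N f -> jet de N g.
Proof. by move=> e [c [a [Q [h1 h2 h3 h4]]]]; exists c, a, Q; split => // h hd; rewrite -e// h4. Qed.

Lemma jet_le de N de' N' f : de' <= de -> N <= N' -> jet de N f -> jet de' N' f.
Proof.
move=> dd NN [c [a [Q [h1 h2 h3 h4]]]]; exists c, a, Q; split.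
- exact: le_trans NN.
- by move=> i; exact: le_trans NN.
- by move=> i j; exact: le_trans NN.
- move=> h hd; apply: le_trans (h4 h (le_trans hd dd)) _.
  by rewrite ler_wpM2r// exprn_ge0// nrm1_ge0.
Qed.

Lemma jet_ge0 de N f : jet de N f -> 0 <= N.
Proof. by move=> [c [a [Q [h1 _ _ _]]]]; exact: le_trans h1. Qed.

Lemma jet_at0 de N f c a Q : 0 <= de ->
  (forall h, nrm1 h <= de -> `|f h - (c + dot a h + qform Q h)| <= N * nrm1 h ^+ 3) -> f 0 = c.
Proof.
move=> d0 h4; have := h4 0; rewrite nrm10 => /(_ d0).
rewrite expr0n mulr0 dot0r qform0r !addr0 normr_le0 subr_eq0.
by move=> /eqP.
Qed.

Lemma jet_cst de c : jet de `|c| (fun=> c).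
Proof.
exists c, 0, 0; split => //; [by move=> i; rewrite mxE normr0|by move=> i j; rewrite mxE normr0|].
move=> h _; rewrite dot0l qform0l !addr0 subrr normr0.
by rewrite mulr_ge0// exprn_ge0// nrm1_ge0.
Qed.

Lemma jet_lin de N a : 0 <= N -> (forall i, `|a i 0| <= N) -> jet de N (dot a).
Proof.
move=> N0 aN; exists 0, a, 0; split; rewrite ?normr0//; first by move=> i j; rewrite mxE normr0.
move=> h _; rewrite qform0l add0r addr0 subrr normr0.
by rewrite mulr_ge0// exprn_ge0// nrm1_ge0.
Qed.

Lemma jetD de N N' f g : jet de N f -> jet de N' g -> jet de (N + N') (fun h => f h + g h).
Proof.
move=> [c [a [Q [h1 h2 h3 h4]]]] [c' [a' [Q' [h1' h2' h3' h4']]]].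
exists (c + c'), (a + a'), (Q + Q'); split.
- by rewrite (le_trans (ler_normD _ _))// lerD.
- by move=> i; rewrite mxE (le_trans (ler_normD _ _))// lerD.
- by move=> i j; rewrite mxE (le_trans (ler_normD _ _))// lerD.
- move=> h hd; have e : f h + g h - (c + c' + dot (a + a') h + qform (Q + Q') h) =
    (f h - (c + dot a h + qform Q h)) + (g h - (c' + dot a' h + qform Q' h)).
    by rewrite dotDl qformDl; ring.
  by rewrite e (le_trans (ler_normD _ _))// mulrDl lerD ?h4 ?h4'.
Qed.

Lemma jetZ de N k f : jet de N f -> jet de (`|k| * N) (fun h => k * f h).
Proof.
move=> [c [a [Q [h1 h2 h3 h4]]]]; exists (k * c), (k *: a), (k *: Q); split.
- by rewrite normrM ler_wpM2l.
- by move=> i; rewrite mxE normrM ler_wpM2l.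
- by move=> i j; rewrite mxE normrM ler_wpM2l.
- move=> h hd; rewrite dotZl qformZl -!mulrDr -mulrBr normrM -mulrA ler_wpM2l//.
  exact: h4.
Qed.

Lemma jet_bound de N f : de <= 1 -> jet de N f -> forall h, nrm1 h <= de -> `|f h| <= 4 * N.
Proof.
move=> d1 jf; have N0 := jet_ge0 jf; move: jf => [c [a [Q [h1 h2 h3 h4]]]] h hd.
have n0 := nrm1_ge0 h; have n1 : nrm1 h <= 1 by exact: le_trans hd d1.
have := h4 h hd; have := dot_bound h h2; have := qform_bound h h3.
have a2 : nrm1 h ^+ 2 <= 1 by exact: exprn_ile1.
have a3 : nrm1 h ^+ 3 <= 1 by exact: exprn_ile1.
have b1 : N * nrm1 h <= N by exact: ler_piMr.
have b2 : N * nrm1 h ^+ 2 <= N by exact: ler_piMr.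
have b3 : N * nrm1 h ^+ 3 <= N by exact: ler_piMr.
by move: h1; rewrite !ler_norml => /andP[? ?] /andP[? ?] /andP[? ?] /andP[? ?]; apply/andP; split; lra.
Qed.

Lemma jet_lip de N f : 0 <= de <= 1 -> jet de N f -> forall h, nrm1 h <= de -> `|f h - f 0| <= 3 * N * nrm1 h.
Proof.
move=> /andP[d0 d1] jf; have N0 := jet_ge0 jf; move: jf => [c [a [Q [h1 h2 h3 h4]]]] h hd.
have n0 := nrm1_ge0 h; have n1 : nrm1 h <= 1 by exact: le_trans hd d1.
rewrite (jet_at0 d0 h4).
have := h4 h hd; have := dot_bound h h2; have := qform_bound h h3.
have b2 : N * nrm1 h ^+ 2 <= N * nrm1 h by rewrite ler_wpM2l// expr2 ler_piMl.
have b3 : N * nrm1 h ^+ 3 <= N * nrm1 h by rewrite ler_wpM2l// exprS ler_piMr// exprn_ile1.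
by rewrite !ler_norml => /andP[? ?] /andP[? ?] /andP[? ?]; apply/andP; split; lra.
Qed.

Lemma jetM de N N' f g : de <= 1 -> jet de N f -> jet de N' g -> jet de (16 * N * N') (fun h => f h * g h).
Proof.
move=> d1 jf jg; have N0 := jet_ge0 jf; have N0' := jet_ge0 jg; have bg := jet_bound d1 jg.
move: jf jg => [c [a [Q [h1 h2 h3 h4]]]] [c' [a' [Q' [h1' h2' h3' h4']]]].
have NN : 0 <= N * N' by rewrite mulr_ge0.
have nM x y : `|x| <= N -> `|y| <= N' -> `|x * y| <= N * N' by move=> ? ?; rewrite normrM ler_pM.
exists (c * c'), (c' *: a + c *: a'), (c' *: Q + c *: Q' + a *m a'^T); split.
- by have := nM _ _ h1 h1'; lra.
- move=> i; rewrite !mxE (le_trans (ler_normD _ _))//.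
  by have := nM _ _ (h2 i) h1'; have := nM _ _ h1 (h2' i); rewrite (mulrC c'); lra.
- move=> i j; rewrite !mxE big_ord1 mxE; do 2 rewrite (le_trans (ler_normD _ _))// -?lerBrDr.
  have := nM _ _ (h3 i j) h1'; have := nM _ _ h1 (h3' i j); have := nM _ _ (h2 i) (h2' j).
  by rewrite (mulrC c'); lra.
move=> h hd; have n0 := nrm1_ge0 h; have n1 : nrm1 h <= 1 by exact: le_trans hd d1.
rewrite !(dotDl, dotZl, qformDl, qformZl, qform_outer).
have r1 := h4 h hd; have r2 := h4' h hd; have l1 := dot_bound h h2; have l2 := dot_bound h h2'.
have q1 := qform_bound h h3; have q2 := qform_bound h h3'; have bgh := bg h hd.
set n := nrm1 h in n0 n1 r1 r2 l1 l2 q1 q2 *.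
set A := dot a h in l1 r1 *; set A' := dot a' h in l2 r2 *; set B := qform Q h in q1 r1 *; set B' := qform Q' h in q2 r2 *.
have e : f h * g h - (c * c' + (c' * A + c * A') + (c' * B + c * B' + A * A')) =
  (f h - (c + A + B)) * g h + (c + A + B) * (g h - (c' + A' + B')) + (A * B' + B * A') + B * B' by ring.
rewrite e.
have n3 : 0 <= n ^+ 3 by rewrite exprn_ge0.
(* The five error terms contribute 4, 3, 1, 1 and 1, so the factor 16 of the statement leaves
   room. *)
have m1 : `|(f h - (c + A + B)) * g h| <= 4 * (N * N') * n ^+ 3.
  have -> : 4 * (N * N') * n ^+ 3 = (N * n ^+ 3) * (4 * N') by ring.
  by rewrite normrM ler_pM.
have m2 : `|(c + A + B) * (g h - (c' + A' + B'))| <= 3 * (N * N') * n ^+ 3.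
  have -> : 3 * (N * N') * n ^+ 3 = (3 * N) * (N' * n ^+ 3) by ring.
  rewrite normrM ler_pM//.
  have c1 : N * n <= N by exact: ler_piMr.
  have c2 : N * n ^+ 2 <= N by rewrite ler_piMr// exprn_ile1.
  by clear -c1 c2 h1 l1 q1; move: h1 l1 q1; rewrite !ler_norml => /andP[? ?] /andP[? ?] /andP[? ?]; apply/andP; split; lra.
have m3 : `|A * B'| <= N * N' * n ^+ 3.
  have -> : N * N' * n ^+ 3 = (N * n) * (N' * n ^+ 2) by ring.
  by rewrite normrM ler_pM.
have m4 : `|B * A'| <= N * N' * n ^+ 3.
  have -> : N * N' * n ^+ 3 = (N * n ^+ 2) * (N' * n) by ring.
  by rewrite normrM ler_pM.
have m5 : `|B * B'| <= N * N' * n ^+ 3.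
  apply: (@le_trans _ _ (N * N' * n ^+ 4)).
    have -> : N * N' * n ^+ 4 = (N * n ^+ 2) * (N' * n ^+ 2) by ring.
    by rewrite normrM ler_pM.
  by rewrite ler_wpM2l// [leLHS]exprS ler_piMl.
have m0 : 0 <= N * N' * n ^+ 3 by rewrite mulr_ge0.
do 3 rewrite (le_trans (ler_normD _ _))// -?lerBrDr.
have := ler_normD (A * B') (B * A').
have -> : 16 * N * N' * n ^+ 3 = 16 * (N * N' * n ^+ 3) by ring.
by move: m1 m2 m3 m4 m5 m0; clear; lra.
Qed.

Lemma jet_sub de N f : 0 <= de -> jet de N f -> jet de N (fun h => f h - f 0).
Proof.
move=> d0 jf; have N0 := jet_ge0 jf; move: jf => [c [a [Q [h1 h2 h3 h4]]]].
exists 0, a, Q; split => //; first by rewrite normr0.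
move=> h hd; rewrite (jet_at0 d0 h4) add0r.
have -> : f h - c - (dot a h + qform Q h) = f h - (c + dot a h + qform Q h) by ring.
exact: h4.
Qed.

(** The quadratic part of [u] is a polynomial in the jet [f - f 0], to which sums and products
    apply. Its cubic remainder is controlled by the Lipschitz bound [3 * N * nrm1 h], whose cube
    accounts for the 27. *)
Lemma jet_comp de N f (u : R -> R) G (u0 u1 u2 : R) : 0 <= de <= 1 -> jet de N f ->
  `|u0| <= G -> `|u1| <= G -> `|u2| <= G ->
  (forall h, nrm1 h <= de -> `|u (f h) - (u0 + u1 * (f h - f 0) + u2 * (f h - f 0) ^+ 2)| <= G * `|f h - f 0| ^+ 3) ->
  jet de (G * (1 + N + 16 * N ^+ 2 + 27 * N ^+ 3)) (fun h => u (f h)).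
Proof.
move=> /andP[d0 d1] jf g0 g1 g2 hu.
have N0 := jet_ge0 jf; have G0 : 0 <= G by exact: le_trans g0.
have js := jet_sub d0 jf.
have j2 := jetM d1 js js.
have lip := jet_lip (introT andP (conj d0 d1)) jf.
pose w h := u0 + u1 * (f h - f 0) + u2 * ((f h - f 0) * (f h - f 0)).
have jw : jet de (`|u0| + `|u1| * N + `|u2| * (16 * N * N)) w.
  by apply: jetD; [apply: jetD; [exact: jet_cst|exact: jetZ]|exact: jetZ].
have jr : jet de (G * 27 * N ^+ 3) (fun h => u (f h) - w h).
  have Gp : 0 <= G * 27 * N ^+ 3 by rewrite !mulr_ge0// exprn_ge0.
  exists 0, 0, 0; split; [by rewrite normr0|by move=> i; rewrite mxE normr0|by move=> i j; rewrite mxE normr0|].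
  move=> h hd; rewrite dot0l qform0l !addr0 subr0 /w -expr2.
  apply: le_trans (hu h hd) _.
  have -> : G * 27 * N ^+ 3 * nrm1 h ^+ 3 = G * (3 * N * nrm1 h) ^+ 3 by ring.
  rewrite ler_wpM2l// ler_pXn2r// ?nnegrE// ?lip//.
  by rewrite !mulr_ge0// nrm1_ge0.
apply: (@jet_ext _ _ (fun h => w h + (u (f h) - w h))); first by move=> h _; rewrite addrC subrK.
apply: jet_le (jetD jw jr) => //.
have k1 : `|u1| * N <= G * N by rewrite ler_wpM2r.
have k2 : `|u2| * (16 * N * N) <= G * (16 * N * N) by rewrite ler_wpM2r// !mulr_ge0.
have -> : G * (1 + N + 16 * N ^+ 2 + 27 * N ^+ 3) = G + G * N + G * (16 * N * N) + G * 27 * N ^+ 3 by ring.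
by lra.
Qed.

Lemma jet_sum de (I : Type) (s : seq I) N (F : I -> 'cV[R]_p -> R) : 0 <= N ->
  (forall i, jet de N (F i)) -> jet de ((size s)%:R * N) (fun h => \sum_(i <- s) F i h).
Proof.
move=> N0 jF; elim: s => [|i s IH].
  apply: (@jet_ext _ _ (fun=> 0)); first by move=> h _; rewrite big_nil.
  by apply: jet_le (jet_cst _ 0) => //; rewrite normr0 mul0r.
apply: (@jet_ext _ _ (fun h => F i h + \sum_(i <- s) F i h)); first by move=> h _; rewrite big_cons.
by apply: jet_le (jetD (jF i) IH) => //=; rewrite -natr1 mulrDl mul1r addrC.
Qed.

Lemma series_bounded_cvg (u N : nat -> R) S : (forall k, `|u k| <= N k) ->
  (forall n, series N n <= S) -> cvgn (series u) /\ `|limn (series u)| <= S.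
Proof.
move=> uN NS.
have N0 k : 0 <= N k by exact: le_trans (uN k).
have cN : cvgn (series N).
  apply: nondecreasing_is_cvgn.
    by apply: nondecreasing_series => k _ _; exact: N0.
  by exists S => _ [n _ <-].
have c1 : cvgn [normed series u] by apply: (series_le_cvg _ _ _ cN) => // k /=.
have cu := normed_cvg c1; split => //.
have : `|series u n| @[n --> \oo] --> `|limn (series u)| by apply: cvg_norm.
move=> /cvg_lim <-//; apply: limr_le; first by apply: is_cvg_norm.
apply: nearW => n; rewrite (le_trans _ (NS n))// /series /=.
by rewrite (le_trans (ler_norm_sum _ _ _))// ler_sum.
Qed.

(** Coefficients are summed termwise, dominated by the summable [N]; the remainder bound passes to
    the limit of the partial sums. This is what gives the matrix exponential its expansion without
    differentiating it. *)
Lemma jet_series de S (N : nat -> R) (F : nat -> 'cV[R]_p -> R) f :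
  (forall k, jet de (N k) (F k)) -> (forall n, series N n <= S) ->
  (forall h, nrm1 h <= de -> series (fun k => F k h) @ \oo --> f h) -> jet de S f.
Proof.
move=> jF NS cf.
pose X k := cid (jF k); pose c k := projT1 (X k).
pose Y k := cid (projT2 (X k)); pose a k := projT1 (Y k).
pose Z k := cid (projT2 (Y k)); pose Q k := projT1 (Z k).
have H k : [/\ `|c k| <= N k, forall i, `|a k i 0| <= N k, forall i j, `|Q k i j| <= N k &
   forall h, nrm1 h <= de -> `|F k h - (c k + dot (a k) h + qform (Q k) h)| <= N k * nrm1 h ^+ 3].
  exact: (projT2 (Z k)).
have [cc cb] := @series_bounded_cvg c N S (fun k => let: And4 h _ _ _ := H k in h) NS.
have ca i := @series_bounded_cvg (fun k => a k i 0) N S (fun k => let: And4 _ h _ _ := H k in h i) NS.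
have cQ i j := @series_bounded_cvg (fun k => Q k i j) N S (fun k => let: And4 _ _ h _ := H k in h i j) NS.
exists (limn (series c)), (\col_i limn (series (fun k => a k i 0))),
  (\matrix_(i, j) limn (series (fun k => Q k i j))); split => //.
- by move=> i; rewrite mxE; have [] := ca i.
- by move=> i j; rewrite mxE; have [] := cQ i j.
move=> h hd.
pose A : 'cV[R]_p := \col_i limn (series (fun k => a k i 0)).
pose B : 'M[R]_p := \matrix_(i, j) limn (series (fun k => Q k i j)).
pose g n := series (fun k => F k h) n - (series c n + dot (series a n) h + qform (series Q n) h).
have gc : g n @[n --> \oo] --> f h - (limn (series c) + dot A h + qform B h).
  apply: cvgB; first exact: cf.
  apply: cvgD; first apply: cvgD => //.
    apply: cvg_bigsum => i _; apply: cvgM; last exact: cvg_cst.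
    by under eq_fun do rewrite series_coordE; rewrite mxE; have [] := ca i.
  apply: cvg_bigsum => i _; apply: cvgM; first exact: cvg_cst.
  under eq_fun do rewrite mxE; rewrite mxE.
  apply: cvg_bigsum => j _; apply: cvgM; last exact: cvg_cst.
  by under eq_fun do rewrite series_coordE; rewrite mxE; have [] := cQ i j.
have : `|g n| @[n --> \oo] --> `|f h - (limn (series c) + dot A h + qform B h)| by apply: cvg_norm.
move=> cg; rewrite -(cvg_lim _ cg)//; apply: limr_le; first by apply/cvg_ex; eexists; exact: cg.
apply: nearW => n.
apply: (@le_trans _ _ (series N n * nrm1 h ^+ 3)); last by rewrite ler_wpM2r// exprn_ge0// nrm1_ge0.
have -> : g n = \sum_(0 <= k < n) (F k h - (c k + dot (a k) h + qform (Q k) h)).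
  rewrite /g /series /= sumrB !big_split /=; congr (_ - (_ + _ + _)).
    by rewrite /dot exchange_big /=; apply: eq_bigr => i _; rewrite summxE mulr_suml.
  elim/big_ind2 : _ => [|Q1 r1 Q2 r2 <- <-|//]; first by rewrite qform0l.
  by rewrite qformDl.
rewrite /series /= mulr_suml (le_trans (ler_norm_sum _ _ _))// ler_sum// => k _.
by have [_ _ _ ] := H k; exact.
Qed.

End Jets.

(** * Elementary Taylor bounds *)

Section TaylorBounds.
Context {R : realType}.

Lemma ge0_of_derive (g g' : R -> R) : (forall y : R, is_derive y 1 g (g' y)) -> g 0 = 0 ->
  (forall y, 0 <= y <= 1 -> 0 <= g' y) -> forall x, 0 <= x <= 1 -> 0 <= g x.
Proof.
move=> dg g0 g'0 x /andP[x0 x1]; suff : 0 <= g x - g 0 by rewrite g0 subr0.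
have [|y] := @MVT_segment R g g' 0 x x0.
  apply/continuous_subspaceT => y.
  by apply/differentiable_continuous/derivable1_diffP; have [] := dg y.
rewrite in_itv /= => /andP[y0 yx] ->; rewrite subr0 mulr_ge0// g'0// y0.
exact: le_trans x1.
Qed.

Local Notation M := (cosh (1 : R)).

Lemma cosh_le_cosh1 (x : R) : 0 <= x <= 1 -> cosh x <= M.
Proof.
move=> /andP[x0]; rewrite le_eqVlt => /predU1P[->//|x1].
by rewrite ltW// cosh_lt.
Qed.

Let M0 : 1 <= M. Proof. exact: cosh_ge1. Qed.

(** First rung of a ladder: in each bound the difference of the two sides vanishes at 0 and its
    derivative is the preceding bound. The constant is the maximum of [cosh] on the unit
    interval. *)
Lemma sinh_taylor1 (x : R) : 0 <= x <= 1 -> x <= sinh x <= M * x.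
Proof.
move=> x01; have /andP[x0 _] := x01; rewrite sinh_ge_id//=.
rewrite -subr_ge0; apply: (@ge0_of_derive (fun x => M * x - sinh x) (fun x => M - cosh x)) x01.
- move=> y; have ? := is_derive_sinh y; apply: is_derive_eq; rewrite /GRing.scale /=; ring.
- by rewrite mulr0 sinh0 subrr.
- by move=> y /cosh_le_cosh1; rewrite subr_ge0.
Qed.

Lemma cosh_taylor2 (x : R) : 0 <= x <= 1 -> 1 + x ^+ 2 / 2 <= cosh x <= 1 + M * x ^+ 2 / 2.
Proof.
move=> x01; apply/andP; split; rewrite -subr_ge0.
- apply: (@ge0_of_derive (fun x => cosh x - (1 + x ^+ 2 / 2)) (fun x => sinh x - x)) x01.
  + by move=> y; have ? := is_derive_cosh y; apply: is_derive_eq; rewrite /GRing.scale /=; field.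
  + by rewrite cosh0 expr0n mul0r addr0 subrr.
  + by move=> y /sinh_taylor1 /andP[+ _]; rewrite subr_ge0.
- apply: (@ge0_of_derive (fun x => 1 + M * x ^+ 2 / 2 - cosh x) (fun x => M * x - sinh x)) x01.
  + by move=> y; have ? := is_derive_cosh y; apply: is_derive_eq; rewrite /GRing.scale /=; field.
  + by rewrite cosh0 expr0n mulr0 mul0r addr0 subrr.
  + by move=> y /sinh_taylor1 /andP[_ +]; rewrite subr_ge0.
Qed.

Lemma sinh_taylor3 (x : R) : 0 <= x <= 1 -> x + x ^+ 3 / 6 <= sinh x <= x + M * x ^+ 3 / 6.
Proof.
move=> x01; apply/andP; split; rewrite -subr_ge0.
- apply: (@ge0_of_derive (fun x => sinh x - (x + x ^+ 3 / 6)) (fun x => cosh x - (1 + x ^+ 2 / 2))) x01.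
  + by move=> y; have ? := is_derive_sinh y; apply: is_derive_eq; rewrite /GRing.scale /=; field.
  + by rewrite sinh0 expr0n mul0r addr0 subrr.
  + by move=> y /cosh_taylor2 /andP[+ _]; rewrite subr_ge0.
- apply: (@ge0_of_derive (fun x => x + M * x ^+ 3 / 6 - sinh x) (fun x => 1 + M * x ^+ 2 / 2 - cosh x)) x01.
  + by move=> y; have ? := is_derive_sinh y; apply: is_derive_eq; rewrite /GRing.scale /=; field.
  + by rewrite sinh0 expr0n mulr0 mul0r addr0 subrr.
  + by move=> y /cosh_taylor2 /andP[_ +]; rewrite subr_ge0.
Qed.

Lemma cosh_taylor4 (x : R) : 0 <= x <= 1 -> cosh x <= 1 + x ^+ 2 / 2 + M * x ^+ 4 / 24.
Proof.
move=> x01; rewrite -subr_ge0.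
apply: (@ge0_of_derive (fun x => 1 + x ^+ 2 / 2 + M * x ^+ 4 / 24 - cosh x) (fun x => x + M * x ^+ 3 / 6 - sinh x)) x01.
- by move=> y; have ? := is_derive_cosh y; apply: is_derive_eq; rewrite /GRing.scale /=; field.
- by rewrite cosh0 !expr0n mulr0 !mul0r !addr0 subrr.
- by move=> y /sinh_taylor3 /andP[_ +]; rewrite subr_ge0.
Qed.

Lemma sinh_taylor5 (x : R) : 0 <= x <= 1 -> sinh x <= x + x ^+ 3 / 6 + M * x ^+ 5 / 120.
Proof.
move=> x01; rewrite -subr_ge0.
apply: (@ge0_of_derive (fun x => x + x ^+ 3 / 6 + M * x ^+ 5 / 120 - sinh x) (fun x => 1 + x ^+ 2 / 2 + M * x ^+ 4 / 24 - cosh x)) x01.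
- by move=> y; have ? := is_derive_sinh y; apply: is_derive_eq; rewrite /GRing.scale /=; field.
- by rewrite sinh0 !expr0n mulr0 !mul0r !addr0 subrr.
- by move=> y /cosh_taylor4; rewrite subr_ge0.
Qed.

Lemma cosh_expand (x : R) : 0 <= x <= 1 -> `|cosh x - (1 + x ^+ 2 / 2)| <= M * x ^+ 3.
Proof.
move=> x01; have /andP[h1 _] := cosh_taylor2 x01; have h2 := cosh_taylor4 x01.
have /andP[x0 x1] := x01.
rewrite ger0_norm ?subr_ge0// lerBlDl.
apply: le_trans h2 _; rewrite lerD2l.
have : M * x ^+ 4 <= M * x ^+ 3 by rewrite ler_wpM2l ?(le_trans ler01)// exprS ler_piMl// exprn_ge0.
have : 0 <= M * x ^+ 3 by rewrite mulr_ge0 ?exprn_ge0// (le_trans ler01).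
by lra.
Qed.

Lemma sinhc_expand (x : R) : 0 <= x <= 1 -> `|sinhc x - (1 + x ^+ 2 / 6)| <= M * x ^+ 3.
Proof.
move=> x01; have /andP[h1 _] := sinh_taylor3 x01; have h2 := sinh_taylor5 x01.
have /andP[x0 x1] := x01.
rewrite /sinhc; case: eqVneq => [->|xn0].
  by rewrite !expr0n mul0r addr0 subrr normr0 mulr0.
have xp : 0 < x by rewrite lt_def xn0.
have e : sinh x / x - (1 + x ^+ 2 / 6) = (sinh x - (x + x ^+ 3 / 6)) / x by field.
rewrite e ger0_norm ?divr_ge0 ?subr_ge0// ler_pdivrMr//.
apply: (@le_trans _ _ (M * x ^+ 5 / 120)); first by rewrite lerBlDl.
have -> : M * x ^+ 3 * x = M * x ^+ 4 by ring.
have : M * x ^+ 5 <= M * x ^+ 4 by rewrite ler_wpM2l ?(le_trans ler01)// (exprS x 4) ler_piMl// exprn_ge0.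
have : 0 <= M * x ^+ 4 by rewrite mulr_ge0 ?exprn_ge0// (le_trans ler01).
by lra.
Qed.

Lemma ln_expand (y : R) : `|y| <= 2^-1 -> `|ln (1 + y) - (y - y ^+ 2 / 2)| <= 2 * `|y| ^+ 3.
Proof.
pose g (z : R) := ln (1 + z) - (z - z ^+ 2 / 2).
pose g' (z : R) := (1 + z)^-1 - (1 - z).
have dg (z : R) : - 2^-1 <= z -> is_derive z 1 g (g' z).
  move=> z1; have z2 : 0 < 1 + z by lra.
  have ? : is_derive z 1 (fun z : R => 1 + z) 1 by apply: is_derive_eq; rewrite /GRing.scale /=; ring.
  have l := is_derive1_ln z2.
  have ? := @is_derive1_comp _ (@ln R) (fun z => 1 + z) z _ _ l _.
  rewrite /g; apply: is_derive_eq; rewrite /g' /GRing.scale /=; field; rewrite gt_eqF//.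
have cg (z : R) : - 2^-1 <= z -> {for z, continuous g}.
  by move=> /dg [dz _]; apply/differentiable_continuous/derivable1_diffP.
have g'b (z : R) : - 2^-1 <= z -> `|g' z| <= 2 * z ^+ 2.
  move=> z1; have -> : g' z = z ^+ 2 / (1 + z) by rewrite /g'; field; rewrite gt_eqF//; lra.
  rewrite ger0_norm ?divr_ge0 ?sqr_ge0//; last by lra.
  rewrite ler_pdivrMr; last by lra.
  by rewrite mulrAC ler_peMl ?sqr_ge0//; lra.
have g0 : g 0 = 0 by rewrite /g addr0 ln1 expr0n mul0r subrr subr0.
rewrite ler_norml => /andP[y1 y2]; rewrite -/(g y).
have main z : - 2^-1 <= z -> `|z| <= `|y| -> `|g' z| * `|y| <= 2 * `|y| ^+ 3.
  move=> z1 zy; rewrite [_ ^+ 3]exprSr mulrA ler_wpM2r//.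
  apply: le_trans (g'b _ z1) _; rewrite ler_wpM2l// -real_normK ?num_real//.
  by rewrite ler_pXn2r ?nnegrE.
have [y0|y0] := leP 0 y.
  have dg' z : z \in `]0, y[ -> is_derive z 1 g (g' z).
    by rewrite in_itv /= => /andP[z0 _]; apply: dg; lra.
  have [|z] := @MVT_segment R g g' 0 y y0 dg'.
    apply: continuous_in_subspaceT => z; rewrite inE /= in_itv /= => /andP[z0 _].
    by apply: cg; lra.
  rewrite in_itv /= => /andP[z0 zy]; rewrite g0 !subr0 => ->; rewrite normrM main//; first by lra.
  by rewrite !ger0_norm.
have dg' z : z \in `]y, 0[ -> is_derive z 1 g (g' z).
  by rewrite in_itv /= => /andP[z0 _]; apply: dg; lra.
have [|z] := @MVT_segment R g g' y 0 (ltW y0) dg'.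
  apply: continuous_in_subspaceT => z; rewrite inE /= in_itv /= => /andP[z0 _].
  by apply: cg; lra.
rewrite in_itv /= => /andP[z0 zy]; rewrite g0 !sub0r => /eqP; rewrite eqr_oppLR mulrN opprK => /eqP ->.
rewrite normrM main//; first by lra.
by rewrite !ler0_norm ?lerN2// ltW.
Qed.

Lemma inv_expand (z0 z : R) : 0 <= z0 -> 0 <= z ->
  `|(1 + z)^-1 - ((1 + z0)^-1 + - (1 + z0)^-1 ^+ 2 * (z - z0) + (1 + z0)^-1 ^+ 3 * (z - z0) ^+ 2)|
   <= `|z - z0| ^+ 3.
Proof.
move=> h0 h.
have -> : (1 + z)^-1 - ((1 + z0)^-1 + - (1 + z0)^-1 ^+ 2 * (z - z0) + (1 + z0)^-1 ^+ 3 * (z - z0) ^+ 2) =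
  - ((z - z0) ^+ 3 * ((1 + z0)^-1 ^+ 3 / (1 + z))).
  by field; rewrite !gt_eqF//; lra.
have k (x : R) : 0 <= x -> 0 <= (1 + x)^-1 <= 1.
  by move=> x0; apply/andP; split; [rewrite invr_ge0; lra|rewrite invf_le1; lra].
have /andP[k1 k2] := k _ h0; have /andP[k3 k4] := k _ h.
rewrite normrN normrM normrX ler_piMr ?exprn_ge0//.
rewrite ger0_norm ?mulr_ge0 ?exprn_ge0// mulr_ile1 ?exprn_ge0// exprn_ile1//.
Qed.

End TaylorBounds.

(** * Expansions uniform in the observation *)

Section UniformJets.
Context {R : realType} {p : nat} (T : Type) (P : T -> Prop).
Implicit Types F G : T -> 'cV[R]_p -> R.

Lemma jet_linear de N (f : 'cV[R]_p -> R) : 0 <= N ->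
  (forall k u v, f (k *: u + v) = k * f u + f v) ->
  (forall i, `|f (delta_mx i 0)| <= N) -> jet de N f.
Proof.
move=> N0 lf fN.
have f0 : f 0 = 0 by have := lf 1 0 0; rewrite scale1r addr0 mul1r; lra.
have fs (I : Type) (s : seq I) (w : I -> R) (e : I -> 'cV[R]_p) : f (\sum_(i <- s) w i *: e i) = \sum_(i <- s) w i * f (e i).
  by elim: s => [|i s IH]; rewrite ?big_nil// !big_cons lf IH.
apply: (@jet_ext _ _ _ _ (dot (\col_i f (delta_mx i 0)))); last first.
  by apply: jet_lin => // i; rewrite mxE.
move=> h _; rewrite {2}(matrix_sum_delta h).
under [in RHS]eq_bigr do rewrite big_ord1.
by rewrite fs; apply: eq_bigr => i _; rewrite mxE mulrC.
Qed.

Lemma jet_rem de N (f : 'cV[R]_p -> R) : 0 <= N -> (forall h, nrm1 h <= de -> `|f h| <= N * nrm1 h ^+ 3) -> jet de N f.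
Proof.
move=> N0 hf; exists 0, 0, 0; split; [by rewrite normr0|by move=> i; rewrite mxE normr0|by move=> i j; rewrite mxE normr0|].
by move=> h hd; rewrite dot0l qform0l !addr0 subr0 hf.
Qed.

(** One radius and one bound serve all [x]. The log-density enters this calculus only after division
    by its growth in [x]. *)
Definition ujet F := exists de N, [/\ 0 < de, de <= 1 & forall x, P x -> jet de N (F x)].

Lemma ujet_ext F G : (forall x h, P x -> F x h = G x h) -> ujet F -> ujet G.
Proof.
move=> e [de [N [h1 h2 h3]]]; exists de, N; split => // x Px.
by apply: jet_ext (h3 x Px) => h _; exact: e.
Qed.

Lemma ujet_cst (c : T -> R) C : (forall x, P x -> `|c x| <= C) -> ujet (fun x _ => c x).
Proof. by move=> cC; exists 1, C; split => // x Px; apply: jet_le (jet_cst _ (c x)) => //; exact: cC. Qed.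

Lemma ujet_linear F C : (forall x k u v, P x -> F x (k *: u + v) = k * F x u + F x v) ->
  (forall x i, P x -> `|F x (delta_mx i 0)| <= C) -> ujet F.
Proof.
move=> lF FC; exists 1, (Num.max 0 C); split => // x Px; apply: jet_linear.
- by rewrite le_max lexx.
- by move=> *; exact: lF.
- by move=> i; rewrite le_max FC// orbT.
Qed.

Lemma ujet_of_jet N (f : 'cV[R]_p -> R) : jet 1 N f -> ujet (fun _ => f).
Proof. by move=> jf; exists 1, N. Qed.

Lemma ujetD F G : ujet F -> ujet G -> ujet (fun x h => F x h + G x h).
Proof.
move=> [de [N [h1 h2 h3]]] [de' [N' [h1' h2' h3']]].
exists (Num.min de de'), (N + N'); split; [by rewrite lt_min h1|by rewrite ge_min h2|].
move=> x Px; apply: jetD.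
- by apply: jet_le (h3 x Px) => //; rewrite ge_min lexx.
- by apply: jet_le (h3' x Px) => //; rewrite ge_min lexx orbT.
Qed.

Lemma ujetM F G : ujet F -> ujet G -> ujet (fun x h => F x h * G x h).
Proof.
move=> [de [N [h1 h2 h3]]] [de' [N' [h1' h2' h3']]].
have hm : Num.min de de' <= 1 by rewrite ge_min h2.
exists (Num.min de de'), (16 * N * N'); split => //; first by rewrite lt_min h1.
move=> x Px; apply: jetM => //.
- by apply: jet_le (h3 x Px) => //; rewrite ge_min lexx.
- by apply: jet_le (h3' x Px) => //; rewrite ge_min lexx orbT.
Qed.

Lemma ujetZ k F : ujet F -> ujet (fun x h => k * F x h).
Proof. by apply: ujetM; exact: (@ujet_cst (fun=> k) `|k|). Qed.

Lemma ujetN F : ujet F -> ujet (fun x h => - F x h).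
Proof. by move=> /(ujetZ (-1)); apply: ujet_ext => x h _; rewrite mulN1r. Qed.

Lemma ujet_sum (I : Type) (s : seq I) (F : I -> T -> 'cV[R]_p -> R) :
  (forall i, ujet (F i)) -> ujet (fun x h => \sum_(i <- s) F i x h).
Proof.
move=> jF; elim: s => [|i s IH].
  by apply: (@ujet_ext (fun _ _ => 0)); [move=> x h _; rewrite big_nil|apply: (@ujet_cst (fun=> 0) 0) => x _; rewrite normr0].
by apply: ujet_ext (ujetD (jF i) IH) => x h _; rewrite big_cons.
Qed.

Lemma ujet_comp F (u : T -> R -> R) (G rho : R) : ujet F -> 0 < rho ->
  (forall x, P x -> exists u0 u1 u2, [/\ `|u0| <= G, `|u1| <= G, `|u2| <= G &
    forall h, `|F x h - F x 0| <= rho ->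
    `|u x (F x h) - (u0 + u1 * (F x h - F x 0) + u2 * (F x h - F x 0) ^+ 2)| <= G * `|F x h - F x 0| ^+ 3]) ->
  ujet (fun x h => u x (F x h)).
Proof.
move=> [de [N [d0 d1 jF]]] r0 hu.
pose N' := Num.max 1 N.
have N'0 : 0 < N' by rewrite lt_max ltr01.
(* By the Lipschitz bound this radius keeps the increments of [F x] below [rho], where the expansion
   of [u x] is valid; [N'] is at least 1 so that the quotient makes sense. *)
pose de' := Num.min de (rho / (3 * N')).
have d'0 : 0 < de' by rewrite lt_min d0 divr_gt0// mulr_gt0.
have d'1 : de' <= 1 by rewrite ge_min d1.
exists de', (G * (1 + N' + 16 * N' ^+ 2 + 27 * N' ^+ 3)); split => // x Px.
have jx : jet de' N' (F x) by apply: jet_le (jF x Px); rewrite ?ge_min ?lexx// le_max lexx orbT.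
have [u0 [u1 [u2 [g0 g1 g2 hu']]]] := hu x Px.
have d'01 : 0 <= de' <= 1 by rewrite ltW.
apply: (@jet_comp _ _ _ _ _ (u x) G u0 u1 u2) => // h hd.
apply: hu' => //; apply: le_trans (jet_lip d'01 jx hd) _.
rewrite mulrC -ler_pdivlMr ?mulr_gt0//; apply: le_trans hd _.
by rewrite ge_min lexx orbT.
Qed.

End UniformJets.

(** * Expansion of the log-density *)

Section HalfVec.

Lemma mem_lower_seq d (i j : 'I_d) : ((i, j) \in lower_seq d) = (j <= i)%N.
Proof.
apply/allpairsPdep/idP => [[j' [i' [_ + [-> ->]]]]|ji]; first by rewrite mem_filter => /andP[].
exists j, i; split => //; first by rewrite mem_enum.
by rewrite mem_filter ji mem_enum.
Qed.

Lemma uniq_lower_seq d : uniq (lower_seq d).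
Proof.
apply: allpairs_uniq_dep => [|j _|]; rewrite ?filter_uniq -?enumT ?enum_uniq//.
by move=> [a b] [a' b'] _ _ /= [-> ->].
Qed.

Lemma lower_idx_inj d : injective (@lower_idx d).
Proof. by apply/tuple_uniqP; exact: uniq_lower_seq. Qed.

Lemma lower_idx_ex d (i j : 'I_d) : (j <= i)%N -> exists k, @lower_idx d k = (i, j).
Proof.
rewrite -mem_lower_seq => /(tnthP (Tuple (size_lower_seq d))) [k e].
by exists k; rewrite /lower_idx -e.
Qed.

Lemma lower_idx_le d k : ((@lower_idx d k).2 <= (@lower_idx d k).1)%N.
Proof. by rewrite -mem_lower_seq -surjective_pairing; exact: mem_tnth. Qed.

Context {R : realType}.

Lemma mat_sym d (b : 'cV[R]_(vech_dim d)) : (mat b)^T = mat b.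
Proof. by apply/matrixP => i j; rewrite !mxE; apply: eq_bigl => k; rewrite orbC. Qed.

Lemma matK d (b : 'cV[R]_(vech_dim d)) : vech (mat b) = b.
Proof.
apply/colP => k; rewrite !mxE -surjective_pairing (bigD1 k)/= ?eqxx// big1 ?addr0// => l.
move=> /andP[/orP[/eqP/lower_idx_inj ->|/eqP e]]; rewrite ?eqxx// => lk.
have := lower_idx_le l; rewrite e /= => h1; have h2 := lower_idx_le k.
have e12 : (lower_idx k).1 = (lower_idx k).2 by apply: val_inj; apply/eqP; rewrite eqn_leq h1 h2.
case/negP: lk; apply/eqP; apply: lower_idx_inj; rewrite e.
by case: (lower_idx k) e12 => x y /= ->.
Qed.

Lemma vechK d (A : 'M[R]_d) : A^T = A -> mat (vech A) = A.
Proof.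
move=> sA; apply/matrixP => i j; rewrite mxE.
wlog ij : i j / (j <= i)%N => [H|].
  have [/H//|/ltnW/H e] := leqP j i.
  rewrite -[in RHS]sA [RHS]mxE -e; apply: eq_bigl => k; exact: orbC.
have [k kE] := lower_idx_ex ij.
rewrite (bigD1 k)/= ?kE ?eqxx//= mxE kE big1 ?addr0// => l /andP[/orP[|]/eqP e lk].
  by case/negP: lk; apply/eqP/lower_idx_inj; rewrite kE.
have := lower_idx_le l; rewrite e /= => h1.
have e12 : i = j by apply: val_inj; apply/eqP; rewrite eqn_leq h1 ij.
by case/negP: lk; apply/eqP/lower_idx_inj; rewrite kE e e12.
Qed.

Lemma mat_linear d k (u v : 'cV[R]_(vech_dim d)) i j : mat (k *: u + v) i j = k * mat u i j + mat v i j.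
Proof. by rewrite !mxE mulr_sumr -big_split; apply: eq_bigr => l _; rewrite !mxE. Qed.

Lemma mat_delta d l i j : `|mat (delta_mx l 0 : 'cV[R]_(vech_dim d)) i j| <= (vech_dim d)%:R.
Proof.
rewrite mxE; apply: le_trans (ler_norm_sum _ _ _) _.
have -> : (vech_dim d)%:R = \sum_(k < vech_dim d) (1 : R) by rewrite sumr_const card_ord.
rewrite [leRHS](bigID (fun k => (lower_idx k == (i, j)) || (lower_idx k == (j, i)))) /=.
apply: (@le_trans _ _ (\sum_(k | (lower_idx k == (i, j)) || (lower_idx k == (j, i))) (1 : R))).
  by apply: ler_sum => k _; rewrite mxE normr_nat lern1 leq_b1.
by rewrite lerDl sumr_ge0.
Qed.
End HalfVec.

(** * Triangle inequality and size of coordinates on the hyperboloid *)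

Section LorentzInequalities.
Context {R : realType} {d : nat}.
Local Notation E := 'cV[R]_(1 + d).
Implicit Types (x y mu : E).

Lemma lform_boost mu x y : hyperboloid mu ->
  lform x y = - (lform mu x * lform mu y) + dot (boost mu x) (boost mu y).
Proof.
move=> hmu.
have add (u v : 'cV[R]_d) : PT origin mu (embed (u + v)) = PT origin mu (embed u) + PT origin mu (embed v).
  rewrite !PT_embed// dotDr mulrDl scalerDl addrACA; congr (_ + _).
  by rewrite /embed add_col_mx addr0.
have pol (u v : 'cV[R]_d) : lform (PT origin mu (embed u)) (PT origin mu (embed v)) = dot u v.
  have := PT_embed_lform hmu (u + v); rewrite add.
  rewrite !(lformDl, lformDr) !(PT_embed_lform hmu) !(dotDl, dotDr) (lformC (PT _ _ (embed v))) (dotC v u).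
  by lra.
rewrite -pol !PT_boost// !lformE (hyp_self hmu) (lformC x mu).
by ring.
Qed.

(** The triangle inequality in multiplicative form: [cosh a * cosh b + sinh a * sinh b] is at most
    [2 * cosh a * cosh b], where [a] and [b] are the distances from [s]. *)
Lemma hyp_triangle s x y : hyperboloid s -> hyperboloid x -> hyperboloid y ->
  - lform x y <= 2 * (- lform s x) * (- lform s y).
Proof.
move=> hs hx hy; rewrite (lform_boost x y hs).
have cx := hyp_lform_ge1 hs hx; have cy := hyp_lform_ge1 hs hy.
have := ler_dot (boost s x) (boost s y); rewrite /enorm !dot_boost//.
have sq (c : R) : 1 <= - c -> 0 <= Num.sqrt (c ^+ 2 - 1) <= - c.
  move=> c1; rewrite sqrtr_ge0 /= -[leRHS]ger0_norm; last by lra.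
  by rewrite -sqrtr_sqr ler_wsqrtr// sqrrN gerBl.
have /andP[a0 a1] := sq _ cx; have /andP[b0 b1] := sq _ cy.
have ab : Num.sqrt (lform s x ^+ 2 - 1) * Num.sqrt (lform s y ^+ 2 - 1) <= - lform s x * - lform s y by exact: ler_pM.
by rewrite ler_norml => /andP[]; lra.
Qed.

Lemma time_le s x : hyperboloid s -> hyperboloid x -> x 0 0 <= 2 * s 0 0 * (- lform s x).
Proof.
move=> hs hx; have := hyp_triangle hs hx (@origin_hyp R d).
by rewrite (lformC s origin) lform_origin (lformC x) lform_origin; lra.
Qed.

Lemma space_le_time x i : hyperboloid x -> `|dsubmx x i 0| <= x 0 0.
Proof.
move=> hx; have x2 := hyp_time hx; have x0 := hyp_gt0 hx.
apply: le_trans (ler_coord_enorm _ _) _; rewrite ler_enorm ?(ltW x0)// x2.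
by rewrite lerDr.
Qed.

Lemma lform_le u x : hyperboloid x -> `|lform u x| <= (`|u 0 0| + \sum_i `|dsubmx u i 0|) * x 0 0.
Proof.
move=> hx; have x0 := hyp_gt0 hx; rewrite /lform (le_trans (ler_normD _ _))// mulrDl lerD//.
  by rewrite normrN normrM (gtr0_norm x0).
rewrite mulr_suml (le_trans (ler_norm_sum _ _ _))// ler_sum// => i _.
by rewrite normrM ler_wpM2l// space_le_time.
Qed.

End LorentzInequalities.

Section LogDensityExpansion.
Context {R : realType} {d : nat}.
Local Notation E := 'cV[R]_(1 + d).
Local Notation p := (d + vech_dim d)%N.
Local Notation Theta := 'cV[R]_p.
Variables (mu0 : E) (J : {linear 'cV[R]_d -> E}) (th0 : Theta).
Hypotheses (hmu0 : hyperboloid mu0) (hJ : tangent_isometry mu0 J) (th00 : usubmx th0 = 0).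

Lemma J_tangent a : tangent mu0 (J a).
Proof. by have [_ h] := hJ; apply/h; exists a. Qed.

Lemma J_dot a b : lform (J a) (J b) = dot a b.
Proof. by have [h _] := hJ. Qed.

Lemma mu_ofE (th : Theta) : mu_of mu0 J th =
  cosh (enorm (usubmx th)) *: mu0 + sinhc (enorm (usubmx th)) *: J (usubmx th).
Proof. by rewrite /mu_of (ExpE hmu0 (J_tangent _)) /lnorm J_dot. Qed.

Lemma mu_of_hyp th : hyperboloid (mu_of mu0 J th).
Proof. exact: (Exp_hyp hmu0 (J_tangent _)). Qed.

Lemma lform_mu_of th : - lform mu0 (mu_of mu0 J th) = cosh (enorm (usubmx th)).
Proof. by rewrite /mu_of (lform_Exp hmu0 (J_tangent _)) /lnorm J_dot. Qed.

Lemma Sigma_of_spd (th : Theta) : spd (Sigma_of th).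
Proof. by apply: spd_expmx; exact: mat_sym. Qed.

Lemma logdens_ofE (th : Theta) x : hyperboloid x ->
  logdens (mu_of mu0 J th) (Sigma_of th) x =
  - 2^-1 * \tr (mat (dsubmx th))
  - 2^-1 * (Fc (- lform (mu_of mu0 J th) x) ^+ 2 *
       qform (expmx (- mat (dsubmx th))) (boost (mu_of mu0 J th) x))
  + d.-1%:R * ln (Fc (- lform (mu_of mu0 J th) x)).
Proof.
move=> hx; rewrite (logdensE (mu_of_hyp th))// /Sigma_of det_expmx ?mat_sym// expRK.
by rewrite expmxN ?mat_sym.
Qed.

Lemma usub_th0 (h : Theta) : usubmx (th0 + h) = usubmx h.
Proof. by rewrite linearD /= th00 add0r. Qed.

Lemma nrm1_usub (h : Theta) : enorm (usubmx h) <= nrm1 h.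
Proof.
apply: le_trans (ler_enorm_sum _) _; rewrite /nrm1 big_split_ord /=.
by rewrite -[leLHS]addr0 lerD ?sumr_ge0// ler_sum// => i _; rewrite mxE.
Qed.

Local Notation ujet := (@ujet R p E (@hyperboloid R d)).

Lemma ujet_coord (i : 'I_p) : ujet (fun _ h => h i 0).
Proof.
apply: (@ujet_linear _ _ _ _ _ 1) => [x k u v _|x j _]; first by rewrite !mxE.
by rewrite mxE normr_nat lern1 leq_b1.
Qed.

Lemma ujet_sqr_alpha : ujet (fun _ h => dot (usubmx h) (usubmx h)).
Proof.
apply: ujet_sum => i.
apply: ujet_ext (ujetM (ujet_coord (lshift _ i)) (ujet_coord (lshift _ i))) => x h _.
by rewrite !mxE.
Qed.

(** The norm is not differentiable at 0, but [cosh] is even: its quadratic part involves only the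
    squared norm, which is polynomial in the coordinates. *)
Lemma ujet_cosh : ujet (fun _ h => cosh (enorm (usubmx h))).
Proof.
apply: (@ujet_ext _ _ _ _ (fun _ h => 1 + 2^-1 * dot (usubmx h) (usubmx h) +
  (cosh (enorm (usubmx h)) - (1 + enorm (usubmx h) ^+ 2 / 2)))).
  by move=> x h _; rewrite sqr_enorm; ring.
apply: ujetD; first apply: ujetD.
- by apply: (@ujet_cst _ _ _ _ (fun=> 1) 1) => x _; rewrite normr1.
- exact/ujetZ/ujet_sqr_alpha.
apply: (@ujet_of_jet _ _ _ _ (cosh 1)); apply: jet_rem; first by rewrite ltW// cosh_gt0.
move=> h h1; have n0 := enorm_ge0 (usubmx h); have nl := nrm1_usub h.
have /cosh_expand e : 0 <= enorm (usubmx h) <= 1 by rewrite n0 (le_trans nl).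
apply: le_trans e _; rewrite ler_wpM2l ?(ltW (cosh_gt0 _))//.
by rewrite ler_pXn2r ?nnegrE// nrm1_ge0.
Qed.

Lemma ujet_sinhc : ujet (fun _ h => sinhc (enorm (usubmx h))).
Proof.
apply: (@ujet_ext _ _ _ _ (fun _ h => 1 + 6^-1 * dot (usubmx h) (usubmx h) +
  (sinhc (enorm (usubmx h)) - (1 + enorm (usubmx h) ^+ 2 / 6)))).
  by move=> x h _; rewrite sqr_enorm; ring.
apply: ujetD; first apply: ujetD.
- by apply: (@ujet_cst _ _ _ _ (fun=> 1) 1) => x _; rewrite normr1.
- exact/ujetZ/ujet_sqr_alpha.
apply: (@ujet_of_jet _ _ _ _ (cosh 1)); apply: jet_rem; first by rewrite ltW// cosh_gt0.
move=> h h1; have n0 := enorm_ge0 (usubmx h); have nl := nrm1_usub h.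
have /sinhc_expand e : 0 <= enorm (usubmx h) <= 1 by rewrite n0 (le_trans nl).
apply: le_trans e _; rewrite ler_wpM2l ?(ltW (cosh_gt0 _))//.
by rewrite ler_pXn2r ?nnegrE// nrm1_ge0.
Qed.

(** [mu_of] is a combination of [mu0] and [J alpha] whose coefficients are even functions of the
    norm of [alpha]. For a linear functional only its values at [mu0] and on the images of the basis
    need bounds uniform in [x]. *)
Lemma ujet_mu_lin (L : E -> E -> R) C :
  (forall x k u v, hyperboloid x -> L x (k *: u + v) = k * L x u + L x v) ->
  (forall x, hyperboloid x -> `|L x mu0| <= C /\ forall i, `|L x (J (delta_mx i 0))| <= C) ->
  ujet (fun x h => L x (mu_of mu0 J (th0 + h))).
Proof.
move=> lL bL.
apply: (@ujet_ext _ _ _ _ (fun x h => cosh (enorm (usubmx h)) * L x mu0 +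
   sinhc (enorm (usubmx h)) * L x (J (usubmx h)))).
  move=> x h hx; rewrite mu_ofE usub_th0 lL//.
  have L0 : L x 0 = 0 by have := lL x 1 0 0 hx; rewrite scale1r addr0 mul1r; lra.
  by rewrite -[_ *: J _]addr0 lL// L0 addr0 mulrC.
apply: ujetD; apply: ujetM.
- exact: ujet_cosh.
- by apply: (@ujet_cst _ _ _ _ _ C) => x hx; have [] := bL x hx.
- exact: ujet_sinhc.
apply: (@ujet_linear _ _ _ _ _ C) => [x k u v hx|x i hx].
  by rewrite !linearP lL.
have [C0 CJ] := bL x hx.
case: (split_ordP i) => i1 ->.
  have -> : usubmx (delta_mx (lshift _ i1) 0 : Theta) = delta_mx i1 0.
    by apply/colP => j; rewrite !mxE eq_lshift.
  exact: CJ.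
have -> : usubmx (delta_mx (rshift _ i1) 0 : Theta) = 0.
  by apply/colP => j; rewrite !mxE eq_lrshift.
have L0 : L x 0 = 0 by have := lL x 1 0 0 hx; rewrite scale1r addr0 mul1r; lra.
by rewrite linear0 L0 normr0 (le_trans _ C0).
Qed.

Lemma mu_of_th0 : mu_of mu0 J th0 = mu0.
Proof. by rewrite mu_ofE th00 enorm0 cosh0 scale1r linear0 scaler0 addr0. Qed.

Let c0 x := - lform mu0 x.

Let mass (u : E) : R := `|u 0 0| + \sum_i `|dsubmx u i 0|.

Let mass_ge0 u : 0 <= mass u. Proof. by rewrite addr_ge0// sumr_ge0. Qed.

Let Kmass : R := mass mu0 + \sum_i mass (J (delta_mx i 0)).

Let mass_mu0 : mass mu0 <= Kmass. Proof. by rewrite lerDl sumr_ge0. Qed.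

Let mass_J i : mass (J (delta_mx i 0)) <= Kmass.
Proof. by rewrite /Kmass (bigD1 i)//= addrCA lerDl addr_ge0// sumr_ge0. Qed.

Let lform_bound u x : hyperboloid x -> mass u <= Kmass -> `|- lform u x / c0 x| <= Kmass * (2 * mu0 0 0).
Proof.
move=> hx hu; have c1 := hyp_lform_ge1 hmu0 hx.
have cp : 0 < c0 x by apply: lt_le_trans c1.
rewrite normrM normfV normrN (gtr0_norm cp) ler_pdivrMr// -mulrA.
apply: le_trans (lform_le u hx) _; apply: ler_pM => //; [exact: mass_ge0|exact: ltW (hyp_gt0 hx)|exact: time_le].
Qed.

(** [c0 x] is the hyperbolic cosine of the distance from [mu0]. It dominates all coordinates of [x]
    up to a constant, so the quotient is bounded on the noncompact hyperboloid. *)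
Lemma ujet_lform : ujet (fun x h => - lform (mu_of mu0 J (th0 + h)) x / c0 x).
Proof.
apply: (@ujet_mu_lin (fun x u => - lform u x / c0 x) (Kmass * (2 * mu0 0 0))).
  by move=> x k u v _; rewrite lformDl lformZl; ring.
by move=> x hx; split => [|i]; exact: lform_bound.
Qed.

Lemma lform_at0 x : hyperboloid x -> - lform (mu_of mu0 J (th0 + 0)) x / c0 x = 1.
Proof.
move=> hx; have c1 := hyp_lform_ge1 hmu0 hx.
by rewrite addr0 mu_of_th0 divff// gt_eqF// (lt_le_trans ltr01).
Qed.

(** Moving [mu] multiplies [c0 x] by a factor close to 1 uniformly in [x], so the expansion of [Fc]
    in relative increments applies. *)
Lemma ujet_Fc : ujet (fun x h => Fc (- lform (mu_of mu0 J (th0 + h)) x) / Fc (c0 x)).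
Proof.
pose u x z : R := Fc (c0 x * z) / Fc (c0 x).
apply: (@ujet_ext _ _ _ _ (fun x h => u x (- lform (mu_of mu0 J (th0 + h)) x / c0 x))).
  move=> x h hx; have c1 := hyp_lform_ge1 hmu0 hx; rewrite /u [c0 x * _]mulrC divfK// gt_eqF//.
  exact: lt_le_trans c1.
apply: (@ujet_comp _ _ _ _ (fun x h => - lform (mu_of mu0 J (th0 + h)) x / c0 x) u 2 2^-1); [exact: ujet_lform|by rewrite invr_gt0|].
move=> x hx; have c1 := hyp_lform_ge1 hmu0 hx.
have [a [b [a1 b1 hab]]] := Fc_expand c1.
exists 1, a, b; split; [by rewrite normr1 ler1n|by rewrite (le_trans a1)// ler1n|by rewrite (le_trans b1)// ler1n|].
move=> h; rewrite lform_at0// => he.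
have := hab _ he; rewrite (_ : - lform mu0 x * _ = - lform (mu_of mu0 J (th0 + h)) x); last first.
  rewrite addrC subrK [LHS]mulrC divfK// gt_eqF//; exact: lt_le_trans c1.
have -> : u x (- lform (mu_of mu0 J (th0 + h)) x / c0 x) = Fc (- lform (mu_of mu0 J (th0 + h)) x) / Fc (- lform mu0 x).
  by rewrite /u [c0 x * _]mulrC divfK// gt_eqF//; exact: lt_le_trans c1.
by apply; exact: (hyp_lform_ge1 (mu_of_hyp _) hx).
Qed.

Lemma ujet_ln_Fc : ujet (fun x h => ln (Fc (- lform (mu_of mu0 J (th0 + h)) x) / Fc (c0 x))).
Proof.
apply: (@ujet_comp _ _ _ _ (fun x h => Fc (- lform (mu_of mu0 J (th0 + h)) x) / Fc (c0 x)) (fun=> @ln R) 2 2^-1); [exact: ujet_Fc|by rewrite invr_gt0|].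
move=> x hx; exists 0, 1, (- 2^-1); split.
- by rewrite normr0.
- by rewrite normr1 ler1n.
- by rewrite normrN ger0_norm; lra.
have F0 := Fc_gt0 (hyp_lform_ge1 hmu0 hx).
move=> h; rewrite addr0 mu_of_th0 divff ?gt_eqF// => /ln_expand.
rewrite [1 + (_ - 1)]addrC subrK add0r mul1r.
by rewrite mulNr (mulrC 2^-1).
Qed.

Lemma ujet_time : ujet (fun _ h => mu_of mu0 J (th0 + h) 0 0).
Proof.
apply: (@ujet_mu_lin (fun _ u => u 0 0) Kmass); first by move=> *; rewrite !mxE.
move=> x _; split => [|i]; [apply: le_trans mass_mu0|apply: le_trans (mass_J i)];
  by rewrite lerDl sumr_ge0.
Qed.

Lemma ujet_space i : ujet (fun _ h => dsubmx (mu_of mu0 J (th0 + h)) i 0).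
Proof.
apply: (@ujet_mu_lin (fun _ u => dsubmx u i 0) Kmass); first by move=> *; rewrite !mxE.
move=> x _; split => [|j]; [apply: le_trans mass_mu0|apply: le_trans (mass_J j)];
  by rewrite /mass (bigD1 i)//= addrCA lerDl addr_ge0// sumr_ge0.
Qed.

Lemma ujet_inv_time : ujet (fun _ h => (1 + mu_of mu0 J (th0 + h) 0 0)^-1).
Proof.
apply: (@ujet_comp _ _ _ _ (fun _ h => mu_of mu0 J (th0 + h) 0 0) (fun _ z => (1 + z)^-1) 1 1); [exact: ujet_time|exact: ltr01|].
move=> _ _; have t0 := hyp_gt0 hmu0; rewrite addr0 mu_of_th0.
have k1 : `|(1 + mu0 0 0)^-1| <= 1 by rewrite ger0_norm ?invr_ge0 ?invf_le1; lra.
exists (1 + mu0 0 0)^-1, (- (1 + mu0 0 0)^-1 ^+ 2), ((1 + mu0 0 0)^-1 ^+ 3); split => //.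
- by rewrite normrN normrX exprn_ile1.
- by rewrite normrX exprn_ile1.
by move=> h _; rewrite mul1r; apply: inv_expand; apply/ltW => //; exact: (hyp_gt0 (mu_of_hyp _)).
Qed.

Lemma ujet_boost i : ujet (fun x h => boost (mu_of mu0 J (th0 + h)) x i 0 / c0 x).
Proof.
have tx x : hyperboloid x -> x 0 0 / c0 x <= 2 * mu0 0 0.
  move=> hx; have c1 := hyp_lform_ge1 hmu0 hx.
  by rewrite ler_pdivrMr ?time_le// (lt_le_trans ltr01 c1).
apply: (@ujet_ext _ _ _ _ (fun x h => dsubmx x i 0 / c0 x +
   - ((x 0 0 / c0 x + - lform (mu_of mu0 J (th0 + h)) x / c0 x) *
   ((1 + mu_of mu0 J (th0 + h) 0 0)^-1 * dsubmx (mu_of mu0 J (th0 + h)) i 0)))).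
  by move=> x h hx; rewrite /boost [RHS]mulrC !mxE; ring.
apply: ujetD; last apply/ujetN/ujetM; last exact: (ujetM ujet_inv_time (ujet_space i)).
  apply: (@ujet_cst _ _ _ _ (fun x : E => dsubmx x i 0 / c0 x) (2 * mu0 0 0)) => x hx.
  have c1 := hyp_lform_ge1 hmu0 hx; have cp : 0 < c0 x := lt_le_trans ltr01 c1.
  rewrite normrM normfV (gtr0_norm cp); apply: le_trans (tx x hx).
  by rewrite ler_pM2r ?invr_gt0// space_le_time.
apply: ujetD; last exact: ujet_lform.
apply: (@ujet_cst _ _ _ _ (fun x : E => x 0 0 / c0 x) (2 * mu0 0 0)) => x hx.
have c1 := hyp_lform_ge1 hmu0 hx; have cp : 0 < c0 x := lt_le_trans ltr01 c1.
by rewrite ger0_norm ?tx// divr_ge0 ?ltW// hyp_gt0.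
Qed.

Let NA : R := \sum_i \sum_j `|mat (dsubmx th0) i j| + (vech_dim d)%:R.

Let NA0 : 0 <= NA.
Proof. by rewrite addr_ge0// sumr_ge0// => i _; rewrite sumr_ge0. Qed.

Lemma jet_mat i j : jet 1 NA (fun h : Theta => (- mat (dsubmx (th0 + h))) i j).
Proof.
apply: (@jet_ext _ _ _ _ (fun h => - mat (dsubmx th0) i j + - mat (dsubmx h) i j)).
  move=> h _; have -> : dsubmx (th0 + h) = 1 *: dsubmx th0 + dsubmx h by rewrite scale1r linearD.
  by rewrite [RHS]mxE mat_linear mul1r opprD.
apply: jet_le (jetD (jet_cst 1 (- mat (dsubmx th0) i j)) (jet_linear (N := (vech_dim d)%:R) 1 _ _ _)) => //.
- rewrite normrN lerD2r (bigD1 i)//= (bigD1 j)//= -addrA lerDl addr_ge0// sumr_ge0// => k _.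
  by rewrite sumr_ge0.
- by move=> k u v; rewrite linearP mat_linear opprD mulrN.
- move=> k; rewrite normrN; case: (split_ordP k) => k1 ->.
    have -> : dsubmx (delta_mx (lshift _ k1) 0 : Theta) = 0.
      by apply/colP => l; rewrite !mxE eq_rlshift.
    by rewrite mxE big1 ?normr0// => l _; rewrite mxE.
  have -> : dsubmx (delta_mx (rshift _ k1) 0 : Theta) = delta_mx k1 0.
    by apply/colP => l; rewrite !mxE eq_rshift.
  exact: mat_delta.
Qed.

(** Each matrix product is a sum of [d] products of jets, and each of these costs a factor 16. The
    growth is geometric in [k], which the factorials of the exponential series absorb. *)
Lemma jet_matX k i j : jet 1 ((d%:R * (16 * NA)) ^+ k) (fun h : Theta => ((- mat (dsubmx (th0 + h))) ^+ k) i j).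
Proof.
elim: k i j => [|k IH] i j.
  apply: (@jet_ext _ _ _ _ (fun=> (1%:M : 'M[R]_d) i j)); first by move=> h _; rewrite expr0.
  by apply: jet_le (jet_cst _ _) => //; rewrite expr0 mxE normr_nat lern1 leq_b1.
apply: (@jet_ext _ _ _ _ (fun h => \sum_l (- mat (dsubmx (th0 + h))) i l * ((- mat (dsubmx (th0 + h))) ^+ k) l j)).
  by move=> h _; rewrite exprS -mulmxE [RHS]mxE.
have M0 : 0 <= (d%:R * (16 * NA)) ^+ k by rewrite exprn_ge0// !mulr_ge0.
apply: jet_le (jet_sum (N := 16 * NA * (d%:R * (16 * NA)) ^+ k) (index_enum 'I_d) _ _) => //.
- have -> : size (index_enum 'I_d) = d.
    by rewrite -sum1_size -[RHS]card_ord -sum1_card; apply: eq_bigl.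
  rewrite exprS; set X := _ ^+ k.
  by rewrite (_ : d%:R * (16 * NA * X) = d%:R * (16 * NA) * X) ?lexx//; ring.
- by rewrite !mulr_ge0.
- by move=> l; apply: jetM => //; exact: jet_mat.
Qed.

Lemma ujet_exp i j : ujet (fun _ h => expmx (- mat (dsubmx (th0 + h))) i j).
Proof.
pose M := d%:R * (16 * NA).
apply: (@ujet_of_jet _ _ _ _ (expR M)).
apply: (@jet_series _ _ _ _ (exp_coeff M) (fun k h => (k`!%:R)^-1 * ((- mat (dsubmx (th0 + h))) ^+ k) i j)).
- move=> k; apply: jet_le (jetZ _ (jet_matX k i j)) => //.
  by rewrite /exp_coeff /= ger0_norm ?invr_ge0// mulrC.
- move=> n; apply: nondecreasing_cvgn_le; last exact: is_cvg_series_exp_coeff.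
  by apply: nondecreasing_series => k _ _; rewrite /exp_coeff /= divr_ge0// exprn_ge0// !mulr_ge0.
move=> h _; have sA : (- mat (dsubmx (th0 + h)))^T = - mat (dsubmx (th0 + h)).
  by rewrite linearN /= mat_sym.
rewrite (_ : series _ = (fun n => series (fun k => (k`!%:R)^-1 *: (- mat (dsubmx (th0 + h))) ^+ k) n i j)).
  by apply: cvg_coord; exact: cvg_expmx_sym.
by apply/funext => n; rewrite series_coordE; congr (series _ n); apply/funext => k; rewrite mxE.
Qed.

Lemma ujet_qform : ujet (fun x h => qform (expmx (- mat (dsubmx (th0 + h)))) (boost (mu_of mu0 J (th0 + h)) x) / c0 x ^+ 2).
Proof.
apply: (@ujet_ext _ _ _ _ (fun x h => \sum_i (boost (mu_of mu0 J (th0 + h)) x i 0 / c0 x) *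
   \sum_j expmx (- mat (dsubmx (th0 + h))) i j * (boost (mu_of mu0 J (th0 + h)) x j 0 / c0 x))).
  move=> x h hx; have c1 := hyp_lform_ge1 hmu0 hx; have cp : 0 < c0 x := lt_le_trans ltr01 c1.
  rewrite /qform /dot mulr_suml; apply: eq_bigr => i _.
  rewrite [(_ *m _) i 0]mxE !mulr_sumr mulr_suml; apply: eq_bigr => j _.
  by field; rewrite gt_eqF.
apply: ujet_sum => i; apply: ujetM; first exact: ujet_boost.
by apply: ujet_sum => j; apply: ujetM; [exact: ujet_exp|exact: ujet_boost].
Qed.

Lemma ujet_tr : ujet (fun _ h => \tr (mat (dsubmx (th0 + h)))).
Proof.
apply: (@ujet_ext _ _ _ _ (fun _ h => - \sum_i (- mat (dsubmx (th0 + h))) i i)).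
  move=> x h _; rewrite /mxtrace -sumrN; apply: eq_bigr => i _.
  by rewrite [(- mat _) i i]mxE opprK.
by apply/ujetN/ujet_sum => i; exact: (ujet_of_jet _ (jet_mat i i)).
Qed.

Definition gdist x : R := acosh (- lform mu0 x).

Lemma Fc_le1 (s : R) : 1 <= s -> Fc s <= 1.
Proof. by move=> s1; rewrite invf_le1 ?sinhc_gt0 ?sinhc_ge1// acosh_ge0. Qed.

(** With [s = cosh r] the left side is [r * cosh r / sinh r], and [cosh r = sinh r + expR (- r)].
    This is the linear growth of the tangent vector [Tmap mu x] with the distance. *)
Lemma Fc_mul_le (s : R) : 1 <= s -> Fc s * s <= 1 + acosh s.
Proof.
move=> s1; have r0 := acosh_ge0 s1; rewrite -{2}(acoshK s1).
have -> : cosh (acosh s) = sinh (acosh s) + expR (- acosh s) by rewrite -coshB_sinh; ring.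
rewrite mulrDr Fc_acosh// addrC lerD2r mulr_ile1 ?expR_ge0 ?Fc_le1//; first by rewrite ltW// Fc_gt0.
by rewrite -expR0 ler_expR oppr_le0.
Qed.

Lemma ln_Fc_le (s : R) : 1 <= s -> `|ln (Fc s)| <= acosh s.
Proof.
move=> s1; have r0 := acosh_ge0 s1.
rewrite /Fc lnV ?posrE ?sinhc_gt0// normrN ger0_norm ?ln_ge0 ?sinhc_ge1//.
rewrite -[leRHS]expRK ler_ln ?posrE ?sinhc_gt0 ?expR_gt0//.
rewrite /sinhc; case: eqVneq => [->|n0]; first by rewrite expR0.
have rp : 0 < acosh s by rewrite lt_def n0.
rewrite ler_pdivrMr// /sinh; set r := acosh s in rp *.
have h := expR_ge1Dx (- (2 * r)); have e0 := expR_gt0 r.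
have -> : expR (- r) = expR r * expR (- (2 * r)) by rewrite -expRD; congr expR; ring.
by nra.
Qed.

Lemma ujet_logdens : ujet (fun x h => logdens (mu_of mu0 J (th0 + h)) (Sigma_of (th0 + h)) x / (1 + gdist x) ^+ 2).
Proof.
have g0 x : hyperboloid x -> 0 <= gdist x by move=> hx; exact/acosh_ge0/hyp_lform_ge1.
have inv1 x : hyperboloid x -> `|(1 + gdist x) ^- 2| <= 1.
  move=> /g0 gx; rewrite ger0_norm ?invr_ge0 ?sqr_ge0// invf_le1 ?exprn_gt0 ?ltr_pwDl//.
  by rewrite exprn_ege1// lerDl.
(* Regrouping: the quadratic form loses [c0 x ^ 2], [Fc] is divided by its value at [mu0], and the
   product [Fc (c0 x) * c0 x] that remains is bounded by [1 + gdist x]. *)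
apply: (@ujet_ext _ _ _ _ (fun x h =>
  (1 + gdist x) ^- 2 * (- 2^-1 * \tr (mat (dsubmx (th0 + h)))) +
  - 2^-1 * ((Fc (c0 x) * c0 x / (1 + gdist x)) ^+ 2 *
     ((Fc (- lform (mu_of mu0 J (th0 + h)) x) / Fc (c0 x)) *
      (Fc (- lform (mu_of mu0 J (th0 + h)) x) / Fc (c0 x)) *
     (qform (expmx (- mat (dsubmx (th0 + h)))) (boost (mu_of mu0 J (th0 + h)) x) / c0 x ^+ 2))) +
  d.-1%:R * (ln (Fc (c0 x)) / (1 + gdist x) ^+ 2 +
     (1 + gdist x) ^- 2 * ln (Fc (- lform (mu_of mu0 J (th0 + h)) x) / Fc (c0 x))))).
  move=> x h hx; have c1 := hyp_lform_ge1 hmu0 hx; have cp : 0 < c0 x := lt_le_trans ltr01 c1.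
  rewrite logdens_ofE//.
  have f0 := Fc_gt0 c1; have f1 := Fc_gt0 (hyp_lform_ge1 (mu_of_hyp (th0 + h)) hx).
  rewrite ln_div ?posrE// /c0; rewrite /c0 in cp.
  have gp : 1 + gdist x != 0 by rewrite gt_eqF// ltr_pwDl// g0.
  move: f0 f1 cp; set c := - lform mu0 x; clearbody c => f0 f1 cp.
  by field; rewrite gp !gt_eqF.
apply: ujetD; first apply: ujetD.
- apply: ujetM; last exact/ujetZ/ujet_tr.
  exact: (ujet_cst inv1).
- apply/ujetZ/ujetM; last first.
    by apply: ujetM; [apply: ujetM; exact: ujet_Fc|exact: ujet_qform].
  apply: (@ujet_cst _ _ _ _ (fun x => (Fc (c0 x) * c0 x / (1 + gdist x)) ^+ 2) 1) => x hx.
  have c1 := hyp_lform_ge1 hmu0 hx; have cp : 0 < c0 x := lt_le_trans ltr01 c1.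
  have gx := g0 x hx; have gp : 0 < 1 + gdist x by rewrite ltr_pwDl.
  rewrite normrX exprn_ile1// ger0_norm ?divr_ge0 ?mulr_ge0 ?(ltW gp) ?(ltW cp) ?(ltW (Fc_gt0 c1))//.
  by rewrite ler_pdivrMr// mul1r Fc_mul_le.
apply/ujetZ/ujetD; last first.
  by apply: ujetM; [exact: (ujet_cst inv1)|exact: ujet_ln_Fc].
apply: (@ujet_cst _ _ _ _ (fun x => ln (Fc (c0 x)) / (1 + gdist x) ^+ 2) 1) => x hx.
have c1 := hyp_lform_ge1 hmu0 hx; have gx := g0 x hx.
have gp : 0 < (1 + gdist x) ^+ 2 by rewrite exprn_gt0// ltr_pwDl.
rewrite normrM normfV (gtr0_norm gp) ler_pdivrMr// mul1r (le_trans (ln_Fc_le c1))//.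
rewrite -/(gdist x); nra.
Qed.

Theorem logdens_jet : exists de C : R, [/\ 0 < de, de <= 1, 0 <= C & forall x, hyperboloid x ->
  jet de (C * (1 + gdist x) ^+ 2) (fun h => logdens (mu_of mu0 J (th0 + h)) (Sigma_of (th0 + h)) x)].
Proof.
have [de [N [d0 d1 hN]]] := ujet_logdens.
have N0 : 0 <= N by exact: jet_ge0 (hN mu0 hmu0).
exists de, N; split => // x hx.
have gx : 0 <= gdist x by exact/acosh_ge0/hyp_lform_ge1.
have gp : 0 < (1 + gdist x) ^+ 2 by rewrite exprn_gt0// ltr_pwDl.
apply: jet_le (jet_ext _ (jetZ ((1 + gdist x) ^+ 2) (hN x hx))) => //.
  by rewrite (gtr0_norm gp) mulrC.
by move=> h _; rewrite mulrC divfK// gt_eqF.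
Qed.

End LogDensityExpansion.

(** * Gaussian integrals and changes of variables *)

Section BorelVectors.
Context {R : realType} {dd : measure_display} {T : measurableType dd}.

(** An open set is a countable union of cubes with rational centres and sides governed by [1 / k],
    so the coordinates generate the Borel sets. *)
Lemma measurable_open_preimage n (u : 'I_n -> T -> R) (U : set 'cV[R]_n) :
  (forall i, measurable_fun setT (u i)) -> open U -> measurable [set t | U (\col_i u i t)].
Proof.
move=> mu oU.
pose B (q : 'cV[rat]_n * nat) : set 'cV[R]_n :=
  [set v | forall i, `|v i 0 - ratr (q.1 i 0)| < q.2.+1%:R^-1].
pose D (q : 'cV[rat]_n * nat) : set T := [set t | B q `<=` U /\ B q (\col_i u i t)].
have -> : [set t | U (\col_i u i t)] = \bigcup_q D q.
  apply/seteqP; split => [t /= Ut|t [q _ [/= + h]]]; last exact.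
  have /nbhs_ballP [e /= e0 he] : nbhs (\col_i u i t) U by exact: open_nbhs_nbhs.
  have [k ke] : exists k : nat, k.+1%:R^-1 < e / 2.
    have e20 : 0 < (e / 2)^-1 by rewrite invr_gt0 divr_gt0.
    have hb := archi_boundP (ltW e20).
    exists (Num.bound (e / 2)^-1); rewrite -[ltRHS]invrK ltf_pV2 ?posrE//.
    by apply: lt_trans hb _; rewrite ltr_nat.
  have ex i : exists q : rat, `|u i t - ratr q| < k.+1%:R^-1.
    have k0 : 0 < k.+1%:R^-1 :> R by rewrite invr_gt0.
    set r := k.+1%:R^-1 in k0 *.
    have lt : u i t - r < u i t + r by lra.
    have [q] := rat_in_itvoo lt.
    by rewrite in_itv /= => /andP[q1 q2]; exists q; rewrite ltr_norml; apply/andP; split; lra.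
  exists (\col_i projT1 (cid (ex i)), k) => //=; split => [v /= Bv|i].
    apply: he; split => // i j; rewrite ord1 mxE /ball /=.
    have := Bv i; rewrite mxE; case: (cid (ex i)) => q /= hq hv.
    rewrite (_ : u i t - v i 0 = (u i t - ratr q) - (v i 0 - ratr q)); last by ring.
    apply: le_lt_trans (ler_normB _ _) _.
      by rewrite (splitr e) ltrD// (lt_trans _ ke).
  by rewrite !mxE; case: (cid (ex i)).
apply: countable_bigcupT_measurable => [|q]; first exact: countableP.
have [BU|nBU] := pselect (B q `<=` U); last first.
  by rewrite (_ : D q = set0)// -subset0 => t [].
have -> : D q = ~` \bigcup_i [set t | q.2.+1%:R^-1 <= `|u i t - ratr (q.1 i 0)|].
  apply/seteqP; split => [t [_ h] [i _ /=]|t h].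
    by have := h i; rewrite mxE ltNge => /negP.
  split => // i; rewrite mxE ltNge; apply/negP => hi; apply: h; by exists i.
apply: measurableC; apply: countable_bigcupT_measurable => [|i]; first exact: countableP.
have m : measurable_fun setT (fun t => `|u i t - ratr (q.1 i 0)|).
  by apply: measurableT_comp => //; apply: measurable_funB.
have := m measurableT _ (measurable_itv `[q.2.+1%:R^-1, +oo[).
by rewrite setTI; congr measurable; apply/seteqP; split => t; rewrite /= in_itv /= andbT.
Qed.

Lemma measurable_continuous_col n (u : 'I_n -> T -> R) (g : 'cV[R]_n -> R) :
  (forall i, measurable_fun setT (u i)) -> continuous g ->
  measurable_fun setT (fun t => g (\col_i u i t)).
Proof.
move=> mu cg; apply: (measurability _ (RGenOInfty.measurableE R)) => //.
move=> _ [_ [a ->] <-]; rewrite setTI.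
apply: (@measurable_open_preimage _ u (g @^-1` `]a, +oo[%classic)) => //.
by move/continuousP : cg; apply; exact: interval_open.
Qed.

Lemma measurable_borel_col n (f : T -> 'cV[R]_n) :
  (forall i, measurable_fun setT (fun t => f t i 0)) -> measurable_fun setT (f : T -> @borel_mx R n 1).
Proof.
move=> mf; apply: (@measurability _ _ _ (@borel_mx R n 1) setT f (@open 'cV[R]_n)) => //.
move=> _ [U oU <-]; rewrite setTI.
have -> : f @^-1` U = [set t | U (\col_i f t i 0)].
  apply/seteqP; split => t /=; rewrite (_ : \col_i f t i 0 = f t)//;
    by apply/colP => i; rewrite mxE.
exact: measurable_open_preimage.
Qed.

End BorelVectors.

Section BorelCoordinates.
Context {R : realType}.

Lemma measurable_continuous_borel m n (g : 'M[R]_(m, n) -> R) : continuous g ->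
  measurable_fun setT (g : @borel_mx R m n -> R).
Proof.
move=> cg; apply: (measurability _ (RGenOInfty.measurableE R)) => //.
move=> _ [_ [a ->] <-]; rewrite setTI; apply: sub_sigma_algebra.
by move/continuousP : cg; apply; exact: interval_open.
Qed.

End BorelCoordinates.

(** * Substitution on the real line *)

Section Substitution.
Context {R : realType}.
Notation leb := (@lebesgue_measure R).

Lemma ge0_integral_exhaust (a b : nat -> R) (f : R -> R) : continuous f -> (forall x, 0 <= f x) ->
  (forall n m, (n <= m)%N -> a m <= a n) -> (forall n m, (n <= m)%N -> b n <= b m) ->
  (forall x, exists n, a n <= x <= b n) ->
  (\int[leb]_(x in `[a n, b n]) (f x)%:E)%E @[n --> \oo] --> (\int[leb]_x (f x)%:E)%E.
Proof.
move=> cf f0 da ib ex.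
have mf : measurable_fun setT (EFin \o f).
  by apply/measurable_EFinP; exact: continuous_measurable_fun.
have U : \bigcup_n `[a n, b n]%classic = [set: R].
  rewrite -subTset => x _; have [n hn] := ex x.
  by exists n => //=; rewrite in_itv.
rewrite -U; apply: ge0_nondecreasing_set_cvg_integral => //.
- move=> n m nm; apply/subsetPset => x /=; rewrite !in_itv /= => /andP[h1 h2].
  by rewrite (le_trans (da _ _ nm))// (le_trans h2 (ib _ _ nm)).
- by move=> n; exact: measurable_funTS.
- by move=> n x _; rewrite lee_fin.
Qed.

(** The rule on compact intervals is passed to the limit along [[- n, n]] and its images, which
    exhaust the line because [F] tends to both infinities. *)
Lemma ge0_integral_substT (F F' : R -> R) (G : R -> R) :
  (forall x : R, is_derive x 1 F (F' x)) -> continuous F' -> (forall x, 0 < F' x) ->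
  F x @[x --> -oo] --> -oo -> F x @[x --> +oo] --> +oo ->
  continuous G -> (forall x, 0 <= G x) ->
  (\int[leb]_x (G (F x) * F' x)%:E = \int[leb]_x (G x)%:E)%E.
Proof.
move=> dF cF' F'0 Fn Fp cG G0.
have dF1 x : derive1 F x = F' x by exact: is_derive_derive1 (dF x).
have F'E : F^`()%classic = F' by apply/funext.
have cF : continuous F.
  by move=> x; apply/differentiable_continuous/derivable1_diffP; have [] := dF x.
have incF : {homo F : x y / x < y}.
  move=> x y xy; rewrite -subr_gt0.
  have [|z _ ->] := @MVT R F F' x y xy (fun z _ => dF z).
    exact: continuous_subspaceT.
  by rewrite mulr_gt0// subr_gt0.
have ndF : {homo F : x y / x <= y}.
  by move=> x y; rewrite le_eqVlt => /predU1P[->//|/incF/ltW].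
pose a (n : nat) : R := - n%:R; pose b (n : nat) : R := n%:R.
have h1 : (\int[leb]_(x in `[F (a n), F (b n)]) (G x)%:E)%E @[n --> \oo] --> (\int[leb]_x (G x)%:E)%E.
  apply: ge0_integral_exhaust => //.
  - by move=> n m nm; apply: ndF; rewrite lerN2 ler_nat.
  - by move=> n m nm; apply: ndF; rewrite ler_nat.
  move=> x.
  have [A [Ar hA]] : exists A, A \is Num.real /\ forall y, y < A -> F y < x.
    by have := cvgrNy_lt Fn x; move=> [A [Ar hA]]; exists A.
  have [B [Br hB]] : exists B, B \is Num.real /\ forall y, B < y -> x < F y.
    by have := cvgry_gt Fp x; move=> [B [Br hB]]; exists B.
  pose n := Num.bound (`|A| + `|B|).
  have hn : `|A| + `|B| < n%:R by apply: archi_boundP; rewrite addr_ge0.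
  exists n; apply/andP; split; apply: ltW.
    apply: hA; rewrite /a ltrNl; apply: le_lt_trans hn.
    by rewrite (le_trans (ler_norm _))// normrN lerDl.
  by apply: hB; rewrite /b; apply: le_lt_trans hn; rewrite (le_trans (ler_norm _))// lerDr.
have cGF : continuous (fun x => G (F x) * F' x).
  move=> x; apply: cvgM; last exact: cF'.
  by apply: (@continuous_comp _ _ _ F G x); [exact: cF|exact: cG].
have h2 : (\int[leb]_(x in `[a n, b n]) (G (F x) * F' x)%:E)%E @[n --> \oo] --> (\int[leb]_x (G (F x) * F' x)%:E)%E.
  apply: ge0_integral_exhaust => //.
  - by move=> x; rewrite mulr_ge0// ltW.
  - by move=> n m nm; rewrite lerN2 ler_nat.
  - by move=> n m nm; rewrite ler_nat.
  move=> x; exists (Num.bound `|x|); have := archi_boundP (normr_ge0 x).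
  by rewrite -ler_norml => /ltW.
have e : (fun n => \int[leb]_(x in `[F (a n), F (b n)]) (G x)%:E)%E =
  (fun n => \int[leb]_(x in `[a n, b n]) (G (F x) * F' x)%:E)%E.
  apply/funext => n; rewrite integration_by_substitution_increasing ?F'E//.
  - by rewrite /a /b (le_trans (y := 0))// oppr_le0.
  - by move=> x y _ _; exact: incF.
  - by apply/cvg_ex; exists (F' (a n)); apply: cvg_at_right_filter; exact: cF'.
  - by apply/cvg_ex; exists (F' (b n)); apply: cvg_at_left_filter; exact: cF'.
  - split; first by move=> x _; have [] := dF x.
      by apply: cvg_at_right_filter; exact: cF.
    by apply: cvg_at_left_filter; exact: cF.
  - exact: continuous_subspaceT.
rewrite e in h1; exact: (cvg_unique _ h2 h1).
Qed.

End Substitution.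

Section GaussianIntegral.
Context {R : realType}.
Local Notation BR := (measurableTypeR R).
Notation leb := (@lebesgue_measure R).
Import HBNNSimple.

Lemma integral_normal_nnsfun (f : {nnsfun BR >-> R}) :
  (\int[normal_prob 0 1]_x (f x)%:E = \int[leb]_x ((f x)%:E * (normal_pdf 0 1 x)%:E))%E.
Proof.
have pm : measurable_fun setT (EFin \o normal_pdf (0 : R) 1).
  by apply/measurable_EFinP; exact: measurable_normal_pdf.
have p0 (x : R) : (0 <= (normal_pdf 0 1 x)%:E)%E by rewrite lee_fin normal_pdf_ge0.
under [LHS]eq_integral do rewrite fimfunE -fsumEFin//.
rewrite ge0_integral_fsum//; last 2 first.
  - by move=> r; exact/measurable_EFinP/measurableT_comp.
  - by move=> n x _; rewrite EFinM nnfun_muleindic_ge0.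
under [RHS]eq_integral.
  move=> x xD; rewrite fimfunE -fsumEFin// ge0_mule_fsuml; last first.
    by move=> r; rewrite EFinM nnfun_muleindic_ge0.
  over.
rewrite [RHS]ge0_integral_fsum//; last 2 first.
  - move=> r; apply: emeasurable_funM => //; exact/measurable_EFinP/measurableT_comp.
  - by move=> n x _; rewrite EFinM mule_ge0// nnfun_muleindic_ge0.
apply: eq_fsbigr => r _.
rewrite integralZl_indic_nnsfun//= integral_indic// setIT.
pose A := f @^-1` [set r].
have mA : measurable A by exact: measurable_sfunP.
transitivity (r%:E * \int[leb]_(x in A) (normal_pdf 0 1 x)%:E)%E; first by [].
rewrite integral_mkcond -integralZl//=; last first.
  by apply/(integrable_mkcond _ mA)/(integrableS measurableT) => //; exact: integrable_normal_pdf.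
apply: eq_integral => x _; rewrite patchE indicE -/A; case: ifP => xA.
  by rewrite mulr1.
by rewrite mulr0 mul0e mule0.
Qed.

Lemma ge0_integral_normal (f : BR -> \bar R) : measurable_fun [set: BR] f -> (forall x, 0 <= f x)%E ->
  (\int[normal_prob 0 1]_x f x = \int[leb]_x (f x * (normal_pdf 0 1 x)%:E))%E.
Proof.
move=> mf f0.
have pm : measurable_fun setT (EFin \o normal_pdf (0 : R) 1).
  by apply/measurable_EFinP; exact: measurable_normal_pdf.
have p0 (x : R) : (0 <= (normal_pdf 0 1 x)%:E)%E by rewrite lee_fin normal_pdf_ge0.
pose f_ := nnsfun_approx measurableT mf.
transitivity (lim (\int[normal_prob 0 1]_x (f_ n x)%:E @[n --> \oo])%E).
  rewrite -monotone_convergence//=.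
  - apply: eq_integral => ? /[!inE] xD; apply/esym/cvg_lim => //=.
    exact: cvg_nnsfun_approx.
  - by move=> n; apply/measurable_EFinP; exact: (measurable_funPT (f_ n)).
  - by move=> n ? _; rewrite lee_fin.
  - by move=> x _ i j ij; rewrite lee_fin; have /lefP := nd_nnsfun_approx measurableT mf ij; exact.
have -> : (fun n => \int[normal_prob 0 1]_x (f_ n x)%:E)%E = (fun n => \int[leb]_x ((f_ n x)%:E * (normal_pdf 0 1 x)%:E))%E.
  by apply/funext => n; exact: integral_normal_nnsfun.
rewrite -monotone_convergence//=.
- apply: eq_integral => x _; apply/cvg_lim => //.
  by apply: cvgeZr => //; exact: cvg_nnsfun_approx.
- by move=> n; apply: emeasurable_funM => //; apply/measurable_EFinP; exact: (measurable_funPT (f_ n)).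
- by move=> n x _; rewrite mule_ge0// lee_fin.
- move=> x _ a b ab; rewrite lee_wpmul2r// lee_fin; have /lefP := nd_nnsfun_approx measurableT mf ab; exact.
Qed.

Definition vecof n (t : n.-tuple BR) : 'cV[R]_n := \col_i tnth t i.

Lemma stdgauss_tonelli n (F : n.+1.-tuple BR -> \bar R) : measurable_fun setT F -> (forall t, 0 <= F t)%E ->
  (\int[stdgauss n.+1]_t F t = \int[normal_prob 0 1]_x \int[stdgauss n]_t F [tuple of x :: t])%E /\
  (\int[stdgauss n.+1]_t F t = \int[stdgauss n]_t \int[normal_prob 0 1]_x F [tuple of x :: t])%E.
Proof.
move=> mF F0.
have mG : measurable_fun setT (F \o @cons_pair R n).
  by apply: measurableT_comp => //; exact: measurable_cons_pair.
have e : (\int[stdgauss n.+1]_t F t = \int[(normal_prob 0 1 \x stdgauss n)%E]_p F (cons_pair p))%E.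
  by rewrite /= ge0_integral_distribution.
split.
  by rewrite e (fubini_tonelli1 _ mG)//; move=> p; exact: F0.
by rewrite e (fubini_tonelli2 _ mG)//; move=> p; exact: F0.
Qed.

End GaussianIntegral.

Section ContinuousCombinators.
Context {R : realType} {T : topologicalType}.
Implicit Types f g : T -> R.

Lemma cont_cst (c : R) : continuous (fun _ : T => c).
Proof. by move=> x; exact: cvg_cst. Qed.

Lemma cont_add f g : continuous f -> continuous g -> continuous (fun x => f x + g x).
Proof. by move=> cf cg x; apply: cvgD; [exact: cf|exact: cg]. Qed.

Lemma cont_opp f : continuous f -> continuous (fun x => - f x).
Proof. by move=> cf x; apply: cvgN; exact: cf. Qed.

Lemma cont_mul f g : continuous f -> continuous g -> continuous (fun x => f x * g x).
Proof. by move=> cf cg x; apply: cvgM; [exact: cf|exact: cg]. Qed.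

Lemma cont_inv f : (forall x, f x != 0) -> continuous f -> continuous (fun x => (f x)^-1).
Proof. by move=> f0 cf x; apply: cvgV; [exact: f0|exact: cf]. Qed.

Lemma cont_comp (T' : topologicalType) (h : T -> T') (k : T' -> R) :
  continuous h -> continuous k -> continuous (fun x => k (h x)).
Proof. by move=> ch ck x; apply: (@continuous_comp _ _ _ h k x); [exact: ch|exact: ck]. Qed.

Lemma cont_exp f : continuous f -> continuous (fun x => expR (f x)).
Proof. by move=> cf; apply: (@cont_comp _ f expR cf); exact: continuous_expR. Qed.

Lemma cont_sqrt f : continuous f -> continuous (fun x => Num.sqrt (f x)).
Proof. by move=> cf; apply: (@cont_comp _ f Num.sqrt cf); exact: sqrt_continuous. Qed.

Lemma cont_pow f n : continuous f -> continuous (fun x => f x ^+ n).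
Proof.
move=> cf; elim: n => [|n IH]; first exact: cont_cst.
have -> : (fun x => f x ^+ n.+1) = (fun x => f x * f x ^+ n) by apply/funext => x; rewrite exprS.
exact: cont_mul.
Qed.

Lemma cont_sum (I : Type) (s : seq I) (F : I -> T -> R) :
  (forall i, continuous (F i)) -> continuous (fun x => \sum_(i <- s) F i x).
Proof. by move=> cF x; apply: cvg_bigsum => i _; exact: (cF i x). Qed.

Lemma cont_coord n (u : T -> 'cV[R]_n) i : continuous u -> continuous (fun x => u x i 0).
Proof. by move=> cu; apply: (@cont_comp _ u (fun v => v i 0)) => //; exact: coord_continuous. Qed.

Lemma cont_dot n (u v : T -> 'cV[R]_n) : continuous u -> continuous v ->
  continuous (fun x => dot (u x) (v x)).
Proof. by move=> cu cv; apply: cont_sum => i; apply: cont_mul; exact: cont_coord. Qed.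

Lemma cont_enorm n (u : T -> 'cV[R]_n) : continuous u -> continuous (fun x => enorm (u x)).
Proof. by move=> cu; apply: cont_sqrt; exact: cont_dot. Qed.

Lemma cont_mulmx m n (A : 'M[R]_(m, n)) (u : T -> 'cV[R]_n) : continuous u ->
  continuous (fun x => A *m u x).
Proof.
move=> cu; apply: continuous_mx => i j.
have -> : (fun x => (A *m u x) i j) = (fun x => \sum_k A i k * u x k 0).
  by apply/funext => x; rewrite mxE; apply: eq_bigr => k _; rewrite (ord1 j).
by apply: cont_sum => k; apply: cont_mul; [exact: cont_cst|exact: cont_coord].
Qed.

Lemma cont_scale n (f : T -> R) (u : T -> 'cV[R]_n) : continuous f -> continuous u ->
  continuous (fun x => f x *: u x).
Proof. by move=> cf cu x; apply: cvgZ; [exact: cf|exact: cu]. Qed.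

Lemma cont_addv n (u v : T -> 'cV[R]_n) : continuous u -> continuous v ->
  continuous (fun x => u x + v x).
Proof. by move=> cf cu x; apply: cvgD; [exact: cf|exact: cu]. Qed.

End ContinuousCombinators.

(** * Lebesgue integration through the Gaussian measure; linear changes of variables *)

Section GaussianLebesgue.
Context {R : realType}.
Local Notation BR := (measurableTypeR R).
Notation leb := (@lebesgue_measure R).

Definition consv n (x : R) (v : 'cV[R]_n) : 'cV[R]_n.+1 :=
  \col_i oapp (fun j => v j 0) x (unlift 0 i).

Lemma consv0 n x (v : 'cV[R]_n) : consv x v 0 0 = x.
Proof. by rewrite mxE unlift_none. Qed.

Lemma consvS n x (v : 'cV[R]_n) (i : 'I_n) : consv x v (lift 0 i) 0 = v i 0.
Proof. by rewrite mxE liftK. Qed.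

Lemma consvP n (u : 'cV[R]_n.+1) x (v : 'cV[R]_n) : u 0 0 = x -> (forall i, u (lift 0 i) 0 = v i 0) -> u = consv x v.
Proof.
move=> h0 hS; apply/colP => i; case: (unliftP ord0 i) => [j|] ->; first by rewrite consvS hS.
by rewrite consv0.
Qed.

Lemma consv_ex n (u : 'cV[R]_n.+1) : exists x v, u = consv x v.
Proof. by exists (u 0 0), (\col_i u (lift 0 i) 0); apply: consvP => // i; rewrite mxE. Qed.

Lemma consvE n x (v : 'cV[R]_n) : consv x v = col_mx (x%:M : 'M[R]_1) v.
Proof.
apply/esym/consvP => [|i].
  transitivity (col_mx (x%:M : 'M[R]_1) v (lshift n 0) 0); last by rewrite col_mxEu mxE.
  by congr (col_mx _ _ _ _); exact: val_inj.
transitivity (col_mx (x%:M : 'M[R]_1) v (rshift 1 i) 0); last by rewrite col_mxEd.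
by congr (col_mx _ _ _ _); exact: val_inj.
Qed.

Lemma consvD n x y (v w : 'cV[R]_n) : consv x v + consv y w = consv (x + y) (v + w).
Proof. by apply: consvP => [|i]; rewrite mxE ?consv0 ?consvS// mxE. Qed.

Lemma consvZ n k x (v : 'cV[R]_n) : k *: consv x v = consv (k * x) (k *: v).
Proof. by apply: consvP => [|i]; rewrite mxE ?consv0 ?consvS// mxE. Qed.

Lemma dot_consv n x y (v w : 'cV[R]_n) : dot (consv x v) (consv y w) = x * y + dot v w.
Proof. by rewrite /dot big_ord_recl !consv0; congr (_ + _); apply: eq_bigr => i _; rewrite !consvS. Qed.

Lemma cont_consv n (T : topologicalType) (f : T -> R) (u : T -> 'cV[R]_n) :
  continuous f -> continuous u -> continuous (fun t => consv (f t) (u t)).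
Proof.
move=> cf cu; apply: continuous_mx => i j; rewrite (ord1 j).
case: (unliftP ord0 i) => [k|] ->.
  by under eq_fun do rewrite consvS; exact: cont_coord.
by under eq_fun do rewrite consv0.
Qed.

Lemma vecof_cons n (x : BR) (t : n.-tuple BR) : vecof [tuple of x :: t] = consv x (vecof t).
Proof. by apply: consvP => [|i]; rewrite !mxE// tnthS. Qed.

Definition cge0 n (f : 'cV[R]_n -> R) := continuous f /\ forall v, 0 <= f v.

(** The weight cancels the Gaussian density, so this is the Lebesgue integral divided by the power
    [n / 2] of twice pi. Multidimensional volume thus needs only the measure [stdgauss]. *)
Definition gint n (f : 'cV[R]_n -> R) : \bar R :=
  (\int[stdgauss n]_t (f (vecof t) * expR (dot (vecof t) (vecof t) / 2))%:E)%E.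

Lemma measurable_vecof n (f : 'cV[R]_n -> R) : continuous f ->
  measurable_fun [set: n.-tuple BR] (fun t => f (vecof t)).
Proof. by move=> cf; apply: measurable_continuous_col => // i; exact: measurable_tnth. Qed.

Lemma cont_gauss n (f : 'cV[R]_n -> R) : continuous f -> continuous (fun v => f v * expR (dot v v / 2)).
Proof.
move=> cf; apply: cont_mul => //; apply: cont_exp; apply: cont_mul; last exact: cont_cst.
by apply: cont_dot => x; exact: cvg_id.
Qed.

Lemma cge0_consv n (f : 'cV[R]_n.+1 -> R) x : cge0 f -> cge0 (fun v : 'cV[R]_n => f (consv x v)).
Proof.
move=> [cf f0]; split=> // ; apply: (@cont_comp _ _ _ (fun v => consv x v)) => //.
by apply: cont_consv; [exact: cont_cst|move=> v; exact: cvg_id].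
Qed.

Lemma cont_consv1 n (f : 'cV[R]_n.+1 -> R) v : continuous f -> continuous (fun x : R => f (consv x v)).
Proof.
move=> cf; apply: (@cont_comp _ _ _ (fun x : R => consv x v)) => //.
by apply: cont_consv; [move=> w; exact: cvg_id|move=> w; exact: cvg_cst].
Qed.

Let K := normal_peak (1 : R).

Lemma normal_pdf_peak (x : R) : expR (x * x / 2) * normal_pdf 0 1 x = K.
Proof.
rewrite normal_pdfE ?oner_eq0// /normal_fun mulrCA -expRD subr0 expr1n.
rewrite (_ : _ + _ = 0) ?expR0 ?mulr1// mulNr expr2 -[1 *+ 2]/(2%:R); exact: subrr.
Qed.

Lemma gint_cons1 n (f : 'cV[R]_n.+1 -> R) : cge0 f ->
  gint f = (\int[leb]_x (K%:E * gint (fun v => f (consv x v))))%E.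
Proof.
move=> hf; have [cf f0] := hf.
pose F (t : n.+1.-tuple BR) := (f (vecof t) * expR (dot (vecof t) (vecof t) / 2))%:E.
have mF : measurable_fun setT F by apply/measurable_EFinP; exact: measurable_vecof (cont_gauss cf).
have F0 t : (0 <= F t)%E by rewrite lee_fin mulr_ge0// expR_ge0.
transitivity (\int[stdgauss n.+1]_t F t)%E; first by [].
have [-> _] := stdgauss_tonelli mF F0.
have E x : (\int[stdgauss n]_t F [tuple of x :: t] = (expR (x * x / 2))%:E * gint (fun v => f (consv x v)))%E.
  rewrite /gint -ge0_integralZl_EFin ?expR_ge0//; last 2 first.
  - by move=> t _; rewrite lee_fin mulr_ge0// expR_ge0.
  - by apply/measurable_EFinP; have [cfx _] := cge0_consv x hf; exact: measurable_vecof (cont_gauss cfx).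
  apply: eq_integral => t _; rewrite -EFinM /F vecof_cons dot_consv mulrDl expRD; congr EFin; ring.
have g0 x : (0 <= gint (fun v => f (consv x v)))%E.
  by apply: integral_ge0 => t _; rewrite lee_fin mulr_ge0// expR_ge0.
rewrite ge0_integral_normal.
- apply: eq_integral => x _; rewrite E muleAC -EFinM normal_pdf_peak//.
- have mG : measurable_fun setT (F \o @cons_pair R n).
    by apply: measurableT_comp => //; exact: measurable_cons_pair.
  exact: (@measurable_fun_fubini_tonelli_F _ _ _ _ _ (stdgauss n) _ mG (fun p => F0 (cons_pair p))).
- by move=> x; exact: integral_ge0.
Qed.

Lemma gint_cons2 n (f : 'cV[R]_n.+1 -> R) : cge0 f ->
  gint f = (\int[stdgauss n]_t ((K * expR (dot (vecof t) (vecof t) / 2))%:E *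
    \int[leb]_x (f (consv x (vecof t)))%:E))%E.
Proof.
move=> hf; have [cf f0] := hf.
pose F (t : n.+1.-tuple BR) := (f (vecof t) * expR (dot (vecof t) (vecof t) / 2))%:E.
have mF : measurable_fun setT F by apply/measurable_EFinP; exact: measurable_vecof (cont_gauss cf).
have F0 t : (0 <= F t)%E by rewrite lee_fin mulr_ge0// expR_ge0.
transitivity (\int[stdgauss n.+1]_t F t)%E; first by [].
have [_ ->] := stdgauss_tonelli mF F0.
apply: eq_integral => t _; rewrite ge0_integral_normal//; last first.
  apply/measurable_EFinP; under eq_fun do rewrite vecof_cons.
  have h := @cont_consv1 _ _ (vecof t) (cont_gauss cf).
  have := continuous_measurable_fun h; exact.
rewrite -ge0_integralZl_EFin ?mulr_ge0 ?expR_ge0 ?normal_peak_ge0//; last 2 first.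
- by move=> x _; rewrite lee_fin.
- apply/measurable_EFinP; have h := @cont_consv1 _ _ (vecof t) cf.
  have := continuous_measurable_fun h; exact.
apply: eq_integral => x _; rewrite -!EFinM vecof_cons dot_consv mulrDl expRD -(normal_pdf_peak x).
congr EFin; ring.
Qed.

(** With [gint_ext2] this is how every change of variables is reduced: here the first coordinate is
    frozen, there all the others are and only a one-dimensional integral remains. *)
Lemma gint_ext1 n (f g : 'cV[R]_n.+1 -> R) : cge0 f -> cge0 g ->
  (forall x, gint (fun v => f (consv x v)) = gint (fun v => g (consv x v))) -> gint f = gint g.
Proof. by move=> hf hg e; rewrite (gint_cons1 hf) (gint_cons1 hg); apply: eq_integral => x _; rewrite e. Qed.

Lemma gint_ext2 n (f g : 'cV[R]_n.+1 -> R) : cge0 f -> cge0 g ->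
  (forall v, \int[leb]_x (f (consv x v))%:E = \int[leb]_x (g (consv x v))%:E)%E -> gint f = gint g.
Proof. by move=> hf hg e; rewrite (gint_cons2 hf) (gint_cons2 hg); apply: eq_integral => t _; rewrite e. Qed.

Lemma gintZ n (f : 'cV[R]_n -> R) c : 0 <= c -> cge0 f -> gint (fun v => c * f v) = (c%:E * gint f)%E.
Proof.
move=> c0 [cf f0]; rewrite /gint -ge0_integralZl_EFin//.
- by apply: eq_integral => t _; rewrite -EFinM mulrA.
- by move=> t _; rewrite lee_fin mulr_ge0// expR_ge0.
- by apply/measurable_EFinP; exact: measurable_vecof (cont_gauss cf).
Qed.

Lemma eq_gint n (f g : 'cV[R]_n -> R) : f =1 g -> gint f = gint g.
Proof. by move=> /funext ->. Qed.

(** The substitution rule above is for increasing maps; the reflection brings in negative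
    scalings. *)
Lemma leb_reflect (G : R -> R) : continuous G -> (forall x, 0 <= G x) ->
  (\int[leb]_x (G (- x))%:E = \int[leb]_x (G x)%:E)%E.
Proof.
move=> cG G0.
have cGN : continuous (fun x => G (- x)) by apply: cont_comp => //; exact: oppr_continuous.
pose a (n : nat) : R := - n%:R; pose b (n : nat) : R := n%:R.
have ex (x : R) : exists n, a n <= x <= b n.
  by exists (Num.bound `|x|); have := archi_boundP (normr_ge0 x); rewrite -ler_norml => /ltW.
have ha n m : (n <= m)%N -> a m <= a n by move=> nm; rewrite lerN2 ler_nat.
have hb n m : (n <= m)%N -> b n <= b m by move=> nm; rewrite ler_nat.
have h1 := ge0_integral_exhaust cG G0 ha hb ex.
have h2 := ge0_integral_exhaust cGN (fun x => G0 (- x)) ha hb ex.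
have e : (fun n => \int[leb]_(x in `[a n, b n]) (G (- x))%:E)%E = (fun n => \int[leb]_(x in `[a n, b n]) (G x)%:E)%E.
  apply/funext => n.
  have -> : (\int[leb]_(x in `[a n, b n]) (G x)%:E = \int[leb]_(x in `[(- b n)%R, (- a n)%R]) (G x)%:E)%E.
    by rewrite /a /b opprK.
  rewrite integration_by_substitution_oppr//.
    by rewrite (le_trans (y := 0))// /a oppr_le0.
  exact: continuous_subspaceT.
by rewrite e in h2; exact: (cvg_unique _ h2 h1).
Qed.

Lemma leb_shift (G : R -> R) c : continuous G -> (forall x, 0 <= G x) ->
  (\int[leb]_x (G (x + c))%:E = \int[leb]_x (G x)%:E)%E.
Proof.
move=> cG G0; 
have d (x : R) : is_derive x 1 (fun x : R => x + c) ((fun=> 1) x).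
  by apply: is_derive_eq; rewrite addr0.
rewrite -[RHS](ge0_integral_substT d)//.
- by apply: eq_integral => x _; rewrite mulr1.
- by move=> x; exact: cvg_cst.
- apply/cvgrNyPle => A; near=> x; rewrite -lerBrDr; near: x; exact: nbhs_ninfty_le (num_real _).
- apply/cvgryPge => A; near=> x; rewrite -lerBlDr; near: x; exact: nbhs_pinfty_ge (num_real _).
Unshelve. all: end_near. Qed.

Lemma leb_scale (G : R -> R) a : continuous G -> (forall x, 0 <= G x) -> a != 0 ->
  (\int[leb]_x (`|a| * G (a * x))%:E = \int[leb]_x (G x)%:E)%E.
Proof.
move=> + + a0; wlog ap : G a a0 / 0 < a => [H cG G0|cG G0].
  have [/H ->//|an|e] := ltgtP 0 a; last by rewrite -e eqxx in a0.
  rewrite -(leb_reflect cG G0) -(H (fun x => G (- x)) (- a)) ?oppr_eq0 ?oppr_gt0//.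
    by apply: eq_integral => x _; rewrite normrN mulNr opprK.
  by apply: cont_comp => //; exact: oppr_continuous.
have d (x : R) : is_derive x 1 (fun x : R => a * x) ((fun=> a) x).
  by apply: is_derive_eq; rewrite /GRing.scale /= mulr1.
rewrite -[RHS](ge0_integral_substT d)//.
- by apply: eq_integral => x _; rewrite gtr0_norm// mulrC.
- by move=> x; exact: cvg_cst.
- apply/cvgrNyPle => A; near=> x; rewrite mulrC -ler_pdivlMr//; near: x; exact: nbhs_ninfty_le (num_real _).
- apply/cvgryPge => A; near=> x; rewrite mulrC -ler_pdivrMr//; near: x; exact: nbhs_pinfty_ge (num_real _).
Unshelve. all: end_near. Qed.

Lemma cont_addl n (f : 'cV[R]_n -> R) (c : 'cV[R]_n) : continuous f -> continuous (fun v : 'cV[R]_n => f (v + c)).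
Proof.
move=> cf; have h : continuous (fun v : 'cV[R]_n => v + c).
  apply: continuous_mx => i j.
  have -> : (fun v : 'cV[R]_n => (v + c) i j) = (fun v => v i j + c i j) by apply/funext => v; rewrite mxE.
  by apply: cont_add; [exact: coord_continuous|exact: cont_cst].
exact: (cont_comp h cf).
Qed.

Lemma gint_shift n (f : 'cV[R]_n -> R) (c : 'cV[R]_n) : cge0 f -> gint (fun v : 'cV[R]_n => f (v + c)) = gint f.
Proof.
elim: n f c => [|n IH] f c [cf f0].
  by apply: eq_gint => v; congr f; apply/colP => -[].
have [x0 [c' ->]] := consv_ex c.
have h1 : cge0 (fun v => f (v + consv x0 c')).
  by split=> //; exact: cont_addl.
have h2 : cge0 (fun v => f (v + consv x0 0)).
  by split=> //; exact: cont_addl.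
transitivity (gint (fun v => f (v + consv x0 0))).
  apply: gint_ext1 => // x.
  rewrite -(IH (fun v => f (consv x v + consv x0 0)) c').
    by apply: eq_gint => v /=; rewrite !consvD addr0.
  exact: (cge0_consv x h2).
apply: gint_ext2 => // v; rewrite -[RHS](leb_shift x0)//; last exact: cont_consv1.
by apply: eq_integral => x _; rewrite consvD addr0.
Qed.

Definition lin_change n (A : 'M[R]_n) := forall f, cge0 f ->
  gint (fun v => `|\det A| * f (A *m v)) = gint f.

Lemma cge0_lin n (A : 'M[R]_n) f c : 0 <= c -> cge0 f -> cge0 (fun v => c * f (A *m v)).
Proof.
move=> c0 [cf f0]; split=> [|v]; last by rewrite mulr_ge0.
apply: cont_mul; first exact: cont_cst.
by apply: (@cont_comp _ _ _ (fun v => A *m v)) => //; apply: cont_mulmx => v; exact: cvg_id.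
Qed.

Lemma lin_changeM n (A B : 'M[R]_n) : lin_change A -> lin_change B -> lin_change (A *m B).
Proof.
move=> hA hB f hf; rewrite -(hA f hf) -(hB (fun v => `|\det A| * f (A *m v))); last exact: cge0_lin.
by apply: eq_gint => v; rewrite det_mulmx normrM mulmxA; ring.
Qed.

Definition blk n a (r : 'rV[R]_n) (c : 'cV[R]_n) (D : 'M[R]_n) : 'M[R]_n.+1 :=
  @block_mx R 1 n 1 n a%:M r c D.

Lemma mul_block_consv n a (r : 'rV[R]_n) c (D : 'M[R]_n) x v :
  (blk a r c D) *m consv x v = consv (a * x + (r *m v) 0 0) (x *: c + D *m v).
Proof.
transitivity ((@block_mx R 1 n 1 n a%:M r c D) *m (@col_mx R 1 n 1 x%:M v)); first by rewrite -consvE.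
rewrite [RHS]consvE mul_block_col -scalar_mxM mul_mx_scalar; apply: (congr2 (@col_mx R 1 n 1)) => //.
by apply/matrixP => i j; rewrite !ord1 !mxE.
Qed.

Lemma lin_change_diag n a (D : 'M[R]_n) : a != 0 -> lin_change D ->
  lin_change (blk a 0 0 D).
Proof.
move=> a0 hD f hf; have [cf f0] := hf.
have -> : `|\det (blk a 0 0 D)| = `|a| * `|\det D| by rewrite /blk (det_ublock (a%:M : 'M[R]_1)) det_scalar1 normrM.
have h1 : cge0 (fun v => `|a| * f ((blk a 0 0 1%:M) *m v)) by exact: cge0_lin.
transitivity (gint (fun v => `|a| * f ((blk a 0 0 1%:M) *m v))).
  apply: gint_ext1 => [|//|x].
    by apply: cge0_lin => //; rewrite mulr_ge0.
  rewrite -[RHS](hD _ (cge0_consv x h1)); apply: eq_gint => v.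
  by rewrite !mul_block_consv !mul0mx !scaler0 !add0r mul1mx; ring.
apply: gint_ext2 => // v.
rewrite -[RHS](leb_scale _ _ a0)//; last exact: cont_consv1.
by apply: eq_integral => x _; rewrite mul_block_consv mul0mx mul1mx scaler0 add0r mxE addr0.
Qed.

Lemma lin_change_shear n (r : 'rV[R]_n) : lin_change (blk 1 r 0 1%:M).
Proof.
move=> f hf; have [cf f0] := hf.
have -> : `|\det (blk 1 r 0 1%:M)| = 1 by rewrite /blk (det_ublock (1%:M : 'M[R]_1)) !det1 mulr1 normr1.
apply: gint_ext2 => [||v]//; first exact: cge0_lin.
rewrite -[RHS](leb_shift ((r *m v) 0 0))//; last exact: cont_consv1.
by apply: eq_integral => x _; rewrite mul_block_consv mul1mx scaler0 add0r !mul1r.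
Qed.

Lemma lin_change_coshear n (c : 'cV[R]_n) : lin_change (blk 1 0 c 1%:M).
Proof.
move=> f hf; have [cf f0] := hf.
have -> : `|\det (blk 1 0 c 1%:M)| = 1 by rewrite /blk (det_lblock (1%:M : 'M[R]_1)) !det1 mulr1 normr1.
apply: gint_ext1 => [||x]//; first exact: cge0_lin.
rewrite -(@gint_shift _ (fun v => f (consv x v)) (x *: c)); last exact: cge0_consv.
by apply: eq_gint => v; rewrite mul_block_consv mul1mx mul0mx mxE addr0 !mul1r addrC.
Qed.

(** Gaussian elimination: a nonzero corner factors the matrix into a column shear, a block diagonal
    matrix and a row shear. Each factor is handled by Tonelli and by the induction hypothesis on the
    smaller block. *)
Lemma lin_changeP n (A : 'M[R]_n) : A \in unitmx -> lin_change A.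
Proof.
elim: n A => [|n IH] A uA.
  move=> f hf; apply: eq_gint => v; rewrite det_mx00 normr1 mul1r; congr f.
  by apply/colP => -[].
have main (B : 'M[R]_n.+1) : B \in unitmx -> B 0 0 != 0 -> lin_change B.
  move=> uB b0; pose a := B 0 0.
  pose r : 'rV[R]_n := ursubmx (B : 'M[R]_(1 + n)); pose c : 'cV[R]_n := dlsubmx (B : 'M[R]_(1 + n)).
  pose D := drsubmx (B : 'M[R]_(1 + n)) - c *m (a^-1 *: r).
  have eB : B = (blk 1 0 (a^-1 *: c) 1%:M) *m (blk a 0 0 D)
               *m (blk 1 (a^-1 *: r) 0 1%:M).
    rewrite -[RHS]/(@mulmx R (1 + n) (1 + n) (1 + n) (@mulmx R (1 + n) (1 + n) (1 + n)
      (block_mx 1%:M 0 (a^-1 *: c) 1%:M) (block_mx a%:M 0 0 D)) (block_mx 1%:M (a^-1 *: r) 0 1%:M)).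
    rewrite !mulmx_block !(mul0mx, mulmx0, mul1mx, mulmx1, addr0, add0r).
    rewrite mul_scalar_mx mul_mx_scalar !scalerA mulfV// !scale1r.
    rewrite /D addrC subrK -[LHS](submxK (B : 'M[R]_(1 + n))).
    have -> : ulsubmx (B : 'M[R]_(1 + n)) = a%:M.
      apply/matrixP => i j; rewrite !ord1 !mxE /a eqxx mulr1n.
      by congr (B _ _); apply: val_inj.
    by [].
  rewrite eB; apply: lin_changeM; last exact: lin_change_shear.
  apply: lin_changeM; first exact: lin_change_coshear.
  apply: lin_change_diag => //; apply: IH.
  move: uB; rewrite eB /blk !unitmxE !det_mulmx (det_ublock (a%:M : 'M[R]_1)) !unitrM.
  by move=> /andP[/andP[_ /andP[]]].
have [e|] := eqVneq (A 0 0) 0; last exact: main.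
(* With a zero corner, invertibility supplies a nonzero entry lower in the first column, and adding
   that row to the first creates the pivot. *)
have [i Ai] : exists i, A (lift 0 i) 0 != 0.
  apply: contrapT => H; move: uA; rewrite unitmxE unitfE; apply/negP/negPn.
  rewrite (expand_det_col _ 0) big1// => i _.
  case: (unliftP ord0 i) => [j|] ->; last by rewrite e mul0r.
  by have [->|nz] := eqVneq (A (lift 0 j) 0) 0; [rewrite mul0r|case: H; exists j].
pose r : 'rV[R]_n := delta_mx 0 i.
pose S (s : 'rV[R]_n) : 'M[R]_n.+1 := blk 1 s 0 1%:M.
have SS : S (- r) *m S r = 1%:M.
  rewrite /S -[LHS]/(@mulmx R (1 + n) (1 + n) (1 + n) (block_mx 1%:M (- r) 0 1%:M) (block_mx 1%:M r 0 1%:M)).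
  rewrite mulmx_block !(mul0mx, mulmx0, mul1mx, mulmx1, addr0, add0r) subrr.
  exact: (esym (scalar_mx_block 1 n 1)).
rewrite -[A]mul1mx -SS -mulmxA; apply: lin_changeM; first exact: lin_change_shear.
apply: main.
  rewrite unitmx_mul uA andbT unitmxE /S /blk (det_ublock (1%:M : 'M[R]_1)) !det1 mulr1; exact: unitr1.
have -> : (S r *m A) 0 0 = A (lift 0 i) 0.
  have -> : (S r *m A) 0 0 = (S r *m col 0 A) 0 0 by rewrite !mxE; apply: eq_bigr => k _; rewrite !mxE.
  have -> : col 0 A = consv 0 (\col_i A (lift 0 i) 0) by apply: consvP => [|k]; rewrite !mxE.
  by rewrite mul_block_consv consv0 mul1r add0r -rowE !mxE.
exact: Ai.
Qed.

End GaussianLebesgue.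

(** * Radial change of variables *)

Section Radial.
Context {R : realType}.
Local Notation BR := (measurableTypeR R).
Notation leb := (@lebesgue_measure R).
Let K := normal_peak (1 : R).

Lemma cont_id (T : topologicalType) : continuous (fun x : T => x).
Proof. by move=> x; exact: cvg_id. Qed.

Lemma is_derive_continuous (f f' : R -> R) : (forall x : R, is_derive x 1 f (f' x)) -> continuous f.
Proof. by move=> df x; apply/differentiable_continuous/derivable1_diffP; have [] := df x. Qed.

Lemma continuous_cosh : continuous (@cosh R).
Proof. exact: (is_derive_continuous (@is_derive_cosh R)). Qed.

Lemma continuous_sinh : continuous (@sinh R).
Proof. exact: (is_derive_continuous (@is_derive_sinh R)). Qed.

Lemma Fc_cosh (r : R) : 0 <= r -> Fc (cosh r) = (sinhc r)^-1.
Proof. by move=> r0; rewrite /Fc coshK. Qed.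

(** The expansion of [Fc] is a Lipschitz estimate, valid also at the singular value 1. The maximum
    extends [Fc] continuously to the whole line, so that continuous functions of ambient points can
    be composed with it. *)
Lemma continuous_Fcmax : continuous (fun s : R => Fc (Num.max 1 s)).
Proof.
pose F s : R := Fc (Num.max 1 s).
have F1 (s : R) : (1 : R) <= Num.max 1 s by rewrite le_max lexx.
have bnd s y : `|Num.max 1 y - Num.max 1 s| <= 2^-1 -> `|F y - F s| <= 4 * `|y - s|.
  move=> h; set a := Num.max 1 s; set b := Num.max 1 y.
  have a1 : 1 <= a := F1 s; have b1 : 1 <= b := F1 y.
  have ab : `|b - a| <= `|y - s|.
    rewrite /a /b; case: (leP 1 y) => h1; case: (leP 1 s) => h2; rewrite ?subrr ?normr0//.
      by rewrite !ger0_norm; lra.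
    by rewrite distrC [X in _ <= X]distrC !ger0_norm; lra.
  have [u [v [hu hv]]] := Fc_expand a1.
  pose e := (b - a) / a.
  have a0 : a != 0 by rewrite gt_eqF//; lra.
  have be : a * (1 + e) = b by rewrite /e mulrDr mulr1 mulrC mulfVK//; ring.
  have ne : `|e| <= `|b - a|.
    rewrite /e normrM normfV (ger0_norm (_ : 0 <= a)); last lra.
    by rewrite ler_pdivrMr; [rewrite ler_peMr//; lra|lra].
  move=> /(_ e); rewrite be => /(_ (le_trans ne h) b1) hh.
  have Fa1 := Fc_le1 a1; have Fa0 := Fc_gt0 a1.
  have -> : F y - F s = Fc a * (Fc b / Fc a - 1).
    by rewrite mulrBr mulr1 mulrC mulfVK// gt_eqF.
  rewrite normrM (ger0_norm (ltW Fa0)).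
  have n0 : 0 <= `|e| by [].
  have e2 : `|e| ^+ 2 <= 2^-1 * `|e| by rewrite expr2 ler_wpM2r//; lra.
  have e3 : `|e| ^+ 3 <= 2^-1 * `|e|.
    rewrite exprS; apply: (@le_trans _ _ (`|e| * 2^-1)); last lra.
    by rewrite ler_wpM2l//; lra.
  have : `|Fc b / Fc a - 1| <= 3 * `|e|.
    have -> : Fc b / Fc a - 1 = (Fc b / Fc a - (1 + u * e + v * e ^+ 2)) + (u * e + v * e ^+ 2) by ring.
    apply: le_trans (ler_normD _ _) _.
    have : `|u * e + v * e ^+ 2| <= `|e| + `|e| ^+ 2.
      apply: le_trans (ler_normD _ _) _; rewrite (normrM u e) (normrM v (e ^+ 2)) normrX; apply: lerD.
        by rewrite ler_piMl.
      by rewrite ler_piMl// exprn_ge0.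
    lra.
  move=> h3; apply: (@le_trans _ _ (1 * `|Fc b / Fc a - 1|)); last lra.
  by rewrite ler_wpM2r.
move=> s; apply/cvgrPdist_le => eps e0; near=> y.
have hy : `|s - y| <= Num.min 2^-1 (eps / 4).
  near: y; have : nbhs s (ball s (Num.min 2^-1 (eps / 4))).
    by apply: nbhsx_ballx; rewrite lt_min; apply/andP; split; lra.
  by apply: filterS => y; rewrite /ball /= => /ltW.
move: hy; rewrite le_min => /andP[h1 h2].
rewrite distrC; apply: le_trans (bnd s y _) _; last by rewrite distrC; lra.
apply: le_trans h1; case: (leP 1 y) => g1; case: (leP 1 s) => g2; rewrite ?subrr ?normr0//.
- by rewrite distrC.
- by clear -g1 g2; rewrite distrC !ler0_norm; lra.
- by clear -g1 g2; rewrite distrC !ger0_norm; lra.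
Unshelve. all: end_near. Qed.

Lemma cont_sinhc_enorm n (T : topologicalType) (u : T -> 'cV[R]_n) : continuous u ->
  continuous (fun v => sinhc (enorm (u v))).
Proof.
move=> cu; have -> : (fun v => sinhc (enorm (u v))) = (fun v => (Fc (Num.max 1 (cosh (enorm (u v)))))^-1).
  apply/funext => v; have /max_idPr -> := cosh_ge1 (enorm (u v)).
  by rewrite Fc_cosh ?invrK// enorm_ge0.
apply: cont_inv => [v|]; first by rewrite gt_eqF// Fc_gt0// le_max lexx.
exact: (cont_comp (cont_comp (cont_enorm cu) continuous_cosh) continuous_Fcmax).
Qed.

(** A probability density in [t] for every [r], with antiderivative [- expR (- (expR t * r))]. It
    lets an auxiliary scale variable be integrated in without changing the total. *)
Lemma leb_gumbel (r : R) : 0 < r ->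
  (\int[leb]_t (expR t * r * expR (- (expR t * r)))%:E = 1)%E.
Proof.
move=> r0; pose F (t : R) := - expR (- (expR t * r)).
have dF (t : R) : is_derive t 1 F (expR t * r * expR (- (expR t * r))).
  apply: is_derive_eq; rewrite /GRing.scale /=; ring.
have cf : continuous (fun t : R => expR t * r * expR (- (expR t * r))).
  have c1 : continuous (fun t : R => expR t * r).
    by apply: cont_mul; [exact: continuous_expR|exact: cont_cst].
  by apply: cont_mul => //; apply: cont_exp; exact: cont_opp.
have f0 (t : R) : 0 <= expR t * r * expR (- (expR t * r)) by rewrite !mulr_ge0 ?expR_ge0// ltW.
pose a (n : nat) : R := - n%:R; pose b (n : nat) : R := n%:R.
have ex (x : R) : exists n, a n <= x <= b n.
  by exists (Num.bound `|x|); have := archi_boundP (normr_ge0 x); rewrite -ler_norml => /ltW.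
have ha n m : (n <= m)%N -> a m <= a n by move=> nm; rewrite lerN2 ler_nat.
have hb n m : (n <= m)%N -> b n <= b m by move=> nm; rewrite ler_nat.
have h1 := ge0_integral_exhaust cf f0 ha hb ex.
rewrite -(@cvg_shiftS _ (fun n => _)) in h1.
have e : (fun n => \int[leb]_(t in `[a n.+1, b n.+1]) (expR t * r * expR (- (expR t * r)))%:E)%E =
   (fun n => (F (b n.+1) - F (a n.+1))%:E).
  apply/funext => n; rewrite EFinB; apply: continuous_FTC2.
  - by rewrite /a /b (@lt_le_trans _ _ 0)// oppr_lt0 ltr0n.
  - exact: continuous_subspaceT.
  - split; first by move=> x _; have [] := dF x.
      by apply: cvg_at_right_filter; exact: (is_derive_continuous dF).
    by apply: cvg_at_left_filter; exact: (is_derive_continuous dF).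
  - by move=> x _; exact: is_derive_derive1 (dF x).
rewrite e in h1; apply: (cvg_unique _ h1) => //.
apply: cvg_EFin; first by near=> n.
have -> : fine \o (fun n => (F (b n.+1) - F (a n.+1))%:E) = (fun n => F (b n.+1) - F (a n.+1)) by [].
have la : (expR (a n.+1) : R) @[n --> \oo] --> (0 : R).
  apply: (@squeeze_cvgr _ _ _ _ (fun=> 0) (fun n => n.+1%:R^-1)); [|exact: cvg_cst|exact: cvg_harmonic].
  near=> n; rewrite expR_ge0/= /a expRN lef_pV2 ?posrE ?expR_gt0 ?ltr0n//.
  by apply: le_trans (expR_ge1Dx _); rewrite lerDr.
have -> : (1 : R) = - 0 - - expR (- (0 * r)) by rewrite mul0r !oppr0 expR0 opprK add0r.
apply: cvgB.
  apply: cvgN.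
  apply: (@squeeze_cvgr _ _ _ _ (fun=> 0) (fun n => n.+1%:R^-1 * r^-1)); [|exact: cvg_cst|].
    near=> n; rewrite expR_ge0/= expRN -invfM lef_pV2 ?posrE ?expR_gt0 ?mulr_gt0 ?ltr0n//.
    apply: le_trans (expR_ge1Dx _); rewrite -[leLHS]add0r lerD// ler_wpM2r ?(ltW r0)//.
    by apply: le_trans (expR_ge1Dx _); rewrite lerDr.
  rewrite -[X in _ --> X](mul0r r^-1); apply: cvgM; [exact: cvg_harmonic|exact: cvg_cst].
apply: cvgN; apply: (@cvg_comp _ _ _ (fun n => expR (a n.+1)) (fun x : R => expR (- (x * r))) _ _ _ la).
have h : continuous (fun x : R => expR (- (x * r))); last exact: h.
apply: cont_exp; apply: cont_opp; apply: cont_mul; [exact: cont_id|exact: cont_cst].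
Unshelve. all: end_near. Qed.

(** The origin lies on no ray; being null, it can be discarded when integrals are compared ray by
    ray. *)
Lemma stdgauss_null0 n : stdgauss n.+1 [set t : n.+1.-tuple BR | vecof t = 0] = 0%E.
Proof.
pose A := [set t : n.+1.-tuple BR | vecof t = 0].
have mA : measurable A.
  have -> : A = (fun t => dot (vecof t) (vecof t)) @^-1` [set 0].
    by apply/seteqP; split=> t /= h; [rewrite h dot0l|apply/eqP; rewrite -dot_eq0 h].
  rewrite -[X in measurable X]setTI.
  apply: (@measurable_vecof _ _ (fun v => dot v v)) => //.
  by apply: cont_dot; exact: cont_id.
rewrite -/A -(setIT A) -integral_indic//.
have [_ ->] := stdgauss_tonelli (F := fun t => (\1_A t)%:E)
  (ltac:(by apply/measurable_EFinP; exact: measurable_indic)) (fun t => ltac:(by rewrite lee_fin)).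
apply: integral0_eq => t _.
have N0 : normal_prob (0 : R) 1 [set 0] = 0%E.
  have /null_content_dominatesP h := @normal_prob_dominates R 0 1.
  by apply: h => //; exact: lebesgue_measure_set1.
apply/eqP; rewrite eq_le integral_ge0 ?andbT => [|x _]; last by rewrite lee_fin.
rewrite -N0 -[X in (_ <= _ X)%E]setIT -integral_indic//.
apply: ge0_le_integral => //.
- apply/measurable_EFinP.
  have -> : (fun x : BR => \1_A [tuple of x :: t]) = \1_((fun x : BR => [tuple of x :: t]) @^-1` A) :> (BR -> R).
    by [].
  apply: measurable_indic; rewrite -[X in measurable X]setTI.
  have m : measurable_fun setT (fun x : BR => [tuple of x :: t]) by apply: measurable_cons.
  exact: m.
- by apply/measurable_EFinP; exact: measurable_indic.
- move=> x _; rewrite lee_fin !indicE.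
  case: (boolP (_ \in A)) => [|_]; last by rewrite ler0n.
  rewrite inE /A /= => h; rewrite mem_set//=.
  by have := congr1 (fun v : 'cV[R]_n.+1 => v 0 0) h; rewrite vecof_cons consv0 mxE.
Qed.

Definition tailv n (u : 'cV[R]_n.+1) : 'cV[R]_n := \col_i u (lift 0 i) 0.

Lemma tailvK n x (v : 'cV[R]_n) : tailv (consv x v) = v.
Proof. by apply/colP => i; rewrite mxE consvS. Qed.

Lemma cont_tailv n : continuous (@tailv n).
Proof.
apply: continuous_mx => i j; under eq_fun do rewrite mxE; exact: coord_continuous.
Qed.

(* Integrating against the Gumbel density of [t + ln |v|] and rescaling by [exp t] turns a
   comparison of Gaussian integrals into a comparison along each ray. *)
Lemma gint_ray n (g1 g2 : 'cV[R]_n.+1 -> R) : cge0 g1 -> cge0 g2 ->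
  (forall v : 'cV[R]_n.+1, (v != 0)%R ->
    \int[leb]_t (g1 (expR (- t) *: v) * expR (- t) ^+ n.+1)%:E =
    \int[leb]_t (g2 (expR (- t) *: v) * expR (- t) ^+ n.+1)%:E)%E ->
  gint g1 = gint g2.
Proof.
move=> h1 h2 e.
pose W (u : 'cV[R]_n.+2) := expR (u 0 0) * enorm (tailv u) * expR (- (expR (u 0 0) * enorm (tailv u))).
have cW : continuous W.
  have c1 : continuous (fun u : 'cV[R]_n.+2 => expR (u 0 0) * enorm (tailv u)).
    apply: cont_mul; first by apply: cont_exp; exact: coord_continuous.
    by apply: cont_enorm; exact: cont_tailv.
  by apply: cont_mul => //; apply: cont_exp; exact: cont_opp.
have W0 u : 0 <= W u by rewrite !mulr_ge0 ?expR_ge0 ?enorm_ge0.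
(* Integrating the extra coordinate first gives total mass 1 away from the origin, up to the
   constant [K] of one more Gaussian coordinate. *)
have A g : cge0 g -> gint (fun u => g (tailv u) * W u) = (K%:E * gint g)%E.
  move=> [cg g0]; have hF : cge0 (fun u => g (tailv u) * W u).
    split=> [|u]; last by rewrite mulr_ge0.
    by apply: cont_mul => //; apply: (cont_comp (@cont_tailv n.+1)).
  rewrite (gint_cons2 hF) -gintZ ?normal_peak_ge0//.
  have mg : measurable_fun [set: n.+1.-tuple BR] (fun t => K * g (vecof t) * expR (dot (vecof t) (vecof t) / 2)).
    by apply: (measurable_vecof (f := fun v => K * g v * expR (dot v v / 2)));
      apply: cont_gauss; apply: cont_mul => //; exact: cont_cst.
  pose A := [set t : n.+1.-tuple BR | vecof t = 0].
  have mA : measurable A.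
    have -> : A = (fun t => dot (vecof t) (vecof t)) @^-1` [set 0].
      by apply/seteqP; split=> t /= h; [rewrite h dot0l|apply/eqP; rewrite -dot_eq0 h].
    rewrite -[X in measurable X]setTI.
    apply: (@measurable_vecof _ _ (fun v => dot v v)) => //.
    by apply: cont_dot; exact: cont_id.
  transitivity (\int[stdgauss n.+1]_t (K * g (vecof t) * expR (dot (vecof t) (vecof t) / 2) * \1_(~` A) t)%:E)%E.
    apply: eq_integral => t _.
    under eq_integral do rewrite tailvK.
    have [vt|vt] := eqVneq (vecof t) 0.
      rewrite indicE memNset; last by move=> /(_ vt).
      rewrite mulr0; under eq_integral do rewrite /W tailvK vt enorm0 !(mulr0, mul0r).
      by rewrite integral0 mule0.
    rewrite indicE mem_set; last by move=> /= /eqP; rewrite (negPf vt).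
    under eq_integral do rewrite /W tailvK consv0.
    have r0 : 0 < enorm (vecof t) by rewrite enorm_gt0.
    under eq_integral do rewrite EFinM.
    rewrite ge0_integralZl_EFin// ?leb_gumbel ?mule1 -?EFinM//.
    - by congr EFin; rewrite /K /= mulr1; ring.
    - by move=> x _; rewrite lee_fin !mulr_ge0 ?expR_ge0 ?enorm_ge0.
    - apply/measurable_EFinP.
      have h := @cont_consv1 _ _ _ (vecof t) cW.
      have := continuous_measurable_fun h; rewrite /W.
      by under eq_fun do rewrite tailvK consv0.
  apply: ge0_ae_eq_integral => //.
  - apply/measurable_EFinP; apply: measurable_funM => //; apply: measurable_indic; exact: measurableC.
  - by apply/measurable_EFinP.
  - by move=> t _; rewrite lee_fin !mulr_ge0 ?expR_ge0 ?normal_peak_ge0.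
  - by move=> t _; rewrite lee_fin !mulr_ge0 ?expR_ge0 ?normal_peak_ge0.
  exists A; split=> //; first exact: stdgauss_null0.
  move=> t /= h; apply: contrapT => nA; apply: h => _.
  by rewrite indicE mem_set ?mulr1.
pose G g (u : 'cV[R]_n.+2) := expR (- u 0 0) ^+ n.+1 * (g (expR (- u 0 0) *: tailv u) *
   (enorm (tailv u) * expR (- enorm (tailv u)))).
have cG g : cge0 g -> cge0 (G g).
  move=> [cg g0]; split=> [|u]; last by rewrite !mulr_ge0 ?exprn_ge0 ?expR_ge0 ?enorm_ge0.
  have ce : continuous (fun u : 'cV[R]_n.+2 => expR (- u 0 0)).
    by apply: cont_exp; apply: cont_opp; exact: coord_continuous.
  have cn : continuous (fun u : 'cV[R]_n.+2 => enorm (tailv u)) by apply: cont_enorm; exact: cont_tailv.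
  apply: cont_mul; first exact: cont_pow.
  apply: cont_mul; last by apply: cont_mul => //; apply: cont_exp; exact: cont_opp.
  apply: (@cont_comp _ _ _ (fun u : 'cV[R]_n.+2 => expR (- u 0 0) *: tailv u)) => //.
  by apply: cont_scale => //; exact: cont_tailv.
(* For a fixed scale [s] the vector is rescaled by [expR (- s)]. The weight then no longer depends
   on [s], and only [g] runs along the ray. *)
have B g : cge0 g -> gint (fun u => g (tailv u) * W u) = gint (G g).
  move=> hg; have [cg g0] := hg; have hF : cge0 (fun u => g (tailv u) * W u).
    split=> [|u]; last by rewrite mulr_ge0.
    by apply: cont_mul => //; apply: (cont_comp (@cont_tailv n.+1)).
  apply: gint_ext1 => // [|s]; first exact: cG.
  have us : (expR (- s))%:M \in @unitmx R n.+1 by rewrite unitmxE det_scalar unitfE expf_neq0// gt_eqF ?expR_gt0.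
  rewrite -(lin_changeP us (cge0_consv s hF)); apply: eq_gint => v.
  rewrite /G /W !tailvK !consv0 det_scalar mul_scalar_mx ger0_norm ?exprn_ge0 ?expR_ge0//.
  rewrite enormZ ger0_norm ?expR_ge0//.
  have e1 : expR s * (expR (- s) * enorm v) = enorm v by rewrite mulrA -expRD subrr expR0 mul1r.
  by rewrite e1.
have E : gint (G g1) = gint (G g2).
  apply: gint_ext2; [exact: cG|exact: cG|move=> v].
  have H g : cge0 g -> (\int[leb]_x (G g (consv x v))%:E = (enorm v * expR (- enorm v))%:E *
     \int[leb]_t (g (expR (- t) *: v) * expR (- t) ^+ n.+1)%:E)%E.
    move=> [cg g0]; rewrite -ge0_integralZl_EFin ?mulr_ge0 ?expR_ge0 ?enorm_ge0//.
    - by apply: eq_integral => x _; rewrite /G tailvK consv0 -EFinM; congr EFin; ring.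
    - by move=> x _; rewrite lee_fin mulr_ge0// exprn_ge0// expR_ge0.
    - apply/measurable_EFinP.
      have ce : continuous (fun t : R => expR (- t)) by apply: cont_exp; apply: cont_opp; exact: cont_id.
      have h : continuous (fun t : R => g (expR (- t) *: v) * expR (- t) ^+ n.+1).
        apply: cont_mul; last exact: cont_pow.
        apply: (@cont_comp _ _ _ (fun t : R => expR (- t) *: v)) => //.
        by apply: cont_scale => //; move=> t; exact: cvg_cst.
      have := continuous_measurable_fun h; exact.
  rewrite !H//; have [->|v0] := eqVneq v 0; first by rewrite enorm0 mul0r !mul0e.
  by rewrite e.
have : (K%:E * gint g1 = K%:E * gint g2)%E by rewrite -!A// !B.
have K0 : 0 < K by rewrite normal_peak_gt0// oner_neq0.
move=> /(congr1 (fun z => (K^-1)%:E * z)%E).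
by rewrite !muleA -!EFinM mulVf ?mul1e// gt_eqF.
Qed.

(** The map [v] to [sinhc |v| v] preserves rays; its Jacobian is [cosh |v|] in the radial direction
    and [sinhc |v|] in the [n] others. *)
Lemma gint_radial n (f : 'cV[R]_n.+1 -> R) : cge0 f ->
  gint (fun v => f (sinhc (enorm v) *: v) * (cosh (enorm v) * sinhc (enorm v) ^+ n)) = gint f.
Proof.
move=> hf; have [cf f0] := hf.
have cn : continuous (fun v : 'cV[R]_n.+1 => enorm v) by apply: cont_enorm; exact: cont_id.
have cs : continuous (fun v : 'cV[R]_n.+1 => sinhc (enorm v)) by apply: cont_sinhc_enorm; exact: cont_id.
apply: gint_ray => // [|v v0].
  split=> [|v]; last by rewrite mulr_ge0// mulr_ge0 ?exprn_ge0// ltW// ?cosh_gt0// sinhc_gt0// enorm_ge0.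
  apply: cont_mul.
    by apply: (@cont_comp _ _ _ (fun v => sinhc (enorm v) *: v)) => //; apply: cont_scale => //; exact: cont_id.
  by apply: cont_mul; [exact: (cont_comp cn continuous_cosh)|exact: cont_pow].
have r0 : 0 < enorm v by rewrite enorm_gt0.
set r := enorm v in r0 *.
pose y (t : R) := expR (- t) * r.
have y0 t : 0 < y t by rewrite mulr_gt0// expR_gt0.
(* On the ray parametrized by [expR (- t) *: v] the radial map acts as [t] to [F t], because
   [expR (- F t) = expR (- t) * sinhc (y t)]. *)
pose F t := - ln (sinh (y t) / r).
pose F' t := cosh (y t) / sinhc (y t).
have sy t : 0 < sinh (y t) / r by rewrite divr_gt0// sinh_gt0.
have sc t : sinhc (y t) != 0 by rewrite gt_eqF// sinhc_gt0// ltW.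
have dy (t : R) : is_derive t 1 y (- y t).
  apply: is_derive_eq; rewrite /y /GRing.scale /=; ring.
have dF (t : R) : is_derive t 1 F (F' t).
  have l := is_derive1_ln (sy t).
  have ds := is_derive_sinh (y t).
  have d1 : is_derive t 1 (fun t => sinh (y t)) (cosh (y t) * - y t) by apply: is_derive1_comp.
  have d2 : is_derive t 1 (fun t => sinh (y t) / r) (cosh (y t) * - y t / r).
    by apply: is_derive_eq; rewrite /GRing.scale /=; ring.
  have d3 : is_derive t 1 (fun t => ln (sinh (y t) / r)) ((sinh (y t) / r)^-1 * (cosh (y t) * - y t / r)).
    by apply: (@is_derive1_comp _ (@ln R) (fun t => sinh (y t) / r)).
  apply: is_derive_eq; rewrite /F' /sinhc gt_eqF//.
  by field; rewrite !gt_eqF// sinh_gt0.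
have cy : continuous y := is_derive_continuous dy.
have cF' : continuous F'.
  have -> : F' = (fun t => cosh (y t) / (sinh (y t) / y t)).
    by apply/funext => t; rewrite /F' /sinhc gt_eqF.
  apply: cont_mul; first exact: (cont_comp cy continuous_cosh).
  apply: cont_inv => [t|]; first by rewrite gt_eqF// divr_gt0// sinh_gt0.
  apply: cont_mul; first exact: (cont_comp cy continuous_sinh).
  by apply: cont_inv => // t; rewrite gt_eqF.
have F'0 t : 0 < F' t by rewrite divr_gt0 ?cosh_gt0// sinhc_gt0// ltW.
have eF t : expR (- F t) = expR (- t) * sinhc (y t).
  rewrite /F opprK lnK ?posrE// -sinhcE /y; field; exact: lt0r_neq0.
have FE t : F t = t - ln (sinhc (y t)).
  apply: oppr_inj; apply: expR_inj; rewrite eF opprB addrC expRD lnK// posrE sinhc_gt0// ltW//.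
have Fle t : F t <= t by rewrite FE lerBlDr lerDl ln_ge0// sinhc_ge1// ltW.
have Fge t : 0 <= t -> t - r <= F t.
  move=> t0; rewrite FE lerD2l lerN2.
  have h := ln_Fc_le (cosh_ge1 (y t)).
  have y1 := ltW (y0 t).
  rewrite (Fc_cosh y1) (coshK y1) lnV ?posrE ?sinhc_gt0// normrN in h.
  apply: le_trans (ler_norm _) _; apply: le_trans h _.
  by rewrite /y ler_piMl ?(ltW r0)// -[leRHS]expR0 ler_expR oppr_le0.
have ce : continuous (fun t : R => expR (- t)) by apply: cont_exp; apply: cont_opp; exact: cont_id.
pose G t := f (expR (- t) *: v) * expR (- t) ^+ n.+1.
rewrite -[RHS](@ge0_integral_substT _ F F' G)//.
- apply: eq_integral => t _; congr EFin; rewrite /G eF scalerA enormZ ger0_norm ?expR_ge0//.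
  rewrite -/r -/(y t) [sinhc _ * expR _]mulrC /F' exprMn.
  move: (sinhc (y t)) (cosh (y t)) (sc t) => b a b0; move: (f _) => c.
  by rewrite [b ^+ n.+1]exprS; field.
- apply/cvgrNyPle => A; near=> t; apply: le_trans (Fle t) _; near: t; exact: nbhs_ninfty_le (num_real _).
- apply/cvgryPge => A; near=> t; apply: le_trans (Fge t _); last first.
    by near: t; exact: nbhs_pinfty_ge (num_real _).
  by rewrite lerBrDr; near: t; exact: nbhs_pinfty_ge (num_real _).
- apply: cont_mul; last exact: cont_pow.
  apply: (@cont_comp _ _ _ (fun t : R => expR (- t) *: v)) => //.
  by apply: cont_scale => //; move=> t; exact: cvg_cst.
- by move=> t; rewrite mulr_ge0// exprn_ge0// expR_ge0.
Unshelve. all: end_near. Qed.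

End Radial.

(** * Wrapped normal densities *)

Lemma cont_cstT (T U : topologicalType) (c : U) : continuous (fun _ : T => c).
Proof. by move=> x; exact: cvg_cst. Qed.

Lemma cont_compT (T U V : topologicalType) (h : T -> U) (k : U -> V) :
  continuous h -> continuous k -> continuous (fun x => k (h x)).
Proof. by move=> ch ck x; apply: (@continuous_comp _ _ _ h k x); [exact: ch|exact: ck]. Qed.

Section BoostInvariance.
Context {R : realType}.
Notation leb := (@lebesgue_measure R).

Definition omega n (u : 'cV[R]_n) : R := Num.sqrt (1 + dot u u).

Lemma omega_gt0 n (u : 'cV[R]_n) : 0 < omega u.
Proof. by rewrite sqrtr_gt0; have := dot_ge0 u; lra. Qed.

Lemma omega_sqr n (u : 'cV[R]_n) : omega u ^+ 2 = 1 + dot u u.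
Proof. by rewrite sqr_sqrtr//; have := dot_ge0 u; lra. Qed.

Lemma cont_omega n (T : topologicalType) (u : T -> 'cV[R]_n) : continuous u ->
  continuous (fun t => omega (u t)).
Proof. by move=> cu; apply: cont_sqrt; apply: cont_add; [exact: cont_cst|exact: cont_dot]. Qed.

Definition axis_boost n (m0 m : R) (u : 'cV[R]_n.+1) : 'cV[R]_n.+1 :=
  consv (m0 * u 0 0 + m * omega u) (tailv u).

Lemma cont_axis_boost n m0 m : continuous (@axis_boost n m0 m).
Proof.
apply: cont_consv; last exact: cont_tailv.
apply: cont_add; apply: cont_mul; try exact: cont_cst; first exact: coord_continuous.
by apply: cont_omega; exact: cont_id.
Qed.

(** Along the boosted axis the map [F] has derivative [o (F x) / o x], because the new time
    coordinate is [m0 * o x + m * x]. Hence the measure [dx / o x] is invariant. *)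
Lemma gint_axis_boost n (m0 m : R) (f : 'cV[R]_n.+1 -> R) : cge0 f -> 0 < m0 -> m0 ^+ 2 = 1 + m ^+ 2 ->
  gint (fun u => f (axis_boost m0 m u) / omega u) = gint (fun u => f u / omega u).
Proof.
move=> [cf f0] m0p m01.
have co n' : continuous (fun u : 'cV[R]_n' => (omega u)^-1).
  by apply: cont_inv => [u|]; [rewrite gt_eqF// omega_gt0|apply: cont_omega; exact: cont_id].
have o0 n' (u : 'cV[R]_n') : 0 <= (omega u)^-1 by rewrite invr_ge0 ltW// omega_gt0.
apply: gint_ext2.
- split=> [|u]; last exact: mulr_ge0.
  apply: cont_mul; last exact: co.
  have h := @cont_axis_boost n m0 m; exact: (cont_comp h cf).
- by split=> [|u]; [apply: cont_mul; [exact: cf|exact: co]|exact: mulr_ge0].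
move=> w; pose o (x : R) := omega (consv x w).
have oE x : o x = Num.sqrt (1 + (x * x + dot w w)) by rewrite /o /omega dot_consv.
have op x : 0 < o x := omega_gt0 _.
have osq x : o x ^+ 2 = 1 + (x * x + dot w w) by rewrite /o omega_sqr dot_consv.
have dw := dot_ge0 w.
pose F (x : R) := m0 * x + m * o x; pose F' (x : R) := m0 + m * (x / o x).
have mlt : `|m| < m0.
  have : `|m| ^+ 2 < m0 ^+ 2 by rewrite -normrX ger0_norm ?sqr_ge0//; lra.
  by rewrite ltr_pXn2r ?nnegrE// ltW.
have do_ (x : R) : is_derive x 1 o (x / o x).
  have -> : o = (fun x => Num.sqrt (1 + (x * x + dot w w))) by apply/funext => z; rewrite oE.
  have p : 0 < 1 + (x * x + dot w w) by have := sqr_ge0 x; rewrite expr2; lra.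
  have ds := is_derive1_sqrt p.
  have d2 : is_derive x 1 (fun x : R => 1 + (x * x + dot w w)) (2 * x).
    by apply: is_derive_eq; rewrite /GRing.scale /=; ring.
  have d3 := @is_derive1_comp _ (@Num.sqrt R) (fun x : R => 1 + (x * x + dot w w)) x _ _ ds d2.
  apply: (is_derive_eq d3); field.
  by rewrite gt_eqF// sqrtr_gt0.
have dF (x : R) : is_derive x 1 F (F' x).
  by have := do_ x => ?; apply: is_derive_eq; rewrite /GRing.scale /F' /=; ring.
have co' : continuous o := is_derive_continuous do_.
have cF' : continuous F'.
  apply: cont_add; first exact: cont_cst.
  apply: cont_mul; first exact: cont_cst.
  apply: cont_mul; first exact: cont_id.
  by apply: cont_inv => // x; rewrite gt_eqF.
have xo x : `|x| <= o x.
  have : `|x| ^+ 2 <= o x ^+ 2 by rewrite osq -normrX ger0_norm ?sqr_ge0// expr2; lra.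
  by rewrite ler_pXn2r ?nnegrE// ltW.
have mo x : 0 < m0 * o x + m * x.
  have : `|m * x| <= `|m| * o x by rewrite normrM ler_wpM2l.
  have : `|m| * o x < m0 * o x by rewrite ltr_pM2r.
  rewrite ler_norml => h1 /andP[h2 h3]; lra.
have F'E x : F' x = (m0 * o x + m * x) / o x by rewrite /F'; field; rewrite gt_eqF.
have F'0 x : 0 < F' x by rewrite F'E divr_gt0.
have oF x : o (F x) = m0 * o x + m * x.
  apply: (@pexpIrn _ 2); rewrite ?nnegrE ?ltW//.
  rewrite osq /F; have := osq x; move: (o x) => z hz.
  have -> : (m0 * z + m * x) ^+ 2 = (1 + m ^+ 2) * z ^+ 2 + 2 * m0 * m * x * z + m ^+ 2 * x ^+ 2 by rewrite -m01; ring.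
  have -> : 1 + ((m0 * x + m * z) * (m0 * x + m * z) + dot w w) =
     1 + ((1 + m ^+ 2) * x ^+ 2 + 2 * m0 * m * x * z + m ^+ 2 * z ^+ 2 + dot w w) by rewrite -m01; ring.
  have -> : dot w w = z ^+ 2 - 1 - x * x by lra.
  ring.
pose G x := f (consv x w) / o x.
have cG : continuous G.
  by apply: cont_mul; [exact: cont_consv1|apply: cont_inv => // x; rewrite gt_eqF].
have oub x : o x <= o 0 + `|x|.
  have : o x ^+ 2 <= (o 0 + `|x|) ^+ 2.
    rewrite sqrrD !osq -normrX (ger0_norm (sqr_ge0 x)).
    have : 0 <= o 0 * `|x| by rewrite mulr_ge0// ltW.
    rewrite expr2; lra.
  by rewrite ler_pXn2r ?nnegrE ?addr_ge0// ltW.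
(* Since [|m| < m0], the perturbation of [m0 * x] is too small to prevent [F] from tending to both
   infinities. *)
have Fb x : `|F x - m0 * x| <= `|m| * o 0 + `|m| * `|x|.
  by rewrite /F addrC addKr normrM (gtr0_norm (op x)) -mulrDr ler_wpM2l.
rewrite -[RHS](@ge0_integral_substT _ F F' G)//.
- apply: eq_integral => x _; congr EFin.
  rewrite /G F'E oF /axis_boost tailvK consv0 -/(o x) -/(F x); field.
  by rewrite !gt_eqF.
- apply/cvgrNyPle => A; near=> x.
  have x0 : x <= 0 by near: x; exact: nbhs_ninfty_le (num_real _).
  have : x <= (A - `|m| * o 0) / (m0 - `|m|) by near: x; exact: nbhs_ninfty_le (num_real _).
  rewrite ler_pdivlMr ?subr_gt0// => h.
  have := Fb x; rewrite (ler0_norm x0) ler_norml => /andP[_ h2]; lra.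
- apply/cvgryPge => A; near=> x.
  have x0 : 0 <= x by near: x; exact: nbhs_pinfty_ge (num_real _).
  have : (A + `|m| * o 0) / (m0 - `|m|) <= x by near: x; exact: nbhs_pinfty_ge (num_real _).
  rewrite ler_pdivrMr ?subr_gt0// => h.
  have := Fb x; rewrite (ger0_norm x0) ler_norml => /andP[h2 _]; lra.
- by move=> x; rewrite divr_ge0// ltW.
Unshelve. all: end_near. Qed.

End BoostInvariance.

(** * Hyperbolic volume in charts and normalization of the density *)

Section HyperbolicChange.
Context {R : realType} {n : nat}.
Local Notation d := n.+1.
Local Notation E := 'cV[R]_(1 + d).

Definition lift (u : 'cV[R]_d) : E := col_mx (omega u)%:M u.

Lemma lift_hyp u : hyperboloid (lift u).
Proof.
rewrite /hyperboloid /= /lform /lift time_col_mx col_mxKd mxE eqxx mulr1n; split; last exact: omega_gt0.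
by rewrite -expr2 omega_sqr; ring.
Qed.

Lemma liftK x : hyperboloid x -> lift (dsubmx x) = x.
Proof.
move=> hx; apply: eqE; last by rewrite /lift col_mxKd.
rewrite /lift time_col_mx mxE eqxx mulr1n /omega -(hyp_time hx) sqrtr_sqr ger0_norm//.
exact: ltW (hyp_gt0 hx).
Qed.

Lemma cont_lift : continuous lift.
Proof.
apply: continuous_mx => i j; rewrite (ord1 j) -(@splitK 1 d i); case: (fintype.split i) => k /=.
  under eq_fun do rewrite /lift (@col_mxEu R 1 d 1) (ord1 k) mxE eqxx mulr1n.
  by apply: cont_omega; exact: cont_id.
by under eq_fun do rewrite /lift (@col_mxEd R 1 d 1); exact: coord_continuous.
Qed.

(** The Lorentz boost moving the origin to [mu], read on space parts: the point [lift u] is sent to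
    [lift (bst mu u)]. *)
Definition bst (mu : E) (u : 'cV[R]_d) : 'cV[R]_d :=
  omega u *: dsubmx mu + u + (dot (dsubmx mu) u / (1 + mu 0 0)) *: dsubmx mu.

Lemma cont_bst mu : continuous (bst mu).
Proof.
apply: cont_addv; first apply: cont_addv.
- by apply: cont_scale; [exact: (cont_omega (@cont_id _))|exact: cont_cstT].
- exact: cont_id.
- apply: cont_scale; last by exact: cont_cstT.
  apply: cont_mul; last exact: cont_cst.
  by apply: cont_dot; [exact: cont_cstT|exact: cont_id].
Qed.

(** A Householder reflection turns the space part of [mu] onto the first axis. It preserves [omega]
    and has determinant of modulus 1, so the axis case suffices. *)
Lemma gint_bst mu (f : 'cV[R]_d -> R) : hyperboloid mu -> cge0 f ->
  gint (fun u => f (bst mu u) / omega u) = gint (fun u => f u / omega u).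
Proof.
move=> hmu [cf f0]; pose m' := dsubmx mu; pose m := enorm m'.
have m0p := hyp_gt0 hmu.
have m0 : mu 0 0 ^+ 2 = 1 + m ^+ 2 by rewrite sqr_enorm (hyp_time hmu).
pose w1 : 'cV[R]_d := consv m 0.
have ew : dot m' m' = dot w1 w1 by rewrite dot_consv dot0l addr0 -expr2 sqr_enorm.
have [H [sH HH Hm]] := householder ew.
have dH u : dot (H *m u) (H *m u) = dot u u by rewrite dot_mulmxr mulmxA sH HH mul1mx.
have oH u : omega (H *m u) = omega u by rewrite /omega dH.
have bE u : H *m bst mu u = axis_boost (mu 0 0) m (H *m u).
  rewrite /bst !mulmxDr -!scalemxAr Hm.
  have -> : dot (dsubmx mu) u = m * (H *m u) 0 0.
    have -> : dsubmx mu = H *m w1 by rewrite -Hm mulmxA HH mul1mx.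
    rewrite -[in LHS]sH -dot_mulmxr /w1.
    have [x [v ->]] := consv_ex (H *m u).
    by rewrite dot_consv dot0l addr0 consv0.
  rewrite /axis_boost oH; have [x [v ->]] := consv_ex (H *m u).
  rewrite tailvK consv0 /w1 !consvZ !consvD !scaler0 addr0 add0r; congr consv.
  have -> : m * x / (1 + mu 0 0) * m = x * (m ^+ 2) / (1 + mu 0 0) by ring.
  have -> : m ^+ 2 = mu 0 0 ^+ 2 - 1 by lra.
  by field; rewrite gt_eqF//; lra.
have uH : H \in unitmx by case/mulmx1_unit : HH.
have nH : `|\det H| = 1.
  have := congr1 determinant HH; rewrite det_mulmx det1 => h.
  have : `|\det H| ^+ 2 = 1 ^+ 2 by rewrite expr1n -normrX expr2 h normr1.
  by move/(pexpIrn (isT : (0 < 2)%N)); apply; rewrite nnegrE.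
have co : continuous (fun u : 'cV[R]_d => (omega u)^-1).
  by apply: cont_inv => [u|]; [rewrite gt_eqF// omega_gt0|apply: cont_omega; exact: cont_id].
have o0 (u : 'cV[R]_d) : 0 <= (omega u)^-1 by rewrite invr_ge0 ltW// omega_gt0.
have cfH : continuous (fun v => f (H *m v)).
  by apply: (@cont_comp _ _ _ (fun v => H *m v)) => //; apply: cont_mulmx; exact: cont_id.
have hg1 : cge0 (fun y => f (H *m axis_boost (mu 0 0) m y) / omega y).
  by split=> [|u]; [apply: cont_mul => //; exact: (cont_comp (@cont_axis_boost _ n (mu 0 0) m) cfH)|rewrite mulr_ge0].
have hg2 : cge0 (fun u => f u / omega u) by split=> [|u]; [exact: cont_mul|rewrite mulr_ge0].
transitivity (gint (fun u => `|\det H| * (f (H *m axis_boost (mu 0 0) m (H *m u)) / omega (H *m u)))).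
  by apply: eq_gint => u; rewrite nH mul1r oH -bE mulmxA HH mul1mx.
rewrite (lin_changeP uH hg1) (@gint_axis_boost _ _ _ _ (fun v => f (H *m v)))//.
rewrite -[RHS](lin_changeP uH hg2); apply: eq_gint => u.
by rewrite nH mul1r oH.
Qed.

(** The wrapped exponential at [mu] is the one at the origin, which is radial, followed by the boost
    to [mu]. *)
Lemma wexp_lift mu v : hyperboloid mu -> wexp mu v = lift (bst mu (sinhc (enorm v) *: v)).
Proof.
move=> hmu; rewrite -[LHS]liftK; last exact: wexp_hyp.
congr lift; rewrite wexpE// PT_embed// /bst.
have -> : omega (sinhc (enorm v) *: v) = cosh (enorm v).
  rewrite /omega dotZl dotZr -sqr_enorm mulrA -expr2 -exprMn sinhcE -cosh2_sinh2 sqrtr_sqr.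
  by rewrite ger0_norm// ltW// cosh_gt0.
rewrite spaceD !spaceZ !spaceD !spaceZ /embed /origin !col_mxKd spaceD col_mxKd add0r scalerDr scalerA addrA.
by rewrite dotZr mulrA.
Qed.

(* The Riemannian volume is the image of the Lebesgue measure [sinhc |v| ^ (d - 1) dv] under
   every wrapped exponential chart, and of [du / omega u] under the projection chart. *)
Lemma gint_wexp mu (M : E -> R) : hyperboloid mu -> (forall x, 0 <= M x) ->
  continuous (fun u => M (lift u)) ->
  gint (fun v => M (wexp mu v) * sinhc (enorm v) ^+ n) = gint (fun u => M (lift u) / omega u).
Proof.
move=> hmu M0 cM.
have co : continuous (fun u : 'cV[R]_d => (omega u)^-1).
  by apply: cont_inv => [u|]; [rewrite gt_eqF// omega_gt0|apply: cont_omega; exact: cont_id].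
have o0 (u : 'cV[R]_d) : 0 <= (omega u)^-1 by rewrite invr_ge0 ltW// omega_gt0.
rewrite -(gint_bst hmu (f := fun u => M (lift u)))//.
rewrite -(gint_radial (f := fun u => M (lift (bst mu u)) / omega u)); last first.
  by split=> [|u]; [apply: cont_mul => //; exact: (cont_comp (@cont_bst mu) cM)|rewrite mulr_ge0].
apply: eq_gint => v; rewrite wexp_lift//.
have -> : omega (sinhc (enorm v) *: v) = cosh (enorm v).
  rewrite /omega dotZl dotZr -sqr_enorm mulrA -expr2 -exprMn sinhcE -cosh2_sinh2 sqrtr_sqr.
  by rewrite ger0_norm// ltW// cosh_gt0.
by field; rewrite gt_eqF// cosh_gt0.
Qed.

Lemma cont_lform (T : topologicalType) (x : E) (u : T -> E) : continuous u -> continuous (fun t => lform x (u t)).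
Proof.
move=> cu; apply: cont_add; last first.
  apply: cont_dot; first by exact: cont_cstT.
  apply: continuous_mx => i j; under eq_fun do rewrite mxE; rewrite (ord1 j).
  exact: cont_coord.
by apply: cont_opp; apply: cont_mul; [exact: cont_cst|exact: cont_coord].
Qed.

Lemma cont_boost (T : topologicalType) (mu : E) (u : T -> E) : continuous u -> continuous (fun t => boost mu (u t)).
Proof.
move=> cu; apply: continuous_mx => i j; rewrite (ord1 j).
have -> : (fun t => boost mu (u t) i 0) =
  (fun t => u t (rshift 1 i) 0 - (u t 0 0 - lform mu (u t)) / (1 + mu 0 0) * dsubmx mu i 0).
  by apply/funext => t; rewrite !mxE.
apply: cont_add; first exact: cont_coord.
apply: cont_opp; apply: cont_mul; last exact: cont_cst.
apply: cont_mul; last exact: cont_cst.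
by apply: cont_add; [exact: cont_coord|apply: cont_opp; exact: cont_lform].
Qed.

Lemma cont_logdens_hyp (T : topologicalType) (mu : E) S (u : T -> E) : hyperboloid mu ->
  (forall t, hyperboloid (u t)) -> continuous u -> continuous (fun t => logdens mu S (u t)).
Proof.
move=> hmu hu cu.
have -> : (fun t => logdens mu S (u t)) = (fun t => - 2^-1 * ln (\det S)
   - 2^-1 * (Fc (Num.max 1 (- lform mu (u t))) ^+ 2 * qform (invmx S) (boost mu (u t)))
   + d.-1%:R * ln (Fc (Num.max 1 (- lform mu (u t))))).
  apply/funext => t; rewrite logdensE//.
  by have /max_idPr -> := hyp_lform_ge1 hmu (hu t).
have cF : continuous (fun t => Fc (Num.max 1 (- lform mu (u t)))).
  by apply: (cont_comp _ continuous_Fcmax); apply: cont_opp; exact: cont_lform.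
have cb := @cont_boost _ mu _ cu.
apply: cont_add; last first.
  apply: cont_mul; first exact: cont_cst.
  move=> t; apply: (@continuous_comp _ _ _ (fun t => Fc (Num.max 1 (- lform mu (u t)))) (@ln R) t); first exact: cF.
  by apply: continuous_ln; rewrite Fc_gt0// le_max lexx.
apply: cont_add; first exact: cont_cst.
apply: cont_opp; apply: cont_mul; first exact: cont_cst.
apply: cont_mul; first exact: cont_pow.
have := cont_dot cb (@cont_mulmx _ _ _ _ (invmx S) _ cb); exact.
Qed.

(** The volume factor of the wrapped chart cancels the [phi] term of the log-density and leaves an
    ordinary Gaussian density in [v]. *)
Lemma expR_logdens_wexp mu (S : 'M[R]_d) (v : 'cV[R]_d) : hyperboloid mu -> 0 < \det S ->
  expR (logdens mu S (wexp mu v)) * sinhc (enorm v) ^+ n =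
  (Num.sqrt (\det S))^-1 * expR (- (qform (invmx S) v / 2)).
Proof.
move=> hmu dS; rewrite /logdens Tmap_wexp//.
have s0 := sinhc_gt0 (enorm_ge0 v).
have -> : phi v = ln (sinhc (enorm v)).
  by rewrite /phi /sinhc enorm_eq0; case: ifP; rewrite // ln1.
set D := \det S; set c := enorm v in s0 *.
have sD : 0 < Num.sqrt D by rewrite sqrtr_gt0.
have e1 : expR (- 2^-1 * ln D) = (Num.sqrt D)^-1.
  have -> : ln D = ln (Num.sqrt D) + ln (Num.sqrt D).
    by rewrite -lnM ?posrE// -expr2 sqr_sqrtr// ltW.
  have -> : - 2^-1 * (ln (Num.sqrt D) + ln (Num.sqrt D)) = - ln (Num.sqrt D) by field.
  by rewrite expRN lnK// posrE.
have e3 : expR (- (d.-1%:R * ln (sinhc c))) * sinhc c ^+ n = 1.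
  rewrite -mulrN expRM_natl expRN lnK ?posrE// -exprMn mulVf ?gt_eqF// expr1n//.
have -> : - 2^-1 * ln D - 2^-1 * qform (invmx S) v - d.-1%:R * ln (sinhc c) =
  - 2^-1 * ln D + (- (qform (invmx S) v / 2) + - (d.-1%:R * ln (sinhc c))) by field.
by rewrite expRD e1 expRD -!mulrA e3 mulr1.
Qed.

Lemma cont_wexp mu : hyperboloid mu -> continuous (fun v : 'cV[R]_d => bst mu (sinhc (enorm v) *: v)).
Proof.
move=> hmu; have h : continuous (fun v : 'cV[R]_d => sinhc (enorm v) *: v).
  by apply: cont_scale; [apply: cont_sinhc_enorm; exact: cont_id|exact: cont_id].
exact: (cont_compT h (@cont_bst mu)).
Qed.

Lemma hwn_vecE mu S t : hwn_vec mu S t = wexp mu (sqrtmx S *m vecof t) :> E.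
Proof. by []. Qed.

(** Identifies [expR (logdens mu S)] as a density with respect to [du / omega u]: the wrapped chart
    is pulled back by the square root of [S], after which the quadratic form cancels the weight of
    [gint]. *)
Lemma integral_hwn mu (S : 'M[R]_d) (g : E -> R) : hyperboloid mu -> spd S -> (forall x, 0 <= g x) ->
  continuous (fun u => g (lift u)) ->
  (\int[stdgauss d]_t (g (hwn_vec mu S t))%:E)%E =
  gint (fun u => g (lift u) * expR (logdens mu S (lift u)) / omega u).
Proof.
move=> hmu hS g0 cg.
have [sS _] := hS.
have pS : psd S.
  split=> // v; have [->|v0] := eqVneq v 0; first by rewrite /qform dot0l.
  by apply: ltW; apply hS.
have [[sA _] AA] := sqrtmxP pS; set A := sqrtmx S in sA AA *.
have uS := spd_unitmx hS.
have dAA : \det A ^+ 2 = \det S by rewrite expr2 -det_mulmx AA.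
have dS : 0 < \det S by rewrite -dAA exprn_even_gt0//= -sqrf_eq0 dAA -unitfE -unitmxE.
have uA : A \in unitmx by rewrite unitmxE unitfE -sqrf_eq0 dAA gt_eqF.
have nA : `|\det A| = Num.sqrt (\det S) by rewrite -dAA sqrtr_sqr.
have nA0 : 0 < `|\det A| by rewrite nA sqrtr_gt0.
have cl : continuous (fun u => expR (logdens mu S (lift u))).
  by apply: cont_exp; apply: cont_logdens_hyp => //; [exact: lift_hyp|exact: cont_lift].
rewrite -(gint_wexp (M := fun x => g x * expR (logdens mu S x)) hmu); last 2 first.
- by move=> x; rewrite mulr_ge0// expR_ge0.
- exact: cont_mul.
pose f v := g (wexp mu v) * (`|\det A|^-1 * expR (- (qform (invmx S) v / 2))).
transitivity (gint f); last first.
  by apply: eq_gint => v; rewrite /f nA -(expR_logdens_wexp v hmu dS) mulrA.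
have hf : cge0 f.
  split=> [|v]; last by rewrite !mulr_ge0 ?expR_ge0// invr_ge0 ltW.
  apply: cont_mul.
    have -> : (fun v => g (wexp mu v)) = (fun v => g (lift (bst mu (sinhc (enorm v) *: v)))).
      by apply/funext => v; rewrite wexp_lift.
    exact: (cont_comp (cont_wexp hmu) cg).
  apply: cont_mul; first exact: cont_cst.
  apply: cont_exp; apply: cont_opp; apply: cont_mul; last exact: cont_cst.
  by apply: cont_dot; [exact: cont_id|apply: cont_mulmx; exact: cont_id].
rewrite -(lin_changeP uA hf); apply: eq_integral => t _; congr EFin; rewrite hwn_vecE -/A /f.
have -> : qform (invmx S) (A *m vecof t) = dot (vecof t) (vecof t).
  rewrite /qform dotC dot_mulmxr sA dotC mulmxA -{1}AA.
  have -> : A *m invmx (A *m A) *m (A *m vecof t) = vecof t; last by [].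
  have -> : A *m vecof t = (A *m A) *m (invmx A *m vecof t).
    by rewrite mulmxA -[A *m A *m invmx A]mulmxA mulmxV// mulmx1.
  by rewrite -mulmxA (mulmxA (invmx _)) mulVmx ?AA// mul1mx mulmxA mulmxV// mul1mx.
rewrite expRN; field; rewrite !gt_eqF// expR_gt0//.
Qed.

Lemma integral_density mu (S : 'M[R]_d) : hyperboloid mu -> spd S ->
  gint (fun u => expR (logdens mu S (lift u)) / omega u) = 1%E.
Proof.
move=> hmu hS; rewrite -[LHS](_ : gint (fun u => 1 * expR (logdens mu S (lift u)) / omega u) = _); last first.
  by apply: eq_gint => u; rewrite mul1r.
rewrite -(integral_hwn (g := fun=> 1))//; last exact: cont_cst.
by rewrite integral_cst// mul1e; exact: probability_setT.
Qed.

(** The reference measure does not depend on the parameter, so the density at [(mu0, S0)] cancels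
    and that at [(mu, S)] integrates to 1. *)
Theorem integral_likelihood_ratio mu0 (S0 : 'M[R]_d) mu S : hyperboloid mu0 -> spd S0 -> hyperboloid mu -> spd S ->
  (\int[stdgauss d]_t (expR (logdens mu S (hwn_vec mu0 S0 t) - logdens mu0 S0 (hwn_vec mu0 S0 t)))%:E = 1)%E.
Proof.
move=> h0 hS0 h hS.
have cl m (T : 'M[R]_d) : hyperboloid m -> continuous (fun u => logdens m T (lift u)).
  by move=> hm; apply: cont_logdens_hyp => //; [exact: lift_hyp|exact: cont_lift].
rewrite (integral_hwn (g := fun x => expR (logdens mu S x - logdens mu0 S0 x)))//.
- rewrite -[RHS](integral_density h hS); apply: eq_gint => u.
  by rewrite -expRD subrK.
- by apply: cont_exp; apply: cont_add; [exact: cl|apply: cont_opp; exact: cl].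
Qed.

End HyperbolicChange.

(** * Expectations and independence *)

Section Expectation.
Context {R : realType} {dd : measure_display} {T : measurableType dd}.
Variable P : probability T R.
Implicit Types f g : T -> R.

Definition L1 f := P.-integrable setT (EFin \o f).
Definition Ex f : R := fine (\int[P]_x (f x)%:E)%E.
Definition Pr (A : set T) : R := fine (P A).

Lemma L1_meas f : L1 f -> measurable_fun setT f.
Proof. by move=> /measurable_int /measurable_EFinP. Qed.

Lemma L1_le f g : measurable_fun setT f -> L1 g -> (forall x, `|f x| <= g x) -> L1 f.
Proof.
move=> mf Lg fg; apply: le_integrable Lg => //; first exact/measurable_EFinP.
by move=> x _; rewrite /= lee_fin (le_trans (fg x))// ler_norm.
Qed.

Lemma L1_cst c : L1 (fun=> c).
Proof. exact: finite_measure_integrable_cst. Qed.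

Lemma L1_bounded f M : measurable_fun setT f -> (forall x, `|f x| <= M) -> L1 f.
Proof. by move=> mf; apply: L1_le => //; exact: L1_cst. Qed.

Lemma L1D f g : L1 f -> L1 g -> L1 (fun x => f x + g x).
Proof. by move=> Lf Lg; have := integrableD measurableT Lf Lg. Qed.

Lemma L1Z c f : L1 f -> L1 (fun x => c * f x).
Proof. by move=> Lf; have := integrableZl measurableT c Lf. Qed.

Lemma L1N f : L1 f -> L1 (fun x => - f x).
Proof. by move=> Lf; have := integrableN Lf. Qed.

Lemma L1B f g : L1 f -> L1 g -> L1 (fun x => f x - g x).
Proof. by move=> Lf Lg; apply: L1D => //; exact: L1N. Qed.

Lemma L1_norm f : L1 f -> L1 (fun x => `|f x|).
Proof. by move=> Lf; have := integrable_abse Lf. Qed.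

Lemma L1_sum (I : Type) (s : seq I) (F : I -> T -> R) : (forall i, L1 (F i)) ->
  L1 (fun x => \sum_(i <- s) F i x).
Proof.
move=> LF; elim: s => [|i s IH].
  by under eq_fun do rewrite big_nil; exact: L1_cst.
by under eq_fun do rewrite big_cons; exact: L1D.
Qed.

Lemma EFin_Ex f : L1 f -> (Ex f)%:E = (\int[P]_x (f x)%:E)%E.
Proof. by move=> Lf; rewrite /Ex fineK//; exact: integrable_fin_num. Qed.

Lemma ExD f g : L1 f -> L1 g -> Ex (fun x => f x + g x) = Ex f + Ex g.
Proof. by move=> Lf Lg; exact: RintegralD. Qed.

Lemma ExZ c f : L1 f -> Ex (fun x => c * f x) = c * Ex f.
Proof. by move=> Lf; exact: RintegralZl. Qed.

Lemma ExB f g : L1 f -> L1 g -> Ex (fun x => f x - g x) = Ex f - Ex g.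
Proof. by move=> Lf Lg; exact: RintegralB. Qed.

Lemma ExN f : L1 f -> Ex (fun x => - f x) = - Ex f.
Proof.
move=> Lf; rewrite -mulN1r -ExZ//; congr Ex; apply/funext => x; by rewrite mulN1r.
Qed.

Lemma Ex_cst c : Ex (fun=> c) = c.
Proof. by rewrite /Ex integral_cst//= probability_setT mule1. Qed.

Lemma Ex_sum (I : Type) (s : seq I) (F : I -> T -> R) : (forall i, L1 (F i)) ->
  Ex (fun x => \sum_(i <- s) F i x) = \sum_(i <- s) Ex (F i).
Proof.
move=> LF; elim: s => [|i s IH].
  by under eq_fun do rewrite big_nil; rewrite big_nil Ex_cst.
under eq_fun do rewrite big_cons; rewrite big_cons ExD// ?IH//.
exact: L1_sum.
Qed.

Lemma Ex_le f g : L1 f -> L1 g -> (forall x, f x <= g x) -> Ex f <= Ex g.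
Proof. by move=> Lf Lg fg; apply: le_Rintegral. Qed.

Lemma Ex_ge0 f : (forall x, 0 <= f x) -> 0 <= Ex f.
Proof. by move=> f0; apply: Rintegral_ge0. Qed.

Lemma Ex_abs f : L1 f -> `|Ex f| <= Ex (fun x => `|f x|).
Proof. by move=> Lf; exact: le_normr_Rintegral. Qed.

Lemma Ex_abs_le f g : measurable_fun setT f -> L1 g -> (forall x, `|f x| <= g x) -> `|Ex f| <= Ex g.
Proof.
move=> mf Lg fg; have Lf := L1_le mf Lg fg.
by apply: le_trans (Ex_abs Lf) _; apply: Ex_le => //; exact: L1_norm.
Qed.

Lemma Ex_bounded f M : measurable_fun setT f -> (forall x, `|f x| <= M) -> `|Ex f| <= M.
Proof. by move=> mf fM; rewrite -[leRHS]Ex_cst; apply: Ex_abs_le => //; exact: L1_cst. Qed.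

Lemma Pr_ge0 A : 0 <= Pr A.
Proof. by rewrite fine_ge0. Qed.

Lemma EFin_Pr A : measurable A -> (Pr A)%:E = P A.
Proof. by move=> mA; rewrite /Pr fineK// fin_num_measure. Qed.

Lemma Pr_le A B : measurable A -> measurable B -> A `<=` B -> Pr A <= Pr B.
Proof. by move=> mA mB AB; rewrite -lee_fin !EFin_Pr// le_measure// inE. Qed.

Lemma PrU A B : measurable A -> measurable B -> Pr (A `|` B) <= Pr A + Pr B.
Proof.
move=> mA mB; rewrite -lee_fin EFinD !EFin_Pr//; first exact: measureU2.
exact: measurableU.
Qed.

Lemma Ex_indic A : measurable A -> Ex \1_A = Pr A.
Proof. by move=> mA; rewrite /Ex integral_indic// setIT. Qed.

Lemma markov_ge f c : L1 f -> (forall x, 0 <= f x) -> 0 < c -> Pr [set x | c <= f x] <= Ex f / c.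
Proof.
move=> Lf f0 c0; have mf := L1_meas Lf.
have mA : measurable [set x | c <= f x].
  have -> : [set x | c <= f x] = f @^-1` `[c, +oo[%classic.
    by apply/seteqP; split=> x /=; rewrite in_itv/= andbT.
  by rewrite -[X in measurable X]setTI; exact: mf.
rewrite ler_pdivlMr// -Ex_indic// mulrC -ExZ; last first.
  by apply: (@L1_bounded _ 1) => // x; rewrite indicE; case: (_ \in _); rewrite /= ?normr0 ?normr1.
apply: Ex_le => // [|x].
  apply: L1Z; apply: (@L1_bounded _ 1) => // x; rewrite indicE.
  by case: (_ \in _); rewrite /= ?normr0 ?normr1.
rewrite indicE; case: (boolP (_ \in _)) => [|_]; last by rewrite mulr0.
by rewrite inE /= mulr1.
Qed.

Lemma Ex_dominated (F : nat -> T -> R) f g : (forall n, measurable_fun setT (F n)) ->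
  measurable_fun setT f -> L1 g -> (forall x, F n x @[n --> \oo] --> f x) -> (forall n x, `|F n x| <= g x) ->
  Ex (F n) @[n --> \oo] --> Ex f.
Proof.
move=> mF mf Lg cF dom.
have fg x : `|f x| <= g x.
  have h : `|F n x| @[n --> \oo] --> `|f x| by apply: cvg_norm; exact: cF.
  rewrite -(cvg_lim _ h)//; apply: limr_le; first by apply: cvgP h.
  by near=> n.
have Lf := L1_le mf Lg fg.
have h : ((\int[P]_x (F n x)%:E)%E @[n --> \oo] --> (Ex f)%:E)%classic.
  rewrite EFin_Ex//; apply: (@dominated_cvg _ _ _ P setT measurableT _ (EFin \o f) (EFin \o g)) => //.
  - by move=> n; apply/measurable_EFinP.
  - by move=> x _; apply: cvg_EFin; [near=> n|exact: cF].
  - by move=> n x _; rewrite /= lee_fin.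
exact: fine_cvg h.
Unshelve. all: end_near. Qed.

Lemma Ex_eq0_ae f : L1 f -> (forall x, 0 <= f x) -> Ex f = 0 -> P [set x | 0 < f x] = 0%E.
Proof.
move=> Lf f0 e; have mf := L1_meas Lf.
have : (\int[P]_(x in setT) `|(f x)%:E| = 0)%E.
  under eq_integral do rewrite gee0_abs ?lee_fin//.
  by rewrite -EFin_Ex// e.
move/(ae_eq_integral_abs _ measurableT _).1 => [|N [mN N0 sN]]; first exact/measurable_EFinP.
have mA : measurable [set x | 0 < f x].
  have -> : [set x | 0 < f x] = f @^-1` `]0, +oo[%classic.
    by apply/seteqP; split=> x /=; rewrite in_itv/= andbT.
  by rewrite -[X in measurable X]setTI; exact: mf.
apply/eqP; rewrite eq_le measure_ge0 andbT -N0 le_measure ?inE// => x /= fx.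
apply: sN => /= /(_ I) [] h; by rewrite h ltxx in fx.
Qed.

End Expectation.

Section Transfer.
Context {R : realType} {d1 d2 : measure_display} {T1 : measurableType d1} {T2 : measurableType d2}.
Variables (P : probability T1 R) (Q : probability T2 R) (U : T1 -> T2).
Hypothesis mU : measurable_fun setT U.
Hypothesis lawU : forall A, measurable A -> P (U @^-1` A) = Q A.

Lemma ge0_transfer (f : T2 -> \bar R) : measurable_fun setT f -> (forall x, 0 <= f x)%E ->
  (\int[P]_x f (U x) = \int[Q]_y f y)%E.
Proof.
move=> mf f0; transitivity (\int[pushforward P U]_y f y)%E.
  by rewrite ge0_integral_pushforward.
by apply: eq_measure_integral => // A mA _; exact: lawU.
Qed.

Lemma L1_transfer (f : T2 -> R) : L1 Q f -> L1 P (fun x => f (U x)).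
Proof.
move=> Lf; have mf := L1_meas Lf.
have mfU : measurable_fun setT (fun x => f (U x)) by exact: (measurableT_comp mf).
have /integrableP[_ h] := Lf.
apply/integrableP; split; first exact/measurable_EFinP.
rewrite (ge0_transfer (f := fun y => `|(f y)%:E|%E))//.
by apply: measurableT_comp => //; exact/measurable_EFinP.
Qed.

Lemma Ex_transfer (f : T2 -> R) : L1 Q f -> Ex P (fun x => f (U x)) = Ex Q f.
Proof.
move=> Lf; have mf := L1_meas Lf.
transitivity (fine (\int[pushforward P U]_y (EFin \o f) y)%E); last first.
  by rewrite /Ex; congr fine; apply: eq_measure_integral => // A mA _; exact: lawU.
rewrite (integral_pushforward mU)//; first exact/measurable_EFinP.
exact: L1_transfer.
Qed.

End Transfer.

Section PairLaw.
Context {R : realType} {d d1 d2 : measure_display} {T : measurableType d}.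
Context {T1 : measurableType d1} {T2 : measurableType d2}.
Variables (P : probability T R) (Q1 : probability T1 R) (Q2 : probability T2 R).
Variables (U : T -> T1) (W : T -> T2).
Hypothesis mU : measurable_fun setT U.
Hypothesis mW : measurable_fun setT W.
Hypothesis indep : forall A B, measurable A -> measurable B ->
  P (U @^-1` A `&` W @^-1` B) = (Q1 A * Q2 B)%E.

Lemma pair_law A : measurable A -> P ((fun x => (U x, W x)) @^-1` A) = (Q1 \x Q2)%E A.
Proof.
move=> mA; have mUW : measurable_fun setT (fun x => (U x, W x)) by exact: measurable_fun_pair.
rewrite (@product_measure_unique _ _ _ _ _ Q1 Q2 (pushforward P (fun x => (U x, W x))))// => B C mB mC.
Qed.

Lemma Ex_pair_bounded (f : T1 * T2 -> R) M : measurable_fun setT f -> (forall z, `|f z| <= M) ->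
  Ex P (fun x => f (U x, W x)) = Ex Q1 (fun u => Ex Q2 (fun w => f (u, w))).
Proof.
move=> mf fM; have mUW : measurable_fun setT (fun x => (U x, W x)) by exact: measurable_fun_pair.
have Lf : L1 (Q1 \x Q2)%E f by apply: L1_bounded fM.
rewrite (Ex_transfer mUW pair_law Lf).
have h := integral12_prod_meas1 Lf.
rewrite /Ex -h; congr fine; apply: eq_integral => u _; rewrite /fubini_F /= fineK//.
have : L1 Q2 (fun w => f (u, w)).
  apply: (@L1_bounded _ _ _ _ _ M) => //.
  by apply: (measurableT_comp mf); exact: measurable_pair1.
by move=> /integrable_fin_num; exact.
Qed.

Lemma Ex_prod (f : T1 -> R) (g : T2 -> R) : L1 Q1 f -> L1 Q2 g ->
  L1 P (fun x => f (U x) * g (W x)) /\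
  Ex P (fun x => f (U x) * g (W x)) = Ex Q1 f * Ex Q2 g.
Proof.
move=> Lf Lg; have mUW : measurable_fun setT (fun x => (U x, W x)) by exact: measurable_fun_pair.
have mf := L1_meas Lf; have mg := L1_meas Lg.
pose F (z : T1 * T2) := f z.1 * g z.2.
have mF : measurable_fun setT F.
  by apply: measurable_funM; [exact: (measurableT_comp mf)|exact: (measurableT_comp mg)].
have LF : L1 (Q1 \x Q2)%E F.
  apply/integrableP; split; first exact/measurable_EFinP.
  rewrite fubini_tonelli1//; last by apply: measurableT_comp => //; exact/measurable_EFinP.
  rewrite /fubini_F.
  have e u : (\int[Q2]_y `|(F (u, y))%:E| = `|f u|%:E * \int[Q2]_y `|(g y)%:E|)%E.
    rewrite -ge0_integralZl_EFin//; last by apply: measurableT_comp => //; exact/measurable_EFinP.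
    by apply: eq_integral => y _; rewrite /F /= normrM EFinM.
  under eq_integral do rewrite e.
  have /integrableP[_ hf] := Lf; have /integrableP[_ hg] := Lg.
  have fin : (\int[Q2]_y `|(g y)%:E|)%E \is a fin_num.
    by rewrite ge0_fin_numE// integral_ge0.
  rewrite -(fineK fin) ge0_integralZr//; last 2 first.
  - by apply/measurable_EFinP; exact: measurableT_comp.
  - by rewrite lee_fin fine_ge0// integral_ge0.
  have fin' : (\int[Q1]_x `|(f x)%:E|)%E \is a fin_num.
    by rewrite ge0_fin_numE// integral_ge0.
  by rewrite (_ : (\int[Q1]_x `|f x|%:E)%E = (\int[Q1]_x `|(f x)%:E|)%E)// -(fineK fin') -EFinM ltry.
split; first exact: (L1_transfer mUW pair_law LF).
rewrite -/(Ex P (fun x => F (U x, W x))) (Ex_transfer mUW pair_law LF).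
have h := integral12_prod_meas1 LF.
rewrite /Ex -h.
under eq_integral => u _.
  rewrite /fubini_F /F /=; under eq_integral do rewrite EFinM.
  rewrite integralZl// -EFin_Ex//.
  over.
rewrite integralZr// -EFin_Ex//.
Qed.

End PairLaw.

Section FubiniBounded.
Context {R : realType} {d1 d2 : measure_display} {T1 : measurableType d1} {T2 : measurableType d2}.
Variables (Q1 : probability T1 R) (Q2 : probability T2 R).

Lemma Ex_fubini (f : T1 * T2 -> R) M : measurable_fun setT f -> (forall z, `|f z| <= M) ->
  Ex Q1 (fun u => Ex Q2 (fun w => f (u, w))) = Ex Q2 (fun w => Ex Q1 (fun u => f (u, w))).
Proof.
move=> mf fM; have Lf : L1 (Q1 \x Q2)%E f by apply: L1_bounded fM.
have h := Fubini Lf; rewrite /Ex; congr fine.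
transitivity (\int[Q1]_x \int[Q2]_y (EFin \o f) (x, y))%E.
  apply: eq_integral => u _; apply: (EFin_Ex (P := Q2) (f := fun w => f (u, w))).
  apply: (@L1_bounded _ _ _ _ _ M) => //; exact: measurableT_comp (measurable_pair1 u).
rewrite h; apply: eq_integral => w _; apply/esym; apply: (EFin_Ex (P := Q1) (f := fun u => f (u, w))).
apply: (@L1_bounded _ _ _ _ _ M) => //; exact: measurableT_comp (measurable_pair2 w).
Qed.

End FubiniBounded.

(** * Independent samples and the weak law of large numbers *)

Section IID.
Context {R : realType} {d d1 : measure_display} {Omega : measurableType d} {T : measurableType d1}.
Variables (P : probability Omega R) (Q : probability T R) (X : nat -> Omega -> T).
Hypothesis mX : forall i, measurable_fun setT (X i).
Hypothesis lawX : forall i A, measurable A -> P (X i @^-1` A) = Q A.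
Hypothesis indX : forall (F : {fset nat}) (A : nat -> set T), (forall i, measurable (A i)) ->
  P (\bigcap_(i in [set` F]) (X i @^-1` A i)) = (\prod_(i <- F) P (X i @^-1` A i))%E.

Lemma indep_seq (s : seq nat) (A : nat -> set T) : uniq s -> (forall i, measurable (A i)) ->
  P (\bigcap_(i in [set` s]) (X i @^-1` A i)) = (\prod_(i <- s) Q (A i))%E.
Proof.
move=> us mA; pose F := [fset x in s]%fset.
have e : perm_eq F s.
  by apply: uniq_perm => // x; rewrite inE.
transitivity (P (\bigcap_(i in [set` F]) (X i @^-1` A i))).
  by congr (P _); apply: eq_bigcapl; split=> i /=; rewrite inE.
rewrite indX// (perm_big _ e)/=; apply: eq_bigr => i _; exact: lawX.
Qed.

Lemma indep_pair i j A B : i != j -> measurable A -> measurable B ->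
  P (X i @^-1` A `&` X j @^-1` B) = (Q A * Q B)%E.
Proof.
move=> ij mA mB; pose C k := if k == i then A else B.
have mC k : measurable (C k) by rewrite /C; case: ifP.
have u : uniq [:: i; j] by rewrite /= inE ij.
have := indep_seq u mC; rewrite !big_cons big_nil mule1 /C eqxx eq_sym (negPf ij) => <-.
congr (P _); apply/seteqP; split=> x /=.
  by move=> [h1 h2] k; rewrite /= !inE => /orP[]/eqP ->; rewrite ?eqxx// eq_sym (negPf ij).
move=> h; have := h i; have := h j; rewrite /= !inE !eqxx orbT eq_sym (negPf ij) => h1 h2.
by split; [exact: h2|exact: h1].
Qed.

Lemma Ex_mul_indep i j f g : i != j -> L1 Q f -> L1 Q g ->
  L1 P (fun w => f (X i w) * g (X j w)) /\ Ex P (fun w => f (X i w) * g (X j w)) = Ex Q f * Ex Q g.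
Proof. by move=> ij Lf Lg; apply: (Ex_prod (mX i) (mX j)) => // A B; exact: indep_pair. Qed.

Lemma L1_X i f : L1 Q f -> L1 P (fun w => f (X i w)).
Proof. exact: (L1_transfer (mX i) (@lawX i)). Qed.

Lemma Ex_X i f : L1 Q f -> Ex P (fun w => f (X i w)) = Ex Q f.
Proof. exact: (Ex_transfer (mX i) (@lawX i)). Qed.

Lemma Ex_sqr_sum g n : L1 Q g -> L1 Q (fun x => g x ^+ 2) -> Ex Q g = 0 ->
  L1 P (fun w => (\sum_(i < n) g (X i w)) ^+ 2) /\
  Ex P (fun w => (\sum_(i < n) g (X i w)) ^+ 2) = n%:R * Ex Q (fun x => g x ^+ 2).
Proof.
move=> Lg Lg2 g0.
have -> : (fun w => (\sum_(i < n) g (X i w)) ^+ 2) =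
   (fun w => \sum_(i < n) \sum_(j < n) g (X i w) * g (X j w)).
  by apply/funext => w; rewrite expr2 mulr_suml; apply: eq_bigr => i _; rewrite mulr_sumr.
have H (i j : 'I_n) : L1 P (fun w => g (X i w) * g (X j w)) /\
    Ex P (fun w => g (X i w) * g (X j w)) = (if i == j then Ex Q (fun x => g x ^+ 2) else 0).
  have [->|ij] := eqVneq i j; last by have := Ex_mul_indep ij Lg Lg; rewrite g0 mulr0.
  have -> : (fun w => g (X j w) * g (X j w)) = (fun w => g (X j w) ^+ 2) by apply/funext => w; rewrite expr2.
  by split; [exact: (L1_X j Lg2)|exact: (Ex_X j Lg2)].
split; first by apply: L1_sum => i; apply: L1_sum => j; case: (H i j).
rewrite Ex_sum; last by move=> i; apply: L1_sum => j; case: (H i j).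
rewrite -[n in RHS]card_ord mulr_natl -sumr_const; apply: eq_bigr => i _.
rewrite Ex_sum; last by move=> j; case: (H i j).
rewrite (bigD1 i)//= (H i i).2 eqxx big1 ?addr0// => j ji.
by rewrite (H i j).2 eq_sym (negPf ji).
Qed.

Lemma measurable_sumX (f : T -> R) n : measurable_fun setT f -> measurable_fun setT (fun w => \sum_(i < n) f (X i w)).
Proof. by move=> mf; apply: measurable_sum => i; exact: (measurableT_comp mf). Qed.

(** Chebyshev: independence kills the cross terms of the squared centred sum, so the probability is
    at most a constant over [n]. *)
Lemma lln f eps : L1 Q f -> L1 Q (fun x => f x ^+ 2) -> 0 < eps ->
  Pr P [set w | eps <= `|(\sum_(i < n) f (X i w)) / n%:R - Ex Q f|] @[n --> \oo] --> 0.
Proof.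
move=> Lf Lf2 e0; pose g x := f x - Ex Q f.
have Lg : L1 Q g by apply: L1B => //; exact: L1_cst.
have g0 : Ex Q g = 0 by rewrite ExB ?Ex_cst ?subrr//; exact: L1_cst.
have Lg2 : L1 Q (fun x => g x ^+ 2).
  have -> : (fun x => g x ^+ 2) = (fun x => f x ^+ 2 + (- (2 * Ex Q f) * f x + Ex Q f ^+ 2)).
    by apply/funext => x; rewrite /g; ring.
  by apply: L1D => //; apply: L1D; [exact: L1Z|exact: L1_cst].
pose V := Ex Q (fun x => g x ^+ 2).
apply: (@squeeze_cvgr _ _ _ _ (fun=> 0) (fun n => (V / eps ^+ 2) * n%:R^-1)); last first.
- rewrite -[X in _ --> X](mulr0 (V / eps ^+ 2)); apply: cvgM; first exact: cvg_cst.
  by rewrite -(@cvg_shiftS _ (fun n : nat => n%:R^-1 : R)); exact: cvg_harmonic.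
- exact: cvg_cst.
near=> n; rewrite Pr_ge0/=.
have n0 : (0 < n)%N by near: n; exists 1%N.
have nR : (0 : R) < n%:R by rewrite ltr0n.
have [LS ES] := Ex_sqr_sum n Lg Lg2 g0.
have eg w : ((\sum_(i < n) g (X i w)) ^+ 2 : R) = (`|(\sum_(i < n) f (X i w)) / n%:R - Ex Q f| * n%:R) ^+ 2.
  have -> : \sum_(i < n) g (X i w) = ((\sum_(i < n) f (X i w)) / n%:R - Ex Q f) * n%:R.
    by rewrite mulrBl mulfVK ?gt_eqF// sumrB sumr_const card_ord mulr_natr.
  by rewrite -[LHS](@ger0_norm _ (_ ^+ 2)) ?sqr_ge0// normrX normrM (ger0_norm (ltW nR)).
have -> : [set w | eps <= `|(\sum_(i < n) f (X i w)) / n%:R - Ex Q f|] =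
   [set w | (eps * n%:R) ^+ 2 <= (\sum_(i < n) g (X i w)) ^+ 2].
  by apply/seteqP; split=> w /=; rewrite eg ler_pXn2r ?nnegrE ?mulr_ge0 ?(ltW nR) ?(ltW e0)// ler_pM2r.
apply: le_trans (markov_ge LS _ _) _.
- by move=> w; exact: sqr_ge0.
- by rewrite exprn_gt0// mulr_gt0.
rewrite ES -/V le_eqVlt; apply/orP; left; apply/eqP; field.
by rewrite !gt_eqF.
Unshelve. all: end_near. Qed.

Definition prefix n w : n.-tuple T := [tuple X i w | i < n].

Lemma measurable_prefix n : measurable_fun setT (prefix n).
Proof.
apply/measurable_fun_tnthP => i; rewrite (_ : _ \o _ = X i)//.
by apply/funext => w /=; rewrite tnth_mktuple.
Qed.

(** Boxes form a family closed under intersection that generates the sets of tuples, so they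
    determine finite measures. *)
Lemma sub_box_sigma n : (measurable : set (set (n.-tuple T))) =
  <<s [set A | exists2 B : 'I_n -> set T, (forall i, measurable (B i)) & A = [set t | forall i, B i (tnth t i)]] >>.
Proof.
apply/seteqP; split.
  apply: smallest_sub; first exact: smallest_sigma_algebra.
  case: n => [|n]; first by rewrite big_ord0.
  rewrite -bigcup_mkord_ord; apply: bigcup_sub => k _ _ [Y mY <-].
  apply: sub_sigma_algebra; exists (fun i => if i == inord k then Y else setT).
    by move=> i; case: ifP.
  rewrite setTI; apply/seteqP; split=> t /=.
    by move=> h i; case: ifP => // /eqP ->.
  by move=> /(_ (inord k)); rewrite eqxx.
apply: smallest_sub; first exact: sigma_algebra_measurable.
move=> _ [B mB ->].
have -> : [set t : n.-tuple T | forall i, B i (tnth t i)] = \bigcap_(i in [set: 'I_n]) ((@tnth _ T ^~ i) @^-1` B i).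
  by apply/seteqP; split=> t /= h i; [move=> _; exact: h|exact: h].
apply: fin_bigcap_measurable => // i _; rewrite -[X in measurable X]setTI.
exact: measurable_tnth.
Qed.

(** For fixed [B] both sides are finite measures in [A]. They agree on boxes, where the assumed
    product rule for finite families of observations applies. *)
Lemma indep_prefix n A B : measurable A -> measurable B ->
  P (prefix n @^-1` A `&` X n @^-1` B) = (P (prefix n @^-1` A) * Q B)%E.
Proof.
move=> mA mB.
have mXB : measurable (X n @^-1` B) by rewrite -[X in measurable X]setTI; exact: mX.
pose m1' := [the measure _ _ of pushforward (mrestr P mXB) (prefix n)].
pose m1 := m1' (@measurable_prefix n).
pose m0' := [the measure _ _ of pushforward P (prefix n)].
pose m0 := m0' (@measurable_prefix n).
have QB0 : 0 <= Pr Q B by exact: Pr_ge0.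
pose m2 := [the measure _ _ of mscale (NngNum QB0) m0].
suff -> : P (prefix n @^-1` A `&` X n @^-1` B) = m2 A.
  by rewrite /m2 /= /mscale /= EFin_Pr// muleC.
have -> : P (prefix n @^-1` A `&` X n @^-1` B) = m1 A by [].
apply: (@measure_unique _ _ _ _ (fun=> setT) (sub_box_sigma n)) => //.
- move=> _ _ [B1 mB1 ->] [B2 mB2 ->]; exists (fun i => B1 i `&` B2 i).
    by move=> i; exact: measurableI.
  by apply/seteqP; split=> t /=; [move=> [h1 h2] i; split|move=> h; split=> i; case: (h i)].
- by move=> _; exists (fun=> setT) => //; apply/seteqP; split.
- by rewrite bigcup_const//; exists 0%N.
- move=> _ [C mC ->].
  (* The product rule is stated for events indexed by all natural numbers; indices beyond [n]
     receive the full space. *)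
  pose D k := if (k == n)%N then B else if insub k is Some i then C i else setT.
  have mD k : measurable (D k) by rewrite /D; case: ifP => // _; case: insub.
  have Dn : D n = B by rewrite /D eqxx.
  have Di (i : 'I_n) : D i = C i by rewrite /D ltn_eqF// valK.
  have e1 : prefix n @^-1` [set t | forall i, C i (tnth t i)] = \bigcap_(i in [set` iota 0 n]) (X i @^-1` D i).
    apply/seteqP; split=> w /= h.
      move=> k /=; rewrite mem_iota add0n => /= kn.
      by have := h (Ordinal kn); rewrite tnth_mktuple -Di.
    move=> i; rewrite tnth_mktuple -Di; apply: h; by rewrite /= mem_iota add0n ltn_ord.
  have e2 : prefix n @^-1` [set t | forall i, C i (tnth t i)] `&` X n @^-1` B =
      \bigcap_(i in [set` rcons (iota 0 n) n]) (X i @^-1` D i).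
    rewrite e1; apply/seteqP; split=> w /=.
      move=> [h hB] k /=; rewrite mem_rcons inE => /orP[/eqP ->|kn]; first by rewrite Dn.
      exact: h.
    move=> h; split; last by rewrite -Dn; apply: h; rewrite /= mem_rcons inE eqxx.
    by move=> k /= kn; apply: h; rewrite /= mem_rcons inE kn orbT.
  transitivity (P (\bigcap_(i in [set` rcons (iota 0 n) n]) (X i @^-1` D i))); first by rewrite -e2.
  rewrite indep_seq ?rcons_uniq ?iota_uniq ?mem_iota ?ltnn ?andbF// -cats1 big_cat/= big_seq1 Dn.
  rewrite /mscale /= EFin_Pr// muleC; congr (_ * _)%E.
  by rewrite /pushforward e1 indep_seq ?iota_uniq.
- move=> k; rewrite /m1 /= /pushforward /mrestr preimage_setT setTI.
  by rewrite (le_lt_trans (probability_le1 _ _))// ltry.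
Qed.

End IID.

(** * Score identities *)

Section ExpTaylor.
Context {R : realType}.

Lemma nonneg_of_derive (g g' : R -> R) : (forall y : R, is_derive y 1 g (g' y)) -> g 0 = 0 ->
  (forall y, 0 <= y -> 0 <= g' y) -> forall x, 0 <= x -> 0 <= g x.
Proof.
move=> dg g0 g'0 x x0; suff : 0 <= g x - g 0 by rewrite g0 subr0.
have [|y] := @MVT_segment R g g' 0 x x0.
  by apply: continuous_subspaceT; exact: is_derive_continuous dg.
rewrite in_itv /= => /andP[y0 _] ->; by rewrite mulr_ge0 ?subr0 ?g'0.
Qed.

(** Each inequality is integrated from the one before it. For negative [y] the bound [|y| ^ 3]
    already holds without the exponential. *)
Lemma exp_expand (y : R) : `|expR y - (1 + y + y ^+ 2 / 2)| <= `|y| ^+ 3 * expR `|y|.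
Proof.
have e1 (z : R) : 1 - z <= expR (- z) by have := expR_ge1Dx (- z).
have main (z : R) : 0 <= z -> `|expR z - (1 + z + z ^+ 2 / 2)| <= z ^+ 3 * expR z.
  move=> z0; have a1 (w : R) : 0 <= w -> expR w - 1 <= w * expR w.
    move=> w0; have := e1 w; rewrite expRN => h.
    have : (1 - w) * expR w <= (expR w)^-1 * expR w by rewrite ler_pM2r// expR_gt0.
    by rewrite mulVf ?gt_eqF ?expR_gt0// mulrBl mul1r; lra.
  have a2 (w : R) : 0 <= w -> 0 <= expR w - (1 + w) by move=> _; have := expR_ge1Dx w; lra.
  have a3 (w : R) : 0 <= w -> 0 <= w ^+ 2 * expR w - (expR w - (1 + w)).
    apply: (@nonneg_of_derive (fun w => w ^+ 2 * expR w - (expR w - (1 + w)))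
       (fun w => 2 * w * expR w + w ^+ 2 * expR w - (expR w - 1))).
    - move=> v; apply: is_derive_eq; rewrite /GRing.scale /=; ring.
    - by rewrite expR0; ring.
    - move=> v v0; have := a1 v v0; have : 0 <= v * expR v by rewrite mulr_ge0// expR_ge0.
      have : 0 <= v ^+ 2 * expR v by rewrite mulr_ge0 ?expR_ge0// sqr_ge0.
      lra.
  have a4 (w : R) : 0 <= w -> 0 <= expR w - (1 + w + w ^+ 2 / 2).
    apply: (@nonneg_of_derive (fun w => expR w - (1 + w + w ^+ 2 / 2)) (fun w => expR w - (1 + w))) => //.
    - move=> v; apply: is_derive_eq; rewrite /GRing.scale /=; by field.
    - by rewrite expR0; field.
  have a5 (w : R) : 0 <= w -> 0 <= w ^+ 3 * expR w - (expR w - (1 + w + w ^+ 2 / 2)).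
    apply: (@nonneg_of_derive (fun w => w ^+ 3 * expR w - (expR w - (1 + w + w ^+ 2 / 2)))
       (fun w => 3 * w ^+ 2 * expR w + w ^+ 3 * expR w - (expR w - (1 + w)))).
    - move=> v; apply: is_derive_eq; rewrite /GRing.scale /=; by field.
    - by rewrite expR0; field.
    - move=> v v0; have := a3 v v0.
      have : 0 <= v ^+ 3 * expR v by rewrite mulr_ge0 ?expR_ge0// exprn_ge0.
      have : 0 <= v ^+ 2 * expR v by rewrite mulr_ge0 ?expR_ge0// sqr_ge0.
      lra.
  by rewrite ger0_norm ?a4//; have := a5 z z0; lra.
case: (leP 0 y) => y0; first by rewrite (ger0_norm y0); exact: main.
have z0 : 0 <= - y by lra.
rewrite (ltr0_norm y0); set z := - y in z0 *; have -> : y = - z by rewrite opprK.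
have b1 (w : R) : 0 <= w -> 0 <= w ^+ 2 / 2 - (expR (- w) - 1 + w).
  apply: (@nonneg_of_derive (fun w => w ^+ 2 / 2 - (expR (- w) - 1 + w)) (fun w => w + expR (- w) - 1)).
  - move=> v; apply: is_derive_eq; rewrite /GRing.scale /=; by field.
  - by rewrite oppr0 expR0; field.
  - by move=> v v0; have := e1 v; lra.
have b2 (w : R) : 0 <= w -> 0 <= expR (- w) - 1 + w - w ^+ 2 / 2 + w ^+ 3.
  apply: (@nonneg_of_derive (fun w => expR (- w) - 1 + w - w ^+ 2 / 2 + w ^+ 3)
     (fun w => - expR (- w) + 1 - w + 3 * w ^+ 2)).
  - move=> v; apply: is_derive_eq; rewrite /GRing.scale /=; by field.
  - by rewrite oppr0 expR0; field.
  - by move=> v v0; have := b1 v v0; have := sqr_ge0 v; lra.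
have h1 := b1 z z0; have h2 := b2 z z0.
apply: (@le_trans _ _ (z ^+ 3 * 1)); last first.
  by rewrite ler_wpM2l ?exprn_ge0// -[leLHS]expR0 ler_expR.
rewrite mulr1 sqrrN ler_norml; apply/andP; split; first by lra.
by have := exprn_ge0 3 z0; lra.
Qed.

(** Adding the bounds at [t] and [- t] isolates the quadratic coefficient; dividing by the leading
    power and letting [t] tend to 0 kills first [be], then [al]. *)
Lemma cubic_vanish (al be C tau : R) : 0 < tau ->
  (forall t, `|t| <= tau -> `|t * al + t ^+ 2 * be| <= C * `|t| ^+ 3) -> al = 0 /\ be = 0.
Proof.
move=> t0 H; have C0 : 0 <= C.
  have := H tau; rewrite (gtr0_norm t0) => /(_ (lexx _)) h.
  have : 0 <= C * tau ^+ 3 by exact: le_trans h.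
  by rewrite pmulr_lge0// exprn_gt0.
have small (x K : R) : 0 <= K -> (forall t, 0 < t <= tau -> `|x| <= K * t) -> x = 0.
  move=> K0 hx; apply/eqP; rewrite -normr_le0; apply/ler_addgt0Pr => e e0; rewrite add0r.
  pose t := Num.min tau (e / (K + 1)).
  have tp : 0 < t <= tau.
    by rewrite /t ge_min lexx andbT lt_min t0 divr_gt0// ltr_wpDl.
  apply: le_trans (hx t tp) _; apply: (@le_trans _ _ (K * (e / (K + 1)))).
    by rewrite ler_wpM2l// /t ge_min lexx orbT.
  rewrite mulrA ler_pdivrMr ?ltr_wpDl// mulrC ler_wpM2l ?ltW//; lra.
have b0 : be = 0.
  apply: (small _ C C0) => t /andP[tp tt].
  have := H t; rewrite (ger0_norm (ltW tp)) => /(_ tt) h1.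
  have := H (- t); rewrite normrN (ger0_norm (ltW tp)) => /(_ tt) h2.
  have h3 : `|2 * t ^+ 2 * be| <= 2 * (C * t ^+ 3).
    have -> : 2 * t ^+ 2 * be = (t * al + t ^+ 2 * be) + (- t * al + (- t) ^+ 2 * be) by ring.
    by apply: le_trans (ler_normD _ _) _; lra.
  have p : 0 < 2 * t ^+ 2 by rewrite mulr_gt0// exprn_gt0.
  move: h3; rewrite normrM (ger0_norm (ltW p)).
  have -> : 2 * (C * t ^+ 3) = 2 * t ^+ 2 * (C * t) by ring.
  by rewrite ler_pM2l.
split=> //; apply: (small _ (C * tau)); first by rewrite mulr_ge0// ltW.
move=> t /andP[tp tt]; have := H t; rewrite (ger0_norm (ltW tp)) => /(_ tt).
rewrite b0 mulr0 addr0 normrM (ger0_norm (ltW tp)).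
have -> : C * t ^+ 3 = t * (C * t * t) by ring.
rewrite ler_pM2l// => h; apply: le_trans h _.
by apply: ler_wpM2r; [exact: ltW|exact: ler_wpM2l].
Qed.

End ExpTaylor.

Section Moments.
Context {R : realType} {dd : measure_display} {T : measurableType dd}.
Variables (Q : probability T R) (N : T -> R) (k0 : R).
Hypothesis k0_gt0 : 0 < k0.
Hypothesis mN : measurable_fun setT N.
Hypothesis N0 : forall x, 0 <= N x.
Hypothesis LN : L1 Q (fun x => expR (k0 * N x)).

Lemma pow_le_exp (k y : R) j : 0 < k -> 0 <= y -> y ^+ j <= (k^-1) ^+ j * expR (j%:R * (k * y)).
Proof.
move=> k1 y0; rewrite expRM_natl -exprMn; apply: lerXn2r; rewrite ?nnegrE//.
  by rewrite mulr_ge0 ?invr_ge0 ?expR_ge0// ltW.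
rewrite mulrC ler_pdivlMr// mulrC; apply: le_trans (expR_ge1Dx _); lra.
Qed.

(** Half of the available exponent absorbs the power: [k] is chosen so that [j] factors
    [expR (k * N x)] use exactly [k0 / 2]. *)
Lemma L1_pow_exp j : L1 Q (fun x => N x ^+ j * expR (k0 / 2 * N x)).
Proof.
case: j => [|j].
  apply: (L1_le _ LN) => [|x].
    by apply: measurable_funM => //; apply: measurableT_comp => //; exact: measurable_funM.
  by rewrite expr0 mul1r ger0_norm ?expR_ge0// ler_expR; apply: ler_wpM2r => //; rewrite ler_pdivrMr// ler_peMr ?(ltW k0_gt0)// ler1n.
pose k := k0 / (2 * j.+1%:R).
have j0 : (0 : R) < j.+1%:R by rewrite ltr0n.
have kp : 0 < k by rewrite divr_gt0// mulr_gt0.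
apply: (L1_le _ (L1Z (k^-1 ^+ j.+1) LN)) => [|x].
  apply: measurable_funM; first exact: measurable_funX.
  by apply: measurableT_comp => //; exact: measurable_funM.
rewrite ger0_norm ?mulr_ge0 ?exprn_ge0 ?expR_ge0//.
have h := pow_le_exp j.+1 kp (N0 x).
apply: (@le_trans _ _ (k^-1 ^+ j.+1 * expR (j.+1%:R * (k * N x)) * expR (k0 / 2 * N x))).
  by rewrite ler_wpM2r// expR_ge0.
rewrite -mulrA -expRD; have -> : j.+1%:R * (k * N x) + k0 / 2 * N x = k0 * N x.
  by rewrite /k; set J := j.+1%:R; field; rewrite gt_eqF.
exact: lexx.
Qed.

Lemma L1_pow j : L1 Q (fun x => N x ^+ j).
Proof.
apply: (L1_le _ (L1_pow_exp j)) => [|x]; first exact: measurable_funX.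
rewrite ger0_norm ?exprn_ge0// ler_peMr ?exprn_ge0// -expR0 ler_expR mulr_ge0//.
by rewrite divr_ge0// ltW.
Qed.

End Moments.

Section ScoreIdentities.
Context {R : realType} {dd : measure_display} {T : measurableType dd} {p : nat}.
Variables (Q : probability T R) (N : T -> R) (k0 de : R) (D : 'cV[R]_p -> T -> R).
Hypothesis k0_gt0 : 0 < k0.
Hypothesis de_gt0 : 0 < de.
Hypothesis mN : measurable_fun setT N.
Hypothesis N0 : forall x, 0 <= N x.
Hypothesis LN : L1 Q (fun x => expR (k0 * N x)).
Hypothesis mD : forall h, measurable_fun setT (D h).
Hypothesis D0 : forall x, D 0 x = 0.
Hypothesis jD : forall x, jet de (N x) (fun h => D h x).

(** The expansion at each observation, with coefficients measurable in it. There is no constant term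
    since [D 0] vanishes, and symmetry lets [q] be recovered from its quadratic form. *)
Definition coeffs (a : T -> 'cV[R]_p) (q : T -> 'M[R]_p) :=
  [/\ (forall i, measurable_fun setT (fun x => a x i 0)), (forall i j, measurable_fun setT (fun x => q x i j)),
      (forall x, (q x)^T = q x), (forall x i, `|a x i 0| <= N x) & (forall x i j, `|q x i j| <= N x)] /\
  forall x h, nrm1 h <= de -> `|D h x - (dot (a x) h + qform (q x) h)| <= N x * nrm1 h ^+ 3.

Lemma nrm1_delta (i : 'I_p) : nrm1 (delta_mx i 0 : 'cV[R]_p) = 1.
Proof.
rewrite /nrm1 (bigD1 i)//= big1 ?addr0; first by rewrite mxE !eqxx normr1.
by move=> j /negPf ji; rewrite mxE ji normr0.
Qed.

Lemma nrm1D (u v : 'cV[R]_p) : nrm1 (u + v) <= nrm1 u + nrm1 v.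
Proof. by rewrite /nrm1 -big_split; apply: ler_sum => i _; rewrite mxE ler_normD. Qed.

Lemma qform_scale (M : 'M[R]_p) k (h : 'cV[R]_p) : qform M (k *: h) = k ^+ 2 * qform M h.
Proof. by rewrite /qform -scalemxAr dotZl dotZr expr2 mulrA. Qed.

Lemma qform_delta (M : 'M[R]_p) i j : dot (delta_mx i 0) (M *m delta_mx j 0) = M i j.
Proof. by rewrite dotC dot_delta -colE mxE. Qed.

Lemma qform_polar (M : 'M[R]_p) i j : M^T = M ->
  M i j = (qform M (delta_mx i 0 + delta_mx j 0) - qform M (delta_mx i 0) - qform M (delta_mx j 0)) / 2.
Proof.
move=> sM; rewrite /qform mulmxDr dotDl !dotDr !qform_delta.
have -> : M j i = M i j by rewrite -[in LHS]sM mxE.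
by field.
Qed.

Lemma small_scale (h : 'cV[R]_p) : \forall n \near \oo, nrm1 (n%:R^-1 *: h) <= de.
Proof.
have [n0 hn] : exists n0 : nat, nrm1 h / de < n0%:R.
  by exists (Num.bound (nrm1 h / de)); apply: archi_boundP; rewrite divr_ge0 ?nrm1_ge0// ltW.
exists n0.+1 => // n /= n0n; have np : (0 : R) < n%:R by rewrite ltr0n (leq_trans _ n0n).
rewrite nrm1Z ger0_norm ?invr_ge0 ?(ltW np)// mulrC ler_pdivrMr// mulrC -ler_pdivrMr//.
by apply: le_trans (ltW hn) _; rewrite ler_nat ltnW.
Qed.

Lemma cvg_inv_nat (C : R) : C * n%:R^-1 @[n --> \oo] --> (0 : R).
Proof.
rewrite -[X in _ --> X](mulr0 C); apply: cvgM; first exact: cvg_cst.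
by rewrite -(@cvg_shiftS _ (fun n : nat => n%:R^-1 : R)); exact: cvg_harmonic.
Qed.

Lemma cvg_of_bound (u : nat -> R) l C : (\forall n \near \oo, `|u n - l| <= C * n%:R^-1) -> u n @[n --> \oo] --> l.
Proof.
move=> h; apply/cvgrPdist_le => e e0.
have /cvgrPdist_le /(_ e e0) h2 := cvg_inv_nat C.
near=> n; have h3 : `|u n - l| <= C * n%:R^-1 by near: n.
rewrite distrC; apply: le_trans h3 _; have : `|0 - C * n%:R^-1| <= e by near: n; exact: h2.
by rewrite sub0r normrN; apply: le_trans; exact: ler_norm.
Unshelve. all: end_near. Qed.

(** Pointwise choice says nothing about measurability, but the coefficients are determined: [a] is a
    limit of difference quotients along [1 / n], the quadratic form is a limit of second-order
    quotients, and polarization gives the entries of the symmetrized [q]. *)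
Lemma coeffs_ex : exists a q, coeffs a q.
Proof.
have H x : exists aq : 'cV[R]_p * 'M[R]_p, [/\ (forall i, `|aq.1 i 0| <= N x), (aq.2)^T = aq.2, (forall i j, `|aq.2 i j| <= N x) &
   forall h, nrm1 h <= de -> `|D h x - (dot aq.1 h + qform aq.2 h)| <= N x * nrm1 h ^+ 3].
  have [c [a [Q0 [hc ha hQ hD]]]] := jD x.
  have c0 : c = 0 by rewrite -(jet_at0 (ltW de_gt0) hD) D0.
  exists (a, 2^-1 *: (Q0 + Q0^T)); split => //=.
  - by rewrite linearZ /= linearD /= trmxK addrC.
  - move=> i j; rewrite !mxE normrM ger0_norm ?invr_ge0//.
    have := ler_normD (Q0 i j) (Q0 j i); have := hQ i j; have := hQ j i; lra.
  - move=> h hh; have -> : qform (2^-1 *: (Q0 + Q0^T)) h = qform Q0 h.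
      rewrite qformZl qformDl; have -> : qform Q0^T h = qform Q0 h.
        by rewrite /qform dot_mulmxr trmxK dotC.
      by field.
    by have := hD h hh; rewrite c0 add0r.
have [f hf] := choice H.
exists (fun x => (f x).1), (fun x => (f x).2); split; last by move=> x h; case: (hf x) => _ _ _; exact.
have ma i : measurable_fun setT (fun x => (f x).1 i 0).
  apply: (@measurable_fun_cvg _ _ _ setT (fun n x => n%:R * D (n%:R^-1 *: delta_mx i 0) x)) => [n|x _].
    by apply: measurable_funM.
  apply: (@cvg_of_bound _ _ (2 * N x)); near=> n.
  have np : (0 : R) < n%:R by rewrite ltr0n; near: n; exists 1%N.
  have hh : nrm1 (n%:R^-1 *: delta_mx i 0 : 'cV[R]_p) <= de by near: n; exact: small_scale.
  have [ha _ hq /(_ _ hh)] := hf x.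
  rewrite dotZr dot_delta qform_scale /qform qform_delta nrm1Z nrm1_delta mulr1 (@ger0_norm _ n%:R^-1) ?invr_ge0 ?(ltW np)//.
  set y := D _ x; set al := (f x).1 i 0; set be := (f x).2 i i; move=> hy.
  have -> : n%:R * y - al = n%:R * (y - (n%:R^-1 * al + n%:R^-1 ^+ 2 * be)) + n%:R^-1 * be.
    by field; rewrite gt_eqF.
  apply: le_trans (ler_normD _ _) _; rewrite !normrM (ger0_norm (ltW np)) (@ger0_norm _ n%:R^-1) ?invr_ge0 ?(ltW np)//.
  have h1 : n%:R * `|y - (n%:R^-1 * al + n%:R^-1 ^+ 2 * be)| <= N x * n%:R^-1.
    apply: (@le_trans _ _ (n%:R * (N x * n%:R^-1 ^+ 3))); first by rewrite ler_wpM2l ?(ltW np).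
    have -> : n%:R * (N x * n%:R^-1 ^+ 3) = N x * n%:R^-1 * n%:R^-1 by field; rewrite gt_eqF.
    rewrite ler_piMr ?mulr_ge0 ?invr_ge0 ?(ltW np)// invf_le1// ler1n; near: n; by exists 1%N.
  have h2 : n%:R^-1 * `|be| <= N x * n%:R^-1 by rewrite mulrC ler_wpM2r ?invr_ge0 ?(ltW np)// hq.
  lra.
have mdot h : measurable_fun setT (fun x => dot (f x).1 h).
  by apply: measurable_sum => i; apply: measurable_funM.
have mq h : measurable_fun setT (fun x => qform (f x).2 h).
  apply: (@measurable_fun_cvg _ _ _ setT (fun n x => n%:R ^+ 2 * (D (n%:R^-1 *: h) x - n%:R^-1 * dot (f x).1 h))) => [n|x _].
    by apply: measurable_funM => //; apply: measurable_funB => //; exact: measurable_funM.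
  apply: (@cvg_of_bound _ _ (N x * nrm1 h ^+ 3)); near=> n.
  have np : (0 : R) < n%:R by rewrite ltr0n; near: n; exists 1%N.
  have hh : nrm1 (n%:R^-1 *: h) <= de by near: n; exact: small_scale.
  have [_ _ _ /(_ _ hh)] := hf x.
  rewrite dotZr qform_scale nrm1Z (@ger0_norm _ n%:R^-1) ?invr_ge0 ?(ltW np)//.
  set y := D _ x; set al := dot _ h; set be := qform _ h; move=> hy.
  have -> : n%:R ^+ 2 * (y - n%:R^-1 * al) - be = n%:R ^+ 2 * (y - (n%:R^-1 * al + n%:R^-1 ^+ 2 * be)).
    by field; rewrite gt_eqF.
  rewrite normrM (@ger0_norm _ (_ ^+ 2)) ?sqr_ge0//.
  apply: (@le_trans _ _ (n%:R ^+ 2 * (N x * (n%:R^-1 * nrm1 h) ^+ 3))); first by rewrite ler_wpM2l ?sqr_ge0.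
  by rewrite le_eqVlt; apply/orP; left; apply/eqP; field; rewrite gt_eqF.
split => //.
- move=> i j; have -> : (fun x => (f x).2 i j) = (fun x => 2^-1 * ((qform (f x).2 (delta_mx i 0 + delta_mx j 0)
      - qform (f x).2 (delta_mx i 0)) - qform (f x).2 (delta_mx j 0))).
    by apply/funext => x; have [_ sq _ _] := hf x; rewrite {1}(qform_polar i j sq) mulrC.
  by apply: measurable_funM => //; apply: measurable_funB => //; exact: measurable_funB.
- by move=> x; case: (hf x).
- by move=> x; case: (hf x).
- by move=> x; case: (hf x).
Unshelve. all: end_near. Qed.

Variables (a : T -> 'cV[R]_p) (q : T -> 'M[R]_p).
Hypothesis haq : coeffs a q.

Lemma measurable_dota h : measurable_fun setT (fun x => dot (a x) h).
Proof. by case: haq => -[ma _ _ _ _] _; apply: measurable_sum => i; exact: measurable_funM. Qed.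

Lemma measurable_qformq h : measurable_fun setT (fun x => qform (q x) h).
Proof.
case: haq => -[_ mq _ _ _] _.
apply: measurable_sum => i; apply: measurable_funM => //.
under eq_fun do rewrite mxE.
by apply: measurable_sum => j; exact: measurable_funM.
Qed.

Lemma dota_le x h : `|dot (a x) h| <= N x * nrm1 h.
Proof. by case: haq => -[_ _ _ ha _] _; exact: dot_bound. Qed.

Lemma qformq_le x h : `|qform (q x) h| <= N x * nrm1 h ^+ 2.
Proof. by case: haq => -[_ _ _ _ hq] _; exact: qform_bound. Qed.

Lemma D_lip x h : nrm1 h <= de -> de <= 1 -> `|D h x| <= 3 * N x * nrm1 h.
Proof.
by move=> hh d1; have := @jet_lip _ _ de (N x) _ _ (jD x) h hh; rewrite D0 subr0; apply; rewrite ltW.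
Qed.

Hypothesis de_le1 : de <= 1.

(** The three terms bound, in this order, the cubic remainder of [D], the error of replacing [D ^ 2]
    by the square of its linear part, and the remainder of the exponential at an argument of size at
    most [3 * N x * nrm1 h]. *)
Definition exp_rem x := N x ^+ 1 + (4 * N x ^+ 2 + 27 * (N x ^+ 3 * expR (k0 / 2 * N x))).

Lemma L1_exp_rem : L1 Q exp_rem.
Proof.
have LNp := L1_pow k0_gt0 mN N0 LN; have LNe := L1_pow_exp k0_gt0 mN N0 LN.
by apply: L1D => //; apply: L1D; exact: L1Z.
Qed.

Lemma exp_jet x h : nrm1 h <= de -> 3 * nrm1 h <= k0 / 2 ->
  `|expR (D h x) - 1 - (dot (a x) h + (qform (q x) h + dot (a x) h ^+ 2 / 2))| <= nrm1 h ^+ 3 * exp_rem x.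
Proof.
move=> hn tk; have [_ hD] := haq; have := hD x _ hn.
have := D_lip x hn de_le1; have := dota_le x h; have := qformq_le x h.
set A := dot _ _; set B := qform _ _; set d := D _ _ => tB tA hd hr.
have he := exp_expand d.
(* The last summand compares [d ^ 2 / 2] with [A ^ 2 / 2] as a product: one factor is of second
   order, the other of first. *)
have -> : expR d - 1 - (A + (B + A ^+ 2 / 2)) =
   (expR d - (1 + d + d ^+ 2 / 2)) + (d - (A + B)) + (d - A) * (d + A) / 2 by field.
have Nx := N0 x; set u := nrm1 h in tk hd hr hn tA tB *.
have u0 : 0 <= u := nrm1_ge0 h.
have u1 : u <= 1 by apply: le_trans de_le1.
have u2 : 0 <= u ^+ 2 by rewrite sqr_ge0.
have u3 : u ^+ 3 <= u ^+ 2 by rewrite exprS ler_piMl.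
have Nu2 : N x * u ^+ 3 <= N x * u ^+ 2 by rewrite ler_wpM2l.
have p1 : `|d - A| <= 2 * N x * u ^+ 2.
  have -> : d - A = (d - (A + B)) + B by ring.
  by apply: le_trans (ler_normD _ _) _; lra.
have p2 : `|d + A| <= 4 * N x * u by apply: le_trans (ler_normD _ _) _; lra.
have p3 : `|(d - A) * (d + A) / 2| <= 4 * N x ^+ 2 * u ^+ 3.
  rewrite !normrM (@ger0_norm _ 2^-1) ?invr_ge0//.
  have := ler_pM (normr_ge0 _) (normr_ge0 _) p1 p2.
  have -> : 2 * N x * u ^+ 2 * (4 * N x * u) = 8 * N x ^+ 2 * u ^+ 3 by ring.
  lra.
have p4 : `|d| ^+ 3 * expR `|d| <= 27 * u ^+ 3 * (N x ^+ 3 * expR (k0 / 2 * N x)).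
  have -> : 27 * u ^+ 3 * (N x ^+ 3 * expR (k0 / 2 * N x)) = (3 * N x * u) ^+ 3 * expR (k0 / 2 * N x) by ring.
  apply: ler_pM; rewrite ?exprn_ge0 ?expR_ge0//.
    by apply: lerXn2r; rewrite ?nnegrE ?mulr_ge0.
  rewrite ler_expR; apply: le_trans hd _.
  have -> : 3 * N x * u = 3 * u * N x by ring.
  exact: ler_wpM2r.
have -> : u ^+ 3 * exp_rem x = N x * u ^+ 3 + 4 * N x ^+ 2 * u ^+ 3 + 27 * u ^+ 3 * (N x ^+ 3 * expR (k0 / 2 * N x)).
  rewrite /exp_rem; ring.
apply: le_trans (ler_normD _ _) _; rewrite addrC.
have : `|(expR d - (1 + d + d ^+ 2 / 2)) + (d - (A + B))| <= `|d| ^+ 3 * expR `|d| + N x * u ^+ 3.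
  by apply: le_trans (ler_normD _ _) _; exact: lerD.
lra.
Qed.

Lemma L1_dota h : L1 Q (fun x => dot (a x) h).
Proof.
apply: (L1_le (measurable_dota h) (L1Z (nrm1 h) (L1_pow k0_gt0 mN N0 LN 1%N))) => x.
by rewrite expr1 mulrC; exact: dota_le.
Qed.

Lemma L1_dota_sqr h : L1 Q (fun x => dot (a x) h ^+ 2).
Proof.
apply: (L1_le _ (L1Z (nrm1 h ^+ 2) (L1_pow k0_gt0 mN N0 LN 2%N))) => [|x]; first exact: measurable_funX (measurable_dota h).
by rewrite normrX -exprMn; apply: lerXn2r; rewrite ?nnegrE ?mulr_ge0 ?nrm1_ge0// mulrC; exact: dota_le.
Qed.

Lemma L1_qformq h : L1 Q (fun x => qform (q x) h).
Proof.
apply: (L1_le (measurable_qformq h) (L1Z (nrm1 h ^+ 2) (L1_pow k0_gt0 mN N0 LN 1%N))) => x.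
by rewrite expr1 mulrC; exact: qformq_le.
Qed.

Lemma L1_second h : L1 Q (fun x => qform (q x) h + dot (a x) h ^+ 2 / 2).
Proof.
apply: L1D; first exact: L1_qformq.
have -> : (fun x => dot (a x) h ^+ 2 / 2) = (fun x => 2^-1 * dot (a x) h ^+ 2).
  by apply/funext => x; rewrite mulrC.
exact: L1Z (L1_dota_sqr h).
Qed.

Hypothesis ED : forall h, nrm1 h <= de -> Ex Q (fun x => expR (D h x)) = 1.

Lemma score_identity h : Ex Q (fun x => dot (a x) h) = 0 /\
  Ex Q (fun x => qform (q x) h + dot (a x) h ^+ 2 / 2) = 0.
Proof.
pose s := nrm1 h.
have s0 : 0 <= s := nrm1_ge0 h.
have La := L1_dota h; have Lb := L1_second h; have LW := L1_exp_rem.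
(* The two entries secure the two hypotheses of [exp_jet] for [t *: h]; adding 1 to [s] covers
   [h = 0]. *)
pose tau := Num.min (de / (s + 1)) (k0 / (6 * (s + 1))).
have s1 : 0 < s + 1 by rewrite ltr_wpDl.
have tau0 : 0 < tau by rewrite lt_min !divr_gt0// mulr_gt0.
apply: (@cubic_vanish _ _ _ (s ^+ 3 * Ex Q exp_rem) tau tau0) => t tt.
have n0 : 0 <= `|t| by [].
have ts : `|t| * s <= de.
  apply: (@le_trans _ _ (tau * (s + 1))); first by apply: ler_pM => //; lra.
  by rewrite -ler_pdivlMr// /tau ge_min lexx.
have tk : 3 * (`|t| * s) <= k0 / 2.
  have : `|t| * s <= tau * (s + 1) by apply: ler_pM => //; lra.
  have : tau * (s + 1) <= k0 / 6.
    have -> : k0 / 6 = k0 / (6 * (s + 1)) * (s + 1) by field; rewrite gt_eqF.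
    by rewrite ler_wpM2r ?(ltW s1)// /tau ge_min lexx orbT.
  lra.
have key x : `|expR (D (t *: h) x) - 1 - (t * dot (a x) h + t ^+ 2 * (qform (q x) h + dot (a x) h ^+ 2 / 2))| <= (`|t| * s) ^+ 3 * exp_rem x.
  have := @exp_jet x (t *: h); rewrite dotZr qform_scale nrm1Z -/s => /(_ ts tk).
  by have -> : t ^+ 2 * qform (q x) h + (t * dot (a x) h) ^+ 2 / 2 =
     t ^+ 2 * (qform (q x) h + dot (a x) h ^+ 2 / 2) by field.
have LA : L1 Q (fun x => t * dot (a x) h + t ^+ 2 * (qform (q x) h + dot (a x) h ^+ 2 / 2)).
  by apply: L1D; exact: L1Z.
have Ldiff : L1 Q (fun x => expR (D (t *: h) x) - 1 - (t * dot (a x) h + t ^+ 2 * (qform (q x) h + dot (a x) h ^+ 2 / 2))).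
  apply: (L1_le _ (L1Z ((`|t| * s) ^+ 3) LW)) => [|x]; last exact: key.
  apply: measurable_funB; last exact: L1_meas LA.
  by apply: measurable_funB => //; exact: measurableT_comp.
have Le : L1 Q (fun x => expR (D (t *: h) x)).
  have -> : (fun x => expR (D (t *: h) x)) = (fun x => (expR (D (t *: h) x) - 1 - (t * dot (a x) h + t ^+ 2 * (qform (q x) h + dot (a x) h ^+ 2 / 2)))
    + (t * dot (a x) h + t ^+ 2 * (qform (q x) h + dot (a x) h ^+ 2 / 2)) + 1) by apply/funext => x; ring.
  by apply: L1D; [exact: L1D|exact: L1_cst].
have E : Ex Q (fun x => expR (D (t *: h) x) - 1 - (t * dot (a x) h + t ^+ 2 * (qform (q x) h + dot (a x) h ^+ 2 / 2))) =
   - (t * Ex Q (fun x => dot (a x) h) + t ^+ 2 * Ex Q (fun x => qform (q x) h + dot (a x) h ^+ 2 / 2)).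
  rewrite ExB//; last by apply: L1B => //; exact: L1_cst.
  rewrite ExB//; last exact: L1_cst.
  rewrite ED ?nrm1Z// Ex_cst subrr sub0r.
  by rewrite (ExD (L1Z t La) (L1Z (t ^+ 2) Lb)) !ExZ.
have := Ex_abs_le (L1_meas Ldiff) (L1Z ((`|t| * s) ^+ 3) LW) key.
rewrite E normrN ExZ//.
by have -> : (`|t| * s) ^+ 3 * Ex Q exp_rem = s ^+ 3 * Ex Q exp_rem * `|t| ^+ 3 by ring.
Qed.

End ScoreIdentities.

(** * Gaussian vectors *)

Lemma integral_prob_cst {R : realType} d (T : measurableType d) (P : probability T R) (c : R) :
  (\int[P]_x c%:E = c%:E)%E.
Proof.
rewrite integral_cst//; transitivity (c%:E * 1)%E; last by rewrite mule1.
by congr (_ * _)%E; exact: probability_setT.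
Qed.

Section GaussianVector.
Context {R : realType}.
Local Notation BR := (measurableTypeR R).

Lemma Ex_ge0_integral (n : nat) (f : n.-tuple BR -> R) : measurable_fun setT f -> (forall t, 0 <= f t) ->
  (\int[stdgauss n]_t (f t)%:E < +oo)%E -> L1 (stdgauss n) f.
Proof.
move=> mf f0 h; apply/integrableP; split; first exact/measurable_EFinP.
by under eq_integral do rewrite gee0_abs ?lee_fin//.
Qed.

Lemma measurable_cat_tuple m n : measurable_fun setT
  (fun p : m.-tuple BR * n.-tuple BR => [the (m + n).-tuple BR of cat_tuple p.1 p.2]).
Proof.
apply/measurable_fun_tnthP => i; rewrite -(splitK i) /comp; case: (fintype.split i) => k /=.
  by under eq_fun do rewrite tnth_lshift; apply: (measurableT_comp (measurable_tnth k)).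
by under eq_fun do rewrite tnth_rshift; apply: (measurableT_comp (measurable_tnth k)).
Qed.

Lemma stdgauss_cat m n (F : (m + n).-tuple BR -> \bar R) : measurable_fun setT F -> (forall t, 0 <= F t)%E ->
  (\int[stdgauss (m + n)]_u F u = \int[stdgauss m]_s \int[stdgauss n]_t F (cat_tuple s t))%E.
Proof.
elim: m F => [|m IH] F mF F0.
  rewrite [RHS]integral_dirac//; last first.
    have -> : (fun s : 0.-tuple BR => \int[stdgauss n]_t F (cat_tuple s t))%E = cst (\int[stdgauss n]_t F (cat_tuple [tuple] t))%E.
      by apply/funext => s; rewrite (tuple0 s).
    exact: measurable_cst.
  transitivity (1 * \int[stdgauss n]_t F (cat_tuple [tuple] t))%E; last by congr (_ * _)%E; rewrite diracT.
  rewrite mul1e; apply: eq_integral => t _; congr F; exact: val_inj.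
have mG : measurable_fun setT (F \o @cons_pair R (m + n)).
  by apply: measurableT_comp => //; exact: measurable_cons_pair.
have mH : measurable_fun setT (fun p : m.+1.-tuple BR * n.-tuple BR => F (cat_tuple p.1 p.2)).
  by apply: (measurableT_comp mF); exact: measurable_cat_tuple.
rewrite (stdgauss_tonelli mF F0).1.
rewrite (stdgauss_tonelli (F := fun s => \int[stdgauss n]_t F (cat_tuple s t))%E _ _).1; last 2 first.
- exact: (@measurable_fun_fubini_tonelli_F _ _ _ _ _ (stdgauss n) _ mH (fun p => F0 _)).
- by move=> s; exact: integral_ge0.
apply: eq_integral => x _; rewrite (IH (fun u => F [tuple of x :: u])); last 2 first.
- by apply: (measurableT_comp mF); apply: measurable_cons.
- by [].
by apply: eq_integral => s _; apply: eq_integral => t _; congr F; exact: val_inj.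
Qed.

Lemma vecof_cat m n (s : m.-tuple BR) (t : n.-tuple BR) : vecof (cat_tuple s t) = col_mx (vecof s) (vecof t).
Proof.
apply/colP => i; rewrite mxE -(splitK i); case: (fintype.split i) => k /=.
  by rewrite tnth_lshift col_mxEu mxE.
by rewrite tnth_rshift col_mxEd mxE.
Qed.

Lemma stdgauss_orth n (M : 'M[R]_n) (f : 'cV[R]_n -> R) : M^T *m M = 1%:M -> cge0 f ->
  (\int[stdgauss n]_t (f (M *m vecof t))%:E = \int[stdgauss n]_t (f (vecof t))%:E)%E.
Proof.
move=> MM [cf f0]; pose g v := f v * expR (- (dot v v / 2)).
have hg : cge0 g.
  split=> [|v]; last by rewrite mulr_ge0// expR_ge0.
  apply: cont_mul => //; apply: cont_exp; apply: cont_opp; apply: cont_mul; last exact: cont_cst.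
  by apply: cont_dot; exact: cont_id.
have uM : M \in unitmx by case/mulmx1_unit : MM.
have dM : `|\det M| = 1.
  have := congr1 determinant MM; rewrite det_mulmx det_tr det1 => h.
  have : `|\det M| ^+ 2 = 1 ^+ 2 by rewrite expr1n -normrX expr2 h normr1.
  by move/(pexpIrn (isT : (0 < 2)%N)); apply; rewrite nnegrE.
have dd v : dot (M *m v) (M *m v) = dot v v by rewrite dot_mulmxr mulmxA MM mul1mx.
have e v : expR (- (dot v v / 2)) * expR (dot v v / 2) = 1 by rewrite -expRD addNr expR0.
transitivity (gint (fun v => `|\det M| * g (M *m v))).
  apply: eq_integral => t _; congr EFin.
  by rewrite dM mul1r /g dd -mulrA e mulr1.
rewrite (lin_changeP uM hg); apply: eq_integral => t _; congr EFin.
by rewrite /g -mulrA e mulr1.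
Qed.

(** The pair of independent vectors is rotated by the orthogonal matrix with blocks [a / c] and
    [b / c]; the first half of the rotated pair is standard Gaussian and the second half drops
    out. *)
Lemma stdgauss_semigroup p (f : 'cV[R]_p -> R) (A : 'M[R]_p) (a b c : R) (x : 'cV[R]_p) : cge0 f ->
  0 < c -> a ^+ 2 + b ^+ 2 = c ^+ 2 ->
  (\int[stdgauss p]_s \int[stdgauss p]_t (f (x + a *: (A *m vecof s) + b *: (A *m vecof t)))%:E =
   \int[stdgauss p]_s (f (x + c *: (A *m vecof s)))%:E)%E.
Proof.
move=> [cf f0] c0 abc.
pose F (u : 'cV[R]_(p + p)) := f (x + c *: (A *m usubmx u)).
have cu : continuous (fun u : 'cV[R]_(p + p) => usubmx u).
  apply: continuous_mx => i j; under eq_fun do rewrite mxE; rewrite (ord1 j); exact: coord_continuous.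
have hF : cge0 F.
  split=> [|u]; last exact: f0.
  apply: (@cont_comp _ _ _ (fun u => x + c *: (A *m usubmx u))) => //.
  apply: cont_addv; first exact: cont_cstT.
  by apply: cont_scale; [exact: cont_cst|exact: cont_mulmx].
have [cF F0] := hF.
pose M : 'M[R]_(p + p) := block_mx (a / c)%:M (b / c)%:M (- (b / c))%:M (a / c)%:M.
have MM : M^T *m M = 1%:M.
  rewrite /M tr_block_mx mulmx_block !tr_scalar_mx -!scalar_mxM -!raddfD /= [RHS]scalar_mx_block.
  have e : a / c * (a / c) + b / c * (b / c) = 1.
    have -> : a / c * (a / c) + b / c * (b / c) = (a ^+ 2 + b ^+ 2) / c ^+ 2 by field; rewrite gt_eqF.
    by rewrite abc mulfV// expf_neq0// gt_eqF.
  have -> : a / c * (a / c) + - (b / c) * - (b / c) = 1 by rewrite mulrNN.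
  have -> : a / c * (b / c) + - (b / c) * (a / c) = 0 by ring.
  have -> : b / c * (a / c) + a / c * - (b / c) = 0 by ring.
  have -> : b / c * (b / c) + a / c * (a / c) = 1 by rewrite addrC.
  by rewrite raddf0.
have mF (u : 'cV[R]_(p + p) -> R) : continuous u -> measurable_fun setT (fun t : (p + p).-tuple BR => (u (vecof t))%:E).
  by move=> ?; apply/measurable_EFinP; exact: measurable_vecof.
have h1 := stdgauss_orth MM hF.
rewrite (stdgauss_cat (F := fun t => (F (M *m vecof t))%:E)) in h1; last 2 first.
- apply: (mF (fun u => F (M *m u))).
  by apply: (@cont_comp _ _ _ (fun u => M *m u)) => //; apply: cont_mulmx; exact: cont_id.
- by move=> t; rewrite lee_fin.
rewrite (stdgauss_cat (F := fun t => (F (vecof t))%:E)) in h1; last 2 first.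
- exact: mF.
- by move=> t; rewrite lee_fin.
transitivity (\int[stdgauss p]_s \int[stdgauss p]_t (F (M *m vecof (cat_tuple s t)))%:E)%E.
  apply: eq_integral => s _; apply: eq_integral => t _; congr EFin.
  rewrite vecof_cat /F /M mul_block_col col_mxKu; congr f.
  rewrite !mul_scalar_mx mulmxDr -!scalemxAr scalerDr !scalerA addrA.
  by congr (_ + _ *: _ + _ *: _); field; rewrite gt_eqF.
rewrite h1; apply: eq_integral => s _; rewrite /F.
under eq_integral do rewrite vecof_cat col_mxKu.
exact: integral_prob_cst.
Qed.

(** Rescaling by [s = sqrt (1 - 2 * c)] turns the integral into that of the Gaussian density. The
    linear change of variables gives a positive number times the integral equal to 1, hence
    finiteness. *)
Lemma L1_gauss_exp n (c : R) : c < 2^-1 -> L1 (stdgauss n) (fun t => expR (c * dot (vecof t) (vecof t))).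
Proof.
move=> c1; apply: Ex_ge0_integral; last first.
- pose s := Num.sqrt (1 - 2 * c).
  have s0 : 0 < s by rewrite sqrtr_gt0; lra.
  have ss : s ^+ 2 = 1 - 2 * c by rewrite sqr_sqrtr//; lra.
  pose g (v : 'cV[R]_n) := expR (- (dot v v / 2)).
  have hg : cge0 g.
    split=> [|v]; last exact: expR_ge0.
    apply: cont_exp; apply: cont_opp; apply: cont_mul; last exact: cont_cst.
    by apply: cont_dot; exact: cont_id.
  have us : s%:M \in @unitmx R n by rewrite unitmxE det_scalar unitfE expf_neq0// gt_eqF.
  have hgs : cge0 (fun v => g (s *: v)).
    split=> [|v]; last exact: expR_ge0.
    apply: (@cont_comp _ _ _ (fun v : 'cV[R]_n => s *: v)); last by case: hg.
    by apply: cont_scale; [exact: cont_cst|exact: cont_id].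
  have g1 : gint g = 1%E.
    rewrite /gint (eq_integral (fun=> 1%E)).
      exact: integral_prob_cst.
    by move=> t _; rewrite /g -expRD addNr expR0.
  have h := lin_changeP us hg; rewrite g1 in h.
  have h2 : ((`|\det (s%:M : 'M[R]_n)|)%:E * gint (fun v => g (s *: v)) = 1)%E.
    by rewrite -(gintZ (normr_ge0 _) hgs) -[RHS]h; apply: eq_gint => v; rewrite mul_scalar_mx.
  have -> : (\int[stdgauss n]_t (expR (c * dot (vecof t) (vecof t)))%:E = gint (fun v => g (s *: v)))%E.
    apply: eq_integral => t _; congr EFin; rewrite /g dotZl dotZr mulrA -expr2 ss -expRD; congr expR; by field.
  have d0 : 0 < `|\det (s%:M : 'M[R]_n)| by rewrite det_scalar normr_gt0 expf_neq0// gt_eqF.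
  case: (gint (fun v => g (s *: v))) h2 => [r _|h3|//]; first exact: ltry.
  by move: h3; rewrite gt0_muley ?lte_fin.
- by move=> t; exact: expR_ge0.
- apply: (measurable_vecof (f := fun v => expR (c * dot v v))).
  apply: cont_exp; apply: cont_mul; first exact: cont_cst.
  by apply: cont_dot; exact: cont_id.
Qed.

(** The Cameron-Martin formula, from translation invariance of [gint]. *)
Lemma gauss_shift_ge0 n (f : 'cV[R]_n -> R) (k : 'cV[R]_n) : cge0 f ->
  (\int[stdgauss n]_t (f (vecof t + k)%R)%:E =
   \int[stdgauss n]_t (f (vecof t) * expR (dot (vecof t) k - dot k k / 2))%:E)%E.
Proof.
move=> hf; have [cf f0] := hf.
have cd (T : topologicalType) (u : T -> 'cV[R]_n) : continuous u -> continuous (fun v => expR (- (dot (u v) (u v) / 2))).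
  by move=> cu; apply: cont_exp; apply: cont_opp; apply: cont_mul; [exact: cont_dot|exact: cont_cst].
have h : cge0 (fun v => f v * expR (- (dot (v - k) (v - k) / 2))).
  split=> [|v]; last by rewrite mulr_ge0// expR_ge0.
  by apply: cont_mul => //; apply: cd; apply: cont_addv; [exact: cont_id|exact: cont_cstT].
have := gint_shift k h.
rewrite (@eq_gint _ _ _ (fun v => f (v + k) * expR (- (dot v v / 2)))) => [e|v]; last by rewrite addrK.
transitivity (gint (fun v => f (v + k) * expR (- (dot v v / 2)))).
  by apply: eq_integral => t _; rewrite -mulrA -expRD addNr expR0 mulr1.
rewrite e; apply: eq_integral => t _; congr EFin; rewrite -mulrA -expRD; congr (_ * expR _).
rewrite !dotBl !dotBr (dotC k (vecof t)); by field.
Qed.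

Definition gnorm n (t : n.-tuple BR) : R := 1 + nrm1 (vecof t).

Lemma gnorm_ge0 n (t : n.-tuple BR) : 0 <= gnorm t.
Proof. by rewrite addr_ge0// nrm1_ge0. Qed.

Lemma cont_nrm1 n : continuous (fun v : 'cV[R]_n => nrm1 v).
Proof.
apply: cont_sum => i; apply: (@cont_comp _ _ _ (fun v : 'cV[R]_n => v i 0)); first exact: coord_continuous.
exact: norm_continuous.
Qed.

Lemma measurable_gnorm n : measurable_fun setT (@gnorm n).
Proof.
apply: (measurable_vecof (f := fun v => 1 + nrm1 v)); apply: cont_add; first exact: cont_cst.
exact: cont_nrm1.
Qed.

Lemma nrm1_sqr_le n (v : 'cV[R]_n) : nrm1 v ^+ 2 <= n%:R * dot v v.
Proof.
have -> : nrm1 v = dot (\col_i `|v i 0|) (const_mx 1).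
  by apply: eq_bigr => i _; rewrite !mxE mulr1.
apply: le_trans (dot_CS _ _) _; rewrite mulrC; apply: ler_pM; rewrite ?dot_ge0//.
  rewrite /dot (eq_bigr (fun=> 1)) ?sumr_const ?card_ord// => i _; by rewrite !mxE mulr1.
by apply: ler_sum => i _; rewrite !mxE -normrM ger0_norm// -expr2 sqr_ge0.
Qed.

(** Since [nrm1 v ^ 2 <= n * dot v v], this choice keeps [gk n * gnorm t] below a constant plus a
    quarter of the squared norm, within the range of [L1_gauss_exp]. *)
Definition gk n : R := (4 * n.+1%:R)^-1.

Lemma gk_gt0 n : 0 < gk n.
Proof. by rewrite invr_gt0 mulr_gt0// ltr0n. Qed.

Lemma L1_gnorm n : L1 (stdgauss n) (fun t => expR (gk n * gnorm t)).
Proof.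
have g0 := gk_gt0 n; have nn : (0 : R) < n.+1%:R by rewrite ltr0n.
have c1 : (4^-1 : R) < 2^-1 by rewrite ltf_pV2 ?posrE// ltr_nat.
apply: (L1_le _ (L1Z (expR (gk n * 2)) (L1_gauss_exp n c1))) => [|t].
  apply: measurableT_comp => //; apply: measurable_funM => //; exact: measurable_gnorm.
rewrite ger0_norm ?expR_ge0// -expRD ler_expR.
have h := nrm1_sqr_le (vecof t); set y := nrm1 _ in h *; set z := dot _ _ in h *.
have h1 : 1 + y <= 2 + y ^+ 2 by have := sqr_ge0 (y - 1); have := sqr_ge0 y; nra.
have z0 : 0 <= z := dot_ge0 _.
have h2 : n%:R * z <= n.+1%:R * z by rewrite ler_wpM2r// ler_nat.
apply: (@le_trans _ _ (gk n * (2 + n.+1%:R * z))).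
  by rewrite ler_wpM2l ?(ltW g0)//; rewrite /gnorm -/y; lra.
rewrite mulrDr lerD2l /gk le_eqVlt; apply/orP; left; apply/eqP; field.
by rewrite gt_eqF.
Qed.

(** The log-likelihood ratio of the Gaussian shift model. It is its own quadratic expansion, so the
    score identities deliver the Gaussian moments, and [exp_jet] will serve for mollification. *)
Definition gD n (k : 'cV[R]_n) (t : n.-tuple BR) := dot (vecof t) k - dot k k / 2.

Lemma gD0 n (t : n.-tuple BR) : gD 0 t = 0.
Proof. by rewrite /gD !dot0r mul0r subrr. Qed.

Lemma gD_qform n (k : 'cV[R]_n) t : gD k t = dot (vecof t) k + qform (- (2^-1)%:M) k.
Proof. by rewrite /gD /qform mulNmx mul_scalar_mx dotNr dotZr mulrC. Qed.

Lemma gauss_coeffs n : coeffs (@gnorm n) 1 (@gD n) (@vecof R n) (fun=> - (2^-1)%:M).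
Proof.
split; last by move=> t h _; rewrite gD_qform subrr normr0 mulr_ge0 ?gnorm_ge0// exprn_ge0// nrm1_ge0.
split.
- move=> i; under eq_fun do rewrite mxE; exact: measurable_tnth.
- by [].
- by move=> _; rewrite linearN /= tr_scalar_mx.
- by move=> t i; apply: le_trans (coord_le_nrm1 _ _) _; rewrite lerDr.
- move=> t i j; rewrite !mxE normrN; case: (_ == _); last by rewrite mulr0n normr0 gnorm_ge0.
  rewrite mulr1n ger0_norm ?invr_ge0//; have := nrm1_ge0 (vecof t); rewrite /gnorm; lra.
Qed.

Lemma gauss_jet n t : jet 1 (@gnorm n t) (fun h => @gD n h t).
Proof.
have [[_ _ _ ha hq] hD] := gauss_coeffs n.
exists 0, (vecof t), (- (2^-1)%:M); split => //.
- by rewrite normr0 gnorm_ge0.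
- by move=> h hh; rewrite add0r; exact: hD.
Qed.

Lemma measurable_gD n k : measurable_fun setT (@gD n k).
Proof.
apply: (measurable_vecof (f := fun v => dot v k - dot k k / 2)).
apply: cont_add; last exact: cont_cst.
by apply: cont_dot; [exact: cont_id|exact: cont_cstT].
Qed.

Lemma gauss_exp_mean n k : Ex (stdgauss n) (fun t => expR (gD k t)) = 1.
Proof.
have h : cge0 (fun _ : 'cV[R]_n => 1 : R) by split=> //; exact: cont_cst.
have := gauss_shift_ge0 k h; rewrite /Ex => e.
transitivity (fine (\int[stdgauss n]_t (1 : R)%:E)%E).
  by congr fine; rewrite e; apply: eq_integral => t _; rewrite mul1r.
by rewrite integral_prob_cst.
Qed.

(** The two score identities for the shift model: the quadratic coefficient is the constant matrix
    minus one half, so the second one fixes the variance. *)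
Lemma gauss_moments n (h : 'cV[R]_n) : Ex (stdgauss n) (fun t => dot (vecof t) h) = 0 /\
  Ex (stdgauss n) (fun t => dot (vecof t) h ^+ 2) = dot h h.
Proof.
have [e1 e2] := score_identity (gk_gt0 n) ltr01 (@measurable_gnorm n) (@gnorm_ge0 n)
  (L1_gnorm n) (@measurable_gD n) (@gD0 n) (@gauss_jet n) (gauss_coeffs n) (lexx _) (fun h _ => gauss_exp_mean h) h.
split=> //; rewrite -[RHS]mulr1.
have Lq : L1 (stdgauss n) (fun t => dot (vecof t) h ^+ 2).
  exact: (L1_dota_sqr (gk_gt0 n) (@measurable_gnorm n) (@gnorm_ge0 n) (L1_gnorm n) (gauss_coeffs n)).
have -> : Ex (stdgauss n) (fun t => dot (vecof t) h ^+ 2) =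
  2 * Ex (stdgauss n) (fun t => qform (- (2^-1)%:M) h + dot (vecof t) h ^+ 2 / 2) - 2 * qform (- (2^-1)%:M) h.
  have -> : (fun t => qform (- (2^-1)%:M) h + dot (vecof t) h ^+ 2 / 2) =
    (fun t : n.-tuple BR => qform (- (2^-1)%:M) h + 2^-1 * dot (vecof t) h ^+ 2).
    by apply/funext => t; rewrite [_ / 2]mulrC.
  rewrite ExD; [|exact: L1_cst|exact: L1Z].
  by rewrite Ex_cst ExZ//; field.
by rewrite e2 /qform mulNmx mul_scalar_mx dotNr dotZr; field.
Qed.

End GaussianVector.

(** * Central limit theorem *)

Section RandomVectorOps.
Context {R : realType} {p : nat}.
Local Notation V := 'cV[R]_p.

Definition mvec {d} {S : measurableType d} (Y : S -> V) := forall i, measurable_fun setT (fun s => Y s i 0).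

Lemma mvec_comp {d} {S : measurableType d} (Y : S -> V) (f : V -> R) : mvec Y -> continuous f ->
  measurable_fun setT (fun s => f (Y s)).
Proof.
move=> mY cf; have := measurable_continuous_col mY cf.
by congr measurable_fun; apply/funext => s; congr f; apply/colP => i; rewrite mxE.
Qed.

Lemma mvecD {d} {S : measurableType d} (Y Z : S -> V) : mvec Y -> mvec Z -> mvec (fun s => Y s + Z s).
Proof. by move=> mY mZ i; under eq_fun do rewrite mxE; exact: measurable_funD. Qed.

Lemma mvecZ {d} {S : measurableType d} c (Y : S -> V) : mvec Y -> mvec (fun s => c *: Y s).
Proof. by move=> mY i; under eq_fun do rewrite mxE; exact: measurable_funM. Qed.

Lemma mvec_cst {d} {S : measurableType d} (x : V) : mvec (fun _ : S => x).
Proof. by move=> i. Qed.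

Lemma mvec_mulmx {d} {S : measurableType d} (A : 'M[R]_p) (Y : S -> V) : mvec Y -> mvec (fun s => A *m Y s).
Proof.
move=> mY i; under eq_fun do rewrite mxE.
by apply: measurable_sum => j; exact: measurable_funM.
Qed.

Lemma mvec_sum {d} {S : measurableType d} n (Y : nat -> S -> V) : (forall i, mvec (Y i)) ->
  mvec (fun s => \sum_(i < n) Y i s).
Proof.
move=> mY i; under eq_fun do rewrite summxE.
by apply: measurable_sum => j; exact: mY.
Qed.

Lemma mvec_comp_fun {d d'} {S : measurableType d} {S' : measurableType d'} (Y : S -> V) (U : S' -> S) :
  mvec Y -> measurable_fun setT U -> mvec (fun s => Y (U s)).
Proof. by move=> mY mU i; exact: (measurableT_comp (mY i) mU). Qed.

Lemma mvec_vecof : mvec (@vecof R p).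
Proof. by move=> i; under eq_fun do rewrite mxE; exact: measurable_tnth. Qed.

(** Bounded Lipschitz test functions. Both constants are preserved by the convolution operators
    below, so they stay fixed under iteration. *)
Definition BL (M L : R) (f : V -> R) :=
  (forall x, `|f x| <= M) /\ (forall x y, `|f x - f y| <= L * nrm1 (x - y)).

Lemma BL_cont M L f : BL M L f -> continuous f.
Proof.
move=> [_ fL] x; apply/(@cvgrPdist_le _ _ _ (nbhs x) (nbhs_filter x)) => e e0.
have c : continuous (fun y : V => `|L| * nrm1 (x - y)).
  apply: cont_mul; first exact: cont_cst.
  apply: (@cont_comp _ _ _ (fun y : V => x - y)); last exact: cont_nrm1.
  apply: continuous_mx => i j; have -> : (fun y : V => (x - y) i j) = (fun y => x i j - y i j).
    by apply/funext => y; rewrite !mxE.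
  by apply: cont_add; [exact: cont_cst|apply: cont_opp; exact: coord_continuous].
have /(@cvgrPdist_le _ _ _ (nbhs x) (nbhs_filter x)) /(_ e e0) := c x.
rewrite subrr nrm10 mulr0; apply: filterS => y; rewrite sub0r normrN => h.
apply: le_trans (fL x y) _; apply: le_trans (ler_norm _) _; rewrite normrM (ger0_norm (nrm1_ge0 _)).
exact: le_trans (ler_norm _) h.
Qed.

Section Operator.
Context {d} {S : measurableType d}.
Variables (mu : probability S R) (Y : S -> V).
Hypothesis mY : mvec Y.

(** Convolution with the law of [Y]. Sums of independent vectors become iterates of such
    operators. *)
Definition op (f : V -> R) (x : V) : R := Ex mu (fun s => f (x + Y s)).

Lemma op_meas (f : V -> R) x : continuous f -> measurable_fun setT (fun s => f (x + Y s)).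
Proof. by move=> cf; apply: mvec_comp cf; apply: mvecD => //; exact: mvec_cst. Qed.

Lemma op_L1 M L f x : BL M L f -> L1 mu (fun s => f (x + Y s)).
Proof. by move=> hf; apply: (@L1_bounded _ _ _ _ _ M) => [|s]; [exact: op_meas (BL_cont hf)|case: hf]. Qed.

Lemma op_close M L M' L' f g c : BL M L f -> BL M' L' g -> (forall x, `|f x - g x| <= c) ->
  forall x, `|op f x - op g x| <= c.
Proof.
move=> hf hg fg x; have Lf := op_L1 x hf; have Lg := op_L1 x hg.
by rewrite /op -ExB//; apply: Ex_bounded => //; exact: (L1_meas (L1B Lf Lg)).
Qed.

Lemma op_BL M L f : BL M L f -> BL M L (op f).
Proof.
move=> hf; have [fM fL] := hf; split=> [x|x y].
  by apply: Ex_bounded => //; apply: op_meas; exact: BL_cont hf.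
have Lx := op_L1 x hf; have Ly := op_L1 y hf.
rewrite /op -ExB//; apply: Ex_bounded => [|s]; first exact: (L1_meas (L1B Lx Ly)).
by apply: le_trans (fL _ _) _; rewrite opprD addrACA subrr addr0.
Qed.

Lemma iter_op_BL M L f k : BL M L f -> BL M L (iter k op f).
Proof. by move=> hf; elim: k => [//|k IH] /=; exact: op_BL. Qed.

End Operator.

Lemma op_comm {d d'} {S : measurableType d} {S' : measurableType d'} (mu : probability S R) (nu : probability S' R)
  (Y : S -> V) (Z : S' -> V) M L f : mvec Y -> mvec Z -> BL M L f ->
  op mu Y (op nu Z f) = op nu Z (op mu Y f).
Proof.
move=> mY mZ hf; apply/funext => x; have [fM _] := hf; have cf := BL_cont hf.
have mF : measurable_fun setT (fun z : S * S' => f (x + Y z.1 + Z z.2)).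
  apply: mvec_comp cf; apply: mvecD; last by exact: (mvec_comp_fun mZ measurable_snd).
  by apply: mvecD; [exact: mvec_cst|exact: (mvec_comp_fun mY measurable_fst)].
have := Ex_fubini mu nu mF (fun z => fM _); rewrite /op /= => ->.
by congr Ex; apply/funext => s; congr Ex; apply/funext => t; rewrite addrAC.
Qed.

Lemma iter_op_comm {d d'} {S : measurableType d} {S' : measurableType d'} (mu : probability S R) (nu : probability S' R)
  (Y : S -> V) (Z : S' -> V) M L f k : mvec Y -> mvec Z -> BL M L f ->
  op mu Y (iter k (op nu Z) f) = iter k (op nu Z) (op mu Y f).
Proof.
move=> mY mZ hf; elim: k => [//|k IH] /=.
by rewrite -IH; apply: (op_comm mu nu mY mZ (iter_op_BL nu mZ k hf)).
Qed.

(** The two operators commute and contract the uniform norm, so replacing one factor of the iterate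
    at a time costs [c] each. *)
Lemma trotter {d d'} {S : measurableType d} {S' : measurableType d'} (mu : probability S R) (nu : probability S' R)
  (Y : S -> V) (Z : S' -> V) M L f c k : mvec Y -> mvec Z -> BL M L f ->
  (forall x, `|op mu Y f x - op nu Z f x| <= c) ->
  forall x, `|iter k (op mu Y) f x - iter k (op nu Z) f x| <= k%:R * c.
Proof.
move=> mY mZ hf hc; elim: k => [|k IH] x /=; first by rewrite subrr normr0 mul0r.
set g := iter k (op nu Z) f; have hg : BL M L g by exact: iter_op_BL.
have h1 : `|op mu Y (iter k (op mu Y) f) x - op mu Y g x| <= k%:R * c.
  exact: (op_close mu mY (iter_op_BL mu mY k hf) hg IH).
have h2 : `|op mu Y g x - op nu Z g x| <= c.
  rewrite /g (iter_op_comm mu nu k mY mZ hf) -iterS iterSr.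
  elim: k x {IH g hg h1} => [|k IHk] x; first exact: hc.
  have b1 := iter_op_BL nu mZ k (op_BL mu mY hf); have b2 := iter_op_BL nu mZ k (op_BL nu mZ hf).
  exact: (op_close nu mZ b1 b2 IHk).
rewrite -natr1 mulrDl mul1r; apply: le_trans (lerD h1 h2).
by rewrite -[X in `|X|](subrKA (op mu Y g x)); exact: ler_normD.
Qed.

Definition smooth (K : R) (f : V -> R) := forall x, exists a q, forall h,
  `|f (x + h) - (f x + dot a h + qform q h)| <= K * nrm1 h ^+ 3.

Section SecondOrder.
Context {d} {S : measurableType d}.
Variables (mu : probability S R) (Y : S -> V) (C : 'M[R]_p).
Hypothesis mY : mvec Y.
Hypothesis LY1 : forall h, L1 mu (fun s => dot (Y s) h).
Hypothesis LY2 : forall h, L1 mu (fun s => dot (Y s) h ^+ 2).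
Hypothesis LY3 : L1 mu (fun s => nrm1 (Y s) ^+ 3).
Hypothesis sC : C^T = C.
Hypothesis EY1 : forall h, Ex mu (fun s => dot (Y s) h) = 0.
Hypothesis EY2 : forall h, Ex mu (fun s => dot (Y s) h ^+ 2) = qform C h.

Lemma mul_coord_polar (y : V) i j : y i 0 * y j 0 =
  2^-1 * (dot y (delta_mx i 0 + delta_mx j 0) ^+ 2 - dot y (delta_mx i 0) ^+ 2 - dot y (delta_mx j 0) ^+ 2).
Proof. by rewrite dotDr !dot_delta; field. Qed.

Lemma cov_coord i j : L1 mu (fun s => Y s i 0 * Y s j 0) /\ Ex mu (fun s => Y s i 0 * Y s j 0) = C i j.
Proof.
have L : L1 mu (fun s => dot (Y s) (delta_mx i 0 + delta_mx j 0) ^+ 2 - dot (Y s) (delta_mx i 0) ^+ 2 - dot (Y s) (delta_mx j 0) ^+ 2).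
  by apply: L1B => //; exact: L1B.
under eq_fun do rewrite mul_coord_polar.
split; first exact: L1Z.
rewrite ExZ// ExB//; last exact: L1B.
by rewrite ExB// !EY2 (qform_polar i j sC) mulrC.
Qed.

Lemma qform_sum (q : 'M[R]_p) (y : V) : qform q y = \sum_i \sum_j q i j * (y i 0 * y j 0).
Proof.
rewrite /qform /dot; apply: eq_bigr => i _; rewrite mxE mulr_sumr; apply: eq_bigr => j _.
by rewrite mulrCA.
Qed.

Lemma Ex_qform (q : 'M[R]_p) : L1 mu (fun s => qform q (Y s)) /\
  Ex mu (fun s => qform q (Y s)) = \sum_i \sum_j q i j * C i j.
Proof.
under eq_fun do rewrite qform_sum.
have L i j : L1 mu (fun s => q i j * (Y s i 0 * Y s j 0)) by apply: L1Z; case: (cov_coord i j).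
split; first by apply: L1_sum => i; exact: L1_sum.
rewrite Ex_sum => [|i]; last exact: L1_sum.
apply: eq_bigr => i _; rewrite Ex_sum//; apply: eq_bigr => j _.
by have [L' E] := cov_coord i j; rewrite ExZ// E.
Qed.

(** Only the first two moments of [Y] enter up to order [e ^ 3]; two laws with equal mean and
    covariance therefore give nearly equal operators. *)
Lemma op_expand M L K f e x a q : BL M L f -> 0 <= e ->
  (forall h, `|f (x + h) - (f x + dot a h + qform q h)| <= K * nrm1 h ^+ 3) ->
  `|op mu (fun s => e *: Y s) f x - (f x + e ^+ 2 * \sum_i \sum_j q i j * C i j)| <=
    e ^+ 3 * (K * Ex mu (fun s => nrm1 (Y s) ^+ 3)).
Proof.
move=> hf e0 hx; have [Lq Eq] := Ex_qform q.
have Lf : L1 mu (fun s => f (x + e *: Y s)) by exact: (op_L1 mu (mvecZ e mY) x hf).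
have La : L1 mu (fun s => dot a (Y s)) by under eq_fun do rewrite dotC; exact: LY1.
have Ea : Ex mu (fun s => dot a (Y s)) = 0 by under eq_fun do rewrite dotC; exact: EY1.
pose g s := f x + (e * dot a (Y s) + e ^+ 2 * qform q (Y s)).
have Lg : L1 mu g by apply: L1D; [exact: L1_cst|apply: L1D; exact: L1Z].
have <- : Ex mu g = f x + e ^+ 2 * \sum_i \sum_j q i j * C i j.
  rewrite ExD; [|exact: L1_cst|by apply: L1D; exact: L1Z].
  by rewrite Ex_cst ExD ?ExZ ?Ea ?mulr0 ?add0r ?Eq//; exact: L1Z.
rewrite -ExB// -ExZ// -ExZ; last exact: L1Z.
apply: Ex_abs_le => [||s].
- exact: (L1_meas (L1B Lf Lg)).
- by apply: L1Z; exact: L1Z.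
rewrite /g; have := hx (e *: Y s); rewrite dotZr qform_scale nrm1Z (ger0_norm e0) -addrA.
by have -> : K * (e * nrm1 (Y s)) ^+ 3 = e ^+ 3 * (K * nrm1 (Y s) ^+ 3) by ring.
Qed.

End SecondOrder.

Local Notation gam := (stdgauss p).

Lemma mvec_gauss (A : 'M[R]_p) : mvec (fun t : p.-tuple (measurableTypeR R) => A *m vecof t).
Proof. by apply: mvec_mulmx; exact: mvec_vecof. Qed.

Lemma op_gauss_semigroup (A : 'M[R]_p) (a b c : R) M L f : BL M L f -> 0 < c -> a ^+ 2 + b ^+ 2 = c ^+ 2 ->
  op gam (fun t => a *: (A *m vecof t)) (op gam (fun t => b *: (A *m vecof t)) f) =
  op gam (fun t => c *: (A *m vecof t)) f.
Proof.
move=> hf c0 abc; have [fM _] := hf; have cf := BL_cont hf; apply/funext => x.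
(* The shift makes the test function nonnegative, as the Tonelli identities require; it is
   subtracted again at the end. *)
pose g v := f v + M.
have hg : cge0 g.
  split=> [|v]; first by apply: cont_add => //; exact: cont_cst.
  by have := fM v; rewrite ler_norml /g => /andP[h _]; lra.
have mA e : mvec (fun t : p.-tuple (measurableTypeR R) => e *: (A *m vecof t)) by apply: mvecZ; exact: mvec_gauss.
have opM (Y : p.-tuple (measurableTypeR R) -> V) y : mvec Y -> Ex gam (fun t => g (y + Y t)) = op gam Y f y + M.
  move=> mY; rewrite /g (ExD (op_L1 gam mY y hf) (L1_cst _ _)).
  by rewrite Ex_cst.
have Lg (Y : p.-tuple (measurableTypeR R) -> V) y : mvec Y -> L1 gam (fun t => g (y + Y t)).
  by move=> mY; apply: L1D; [exact: (op_L1 gam mY y hf)|exact: L1_cst].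
have h := stdgauss_semigroup A x hg c0 abc.
apply: (addIr M); rewrite -(opM _ x (mA c)).
have hf' := op_BL gam (mA b) hf.
have -> : op gam (fun t => a *: (A *m vecof t)) (op gam (fun t => b *: (A *m vecof t)) f) x + M =
   Ex gam (fun s => op gam (fun t => b *: (A *m vecof t)) f (x + a *: (A *m vecof s)) + M).
  by rewrite (ExD (op_L1 gam (mA a) x hf') (L1_cst _ _)) Ex_cst.
rewrite /Ex -h; congr fine; apply: eq_integral => s _.
by rewrite -(opM _ _ (mA b)) (EFin_Ex (Lg _ _ (mA b))).
Qed.

Lemma iter_op_gauss (A : 'M[R]_p) n k M L f : BL M L f -> (0 < n)%N ->
  iter k.+1 (op gam (fun t => (Num.sqrt n%:R)^-1 *: (A *m vecof t))) f =
  op gam (fun t => Num.sqrt (k.+1%:R / n%:R) *: (A *m vecof t)) f.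
Proof.
move=> hf n0; have nR : (0 : R) < n%:R by rewrite ltr0n.
elim: k => [|k IH].
  by rewrite /= div1r sqrtrV// ltW.
rewrite iterS IH; apply: (op_gauss_semigroup A hf).
  by rewrite sqrtr_gt0 divr_gt0// ltr0n.
rewrite exprVn !sqr_sqrtr ?divr_ge0 ?ler0n//.
rewrite -[k.+2]addn1 natrD; set m := k.+1%:R; by field; rewrite gt_eqF.
Qed.

Section IIDSum.
Context {d d1} {Omega : measurableType d} {T : measurableType d1}.
Variables (P : probability Omega R) (Q : probability T R) (X : nat -> Omega -> T).
Hypothesis mX : forall i, measurable_fun setT (X i).
Hypothesis lawX : forall i A, measurable A -> P (X i @^-1` A) = Q A.
Hypothesis indX : forall (F : {fset nat}) (A : nat -> set T), (forall i, measurable (A i)) ->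
  P (\bigcap_(i in [set` F]) (X i @^-1` A i)) = (\prod_(i <- F) P (X i @^-1` A i))%E.
Variables (Y : T -> V).
Hypothesis mY : mvec Y.

(** The last summand is independent of the tuple of the earlier ones, so integrating it first
    replaces [f] by [op Q Y f]. *)
Lemma iter_op_sum n M L f x : BL M L f ->
  Ex P (fun w => f (x + \sum_(i < n) Y (X i w))) = iter n (op Q Y) f x.
Proof.
elim: n f => [|n IH] f hf.
  by under eq_fun do rewrite big_ord0 addr0; rewrite Ex_cst.
rewrite iterSr -IH; last exact: op_BL.
pose pf := mfun_Sub (mem_set (measurable_prefix mX (n := n))).
pose Q1 := distribution P pf.
have ind A B : measurable A -> measurable B -> P (prefix X n @^-1` A `&` X n @^-1` B) = (Q1 A * Q B)%E.
  by move=> mA mB; rewrite (indep_prefix mX lawX indX mA mB).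
have [fM _] := hf; have cf := BL_cont hf.
pose F (z : n.-tuple T * T) := f (x + \sum_(i < n) Y (tnth z.1 i) + Y z.2).
have mS : mvec (fun t : n.-tuple T => \sum_(i < n) Y (tnth t i)).
  move=> j; under eq_fun do rewrite summxE.
  by apply: measurable_sum => i; apply: (measurableT_comp (mY j)); exact: measurable_tnth.
have mF : measurable_fun setT F.
  apply: mvec_comp cf; apply: mvecD; last exact: (mvec_comp_fun mY measurable_snd).
  by apply: mvecD; [exact: mvec_cst|exact: (mvec_comp_fun mS measurable_fst)].
have h := Ex_pair_bounded (measurable_prefix mX (n := n)) (mX n) ind mF (fun z => fM _).
transitivity (Ex P (fun w => F (prefix X n w, X n w))).
  congr Ex; apply/funext => w; rewrite /F /= big_ord_recr /= addrA; congr (f (_ + _ + _)).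
  by apply: eq_bigr => i _; rewrite tnth_mktuple.
rewrite h.
have hT := op_BL Q mY hf.
have LT : L1 Q1 (fun u => op Q Y f (x + \sum_(i < n) Y (tnth u i))) by exact: (op_L1 Q1 mS x hT).
transitivity (Ex Q1 (fun u => op Q Y f (x + \sum_(i < n) Y (tnth u i)))); first by [].
have lw A : measurable A -> P (prefix X n @^-1` A) = Q1 A by [].
have tr := Ex_transfer (measurable_prefix mX (n := n)) lw LT.
rewrite -tr; congr Ex; apply/funext => w; congr (op _ _ _ (_ + _)).
by apply: eq_bigr => i _; rewrite tnth_mktuple.
Qed.

End IIDSum.

Lemma gnorm_pow j : L1 gam (fun t => @gnorm R p t ^+ j).
Proof. exact: (L1_pow (gk_gt0 p) (@measurable_gnorm R p) (@gnorm_ge0 R p) (L1_gnorm p)). Qed.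

(** By the Cameron-Martin formula a shift of the argument becomes the factor [expR (gD k t)], whose
    expansion is known. All smoothness comes from the Gaussian; of [f] only the bound [M] enters the
    constant. *)
Lemma mollify_smooth M L f s : 0 < s -> BL M L f -> exists K, smooth K (op gam (fun t => s *: vecof t) f).
Proof.
move=> s0 hf; have [fM _] := hf; have cf := BL_cont hf.
have M0 : 0 <= M by apply: le_trans (fM 0).
pose W := @exp_rem R _ _ (@gnorm R p) (gk p).
have LW : L1 gam W := L1_exp_rem (gk_gt0 p) (@measurable_gnorm R p) (@gnorm_ge0 R p) (L1_gnorm p).
have W0 : 0 <= Ex gam W.
  apply: Ex_ge0 => t; rewrite /W /exp_rem; have g0 := gnorm_ge0 t.
  rewrite addr_ge0 ?exprn_ge0// addr_ge0//; first by rewrite mulr_ge0 ?exprn_ge0.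
  by rewrite mulr_ge0// mulr_ge0 ?exprn_ge0 ?expR_ge0.
have mvs : mvec (fun t : p.-tuple (measurableTypeR R) => s *: vecof t) by apply: mvecZ; exact: mvec_vecof.
have mf x : measurable_fun setT (fun t => f (x + s *: vecof t)).
  exact: (op_meas mvs x cf).
(* For [nrm1 k <= r] both hypotheses of [exp_jet] hold. *)
pose r : R := Num.min 1 (gk p / 6).
have r0 : 0 < r by rewrite lt_min ltr01 divr_gt0// gk_gt0.
pose E1 : R := Ex gam (fun t => @gnorm R p t ^+ 1); pose E2 : R := Ex gam (fun t => @gnorm R p t ^+ 2).
have E10 : 0 <= E1 by apply: Ex_ge0 => t; rewrite exprn_ge0 ?gnorm_ge0.
have E20 : 0 <= E2 by apply: Ex_ge0 => t; rewrite exprn_ge0 ?gnorm_ge0.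
(* The first term bounds the remainder for [nrm1 k <= r]. For larger [k] the values of the function,
   the linear and the quadratic term are bounded separately and converted into multiples of
   [nrm1 k ^ 3]. *)
pose K := M * Ex gam W + (2 * M / r ^+ 3 + M * E1 / r ^+ 2 + M * (E1 + E2) / r).
have K0 : 0 <= K.
  by rewrite /K !addr_ge0 ?mulr_ge0 ?invr_ge0 ?exprn_ge0 ?addr_ge0 ?(ltW r0)//.
have [[mga mgq _ _ _] _] := gauss_coeffs (R := R) p.
pose q0 : 'M[R]_p := - (2^-1)%:M.
exists (K * s^-1 ^+ 3) => x.
pose fx t := f (x + s *: vecof t).
pose av : V := \col_i Ex gam (fun t => fx t * vecof t i 0).
pose qv : 'M[R]_p := \matrix_(i, j) Ex gam (fun t => fx t * (q0 i j + vecof t i 0 * vecof t j 0 / 2)).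
have Lfx g : L1 gam g -> L1 gam (fun t => fx t * g t).
  move=> Lg; apply: (L1_le _ (L1Z M (L1_norm Lg))) => [|t].
    by apply: measurable_funM; [exact: mf|exact: L1_meas Lg].
  by rewrite normrM ler_wpM2r// fM.
have Lfx_le g c : L1 gam g -> (forall t, `|g t| <= c t) -> L1 gam c -> `|Ex gam (fun t => fx t * g t)| <= M * Ex gam c.
  move=> Lg gc Lc; rewrite -ExZ//; apply: Ex_abs_le => [||t].
  - exact: (L1_meas (Lfx _ Lg)).
  - exact: L1Z.
  - by rewrite normrM; apply: ler_pM => //; exact: fM.
have Lc i : L1 gam (fun t : p.-tuple (measurableTypeR R) => vecof t i 0).
  have -> : (fun t : p.-tuple (measurableTypeR R) => vecof t i 0) = (fun t : p.-tuple (measurableTypeR R) => dot (vecof t) (delta_mx i 0)).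
    by apply/funext => t; rewrite dot_delta.
  exact: (L1_dota (gk_gt0 p) (@measurable_gnorm R p) (@gnorm_ge0 R p) (L1_gnorm p) (gauss_coeffs p)).
have Lcc i j : L1 gam (fun t : p.-tuple (measurableTypeR R) => vecof t i 0 * vecof t j 0).
  apply: (L1_le _ (gnorm_pow 2)) => [|t]; first by apply: measurable_funM; exact: mvec_vecof.
  rewrite normrM expr2; have h i' : `|vecof t i' 0| <= gnorm t.
    by apply: le_trans (coord_le_nrm1 _ _) _; rewrite lerDr.
  by apply: ler_pM.
have Lq i j : L1 gam (fun t : p.-tuple (measurableTypeR R) => q0 i j + vecof t i 0 * vecof t j 0 / 2).
  apply: L1D; first exact: L1_cst.
  by under eq_fun do rewrite mulrC; exact: L1Z.
have La k := L1_dota (gk_gt0 p) (@measurable_gnorm R p) (@gnorm_ge0 R p) (L1_gnorm p) (gauss_coeffs p) k.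
have Lb k := L1_second (gk_gt0 p) (@measurable_gnorm R p) (@gnorm_ge0 R p) (L1_gnorm p) (gauss_coeffs p) k.
have Ea k : dot av k = Ex gam (fun t => fx t * dot (vecof t) k).
  have -> : (fun t => fx t * dot (vecof t) k) = (fun t => \sum_i k i 0 * (fx t * vecof t i 0)).
    by apply/funext => t; rewrite mulr_sumr; apply: eq_bigr => i _; ring.
  rewrite Ex_sum; last by move=> i; apply: L1Z; exact: Lfx.
  by apply: eq_bigr => i _; rewrite ExZ ?mxE 1?mulrC//; exact: Lfx.
have Eq k : qform qv k = Ex gam (fun t => fx t * (qform q0 k + dot (vecof t) k ^+ 2 / 2)).
  have -> : (fun t => fx t * (qform q0 k + dot (vecof t) k ^+ 2 / 2)) =
    (fun t => \sum_i \sum_j (k i 0 * k j 0) * (fx t * (q0 i j + vecof t i 0 * vecof t j 0 / 2))).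
    apply/funext => t.
    have -> : dot (vecof t) k ^+ 2 = \sum_i \sum_j (k i 0 * k j 0) * (vecof t i 0 * vecof t j 0).
      rewrite expr2 /dot mulr_suml; apply: eq_bigr => i _; rewrite mulr_sumr; apply: eq_bigr => j _; ring.
    rewrite qform_sum mulr_suml -big_split mulr_sumr; apply: eq_bigr => i _.
    rewrite mulr_suml -big_split mulr_sumr; apply: eq_bigr => j _ /=; ring.
  rewrite Ex_sum; last by move=> i; apply: L1_sum => j; apply: L1Z; exact: Lfx.
  rewrite qform_sum; apply: eq_bigr => i _.
  rewrite Ex_sum; last by move=> j; apply: L1Z; exact: Lfx.
  by apply: eq_bigr => j _; rewrite (ExZ _ (Lfx _ (Lq i j))) [qv i j]mxE mulrC.
have Efx : op gam (fun t => s *: vecof t) f x = Ex gam (fun t => fx t * 1) by rewrite /op; under [in RHS]eq_fun do rewrite mulr1.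
exists (s^-1 *: av), (s^-1 ^+ 2 *: qv) => h.
pose k := s^-1 *: h.
have hk : h = s *: k by rewrite /k scalerA mulfV ?gt_eqF// scale1r.
have nk : nrm1 k = s^-1 * nrm1 h by rewrite nrm1Z ger0_norm// invr_ge0 ltW.
have -> : K * s^-1 ^+ 3 * nrm1 h ^+ 3 = K * nrm1 k ^+ 3 by rewrite nk; ring.
have -> : dot (s^-1 *: av) h = dot av k by rewrite dotZl /k dotZr.
have -> : qform (s^-1 ^+ 2 *: qv) h = qform qv k by rewrite qformZl /k qform_scale.
have kp := nrm1_ge0 k.
have [kr|kr] := leP (nrm1 k) r.
  have [k1 k6] : nrm1 k <= 1 /\ 3 * nrm1 k <= gk p / 2.
    move: kr; rewrite /r le_min => /andP[h1 h2]; split => //; lra.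
  have key t := exp_jet ltr01 (@gnorm_ge0 R p) (@gD0 R p) (@gauss_jet R p) (gauss_coeffs p) (lexx 1) t k1 k6.
  have shift : op gam (fun t => s *: vecof t) f (x + h) = Ex gam (fun t => fx t * expR (gD k t)).
    pose g v := f (x + s *: v) + M.
    have hg : cge0 g.
      split=> [|v]; last by have := fM (x + s *: v); rewrite ler_norml /g => /andP[h' _]; lra.
      apply: cont_add; last exact: cont_cst.
      apply: (@cont_comp _ _ _ (fun v : V => x + s *: v)) => //.
      by apply: cont_addv; [exact: cont_cstT|apply: cont_scale; [exact: cont_cst|exact: cont_id]].
    have Le : L1 gam (fun t => expR (gD k t)).
      have -> : (fun t => expR (gD k t)) = (fun t => (expR (gD k t) - 1 - (dot (vecof t) k + (qform q0 k + dot (vecof t) k ^+ 2 / 2)))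
         + (dot (vecof t) k + (qform q0 k + dot (vecof t) k ^+ 2 / 2)) + 1) by apply/funext => t; ring.
      apply: L1D; last exact: L1_cst.
      apply: L1D; last exact: L1D.
      apply: (L1_le _ (L1Z (nrm1 k ^+ 3) LW)) => [|t]; last exact: key.
      apply: measurable_funB; last exact: (L1_meas (L1D (La k) (Lb k))).
      by apply: measurable_funB => //; apply: measurableT_comp => //; exact: measurable_gD.
    have e1 : Ex gam (fun t => g (vecof t + k)) = Ex gam (fun t => g (vecof t) * expR (gD k t)).
      by rewrite /Ex (gauss_shift_ge0 k hg).
    have e2 : Ex gam (fun t => g (vecof t + k)) = op gam (fun t => s *: vecof t) f (x + h) + M.
      rewrite -[M in RHS](Ex_cst gam) /op -ExD; [|exact: (op_L1 gam mvs _ hf)|exact: L1_cst].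
      by congr Ex; apply/funext => t; rewrite /g hk scalerDr [s *: vecof t + _]addrC addrA.
    have e3 : Ex gam (fun t => g (vecof t) * expR (gD k t)) = Ex gam (fun t => fx t * expR (gD k t)) + M.
      have -> : (fun t => g (vecof t) * expR (gD k t)) = (fun t => fx t * expR (gD k t) + M * expR (gD k t)).
        by apply/funext => t; rewrite /g mulrDl.
      rewrite ExD; [|exact: Lfx|exact: L1Z].
      by rewrite ExZ// gauss_exp_mean mulr1.
    by apply: (addIr M); rewrite -e2 e1 e3.
  have Le : L1 gam (fun t => expR (gD k t) - 1 - (dot (vecof t) k + (qform q0 k + dot (vecof t) k ^+ 2 / 2))).
    apply: (L1_le _ (L1Z (nrm1 k ^+ 3) LW)) => [|t]; last exact: key.
    apply: measurable_funB; last exact: (L1_meas (L1D (La k) (Lb k))).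
    by apply: measurable_funB => //; apply: measurableT_comp => //; exact: measurable_gD.
  have Le1 : L1 gam (fun t => expR (gD k t)).
    have -> : (fun t => expR (gD k t)) = (fun t => (expR (gD k t) - 1 - (dot (vecof t) k + (qform q0 k + dot (vecof t) k ^+ 2 / 2)))
       + (dot (vecof t) k + (qform q0 k + dot (vecof t) k ^+ 2 / 2)) + 1) by apply/funext => t; ring.
    apply: L1D; last exact: L1_cst.
    by apply: L1D => //; exact: L1D.
  rewrite shift Ea Eq Efx.
  have -> : Ex gam (fun t => fx t * expR (gD k t)) - (Ex gam (fun t => fx t * 1) + Ex gam (fun t => fx t * dot (vecof t) k) +
     Ex gam (fun t => fx t * (qform q0 k + dot (vecof t) k ^+ 2 / 2))) =
     Ex gam (fun t => fx t * (expR (gD k t) - 1 - (dot (vecof t) k + (qform q0 k + dot (vecof t) k ^+ 2 / 2)))).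
    have A0 := Lfx _ (L1_cst gam 1); have A1 := Lfx _ (La k); have A2 := Lfx _ (Lb k).
    rewrite -(ExD A0 A1) -(ExD (L1D A0 A1) A2) -(ExB (Lfx _ Le1) (L1D (L1D A0 A1) A2)).
    by congr Ex; apply/funext => t; ring.
  apply: le_trans (Lfx_le _ (fun t => nrm1 k ^+ 3 * W t) Le key (L1Z _ LW)) _.
  rewrite ExZ// /K mulrDl mulrCA [X in _ <= X + _]mulrC lerDl.
  by rewrite mulr_ge0 ?exprn_ge0// !addr_ge0 ?mulr_ge0 ?invr_ge0 ?exprn_ge0 ?addr_ge0 ?(ltW r0).
have b0 y : `|op gam (fun t => s *: vecof t) f y| <= M by apply: Ex_bounded => // t; exact: (op_meas mvs y cf).
have b1 : `|dot av k| <= M * E1 * nrm1 k.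
  rewrite Ea -mulrA [E1 * _]mulrC -ExZ; last exact: gnorm_pow.
  apply: Lfx_le => //; last by apply: L1Z; exact: gnorm_pow.
  move=> t; rewrite expr1; apply: le_trans (dot_bound _ _ (N := gnorm t)) _; last by rewrite mulrC.
  by move=> i; apply: le_trans (coord_le_nrm1 _ _) _; rewrite lerDr.
have b2 : `|qform qv k| <= M * (E1 + E2) * nrm1 k ^+ 2.
  rewrite Eq -mulrA [_ * nrm1 k ^+ 2]mulrC -ExD; [|exact: gnorm_pow|exact: gnorm_pow].
  rewrite -ExZ; last by apply: L1D; exact: gnorm_pow.
  apply: Lfx_le => //; last by apply: L1Z; apply: L1D; exact: gnorm_pow.
  move=> t; have [[_ _ _ ha hq] _] := gauss_coeffs (R := R) p.
  have h1 : `|qform q0 k| <= gnorm t * nrm1 k ^+ 2 by apply: qform_bound => i j; exact: (hq t).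
  have h2 : `|dot (vecof t) k| <= gnorm t * nrm1 k by apply: dot_bound; exact: ha.
  have h3 : dot (vecof t) k ^+ 2 <= (gnorm t * nrm1 k) ^+ 2.
    by rewrite -[X in X <= _]ger0_norm ?sqr_ge0// normrX; apply: lerXn2r; rewrite ?nnegrE ?mulr_ge0 ?gnorm_ge0.
  apply: le_trans (ler_normD _ _) _; rewrite (@ger0_norm _ (_ / 2)) ?divr_ge0 ?sqr_ge0//.
  have h4 : 0 <= dot (vecof t) k ^+ 2 by exact: sqr_ge0.
  have -> : nrm1 k ^+ 2 * (gnorm t ^+ 1 + gnorm t ^+ 2) = gnorm t * nrm1 k ^+ 2 + (gnorm t * nrm1 k) ^+ 2 by ring.
  lra.
have rk : r <= nrm1 k by exact: ltW.
have t1 : 2 * M <= 2 * M / r ^+ 3 * nrm1 k ^+ 3.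
  rewrite -mulrA [_^-1 * _]mulrC ler_peMr ?mulr_ge0// ler_pdivlMr ?exprn_gt0// mul1r.
  by apply: lerXn2r; rewrite ?nnegrE ?(ltW r0).
have t2 : M * E1 * nrm1 k <= M * E1 / r ^+ 2 * nrm1 k ^+ 3.
  have -> : M * E1 / r ^+ 2 * nrm1 k ^+ 3 = M * E1 * nrm1 k * (nrm1 k ^+ 2 / r ^+ 2) by ring.
  rewrite ler_peMr ?mulr_ge0// ler_pdivlMr ?exprn_gt0// mul1r.
  by apply: lerXn2r; rewrite ?nnegrE ?(ltW r0).
have t3 : M * (E1 + E2) * nrm1 k ^+ 2 <= M * (E1 + E2) / r * nrm1 k ^+ 3.
  have -> : M * (E1 + E2) / r * nrm1 k ^+ 3 = M * (E1 + E2) * nrm1 k ^+ 2 * (nrm1 k / r) by ring.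
  by rewrite ler_peMr ?mulr_ge0 ?exprn_ge0 ?addr_ge0// ler_pdivlMr// mul1r.
have tW : 0 <= M * Ex gam W * nrm1 k ^+ 3 by rewrite !mulr_ge0 ?exprn_ge0.
have n1 := b0 (x + h); have n2 := b0 x.
rewrite /K mulrDl; apply: le_trans (ler_normB _ _) _.
have : `|op gam (fun t => s *: vecof t) f x + dot av k + qform qv k| <= M + M * E1 * nrm1 k + M * (E1 + E2) * nrm1 k ^+ 2.
  by apply: le_trans (ler_normD _ _) _; apply: lerD => //; apply: le_trans (ler_normD _ _) _; exact: lerD.
rewrite !mulrDl; clear -t1 t2 t3 tW n1 n2; lra.
Qed.

End RandomVectorOps.

(** * Weak convergence from Lipschitz test functions *)

Section WeakConvergence.
Context {R : realType} {p : nat}.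
Local Notation V := 'cV[R]_p.

Lemma nrm1N (v : V) : nrm1 (- v) = nrm1 v.
Proof. by apply: eq_bigr => i _; rewrite mxE normrN. Qed.

Lemma nrm1_sub_sym (u v : V) : nrm1 (u - v) = nrm1 (v - u).
Proof. by rewrite -nrm1N opprB. Qed.

Section InfConvolution.
Variables (f : V -> R) (M : R).
Hypothesis cf : continuous f.
Hypothesis fM : forall x, `|f x| <= M.

(** The Pasch-Hausdorff envelope: a minorant of [f] with Lipschitz constant [k], which tends to [f]
    pointwise as [k] grows when [f] is bounded and continuous. *)
Definition infconv (k : R) (x : V) : R := inf [set f y + k * nrm1 (x - y) | y in [set: V]].

Lemma infconv_has_inf k x : 0 <= k -> has_inf [set f y + k * nrm1 (x - y) | y in [set: V]].
Proof.
move=> k0; split; first by exists (f x + k * nrm1 (x - x)), x.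
exists (- M) => _ [y _ <-]; have := fM y; rewrite ler_norml => /andP[h _].
by rewrite -[- M]addr0 lerD// mulr_ge0// nrm1_ge0.
Qed.

Lemma infconv_le k x y : 0 <= k -> infconv k x <= f y + k * nrm1 (x - y).
Proof. by move=> k0; apply: ge_inf; [case: (infconv_has_inf x k0)|exists y]. Qed.

Lemma infconv_le_self k x : 0 <= k -> infconv k x <= f x.
Proof. by move=> k0; have := infconv_le x x k0; rewrite subrr nrm10 mulr0 addr0. Qed.

Lemma infconv_ge k x c : 0 <= k -> (forall y, c <= f y + k * nrm1 (x - y)) -> c <= infconv k x.
Proof.
move=> k0 h; apply: lb_le_inf; first by case: (infconv_has_inf x k0).
by move=> _ [y _ <-].
Qed.

Lemma infconv_BL k : 0 <= k -> BL M k (infconv k).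
Proof.
move=> k0; split=> [x|].
  rewrite ler_norml; apply/andP; split.
    apply: infconv_ge => // y; have := fM y; rewrite ler_norml => /andP[h _].
    by rewrite -[- M]addr0 lerD// mulr_ge0// nrm1_ge0.
  apply: le_trans (infconv_le_self x k0) _; exact: le_trans (ler_norm _) (fM x).
have main x y : infconv k x - k * nrm1 (x - y) <= infconv k y.
  apply: infconv_ge => // z; rewrite lerBlDr; apply: le_trans (infconv_le x z k0) _.
  rewrite -addrA lerD2l -mulrDr ler_wpM2l//.
  have -> : x - z = (y - z) + (x - y) by rewrite [RHS]addrC addrA subrK.
  exact: nrm1D.
move=> x y; rewrite ler_norml; apply/andP; split.
  by have := main y x; rewrite nrm1_sub_sym; lra.
by have := main x y; lra.
Qed.

Lemma nbhs_nrm1 (x : V) (A : set V) : nbhs x A -> exists2 e, 0 < e & forall y, nrm1 (x - y) < e -> A y.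
Proof.
move=> /nbhs_ballP [e /= e0 h]; exists e => // y hy; apply: h; split=> // i j.
rewrite (ord1 j) /ball /=; apply: le_lt_trans hy.
have -> : x i 0 - y i 0 = (x - y) i 0 by rewrite !mxE.
exact: coord_le_nrm1.
Qed.

Lemma infconv_cvg x : infconv n%:R x @[n --> \oo] --> f x.
Proof.
apply/cvgrPdist_le => e e0.
have M0 : 0 <= M by apply: le_trans (fM 0).
have /(@cvgrPdist_le _ _ _ (nbhs x) (nbhs_filter x) f (f x)) h0 : f y @[y --> x] --> f x by exact: cf.
have /nbhs_nrm1 [r r0 hr] := h0 _ e0.
near=> n.
have nr : 2 * M / r <= n%:R by near: n; exact: nbhs_infty_ger.
rewrite ger0_norm ?subr_ge0 ?infconv_le_self// lerBlDr -lerBlDl.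
apply: infconv_ge => // y; have [h|h] := ltP (nrm1 (x - y)) r.
  have := hr y h; rewrite ler_norml => /andP[_ h2].
  have : 0 <= n%:R * nrm1 (x - y) by rewrite mulr_ge0// nrm1_ge0.
  lra.
have h2 : 2 * M <= n%:R * nrm1 (x - y).
  have : 2 * M <= n%:R * r by rewrite -ler_pdivrMr.
  have : n%:R * r <= n%:R * nrm1 (x - y) by rewrite ler_wpM2l.
  lra.
have := fM y; have := fM x; rewrite !ler_norml => /andP[_ h3] /andP[h4 _].
lra.
Unshelve. all: end_near. Qed.

End InfConvolution.

Section WeakOfLipschitz.
Context {d d1} {Omega : measurableType d} {S : measurableType d1}.
Variables (P : probability Omega R) (mu : probability S R) (Y : nat -> Omega -> V) (Z : S -> V).
Hypothesis mY : forall n, (0 < n)%N -> mvec (Y n).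
Hypothesis mZ : mvec Z.
Hypothesis H : forall M L g, BL M L g -> Ex P (fun w => g (Y n w)) @[n --> \oo] --> Ex mu (fun s => g (Z s)).

(** One Lipschitz minorant with nearly the same limiting mean suffices. Applied to [f] and to [- f],
    this one-sided bound gives convergence without any tightness argument. *)
Lemma weak_lower (f : V -> R) (M e : R) : continuous f -> (forall x, `|f x| <= M) -> 0 < e ->
  \forall n \near \oo, Ex mu (fun s => f (Z s)) - e <= Ex P (fun w => f (Y n w)).
Proof.
move=> cf fM e0.
have e20 : 0 < e / 2 by lra.
have BLk k : BL M k%:R (infconv f k%:R) := infconv_BL fM (ler0n R k).
have c1 : Ex mu (fun s => infconv f k%:R (Z s)) @[k --> \oo] --> Ex mu (fun s => f (Z s)).
  apply: (@Ex_dominated _ _ _ mu _ _ (fun=> M)) => //.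
  - by move=> k; apply: mvec_comp mZ (BL_cont (BLk k)).
  - exact: mvec_comp mZ cf.
  - exact: L1_cst.
  - by move=> s; exact: infconv_cvg.
  - by move=> k s; case: (BLk k).
have /cvgrPdist_le /(_ _ e20) [k _ hk] := c1.
have {}hk := hk k (leqnn k).
have /cvgrPdist_le /(_ _ e20) h2 := H (BLk k).
near=> n.
have n0 : (0 < n)%N by near: n; exists 1%N.
have h2' : `|Ex mu (fun s => infconv f k%:R (Z s)) - Ex P (fun w => infconv f k%:R (Y n w))| <= e / 2 by near: n.
have h3 : Ex P (fun w => infconv f k%:R (Y n w)) <= Ex P (fun w => f (Y n w)).
  apply: Ex_le => [||w]; last exact: infconv_le_self.
  - apply: (@L1_bounded _ _ _ _ _ M) => [|w]; last by case: (BLk k).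
    exact: mvec_comp (mY n0) (BL_cont (BLk k)).
  - by apply: (@L1_bounded _ _ _ _ _ M) => // ; exact: mvec_comp (mY n0) cf.
move: hk h2'; rewrite !ler_norml => /andP[_ g1] /andP[_ g2]; lra.
Unshelve. all: end_near. Qed.

Lemma weak_of_BL (f : V -> R) (M : R) : continuous f -> (forall x, `|f x| <= M) ->
  Ex P (fun w => f (Y n w)) @[n --> \oo] --> Ex mu (fun s => f (Z s)).
Proof.
move=> cf fM; apply/cvgrPdist_le => e e0.
have h1 := weak_lower cf fM e0.
have h2 := weak_lower (cont_opp cf) (fun x => ltac:(by rewrite normrN; exact: fM)) e0.
near=> n.
have n0 : (0 < n)%N by near: n; exists 1%N.
have g1 : Ex mu (fun s => f (Z s)) - e <= Ex P (fun w => f (Y n w)) by near: n.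
have g2 : Ex mu (fun s => - f (Z s)) - e <= Ex P (fun w => - f (Y n w)) by near: n.
move: g2; rewrite !ExN.
- by rewrite ler_norml => g2; apply/andP; split; lra.
- by apply: (@L1_bounded _ _ _ _ _ M) => //; exact: mvec_comp (mY n0) cf.
- by apply: (@L1_bounded _ _ _ _ _ M) => //; exact: mvec_comp mZ cf.
Unshelve. all: end_near. Qed.

End WeakOfLipschitz.

Section Slutsky.
Context {d} {Omega : measurableType d}.
Variables (P : probability Omega R) (Y Y' : nat -> Omega -> V).
Hypothesis mY : forall n, (0 < n)%N -> mvec (Y n).
Hypothesis mY' : forall n, (0 < n)%N -> mvec (Y' n).
Hypothesis YY' : forall e, 0 < e -> Pr P [set w | e < nrm1 (Y n w - Y' n w)] @[n --> \oo] --> 0.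

Lemma measurable_gt (g : Omega -> R) e : measurable_fun setT g -> measurable [set w | e < g w].
Proof.
move=> mg; have -> : [set w | e < g w] = g @^-1` `]e, +oo[%classic.
  by apply/seteqP; split=> x /=; rewrite in_itv/= andbT.
by rewrite -[X in measurable X]setTI; exact: mg.
Qed.

Lemma measurable_ge (g : Omega -> R) e : measurable_fun setT g -> measurable [set w | e <= g w].
Proof.
move=> mg; have -> : [set w | e <= g w] = g @^-1` `[e, +oo[%classic.
  by apply/seteqP; split=> x /=; rewrite in_itv/= andbT.
by rewrite -[X in measurable X]setTI; exact: mg.
Qed.

Lemma slutsky_BL M L g (l : R) : BL M L g -> Ex P (fun w => g (Y' n w)) @[n --> \oo] --> l ->
  Ex P (fun w => g (Y n w)) @[n --> \oo] --> l.
Proof.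
move=> hg hl; have [gM gL] := hg; have cg := BL_cont hg.
have M0 : 0 <= M by apply: le_trans (gM 0).
apply/cvgrPdist_le => e e0.
pose r := e / (3 * (`|L| + 1)).
have L1p : 0 < `|L| + 1 by rewrite ltr_wpDl.
have r0 : 0 < r by rewrite divr_gt0// mulr_gt0.
have e3 : 0 < e / 3 by lra.
have e4 : 0 < e / (3 * (2 * M + 1)) by rewrite divr_gt0// mulr_gt0//; lra.
have /cvgrPdist_le /(_ _ e3) h1 := hl.
have /cvgrPdist_le /(_ _ e4) h2 := YY' r0.
near=> n.
have n0 : (0 < n)%N by near: n; exists 1%N.
have h1' : `|l - Ex P (fun w => g (Y' n w))| <= e / 3 by near: n.
have h2' : `|0 - Pr P [set w | r < nrm1 (Y n w - Y' n w)]| <= e / (3 * (2 * M + 1)) by near: n.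
pose B := [set w | r < nrm1 (Y n w - Y' n w)].
have mB : measurable B.
  apply: measurable_gt; apply: (mvec_comp (f := fun v => nrm1 v)); last exact: cont_nrm1.
  by apply: mvecD; [exact: mY|move=> i; under eq_fun do rewrite mxE; apply: measurableT_comp => //; exact: mY'].
have LgY : L1 P (fun w => g (Y n w)) by apply: (@L1_bounded _ _ _ _ _ M) => //; exact: mvec_comp (mY n0) cg.
have LgY' : L1 P (fun w => g (Y' n w)) by apply: (@L1_bounded _ _ _ _ _ M) => //; exact: mvec_comp (mY' n0) cg.
have LB : L1 P (\1_B : Omega -> R).
  apply: (@L1_bounded _ _ _ _ _ 1) => // w; rewrite indicE.
  by case: (_ \in _); rewrite /= ?normr0 ?normr1.
have h3 : `|Ex P (fun w => g (Y n w)) - Ex P (fun w => g (Y' n w))| <= e / 3 + 2 * M * Pr P B.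
  rewrite -ExB// -Ex_indic// -(Ex_cst P (e / 3)) -ExZ// -ExD; [|exact: L1_cst|exact: L1Z].
  apply: Ex_abs_le => [||w].
  - exact: (L1_meas (L1B LgY LgY')).
  - by apply: L1D; [exact: L1_cst|exact: L1Z].
  - rewrite indicE; case: (boolP (w \in B)) => [_|].
      rewrite mulr1; apply: le_trans (ler_normB _ _) _.
      by have := gM (Y n w); have := gM (Y' n w); lra.
    rewrite mulr0 addr0 notin_setE /B /= => /negP; rewrite -leNgt => hw.
    apply: le_trans (gL _ _) _; apply: (@le_trans _ _ ((`|L| + 1) * r)).
      apply: le_trans (ler_norm _) _; rewrite normrM (ger0_norm (nrm1_ge0 _)).
      by apply: ler_pM => //; [exact: nrm1_ge0|lra].
    rewrite /r le_eqVlt; apply/orP; left; apply/eqP; field; exact: lt0r_neq0.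
move: h2'; rewrite sub0r normrN ger0_norm ?Pr_ge0// -/B => h5.
have h4 : 2 * M * Pr P B <= e / 3.
  apply: (@le_trans _ _ ((2 * M + 1) * Pr P B)); first by rewrite ler_wpM2r ?Pr_ge0//; lra.
  have -> : e / 3 = (2 * M + 1) * (e / (3 * (2 * M + 1))) by field; rewrite gt_eqF//; lra.
  by rewrite ler_wpM2l//; lra.
have -> : l - Ex P (fun w => g (Y n w)) = (l - Ex P (fun w => g (Y' n w))) - (Ex P (fun w => g (Y n w)) - Ex P (fun w => g (Y' n w))) by ring.
apply: le_trans (ler_normB _ _) _; lra.
Unshelve. all: end_near. Qed.

End Slutsky.

Lemma nrm1_mulmx (A : 'M[R]_p) (v : V) : nrm1 (A *m v) <= (\sum_i \sum_j `|A i j|) * nrm1 v.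
Proof.
rewrite mulr_suml; apply: ler_sum => i _; rewrite mxE mulr_suml.
apply: le_trans (ler_norm_sum _ _ _) _; apply: ler_sum => j _.
by rewrite normrM ler_wpM2l// coord_le_nrm1.
Qed.

Section CentralLimit.
Context {d d1} {Omega : measurableType d} {T : measurableType d1}.
Variables (P : probability Omega R) (Q : probability T R) (X : nat -> Omega -> T).
Hypothesis mX : forall i, measurable_fun setT (X i).
Hypothesis lawX : forall i A, measurable A -> P (X i @^-1` A) = Q A.
Hypothesis indX : forall (F : {fset nat}) (A : nat -> set T), (forall i, measurable (A i)) ->
  P (\bigcap_(i in [set` F]) (X i @^-1` A i)) = (\prod_(i <- F) P (X i @^-1` A i))%E.
Variables (Y : T -> V) (C : 'M[R]_p).
Hypothesis mY : mvec Y.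
Hypothesis LY1 : forall h, L1 Q (fun s => dot (Y s) h).
Hypothesis LY2 : forall h, L1 Q (fun s => dot (Y s) h ^+ 2).
Hypothesis LY3 : L1 Q (fun s => nrm1 (Y s) ^+ 3).
Hypothesis pC : psd C.
Hypothesis EY1 : forall h, Ex Q (fun s => dot (Y s) h) = 0.
Hypothesis EY2 : forall h, Ex Q (fun s => dot (Y s) h ^+ 2) = qform C h.
Local Notation gam := (stdgauss p).
Local Notation A := (sqrtmx C).
Let G (t : p.-tuple (measurableTypeR R)) := A *m vecof t.

Lemma gauss_vec_facts : [/\ (forall h, L1 gam (fun t => dot (G t) h)), (forall h, L1 gam (fun t => dot (G t) h ^+ 2)),
  L1 gam (fun t => nrm1 (G t) ^+ 3), (forall h, Ex gam (fun t => dot (G t) h) = 0) &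
  (forall h, Ex gam (fun t => dot (G t) h ^+ 2) = qform C h)].
Proof.
have [[sA _] AA] := sqrtmxP pC.
have dG t h : dot (G t) h = dot (vecof t) (A *m h) by rewrite dotC dot_mulmxr sA dotC.
have La := L1_dota (gk_gt0 p) (@measurable_gnorm R p) (@gnorm_ge0 R p) (L1_gnorm p) (gauss_coeffs p).
have La2 := L1_dota_sqr (gk_gt0 p) (@measurable_gnorm R p) (@gnorm_ge0 R p) (L1_gnorm p) (gauss_coeffs p).
split=> [h|h||h|h].
- by under eq_fun do rewrite dG; exact: La.
- by under eq_fun do rewrite dG; exact: La2.
- apply: (L1_le _ (L1Z ((\sum_i \sum_j `|A i j|) ^+ 3) (gnorm_pow 3))) => [|t].
    apply: measurable_funX; apply: (mvec_comp (f := fun v => nrm1 v)); [exact: mvec_gauss|exact: cont_nrm1].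
  have s0 : 0 <= \sum_i \sum_j `|A i j| by apply: sumr_ge0 => i _; exact: sumr_ge0.
  rewrite ger0_norm ?exprn_ge0 ?nrm1_ge0// -exprMn; apply: lerXn2r; rewrite ?nnegrE ?nrm1_ge0 ?mulr_ge0 ?gnorm_ge0//.
  by apply: le_trans (nrm1_mulmx _ _) _; rewrite ler_wpM2l// /gnorm lerDr.
- by under eq_fun do rewrite dG; case: (gauss_moments (A *m h)).
- under eq_fun do rewrite dG; rewrite (gauss_moments (A *m h)).2.
  by rewrite dot_mulmxr sA dotC mulmxA AA.
Qed.

(** After mollification, exchanging one summand for its Gaussian counterpart costs order
    [n ^ (- 3 / 2)], so [n] exchanges cost order [n ^ (- 1 / 2)]. The mollification error is uniform
    in [n]. *)
Lemma clt_BL M L f : BL M L f ->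
  Ex P (fun w => f ((Num.sqrt n%:R)^-1 *: \sum_(i < n) Y (X i w))) @[n --> \oo] --> Ex gam (fun t => f (G t)).
Proof.
move=> hf; have [fM fL] := hf; have cf := BL_cont hf; have [sC _] := pC.
have [LG1 LG2 LG3 EG1 EG2] := gauss_vec_facts.
apply/cvgrPdist_le => e e0.
pose E1 : R := Ex gam (fun t => @gnorm R p t ^+ 1).
have E10 : 0 <= E1 by apply: Ex_ge0 => t; rewrite exprn_ge0 ?gnorm_ge0.
(* At this scale the mollified function stays within [e / 4] of [f]; the other half is split between
   the second mollification error and the exchange error, with a quarter to spare. *)
pose s := e / (4 * (`|L| + 1) * (E1 + 1)).
have s0 : 0 < s by rewrite divr_gt0// !mulr_gt0// ltr_wpDl.
have mvs : mvec (fun t : p.-tuple (measurableTypeR R) => s *: vecof t) by apply: mvecZ; exact: mvec_vecof.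
pose fs := op gam (fun t => s *: vecof t) f.
have hfs : BL M L fs by exact: op_BL.
have [K hK] := mollify_smooth s0 hf.
have close x : `|f x - fs x| <= e / 4.
  rewrite -(Ex_cst gam (f x)) /fs /op -ExB; [|exact: L1_cst|exact: (op_L1 gam mvs x hf)].
  have Lg : L1 gam (fun t => `|L| * s * @gnorm R p t ^+ 1) by apply: L1Z; exact: gnorm_pow.
  apply: (@le_trans _ _ (`|L| * s * E1)).
    rewrite -ExZ; last exact: gnorm_pow.
    apply: Ex_abs_le => // [|t]; first exact: (L1_meas (L1B (L1_cst _ _) (op_L1 gam mvs x hf))).
    apply: le_trans (fL _ _) _; rewrite opprD addrA subrr sub0r nrm1N nrm1Z (gtr0_norm s0).
    apply: le_trans (ler_norm _) _; rewrite normrM (ger0_norm (mulr_ge0 (ltW s0) (nrm1_ge0 _))) mulrA.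
    apply: ler_wpM2l; first by rewrite mulr_ge0 ?(ltW s0).
    by have := lerDr (nrm1 (vecof t)) (1 : R); rewrite /gnorm GRing.expr1 ler01.
  apply: (@le_trans _ _ ((`|L| + 1) * s * (E1 + 1))).
    apply: ler_pM => //; last by rewrite lerDl.
      by rewrite mulr_ge0 ?(ltW s0).
    by rewrite ler_wpM2r ?(ltW s0)// lerDl.
  rewrite /s le_eqVlt; apply/orP; left; apply/eqP; field.
  by rewrite !gt_eqF// ltr_wpDl.
pose C3 := K * Ex Q (fun x => nrm1 (Y x) ^+ 3) + K * Ex gam (fun t => nrm1 (G t) ^+ 3).
near=> n.
have n0 : (0 < n)%N by near: n; exists 1%N.
have nR : (0 : R) < n%:R by rewrite ltr0n.
pose r := (Num.sqrt n%:R)^-1 : R.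
have sn0 : 0 < Num.sqrt (n%:R : R) by rewrite sqrtr_gt0.
have r0 : 0 <= r by rewrite invr_ge0 ltW.
have step x : `|op Q (fun x => r *: Y x) fs x - op gam (fun t => r *: G t) fs x| <= r ^+ 3 * C3.
  have [a [q hx]] := hK x.
  have h1 := op_expand mY LY1 LY2 LY3 sC EY1 EY2 hfs r0 hx.
  have h2 := op_expand (mvec_gauss A) LG1 LG2 LG3 sC EG1 EG2 hfs r0 hx.
  rewrite /C3 mulrDr.
  set z := fs x + _ in h1 h2.
  have -> : op Q (fun x => r *: Y x) fs x - op gam (fun t => r *: G t) fs x =
    (op Q (fun x => r *: Y x) fs x - z) - (op gam (fun t => r *: G t) fs x - z) by ring.
  exact: le_trans (ler_normB _ _) (lerD h1 h2).
have mrG : mvec (fun t => r *: G t) by apply: mvecZ; exact: mvec_gauss.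
have main := trotter n (mvecZ r mY) mrG hfs step 0.
have e1 : iter n (op Q (fun x => r *: Y x)) fs 0 = Ex P (fun w => fs (r *: \sum_(i < n) Y (X i w))).
  rewrite -(iter_op_sum mX lawX indX (mvecZ r mY) n 0 hfs).
  by congr Ex; apply/funext => w; rewrite add0r scaler_sumr.
(* By the semigroup property [n] Gaussian steps of scale [1 / sqrt n] compose to one step of scale
   1. *)
have e2 : iter n (op gam (fun t => r *: G t)) fs 0 = Ex gam (fun t => fs (G t)).
  case: (n) n0 @r r0 {step mrG main e1 sn0 nR} => // m n0 r r0.
  transitivity (op gam (fun t => Num.sqrt (m.+1%:R / m.+1%:R) *: G t) fs 0).
    exact: (congr1 (fun g => g 0) (iter_op_gauss A m hfs n0)).
  have -> : m.+1%:R / m.+1%:R = 1 :> R by rewrite divff// pnatr_eq0.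
  by rewrite sqrtr1 /op; congr Ex; apply/funext => t; rewrite add0r scale1r.
rewrite e1 e2 in main.
have mS : mvec (fun w => r *: \sum_(i < n) Y (X i w)).
  apply: mvecZ; apply: (@mvec_sum _ _ _ _ n (fun i w => Y (X i w))) => i; exact: mvec_comp_fun.
have mG : mvec G by exact: mvec_gauss.
have tail (d2 : measure_display) (S2 : measurableType d2) (m2 : probability S2 R) (Z : S2 -> V) : mvec Z ->
    `|Ex m2 (fun w => f (Z w)) - Ex m2 (fun w => fs (Z w))| <= e / 4.
  move=> mZ.
  have L1f : L1 m2 (fun w => f (Z w)) by apply: (@L1_bounded _ _ _ _ _ M) => //; exact: mvec_comp mZ cf.
  have L1fs : L1 m2 (fun w => fs (Z w)).
    by apply: (@L1_bounded _ _ _ _ _ M) => [|t]; [exact: mvec_comp mZ (BL_cont hfs)|case: hfs].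
  by rewrite -ExB//; apply: Ex_bounded => //; exact: (L1_meas (L1B L1f L1fs)).
have t1 := tail _ _ P _ mS; have t2 := tail _ _ gam _ mG.
have nr : n%:R * (r ^+ 3 * C3) <= e / 4.
  have -> : n%:R * (r ^+ 3 * C3) = C3 * r.
    have : n%:R * r ^+ 2 = 1 by rewrite exprVn sqr_sqrtr ?ler0n// divff// gt_eqF.
    by move=> h; transitivity (n%:R * r ^+ 2 * (r * C3)); [ring|rewrite h; ring].
  have h : (4 * `|C3| / e) ^+ 2 <= n%:R by near: n; exact: nbhs_infty_ger.
  have h3 : 4 * `|C3| / e <= Num.sqrt n%:R.
    rewrite -(@ger0_norm _ (4 * `|C3| / e)) ?divr_ge0 ?mulr_ge0 ?(ltW e0)//.
    by rewrite -sqrtr_sqr ler_wsqrtr.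
  apply: le_trans (ler_wpM2r r0 (ler_norm C3)) _.
  by rewrite ler_pdivrMr// mulrC -ler_pdivrMr ?divr_gt0// invf_div mulrA (mulrC _ 4).
have -> : Ex gam (fun t => f (G t)) - Ex P (fun w => f (r *: \sum_(i < n) Y (X i w))) =
  (Ex gam (fun t => f (G t)) - Ex gam (fun t => fs (G t)))
  - (Ex P (fun w => fs (r *: \sum_(i < n) Y (X i w))) - Ex gam (fun t => fs (G t)))
  - (Ex P (fun w => f (r *: \sum_(i < n) Y (X i w))) - Ex P (fun w => fs (r *: \sum_(i < n) Y (X i w)))) by ring.
apply: le_trans (ler_normB _ _) _; apply: le_trans (lerD (ler_normB _ _) (lexx _)) _.
have := le_trans main nr; lra.
Unshelve. all: end_near. Qed.

End CentralLimit.

End WeakConvergence.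

(** * Linearization of the maximizer *)

Section SmallEvents.
Context {R : realType} {d} {Omega : measurableType d} (P : probability Omega R).
Implicit Types (A B : nat -> set Omega) (C : set Omega).

(* The events need not be measurable: the estimator enters through a matrix
   logarithm, whose measurability is never established. *)
Definition small A := forall t : R, 0 < t -> \forall n \near \oo,
  exists C, [/\ measurable C, Pr P C <= t & A n `<=` C].

Lemma small_sub A B : (\forall n \near \oo, A n `<=` B n) -> small B -> small A.
Proof.
move=> AB sB t t0; have h := sB t t0; near=> n.
have [C [mC PC BC]] : exists C, [/\ measurable C, Pr P C <= t & B n `<=` C] by near: n.
by exists C; split=> //; apply: subset_trans BC; near: n.
Unshelve. all: end_near. Qed.

Lemma small_U A B : small A -> small B -> small (fun n => A n `|` B n).
Proof.
move=> sA sB t t0; have t20 : 0 < t / 2 by lra.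
have hA := sA _ t20; have hB := sB _ t20.
near=> n; have [C [mC PC AC]] : exists B : set Omega, [/\ measurable B, Pr P B <= t / 2 & A n `<=` B] by near: n.
have [D [mD PD BD]] : exists D : set Omega, [/\ measurable D, Pr P D <= t / 2 & B n `<=` D] by near: n.
exists (C `|` D); split; [exact: measurableU| |exact: setUSS].
by rewrite [t in _ <= t]splitr; exact: le_trans (PrU P mC mD) (lerD PC PD).
Unshelve. all: end_near. Qed.

Lemma small_bigU (I : Type) (s : seq I) (A : I -> nat -> set Omega) : (forall i, small (A i)) ->
  small (fun n => \big[setU/set0]_(i <- s) A i n).
Proof.
move=> sA; elim: s => [|i s IH].
  by move=> t t0; near=> n; exists set0; rewrite big_nil /Pr measure0; split=> //; exact: ltW.
by apply: small_sub (small_U (sA i) IH); near=> n; rewrite big_cons.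
Unshelve. all: end_near. Qed.

Lemma small_Pr A : (forall n, measurable (A n)) -> Pr P (A n) @[n --> \oo] --> 0 -> small A.
Proof.
move=> mA /cvgrPdist_le h t t0; have ht := h t t0.
near=> n; exists (A n); split=> //.
have : `|0 - Pr P (A n)| <= t by near: n.
by rewrite sub0r normrN ger0_norm ?Pr_ge0.
Unshelve. all: end_near. Qed.

Lemma Pr_small A : (forall n, (0 < n)%N -> measurable (A n)) -> small A -> Pr P (A n) @[n --> \oo] --> 0.
Proof.
move=> mA sA; apply/cvgrPdist_le => e e0; have h := sA e e0.
near=> n; have n0 : (0 < n)%N by near: n; exists 1%N.
have [B [mB PB AB]] : exists B : set Omega, [/\ measurable B, Pr P B <= e & A n `<=` B] by near: n.
rewrite sub0r normrN ger0_norm ?Pr_ge0//; exact: le_trans (Pr_le P (mA n n0) mB AB) PB.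
Unshelve. all: end_near. Qed.

End SmallEvents.

Section LawOfLargeNumbers.
Context {R : realType} {d d1} {Omega : measurableType d} {T : measurableType d1}.
Variables (P : probability Omega R) (Q : probability T R) (X : nat -> Omega -> T).
Hypothesis mX : forall i, measurable_fun setT (X i).
Hypothesis lawX : forall i A, measurable A -> P (X i @^-1` A) = Q A.
Hypothesis indX : forall (F : {fset nat}) (A : nat -> set T), (forall i, measurable (A i)) ->
  P (\bigcap_(i in [set` F]) (X i @^-1` A i)) = (\prod_(i <- F) P (X i @^-1` A i))%E.

Definition avg (f : T -> R) n w := (\sum_(i < n) f (X i w)) / n%:R.

Lemma measurable_avg f n : measurable_fun setT f -> measurable_fun setT (avg f n).
Proof. by move=> mf; apply: measurable_funM; [exact: (measurable_sumX mX n mf)|exact: measurable_cst]. Qed.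

Lemma lln_small f eps : L1 Q f -> L1 Q (fun x => f x ^+ 2) -> 0 < eps ->
  small P (fun n => [set w | eps <= `|avg f n w - Ex Q f|]).
Proof.
move=> Lf Lf2 e0; apply: small_Pr; last exact: (lln mX lawX indX Lf Lf2 e0).
move=> n; apply: measurable_ge; apply: measurableT_comp => //.
by apply: measurable_funB => //; apply: measurable_avg; exact: L1_meas Lf.
Qed.

(* An upper bound function with negative mean rules out a whole set of parameters. *)
Lemma lln_neg f : L1 Q f -> L1 Q (fun x => f x ^+ 2) -> Ex Q f < 0 ->
  small P (fun n => [set w | 0 <= \sum_(i < n) f (X i w)]).
Proof.
move=> Lf Lf2 e0; have e1 : 0 < - Ex Q f by rewrite oppr_gt0.
apply: small_sub (lln_small Lf Lf2 e1); near=> n => w /= h.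
have : 0 <= avg f n w by rewrite divr_ge0.
move=> h2; apply: le_trans (ler_norm _); lra.
Unshelve. all: end_near. Qed.

End LawOfLargeNumbers.

(** * Local quadratic approximation of the likelihood *)

Section Linearization.
Context {R : realType} {d d1} {Omega : measurableType d} {T : measurableType d1} {p : nat}.
Local Notation V := 'cV[R]_p.
Variables (P : probability Omega R) (Q : probability T R) (X : nat -> Omega -> T).
Hypothesis mX : forall i, measurable_fun setT (X i).
Hypothesis lawX : forall i A, measurable A -> P (X i @^-1` A) = Q A.
Hypothesis indX : forall (F : {fset nat}) (A : nat -> set T), (forall i, measurable (A i)) ->
  P (\bigcap_(i in [set` F]) (X i @^-1` A i)) = (\prod_(i <- F) P (X i @^-1` A i))%E.
Variables (N : T -> R) (k0 de : R) (D : V -> T -> R) (a : T -> V) (q : T -> 'M[R]_p) (I : 'M[R]_p).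
Hypothesis k0_gt0 : 0 < k0.
Hypothesis de_gt0 : 0 < de.
Hypothesis de_le1 : de <= 1.
Hypothesis mN : measurable_fun setT N.
Hypothesis N0 : forall x, 0 <= N x.
Hypothesis LN : L1 Q (fun x => expR (k0 * N x)).
Hypothesis haq : coeffs N de D a q.
Hypothesis Ea : forall h, Ex Q (fun x => dot (a x) h) = 0.
Hypothesis Eq : forall h, Ex Q (fun x => qform (q x) h + dot (a x) h ^+ 2 / 2) = 0.
Hypothesis hI : spd I.
Hypothesis EI : forall i j, Ex Q (fun x => a x i 0 * a x j 0) = I i j.

Lemma spd_lower : exists2 c, 0 < c & forall v : V, c * nrm1 v ^+ 2 <= qform I v.
Proof.
have pI : psd I.
  by case: hI => sI pI; split=> // v; have [->|/pI/ltW//] := eqVneq v 0; rewrite qform0r.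
have [[sA _] AA] := sqrtmxP pI; set A := sqrtmx I in sA AA.
have uA : A \in unitmx by have := spd_unitmx hI; rewrite -AA unitmx_mul => /andP[].
pose k : R := \sum_i \sum_j `|invmx A i j|.
have k0' : 0 <= k by apply: sumr_ge0 => i _; exact: sumr_ge0.
pose k2 := k ^+ 2 * p%:R + 1.
have k2p : 0 < k2 by rewrite ltr_wpDl// mulr_ge0// exprn_ge0.
exists k2^-1; first by rewrite invr_gt0.
move=> v; rewrite mulrC ler_pdivrMr//.
have e : qform I v = dot (A *m v) (A *m v) by rewrite dot_mulmxr sA mulmxA AA dotC.
have h1 := nrm1_mulmx (invmx A) (A *m v); rewrite mulKmx// -/k in h1.
have h2 := nrm1_sqr_le (A *m v).
apply: (@le_trans _ _ ((k * nrm1 (A *m v)) ^+ 2)).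
  by apply: lerXn2r; rewrite ?nnegrE ?nrm1_ge0 ?mulr_ge0 ?nrm1_ge0.
rewrite exprMn e /k2; have dv := dot_ge0 (A *m v).
have : k ^+ 2 * nrm1 (A *m v) ^+ 2 <= k ^+ 2 * (p%:R * dot (A *m v) (A *m v)) by rewrite ler_wpM2l ?sqr_ge0.
move=> h; apply: le_trans h _; set dd := dot _ _ in dv *.
have -> : dd * (k ^+ 2 * p%:R + 1) = k ^+ 2 * (p%:R * dd) + dd by ring.
by rewrite lerDl.
Qed.

Definition scoresum n w : V := (Num.sqrt n%:R)^-1 *: \sum_(i < n) a (X i w).

Lemma La_sqr i : L1 Q (fun x => a x i 0 ^+ 2).
Proof.
apply: (L1_le _ (L1_pow k0_gt0 mN N0 LN 2)) => [|x].
  by apply: measurable_funX; case: haq => -[].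
by rewrite normrX; apply: lerXn2r; rewrite ?nnegrE//; case: haq => -[].
Qed.

(** Chebyshev: the normalized score sum has second moments independent of [n], equal to those of one
    score. The bound [M] therefore serves all sample sizes. *)
Lemma scoresum_tight t : 0 < t -> exists2 M, 0 < M & forall n, (0 < n)%N ->
  exists B, [/\ measurable B, Pr P B <= t & [set w | M <= nrm1 (scoresum n w)] `<=` B].
Proof.
move=> t0; pose s : R := \sum_i Ex Q (fun x => a x i 0 ^+ 2).
have s0 : 0 <= s by apply: sumr_ge0 => i _; apply: Ex_ge0 => x; exact: sqr_ge0.
pose M := Num.sqrt (p%:R * (s + 1) / t) + 1.
have M0 : 0 < M by rewrite ltr_wpDl ?sqrtr_ge0.
exists M => // n n0; have nR : (0 : R) < n%:R by rewrite ltr0n.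
pose f w := \sum_i (scoresum n w i 0) ^+ 2.
have eS w i : scoresum n w i 0 ^+ 2 = n%:R^-1 * (\sum_(j < n) a (X j w) i 0) ^+ 2.
  by rewrite mxE summxE exprMn exprVn sqr_sqrtr// ltW.
have La i : L1 Q (fun x => a x i 0).
  by under eq_fun do rewrite -dot_delta; exact: (L1_dota k0_gt0 mN N0 LN haq).
have Ea0 i : Ex Q (fun x => a x i 0) = 0 by rewrite -[RHS](Ea (delta_mx i 0)); congr Ex; apply/funext => x; rewrite dot_delta.
have LE i := Ex_sqr_sum mX lawX indX n (La i) (La_sqr i) (Ea0 i).
have Lf : L1 P f.
  by apply: L1_sum => i; under eq_fun do rewrite eS; apply: L1Z; exact: (LE i).1.
have Ef : Ex P f = s.
  rewrite Ex_sum; last by move=> i; under eq_fun do rewrite eS; apply: L1Z; exact: (LE i).1.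
  apply: eq_bigr => i _; under eq_fun do rewrite eS; rewrite ExZ; last exact: (LE i).1.
  by rewrite (LE i).2 mulKf// gt_eqF.
have c0 : 0 < (s + 1) / t by rewrite divr_gt0// ltr_wpDl.
have f0 w : 0 <= f w by apply: sumr_ge0 => i _; exact: sqr_ge0.
exists [set w | (s + 1) / t <= f w]; split; first exact: measurable_ge (L1_meas Lf).
  apply: le_trans (markov_ge Lf f0 c0) _; rewrite Ef invf_div mulrA ler_pdivrMr; last by rewrite ltr_wpDl.
  by rewrite mulrC ler_wpM2l ?(ltW t0)// lerDl.
move=> w /= hw; have h := nrm1_sqr_le (scoresum n w).
(* In dimension 0 the norm vanishes and cannot reach [M]. *)
have p0 : (0 : R) < p%:R.
  rewrite ltr0n lt0n; apply: contraTN hw => /eqP p0; rewrite -ltNge.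
  by rewrite /nrm1 big1// => i _; have := ltn_ord i; rewrite {2}p0.
rewrite -(ler_pM2l p0); have -> : f w = dot (scoresum n w) (scoresum n w) by apply: eq_bigr => i _; rewrite expr2.
apply: le_trans h; apply: (@le_trans _ _ (M ^+ 2)); last first.
  by apply: lerXn2r => //; rewrite ?nnegrE ?nrm1_ge0// ltW.
have h2 : 0 <= p%:R * (s + 1) / t by rewrite -mulrA mulr_ge0// ltW.
rewrite mulrA -[leLHS](sqr_sqrtr h2); apply: lerXn2r; rewrite ?nnegrE ?sqrtr_ge0 ?(ltW M0)//.
by rewrite /M lerDl.
Qed.

Lemma Lq i j : L1 Q (fun x => q x i j).
Proof.
apply: (L1_le _ (L1_pow k0_gt0 mN N0 LN 1)) => [|x]; first by case: haq => -[].
by rewrite expr1; case: haq => -[].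
Qed.

Lemma Lq_sqr i j : L1 Q (fun x => q x i j ^+ 2).
Proof.
apply: (L1_le _ (L1_pow k0_gt0 mN N0 LN 2)) => [|x].
  by apply: measurable_funX; case: haq => -[].
by rewrite normrX; apply: lerXn2r; rewrite ?nnegrE//; case: haq => -[].
Qed.

Lemma Ex_dota_sqr h : Ex Q (fun x => dot (a x) h ^+ 2) = qform I h.
Proof.
have Laa k l : L1 Q (fun x => a x k 0 * a x l 0).
  apply: (L1_le _ (L1_pow k0_gt0 mN N0 LN 2)) => [|x].
    by apply: measurable_funM; case: haq => -[].
  by rewrite normrM expr2 ler_pM//; case: haq => -[].
transitivity (Ex Q (fun x => \sum_k \sum_l h k 0 * h l 0 * (a x k 0 * a x l 0))).
  congr Ex; apply/funext => x; rewrite expr2 /dot mulr_suml; apply: eq_bigr => k _.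
  by rewrite mulr_sumr; apply: eq_bigr => l _; ring.
rewrite Ex_sum; last by move=> k; apply: L1_sum => l; exact: L1Z.
rewrite /qform /dot; apply: eq_bigr => k _; rewrite Ex_sum; last by move=> l; exact: L1Z.
by rewrite mxE mulr_sumr; apply: eq_bigr => l _; rewrite ExZ// EI; ring.
Qed.

(** [q] plays the role of half the Hessian: polarization turns the second score identity into a
    statement about entries. *)
Lemma Ex_q i j : Ex Q (fun x => q x i j) = - I i j / 2.
Proof.
have sq x : (q x)^T = q x by case: haq => -[].
have LQ := L1_qformq k0_gt0 mN N0 LN haq; have LA := L1_dota_sqr k0_gt0 mN N0 LN haq.
have LA2 h : L1 Q (fun x => dot (a x) h ^+ 2 / 2).
  by under eq_fun do rewrite mulrC; exact: L1Z.
have sI : I^T = I by case: hI.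
have EA := Ex_dota_sqr.
have EQ h : Ex Q (fun x => qform (q x) h) = - qform I h / 2.
  have := Eq h; rewrite ExD//; have -> : (fun x => dot (a x) h ^+ 2 / 2) = (fun x => 2^-1 * dot (a x) h ^+ 2).
    by apply/funext => x; rewrite mulrC.
  by rewrite ExZ// EA; lra.
transitivity (Ex Q (fun x => 2^-1 * (qform (q x) (delta_mx i 0 + delta_mx j 0) - qform (q x) (delta_mx i 0) - qform (q x) (delta_mx j 0)))).
  by congr Ex; apply/funext => x; rewrite (qform_polar i j (sq x)) mulrC.
rewrite ExZ; last by apply: L1B => //; exact: L1B.
rewrite !ExB//; last exact: L1B.
by rewrite !EQ (qform_polar i j sI); ring.
Qed.

Section Deterministic.
Variables (n : nat) (w : Omega) (c kap K eta : R) (that : V).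
Hypothesis n0 : (0 < n)%N.
Hypothesis kap0 : 0 <= kap.
Hypothesis Ic : forall v, c * nrm1 v ^+ 2 <= qform I v.
Hypothesis qn : forall i j, `|avg X (fun x => q x i j) n w + I i j / 2| <= kap.
Hypothesis Nn : avg X N n w <= K.
Hypothesis eta_de : eta <= de.
Let sn := Num.sqrt (n%:R : R).

(** The linear term is exactly the score sum. Replacing the average of [q] by its mean costs [kap],
    and the cubic remainder on the ball of radius [eta] costs [K * eta] relative to the squared
    norm. *)
Lemma quadratic_expansion h : nrm1 h <= eta ->
  `|\sum_(i < n) D h (X i w) - (dot (scoresum n w) (sn *: h) - qform I (sn *: h) / 2)| <=
    (kap + K * eta) * nrm1 (sn *: h) ^+ 2.
Proof.
move=> hh; have nR : (0 : R) < n%:R by rewrite ltr0n.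
have sn0 : 0 < sn by rewrite sqrtr_gt0.
have sn2 : sn ^+ 2 = n%:R by rewrite sqr_sqrtr// ltW.
have hd := le_trans hh eta_de.
pose E : 'M[R]_p := \matrix_(i, j) (avg X (fun x => q x i j) n w + I i j / 2).
have e1 : \sum_(i < n) (dot (a (X i w)) h + qform (q (X i w)) h) =
   dot (scoresum n w) (sn *: h) - qform I (sn *: h) / 2 + qform E (sn *: h).
  rewrite big_split/= !qform_scale sn2 dotZr /scoresum dotZl mulrA divff ?gt_eqF// mul1r -addrA; congr (_ + _).
    rewrite /dot exchange_big/=; apply: eq_bigr => k _; by rewrite summxE mulr_suml.
  have -> : qform E h = qform (n%:R^-1 *: \sum_(i < n) q (X i w) + 2^-1 *: I) h.
    congr qform; apply/matrixP => i j; rewrite !mxE summxE /avg; ring.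
  rewrite qformDl !qformZl.
  have -> : qform (\sum_(i < n) q (X i w)) h = \sum_(i < n) qform (q (X i w)) h.
    by elim/big_rec2: _ => [|i y1 y2 _ <-]; rewrite ?qform0l ?qformDl.
  by field; rewrite gt_eqF.
set L := dot _ _ - _ in e1 *; set S := \sum_(i < n) D h (X i w).
have -> : S - L = (S - \sum_(i < n) (dot (a (X i w)) h + qform (q (X i w)) h)) + qform E (sn *: h).
  by rewrite e1; ring.
have [_ hD] := haq.
apply: le_trans (ler_normD _ _) _; rewrite mulrDl addrC lerD//.
  by apply: qform_bound => i j; rewrite mxE.
rewrite /S -sumrB; apply: le_trans (ler_norm_sum _ _ _) _.
apply: (@le_trans _ _ (\sum_(i < n) N (X i w) * nrm1 h ^+ 3)); first by apply: ler_sum => i _; exact: hD.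
rewrite -mulr_suml nrm1Z (gtr0_norm sn0) exprMn sn2.
have -> : \sum_(i < n) N (X i w) = n%:R * avg X N n w by rewrite /avg mulrCA divff ?gt_eqF// mulr1.
have h0 := nrm1_ge0 h; have K0 : 0 <= K by apply: le_trans Nn; rewrite divr_ge0// sumr_ge0.
have -> : n%:R * avg X N n w * nrm1 h ^+ 3 = avg X N n w * nrm1 h * (n%:R * nrm1 h ^+ 2) by ring.
rewrite ler_wpM2r ?mulr_ge0 ?sqr_ge0 ?ler0n//.
by apply: ler_pM => //; rewrite divr_ge0// sumr_ge0.
Qed.

Lemma complete_square (u v : V) :
  dot (I *m v) u - qform I u / 2 = qform I v / 2 - qform I (u - v) / 2.
Proof.
have [sI _] := hI; rewrite /qform mulmxBr dotBl !dotBr (dot_mulmxr _ v u) sI [dot u (I *m v)]dotC.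
by rewrite (dotC v (I *m v)); lra.
Qed.

(** Completing the square, the comparison of [that] with [us] gives [c * |v| ^ 2 / 2 <= k * (|v +
    us| ^ 2 + |us| ^ 2)], where [v] is the difference. With [k <= c / 8] half of the left side
    absorbs the [|v|] terms, and the factor 12 remains on [|us| ^ 2]. *)
Lemma maximizer_close : let us := invmx I *m scoresum n w in let k := kap + K * eta in
  0 < c -> k <= c / 8 -> nrm1 that <= eta -> nrm1 us <= sn * eta ->
  (forall h, nrm1 h <= eta -> \sum_(i < n) D h (X i w) <= \sum_(i < n) D that (X i w)) ->
  nrm1 (sn *: that - us) ^+ 2 <= 12 * k / c * nrm1 us ^+ 2.
Proof.
move=> us k c0 kc th_eta us_eta mx; have nR : (0 : R) < n%:R by rewrite ltr0n.
have sn0 : 0 < sn by rewrite sqrtr_gt0.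
pose h := sn^-1 *: us; have sh : sn *: h = us by rewrite scalerA divff ?gt_eqF// scale1r.
have hh : nrm1 h <= eta by rewrite nrm1Z gtr0_norm ?invr_gt0// mulrC ler_pdivrMr// mulrC.
have e1 := quadratic_expansion hh; have e2 := quadratic_expansion th_eta; have m1 := mx h hh.
have uI := spd_unitmx hI; have Su : scoresum n w = I *m us by rewrite mulKVmx.
rewrite sh Su !complete_square subrr qform0r mul0r subr0 -/k in e1.
rewrite Su complete_square -/k in e2.
set u := sn *: that in e2 *; set v := u - us in e2 *.
have uv : u = v + us by rewrite subrK.
have := nrm1D v us; rewrite -uv => t1; have Iv := Ic v.
have v0 := nrm1_ge0 v; have us0 := nrm1_ge0 us; have u0 := nrm1_ge0 u.
have eta0 : 0 <= eta by exact: le_trans (nrm1_ge0 _) hh.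
have K0 : 0 <= K by apply: le_trans Nn; rewrite divr_ge0// sumr_ge0.
have k0' : 0 <= k by rewrite addr_ge0// mulr_ge0.
have u2 : nrm1 u ^+ 2 <= 2 * nrm1 v ^+ 2 + 2 * nrm1 us ^+ 2.
  apply: (@le_trans _ _ ((nrm1 v + nrm1 us) ^+ 2)).
    by apply: lerXn2r; rewrite ?nnegrE ?addr_ge0.
  by have := sqr_ge0 (nrm1 v - nrm1 us); lra.
have k1 := ler_wpM2l k0' u2; have k2 := ler_wpM2r (sqr_ge0 (nrm1 v)) kc.
move: e1 e2; rewrite !ler_norml => /andP[e1 _] /andP[_ e2].
rewrite (mulrC (12 * k)) -mulrA ler_pdivlMl//; lra.
Qed.

End Deterministic.

Variables (thh : nat -> Omega -> V) (rad : R).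
Hypothesis rad0 : 0 < rad.
Hypothesis thh_max : forall n w h, (0 < n)%N -> nrm1 h <= rad ->
  \sum_(i < n) D h (X i w) <= \sum_(i < n) D (thh n w) (X i w).
Hypothesis thh_cons : forall eta, 0 < eta -> small P (fun n => [set w | eta <= nrm1 (thh n w)]).

Theorem linearization e : 0 < e ->
  small P (fun n => [set w | e < nrm1 (Num.sqrt n%:R *: thh n w - invmx I *m scoresum n w)]).
Proof.
move=> e0 t t0; have t20 : 0 < t / 2 by lra.
have [c c0 Ic] := spd_lower; have [M M0 hM] := scoresum_tight t20.
pose kI : R := \sum_i \sum_j `|invmx I i j|.
have kI0 : 0 <= kI by apply: sumr_ge0 => i _; exact: sumr_ge0.
pose M' := kI * M; have M'0 : 0 <= M' by rewrite mulr_ge0// ltW.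
pose K := Ex Q N + 1.
have K1 : 1 <= K by rewrite lerDr; exact: Ex_ge0.
have K0 : 0 < K by apply: lt_le_trans K1.
(* The first entry is the hypothesis of [maximizer_close]; the second brings its conclusion below
   [e ^ 2] when [M'] bounds the linearized estimator. *)
pose kap := Num.min (c / 8) (c * e ^+ 2 / (12 * (M' ^+ 2 + 1))).
have M'2 : 0 < 12 * (M' ^+ 2 + 1) by rewrite mulr_gt0// ltr_wpDl// sqr_ge0.
have kap0 : 0 < kap by rewrite lt_min !divr_gt0// mulr_gt0// exprn_gt0.
have k20 : 0 < kap / 2 by lra.
(* Within [de] the expansion holds, within [rad] the maximizer beats its competitors, and the third
   entry makes the cubic error at most [kap / 2]. *)
pose eta := Num.min de (Num.min rad (kap / 2 / K)).
have eta0 : 0 < eta by rewrite !lt_min de_gt0 rad0 divr_gt0.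
have LN1 : L1 Q N by have := L1_pow k0_gt0 mN N0 LN 1; under eq_fun do rewrite expr1.
have LN2 := L1_pow k0_gt0 mN N0 LN 2.
pose A1 (ij : 'I_p * 'I_p) n := [set w | kap / 2 <= `|avg X (fun x => q x ij.1 ij.2) n w - Ex Q (fun x => q x ij.1 ij.2)|].
pose A2 n := [set w | 1 <= `|avg X N n w - Ex Q N|].
have sA1 ij : small P (A1 ij) by exact: (lln_small mX lawX indX (Lq ij.1 ij.2) (Lq_sqr ij.1 ij.2) k20).
have sA2 : small P A2 by exact: (lln_small mX lawX indX LN1 LN2 ltr01).
have sA := small_U (small_U (small_bigU (index_enum _) sA1) sA2) (thh_cons eta0).
have hA := sA _ t20.
have hs : \forall n \near \oo, M' <= Num.sqrt n%:R * eta.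
  near=> n; rewrite -ler_pdivrMr//.
  have h : (M' / eta) ^+ 2 <= n%:R by near: n; exact: nbhs_infty_ger.
  by rewrite -(@ger0_norm _ (M' / eta)) ?divr_ge0 ?(ltW eta0)// -sqrtr_sqr ler_wsqrtr.
near=> n; have n0 : (0 < n)%N by near: n; exists 1%N.
have hsn : M' <= Num.sqrt n%:R * eta by near: n.
have [B [mB PB AB]] : exists B : set Omega, [/\ measurable B, Pr P B <= t / 2 &
   (\big[setU/set0]_(ij <- index_enum _) A1 ij n `|` A2 n) `|` [set w | eta <= nrm1 (thh n w)] `<=` B] by near: n.
have [B' [mB' PB' AB']] := hM n n0.
exists (B `|` B'); split; first exact: measurableU.
  by rewrite [t in _ <= t]splitr; exact: le_trans (PrU P mB mB') (lerD PB PB').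
move=> w /= he; apply: contrapT => /not_orP[nB nB'].
have /not_orP[/not_orP[n1 n2] n3] : ~ ((\big[setU/set0]_(ij <- index_enum _) A1 ij n `|` A2 n) `|` [set w | eta <= nrm1 (thh n w)]) w.
  by move=> h; apply: nB; exact: AB.
have hS : nrm1 (scoresum n w) <= M.
  by rewrite leNgt; apply/negP => h; apply: nB'; apply: AB'; rewrite /= ltW.
have hth : nrm1 (thh n w) <= eta by move/negP: n3; rewrite -ltNge => /ltW.
have qn i j : `|avg X (fun x => q x i j) n w + I i j / 2| <= kap / 2.
  have : ~ A1 (i, j) n w.
    by move=> h; apply: n1; rewrite -bigcup_seq; exists (i, j) => //=; exact: mem_index_enum.
  by move=> /negP; rewrite -ltNge Ex_q mulNr opprK => /ltW.
have Nn : avg X N n w <= K.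
  by move/negP: n2; rewrite -ltNge => /ltW h; rewrite /K -lerBlDl; exact: le_trans (ler_norm _) h.
have eta_de : eta <= de by rewrite ge_min lexx.
have eta_rad : eta <= rad by rewrite !ge_min lexx orbT.
have Keta : K * eta <= kap / 2 by rewrite mulrC -ler_pdivlMr// !ge_min lexx !orbT.
have kk : kap / 2 + K * eta <= kap by rewrite [leRHS]splitr lerD2l.
have kc : kap / 2 + K * eta <= c / 8 by apply: le_trans kk _; rewrite ge_min lexx.
have us : nrm1 (invmx I *m scoresum n w) <= M'.
  by apply: le_trans (nrm1_mulmx _ _) _; rewrite ler_wpM2l.
have := maximizer_close n0 (ltW k20) Ic qn Nn eta_de c0 kc hth (le_trans us hsn)
  (fun h hh => thh_max w n0 (le_trans hh eta_rad)).
apply/negP; rewrite -ltNge.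
apply: (@le_lt_trans _ _ (12 * kap / c * M' ^+ 2)).
  apply: ler_pM; rewrite ?sqr_ge0//.
  - by rewrite !mulr_ge0 ?invr_ge0 ?(ltW c0)// addr_ge0 ?(ltW k20)// mulr_ge0 ?(ltW K0) ?(ltW eta0).
  - by rewrite ler_wpM2r ?invr_ge0 ?(ltW c0)// ler_wpM2l.
  - by apply: lerXn2r; rewrite ?nnegrE ?nrm1_ge0.
apply: (@le_lt_trans _ _ (e ^+ 2)); last by apply: ltrXn2r => //; rewrite ?nnegrE ?nrm1_ge0 ?(ltW e0).
have : kap <= c * e ^+ 2 / (12 * (M' ^+ 2 + 1)) by rewrite ge_min lexx orbT.
rewrite ler_pdivlMr// => h.
have -> : 12 * kap / c * M' ^+ 2 = (kap * (12 * M' ^+ 2)) / c by ring.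
rewrite ler_pdivrMr// [leRHS]mulrC.
by apply: le_trans h; rewrite ler_wpM2l ?(ltW kap0)// ler_wpM2l// lerDl.
Unshelve. all: end_near. Qed.

End Linearization.

(** * Kullback-Leibler divergence *)

(** Turns the multiplicative triangle inequality back into distances; bounding [cosh] by
    exponentials on either side loses the additive constant [ln 4]. *)
Lemma cosh_mul_le (R : realType) (x y z : R) : 0 <= y -> 0 <= z -> cosh x <= 2 * cosh y * cosh z ->
  x <= y + z + ln 4.
Proof.
have up (s : R) : 0 <= s -> cosh s <= expR s by move=> s0; rewrite -coshD_sinh lerDl sinh_ge0.
move=> y0 z0; have lo : expR x / 2 <= cosh x by rewrite /cosh ler_pM2r ?invr_gt0// lerDl expR_ge0.
have h := ler_pM (ltW (cosh_gt0 y)) (ltW (cosh_gt0 z)) (up y y0) (up z z0).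
rewrite -mulrA => hc; rewrite -ler_expR !expRD lnK ?posrE//; move: lo h hc.
move: (cosh x) (cosh y * cosh z) (expR x) (expR y * expR z) => a b c e; lra.
Qed.

Section FullSupport.
Context {R : realType}.

Lemma null_mul d (T : measurableType d) (mu : probability T R) (g w : T -> R) :
  measurable_fun setT g -> measurable_fun setT w -> (forall x, 0 <= g x) -> (forall x, 0 <= w x) ->
  mu [set x | 0 < g x] = 0%E -> (\int[mu]_x (g x * w x)%:E = 0)%E.
Proof.
move=> mg mw g0 w0 h.
rewrite (@ge0_ae_eq_integral _ _ _ mu setT (fun x => (g x * w x)%:E) (fun=> 0%E))//.
- by rewrite integral0.
- by apply/measurable_EFinP; exact: measurable_funM.
- by move=> x _; rewrite lee_fin mulr_ge0.
- exists [set x | 0 < g x]; split=> //; first exact: measurable_gt.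
  move=> x /= hx; rewrite lt_def g0 andbT; apply/eqP => e; apply: hx => _; by rewrite e mul0r.
Qed.

(* Rescaling the Gaussian around any point keeps the null set null, and the
   rescaled laws concentrate at that point. *)
Lemma stdgauss_full n (f : 'cV[R]_n -> R) : cge0 f ->
  stdgauss n [set t | 0 < f (vecof t)] = 0%E -> forall v, f v = 0.
Proof.
move=> [cf f0] h a; pose g v := f v / (1 + f v).
have fp v : 0 < 1 + f v by rewrite ltr_pwDl.
have cg : continuous g.
  by apply: cont_mul => //; apply: cont_inv => [v|]; [rewrite gt_eqF|apply: cont_add => //; exact: cont_cst].
have g0 v : 0 <= g v by rewrite divr_ge0// ltW.
have g1 v : `|g v| <= 1 by rewrite ger0_norm// ler_pdivrMr// mul1r lerDr.
have zero (r : R) : 0 < r -> Ex (stdgauss n) (fun t => g (r *: vecof t + a)) = 0.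
  move=> r0; have uA : (r%:M : 'M[R]_n) \in unitmx by rewrite unitmxE det_scalar unitfE expf_neq0// gt_eqF.
  pose w v : R := expR (- (dot (r^-1 *: (v - a)) (r^-1 *: (v - a)) / 2)).
  have cw : continuous w.
    apply: cont_exp; apply: cont_opp; apply: cont_mul; last exact: cont_cst.
    have c1 : continuous (fun v : 'cV[R]_n => r^-1 *: (v - a)).
      by apply: cont_scale; [exact: cont_cst|apply: cont_addv; [exact: cont_id|exact: cont_cstT]].
    exact: cont_dot.
  have c1 : cge0 (fun v => g v * w v).
    by split=> [|v]; [exact: cont_mul|rewrite mulr_ge0 ?expR_ge0].
  have c2 : cge0 (fun v : 'cV[R]_n => g (v + a) * w (v + a)).
    by split=> [|v]; [apply: (cont_addl (f := fun v => g v * w v)); case: c1|case: c1].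
  have := lin_changeP uA c2; rewrite (gint_shift a c1).
  have -> : gint (fun v => g v * w v) = 0%E.
    rewrite /gint; under eq_integral do rewrite -mulrA; apply: null_mul.
    - exact: measurable_vecof.
    - apply: (measurable_vecof (f := fun v => w v * expR (dot v v / 2))); exact: cont_gauss.
    - by move=> t; exact: g0.
    - by move=> t; rewrite mulr_ge0 ?expR_ge0.
    - rewrite -h; congr (stdgauss n _); apply/seteqP; split=> t /=; rewrite /g.
        by rewrite pmulr_lgt0// invr_gt0.
      by rewrite pmulr_lgt0// invr_gt0.
  rewrite /gint det_scalar => e.
  have rn : 0 < `|r ^+ n| by rewrite normr_gt0 expf_neq0// gt_eqF.
  apply: (mulfI (lt0r_neq0 rn)); rewrite mulr0 -ExZ; last first.
    apply: (@L1_bounded _ _ _ _ _ 1) => //.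
    apply: (measurable_vecof (f := fun v => g (r *: v + a))).
    apply: (@cont_comp _ _ _ (fun v : 'cV[R]_n => r *: v + a)) => //.
    by apply: cont_addv; [apply: cont_scale; [exact: cont_cst|exact: cont_id]|exact: cont_cstT].
  rewrite /Ex -[RHS](congr1 fine e); congr fine; apply: eq_integral => t _; congr EFin.
  rewrite mul_scalar_mx -!mulrA; congr (_ * (_ * _)); rewrite /w -expRD addrK scalerA mulVf ?gt_eqF// scale1r.
  by rewrite addNr expR0 mulr1.
have lim0 : Ex (stdgauss n) (fun t => g (k.+1%:R^-1 *: vecof t + a)) @[k --> \oo] --> Ex (stdgauss n) (fun=> g a).
  apply: (@Ex_dominated _ _ _ (stdgauss n) _ _ (fun=> 1)) => //.
  - move=> k; apply: (measurable_vecof (f := fun v => g (k.+1%:R^-1 *: v + a))).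
    apply: (@cont_comp _ _ _ (fun v : 'cV[R]_n => k.+1%:R^-1 *: v + a)) => //.
    by apply: cont_addv; [apply: cont_scale; [exact: cont_cst|exact: cont_id]|exact: cont_cstT].
  - exact: L1_cst.
  - move=> t; pose G (s : R) := g (s *: vecof t + a).
    have cG : continuous G.
      apply: (@cont_comp _ _ _ (fun s : R => s *: vecof t + a)) => //.
      by apply: cont_addv; [apply: cont_scale; [exact: cont_id|exact: cont_cstT]|exact: cont_cstT].
    have -> : g a = G 0 by rewrite /G scale0r add0r.
    by apply: (@cvg_comp _ _ _ (fun k : nat => k.+1%:R^-1 : R) G); [exact: cvg_harmonic|exact: cG].
move: lim0; rewrite Ex_cst; have -> : (fun k : nat => Ex (stdgauss n) (fun t => g (k.+1%:R^-1 *: vecof t + a))) = (fun=> 0).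
  by apply/funext => k; rewrite zero// invr_gt0.
move=> /(cvg_lim (@Rhausdorff R)); rewrite lim_cst; last exact: Rhausdorff.
by move/esym/eqP; rewrite mulf_eq0 invr_eq0 (gt_eqF (fp a)) orbF => /eqP.
Qed.

End FullSupport.

Section TransferConverse.
Context {R : realType} {d1 d2 : measure_display} {T1 : measurableType d1} {T2 : measurableType d2}.
Variables (P : probability T1 R) (Q : probability T2 R) (U : T1 -> T2).
Hypothesis mU : measurable_fun setT U.
Hypothesis lawU : forall A, measurable A -> P (U @^-1` A) = Q A.

Lemma L1_of_transfer (f : T2 -> R) : measurable_fun setT f -> L1 P (fun x => f (U x)) -> L1 Q f.
Proof.
move=> mf /integrableP[_ h]; apply/integrableP; split; first exact/measurable_EFinP.
apply: le_lt_trans h; rewrite -(ge0_transfer mU lawU)//.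
- by apply: measurableT_comp => //; exact/measurable_EFinP.
Qed.

End TransferConverse.

Lemma spd_psd (R : realType) n (M : 'M[R]_n) : spd M -> psd M.
Proof. by case=> sM pM; split=> // v; have [->|/pM/ltW//] := eqVneq v 0; rewrite qform0r. Qed.

(** * Identifiability of location and covariance *)

Section Identifiability.
Context {R : realType} {d : nat}.
Local Notation E := 'cV[R]_(1 + d).
Variables (mu mu0 : E) (S S0 : 'M[R]_d).
Hypotheses (hmu : hyperboloid mu) (hmu0 : hyperboloid mu0) (hS : spd S) (hS0 : spd S0).

Lemma spd_invmx (M : 'M[R]_d) : spd M -> spd (invmx M).
Proof.
move=> hM; have [sM pM] := hM; have uM := spd_unitmx hM; split; first by rewrite trmx_inv sM.
move=> v v0; have e : v = M *m (invmx M *m v) by rewrite mulKVmx.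
rewrite /qform {1}e dotC dot_mulmxr sM dotC; apply: pM.
by apply: contraNneq v0 => h; rewrite e h mulmx0.
Qed.

Lemma Tmap_self : Tmap mu mu = 0.
Proof.
rewrite TmapE// /boost (hyp_self hmu) opprK [mu 0 0 + 1]addrC divff ?scale1r ?subrr ?scaler0//.
by rewrite gt_eqF// ltr_pwDl ?(ltW (hyp_gt0 hmu)).
Qed.

Lemma logdens_wexpE (v : 'cV[R]_d) : logdens mu S (wexp mu v) =
  - 2^-1 * ln (\det S) - 2^-1 * qform (invmx S) v + d.-1%:R * ln (Fc (cosh (enorm v))).
Proof.
have e : phi v = - ln (Fc (cosh (enorm v))).
  by rewrite -[in LHS](Tmap_wexp hmu v) (phi_Tmap hmu (wexp_hyp hmu v)) (lform_wexp hmu).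
by rewrite /logdens (Tmap_wexp hmu) e mulrN opprK.
Qed.

Lemma wexp_Tmap (x : E) : hyperboloid x -> wexp mu (Tmap mu x) = x.
Proof.
move=> hx; have c1 := hyp_lform_ge1 hmu hx.
have e : PT origin mu (embed (Tmap mu x)) = logv mu x.
  rewrite TmapE// /logv scaleNr opprK -PT_boost// !PT_embed//.
  rewrite [RHS]scalerDr dotZr -mulrA -scalerA; congr (_ + _).
  by rewrite /embed scale_col_mx scaler0.
by rewrite /wexp e Exp_logv.
Qed.

Lemma logdens_self : logdens mu S mu = - 2^-1 * ln (\det S).
Proof.
have e := logdens_wexpE 0; rewrite -{1}Tmap_self wexp_Tmap// in e.
by rewrite e qform0r enorm0 Fc_cosh// /sinhc eqxx invr1 ln1 !mulr0 subr0 addr0.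
Qed.

Lemma logdens_le (x : E) : hyperboloid x ->
  logdens mu S x <= logdens mu S mu - 2^-1 * qform (invmx S) (Tmap mu x).
Proof.
move=> hx; rewrite -{1}(wexp_Tmap hx) logdens_wexpE logdens_self -[leRHS]addr0 lerD2l.
have c1 := cosh_ge1 (enorm (Tmap mu x)).
by rewrite mulr_ge0_le0// ln_le0// Fc_le1.
Qed.

End Identifiability.

Section Injectivity.
Context {R : realType} {d : nat}.
Local Notation E := 'cV[R]_(1 + d).

Lemma logdens_lt (mu : E) (S : 'M[R]_d) (x : E) : hyperboloid mu -> spd S -> hyperboloid x -> x != mu ->
  logdens mu S x < logdens mu S mu.
Proof.
move=> hmu hS hx xmu; apply: le_lt_trans (logdens_le S hmu hx) _.
rewrite gtrDl oppr_lt0 mulr_gt0// (spd_invmx hS).2//.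
by apply: contraNneq xmu => h; rewrite -(wexp_Tmap hmu hx) h -(Tmap_self hmu) wexp_Tmap.
Qed.

(** The location is the unique maximum point of the density. At equal locations the densities
    differ, in the wrapped chart, only by a constant and a quadratic form, and polarization recovers
    the covariance. *)
Lemma logdens_inj (mu mu0 : E) (S S0 : 'M[R]_d) : hyperboloid mu -> hyperboloid mu0 -> spd S -> spd S0 ->
  (forall x, hyperboloid x -> logdens mu S x = logdens mu0 S0 x) -> mu = mu0 /\ S = S0.
Proof.
move=> hmu hmu0 hS hS0 h.
have e : mu = mu0.
  apply/eqP; case: eqVneq => // ne.
  have h1 := logdens_lt hmu0 hS0 hmu ne; rewrite eq_sym in ne.
  have h2 := logdens_lt hmu hS hmu0 ne.
  by move: h1; rewrite -(h _ hmu) -(h _ hmu0) => h1; have := lt_trans h1 h2; rewrite ltxx.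
split=> //; subst mu0.
have hd := h mu hmu; rewrite !logdens_self// in hd.
have hq v : qform (invmx S) v = qform (invmx S0) v.
  by have := h _ (wexp_hyp hmu v); rewrite !logdens_wexpE//; lra.
have e : invmx S = invmx S0.
  apply/matrixP => i j; rewrite (qform_polar i j (spd_invmx hS).1) (qform_polar i j (spd_invmx hS0).1).
  by rewrite !hq.
by rewrite -(invmxK S) e invmxK.
Qed.

End Injectivity.

(** * Integrability under the wrapped normal law *)

Section WrappedNormalLaw.
Context {R : realType} {n : nat}.
Local Notation d := n.+1.
Local Notation E := 'cV[R]_(1 + d).
Local Notation T := (@borel_mx R (1 + d) 1).
Variables (mu0 : E) (S0 : 'M[R]_d) (Q : probability T R).
Hypotheses (hmu0 : hyperboloid mu0) (hS0 : spd S0).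
Hypothesis lawQ : forall A : set T, measurable A -> hwn mu0 S0 A = Q A.
Local Notation gam := (stdgauss d).
Let U (t : d.-tuple (measurableTypeR R)) : T := hwn_vec mu0 S0 t.

(* A retraction onto the hyperboloid, so that the log-density becomes a
   continuous function on the whole ambient space. *)
Definition retr (x : E) : E := lift (dsubmx x).

Lemma retr_hyp x : hyperboloid (retr x).
Proof. exact: lift_hyp. Qed.

Lemma retrE x : hyperboloid x -> retr x = x.
Proof. exact: liftK. Qed.

Lemma cont_retr : continuous retr.
Proof.
apply: (cont_compT (h := fun x : E => dsubmx x)); last exact: cont_lift.
by apply: continuous_mx => i j; under eq_fun do rewrite mxE; exact: coord_continuous.
Qed.

Lemma measurable_hwn : measurable_fun setT U.
Proof.
apply: measurable_borel_col => i; rewrite /U.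
have e t : hwn_vec mu0 S0 t i 0 = lift (bst mu0 (sinhc (enorm (sqrtmx S0 *m vecof t)) *: (sqrtmx S0 *m vecof t))) i 0.
  by rewrite hwn_vecE wexp_lift.
under eq_fun do rewrite e.
apply: (measurable_vecof (f := fun v => lift (bst mu0 (sinhc (enorm (sqrtmx S0 *m v)) *: (sqrtmx S0 *m v))) i 0)).
apply: cont_coord.
apply: (cont_compT (h := fun v => bst mu0 (sinhc (enorm (sqrtmx S0 *m v)) *: (sqrtmx S0 *m v)))); last exact: cont_lift.
apply: (@cont_compT _ _ _ (fun v => sqrtmx S0 *m v) (fun v : 'cV[R]_d => bst mu0 (sinhc (enorm v) *: v))); last exact: cont_wexp.
by apply: cont_mulmx; exact: cont_id.
Qed.

Lemma hwn_hyp t : hyperboloid (hwn_vec mu0 S0 t).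
Proof. by rewrite hwn_vecE; exact: wexp_hyp. Qed.

Lemma lawU (A : set T) : measurable A -> gam (U @^-1` A) = Q A.
Proof. by move=> mA; rewrite -lawQ. Qed.

Lemma cont_logdens_retr mu S : hyperboloid mu -> continuous (fun x => logdens mu S (retr x)).
Proof. by move=> hmu; apply: cont_logdens_hyp => //; [move=> t; exact: retr_hyp|exact: cont_retr]. Qed.

Lemma cont_gdist_retr mu : hyperboloid mu -> continuous (fun x => gdist mu (retr x)).
Proof.
move=> hmu; have -> : (fun x => gdist mu (retr x)) = (fun x => ln (- lform mu (retr x) + Num.sqrt (lform mu (retr x) ^+ 2 - 1))).
  by apply/funext => x; rewrite /gdist /acosh sqrrN.
have cl : continuous (fun x => lform mu (retr x)) by apply: cont_lform; exact: cont_retr.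
move=> x; apply: continuous_comp; last first.
  apply: continuous_ln; rewrite ltr_pwDl ?sqrtr_ge0//.
  exact: lt_le_trans ltr01 (hyp_lform_ge1 hmu (retr_hyp x)).
apply: (cont_add (cont_opp cl)); apply: cont_sqrt; apply: cont_add; last exact: cont_cst.
exact: cont_pow.
Qed.

(** The common envelope: up to constants it dominates the log-density at every parameter and its
    expansion coefficients at the true one. *)
Definition growth (x : T) : R := (1 + gdist mu0 (retr x)) ^+ 2.

Lemma gdist_ge0 (mu x : E) : hyperboloid mu -> hyperboloid x -> 0 <= gdist mu x.
Proof. by move=> hmu hx; exact/acosh_ge0/hyp_lform_ge1. Qed.

Lemma growth_ge1 x : 1 <= growth x.
Proof. by rewrite exprn_ege1// lerDl gdist_ge0//; exact: retr_hyp. Qed.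

Lemma measurable_growth : measurable_fun setT growth.
Proof.
apply: measurable_continuous_borel; apply: cont_pow; apply: cont_add; first exact: cont_cst.
exact: cont_gdist_retr.
Qed.

(** The distance from [mu0] is the norm of the Gaussian vector before wrapping. The constant [k0] is
    chosen so that the exponent is at most a quarter of [1 + dot (vecof t) (vecof t)]. *)
Lemma L1_growth : exists2 k0, 0 < k0 & L1 Q (fun x => expR (k0 * growth x)).
Proof.
have [[sA _] AA] := sqrtmxP (spd_psd hS0).
set A := sqrtmx S0 in sA AA; pose b : R := \sum_i \sum_j `|S0 i j|.
have b0 : 0 <= b by apply: sumr_ge0 => i _; exact: sumr_ge0.
pose k0 := (8 * (b * d%:R + 1))^-1.
have bd : 0 < 8 * (b * d%:R + 1) by rewrite mulr_gt0// ltr_wpDl// mulr_ge0.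
have k0p : 0 < k0 by rewrite invr_gt0.
exists k0 => //; apply: (L1_of_transfer measurable_hwn lawU).
  apply: measurableT_comp => //; apply: measurable_funM => //; exact: measurable_growth.
have Lg : L1 gam (fun t : d.-tuple (measurableTypeR R) => expR (4^-1 : R) * expR (4^-1 * dot (vecof t) (vecof t))).
  by apply: L1Z; apply: L1_gauss_exp; lra.
apply: L1_le Lg _ => [|t].
  apply: measurableT_comp => //; apply: measurable_funM => //.
  exact: (measurableT_comp measurable_growth measurable_hwn).
rewrite ger0_norm ?expR_ge0// -expRD ler_expR /growth retrE; last exact: hwn_hyp.
have -> : gdist mu0 (hwn_vec mu0 S0 t) = enorm (A *m vecof t).
  by rewrite /gdist hwn_vecE lform_wexp// coshK// enorm_ge0.
have h1 : enorm (A *m vecof t) ^+ 2 <= b * d%:R * dot (vecof t) (vecof t).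
  rewrite sqr_enorm dot_mulmxr sA mulmxA AA dotC.
  apply: le_trans (ler_norm _) _; apply: (@le_trans _ _ (b * nrm1 (vecof t) ^+ 2)).
    apply: qform_bound => i j; rewrite /b (bigD1 i)//= (bigD1 j)//= -addrA lerDl.
    by rewrite addr_ge0 ?sumr_ge0// => k _; rewrite sumr_ge0.
  by rewrite -mulrA ler_wpM2l// nrm1_sqr_le.
set z := enorm _ in h1 *; set D := dot _ _ in h1 *; have D0 : 0 <= D by exact: dot_ge0.
have h2 : (1 + z) ^+ 2 <= 2 * (b * d%:R + 1) * (1 + D).
  have : 0 <= b * d%:R by rewrite mulr_ge0.
  by have := sqr_ge0 (1 - z); nra.
have := ler_wpM2l (ltW k0p) h2; have -> : k0 * (2 * (b * d%:R + 1) * (1 + D)) = 4^-1 + 4^-1 * D.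
  by rewrite /k0; field; rewrite gt_eqF// ltr_wpDl// mulr_ge0.
by [].
Qed.

(** Moving the centre of the envelope costs only a factor, by the triangle inequality with its loss
    [ln 4]. *)
Lemma gdist_le mu : hyperboloid mu -> exists2 K, 1 <= K & forall x, hyperboloid x ->
  1 + gdist mu x <= K * (1 + gdist mu0 x).
Proof.
move=> hmu; pose r := gdist mu0 mu; have r0 : 0 <= r by exact: gdist_ge0.
pose c : R := ln 4; have c0 : 0 <= c by rewrite ln_ge0//; lra.
exists (1 + r + c) => [|x hx]; first lra.
have g0 := gdist_ge0 hmu0 hx; have g1 := gdist_ge0 hmu hx.
have ch (y z : E) : hyperboloid y -> hyperboloid z -> - lform y z = cosh (gdist y z).
  by move=> hy hz; rewrite /gdist acoshK//; exact: hyp_lform_ge1.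
have := hyp_triangle hmu0 hmu hx; rewrite (ch _ _ hmu hx) (ch _ _ hmu0 hmu) (ch _ _ hmu0 hx).
move=> /(cosh_mul_le r0 g0); rewrite -/r -/c => key.
nra.
Qed.

Definition mdens (mu : E) (S : 'M[R]_d) (x : T) : R := logdens mu S (retr x).

Lemma measurable_mdens mu S : hyperboloid mu -> measurable_fun setT (mdens mu S).
Proof. by move=> hmu; apply: measurable_continuous_borel; exact: cont_logdens_retr. Qed.

Lemma L1_growth_pow j : L1 Q (fun x => growth x ^+ j).
Proof.
have [k0 k0p Lk] := L1_growth; apply: (L1_pow k0p measurable_growth _ Lk) => x.
exact: le_trans ler01 (growth_ge1 x).
Qed.

Lemma L1_of_growth (f : T -> R) C : measurable_fun setT f -> (forall x, `|f x| <= C * growth x) ->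
  L1 Q f /\ L1 Q (fun x => f x ^+ 2).
Proof.
move=> mf fC; split; first by apply: L1_le (L1Z C (L1_growth_pow 1)) _ => // x; rewrite expr1.
apply: L1_le (L1Z (C ^+ 2) (L1_growth_pow 2)) _ => [|x]; first exact: measurable_funX.
rewrite normrX -exprMn; apply: lerXn2r; rewrite ?nnegrE//; exact: le_trans (fC x).
Qed.

Lemma logdens_bound mu S : hyperboloid mu -> spd S ->
  exists2 C, 0 <= C & forall x, `|mdens mu S x| <= C * growth x.
Proof.
move=> hmu hS; have [K K1 hK] := gdist_le hmu; have sI := spd_invmx hS.
pose b : R := \sum_i \sum_j `|invmx S i j|.
have b0 : 0 <= b by apply: sumr_ge0 => i _; exact: sumr_ge0.
pose c := `|2^-1 * ln (\det S)| + b * d%:R + d%:R; have c0 : 0 <= c by rewrite !addr_ge0// mulr_ge0.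
exists (c * K ^+ 2); first by rewrite mulr_ge0// sqr_ge0.
move=> x; have hx := retr_hyp x; rewrite /mdens /growth -mulrA -exprMn.
have g0 := gdist_ge0 hmu hx; set g := gdist mu (retr x) in g0.
apply: (@le_trans _ _ (c * (1 + g) ^+ 2)); last first.
  rewrite ler_wpM2l//; apply: lerXn2r; rewrite ?nnegrE ?addr_ge0 ?mulr_ge0 ?addr_ge0 ?gdist_ge0//.
    exact: le_trans K1.
  exact: hK.
rewrite /logdens phi_Tmap//.
have h1 : `|qform (invmx S) (Tmap mu (retr x))| <= b * d%:R * (1 + g) ^+ 2.
  apply: (@le_trans _ _ (b * nrm1 (Tmap mu (retr x)) ^+ 2)).
    apply: qform_bound => i j; rewrite /b (bigD1 i)//= (bigD1 j)//= -addrA lerDl.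
    by rewrite addr_ge0 ?sumr_ge0// => k _; rewrite sumr_ge0.
  rewrite -mulrA ler_wpM2l//; apply: le_trans (nrm1_sqr_le _) _.
  rewrite ler_wpM2l// -sqr_enorm enorm_Tmap//; apply: lerXn2r; rewrite ?nnegrE ?addr_ge0//.
  by rewrite lerDr.
have h2 : `|ln (Fc (- lform mu (retr x)))| <= g by apply: ln_Fc_le; exact: hyp_lform_ge1.
have h3 : 1 <= (1 + g) ^+ 2 by rewrite exprn_ege1// lerDl.
have h4 : g <= (1 + g) ^+ 2 by nra.
apply: le_trans (ler_normB _ _) _; rewrite /c !mulrDl; apply: lerD.
  rewrite mulNr -opprD normrN; apply: le_trans (ler_normD _ _) _; apply: lerD.
    by rewrite ler_peMr.
  rewrite normrM ger0_norm ?invr_ge0//; have := normr_ge0 (qform (invmx S) (Tmap mu (retr x))); lra.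
rewrite normrM normrN (ger0_norm (ler0n _ _)) /=; apply: (@le_trans _ _ (n%:R * g)).
  by rewrite ler_wpM2l.
by apply: ler_pM => //; rewrite ler_nat.
Qed.

Lemma likelihood_ratio mu S : hyperboloid mu -> spd S ->
  L1 Q (fun x => expR (mdens mu S x - mdens mu0 S0 x)) /\ Ex Q (fun x => expR (mdens mu S x - mdens mu0 S0 x)) = 1.
Proof.
move=> hmu hS.
have mE : measurable_fun setT (fun x => expR (mdens mu S x - mdens mu0 S0 x)).
  by apply: measurableT_comp => //; apply: measurable_funB; exact: measurable_mdens.
have e : (\int[Q]_x (expR (mdens mu S x - mdens mu0 S0 x))%:E = 1)%E.
  rewrite -(ge0_transfer measurable_hwn lawU); first last.
  - by move=> x; rewrite lee_fin expR_ge0.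
  - exact/measurable_EFinP.
  rewrite -(integral_likelihood_ratio hmu0 hS0 hmu hS); apply: eq_integral => t _.
  by rewrite /mdens /U !retrE//; exact: hwn_hyp.
split; last by rewrite /Ex e.
apply/integrableP; split; first exact/measurable_EFinP.
under eq_integral do rewrite /= (ger0_norm (expR_ge0 _)); by rewrite e ltry.
Qed.

(** The mean of [expR D - 1 - D], which is nonnegative, equals minus the mean of [D]. Were the
    latter nonnegative, [D] would vanish almost everywhere, by continuity and full support
    everywhere, contradicting identifiability. *)
Lemma kullback_leibler mu S : hyperboloid mu -> spd S -> (mu, S) != (mu0, S0) ->
  Ex Q (fun x => mdens mu S x - mdens mu0 S0 x) < 0.
Proof.
move=> hmu hS ne; have [LR ER] := likelihood_ratio hmu hS.
have [C C0 hC] := logdens_bound hmu hS; have [C' C0' hC'] := logdens_bound hmu0 hS0.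
have [Lm _] := L1_of_growth (measurable_mdens S hmu) hC; have [Lm0 _] := L1_of_growth (measurable_mdens S0 hmu0) hC'.
pose D x := mdens mu S x - mdens mu0 S0 x; have LD : L1 Q D by exact: L1B.
pose r x := expR (D x) - 1 - D x; have Lr : L1 Q r by apply: L1B => //; apply: L1B => //; exact: L1_cst.
have e0 (z : R) : 0 <= expR z - 1 - z by have := expR_ge1Dx z; lra.
have r0 x : 0 <= r x by exact: e0.
have Er : Ex Q r = - Ex Q D.
  by rewrite (ExB (L1B LR (L1_cst Q 1)) LD) (ExB LR (L1_cst Q 1)) ER Ex_cst subrr sub0r.
rewrite ltNge; apply/negP => D0; have Er0 : Ex Q r = 0.
  by apply/eqP; rewrite eq_le Ex_ge0// andbT Er oppr_le0.
have := Ex_eq0_ae Lr r0 Er0.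
pose G (v : 'cV[R]_d) := wexp mu0 (sqrtmx S0 *m v).
pose f (v : 'cV[R]_d) := expR (logdens mu S (G v) - logdens mu0 S0 (G v)) - 1 - (logdens mu S (G v) - logdens mu0 S0 (G v)).
have hG v : hyperboloid (G v) by exact: wexp_hyp.
have cG : continuous G.
  have -> : G = fun v => lift (bst mu0 (sinhc (enorm (sqrtmx S0 *m v)) *: (sqrtmx S0 *m v))).
    by apply/funext => v; rewrite /G wexp_lift.
  apply: (cont_compT (h := fun v => bst mu0 (sinhc (enorm (sqrtmx S0 *m v)) *: (sqrtmx S0 *m v)))); last exact: cont_lift.
  apply: (@cont_compT _ _ _ (fun v => sqrtmx S0 *m v) (fun v : 'cV[R]_d => bst mu0 (sinhc (enorm v) *: v))); last exact: cont_wexp.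
  by apply: cont_mulmx; exact: cont_id.
have cd : continuous (fun v => logdens mu S (G v) - logdens mu0 S0 (G v)).
  by apply: cont_add; [exact: cont_logdens_hyp|apply: cont_opp; exact: cont_logdens_hyp].
have cf : cge0 f.
  split=> [|v]; last exact: e0.
  by apply: cont_add; [apply: cont_add; [exact: cont_exp|exact: cont_cst]|exact: cont_opp].
rewrite -lawU; last exact: measurable_gt (L1_meas Lr).
have -> : U @^-1` [set x | 0 < r x] = [set t | 0 < f (vecof t)].
  by apply/seteqP; split=> t; rewrite /= /r /D /mdens /U !retrE//; exact: hwn_hyp.
move=> /(stdgauss_full cf) f0.
have expD (z : R) : expR z - 1 - z = 0 -> z = 0.
  move=> h; apply/eqP; case: (eqVneq z 0) => // z0.
  by have := expR_gt1Dx z0; lra.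
have [e1 e2] : mu = mu0 /\ S = S0; last by rewrite e1 e2 eqxx in ne.
have [[sA _] AA] := sqrtmxP (spd_psd hS0).
have uA : sqrtmx S0 \in unitmx.
  by have : sqrtmx S0 *m sqrtmx S0 \in unitmx by [rewrite AA spd_unitmx]; rewrite unitmx_mul => /andP[].
apply: (logdens_inj hmu hmu0 hS hS0) => x hx; apply/eqP; rewrite -subr_eq0; apply/eqP.
have := expD _ (f0 (invmx (sqrtmx S0) *m Tmap mu0 x)).
by rewrite /G mulKVmx// wexp_Tmap.
Qed.

End WrappedNormalLaw.

(** * Consistency *)

Section CompactInduction.

(** The sets [A] for which [P] holds of [K] minus [A] form a filter. If it were proper it would
    cluster at a point of [K], which the local hypothesis at that point forbids. *)
Lemma compact_ind (T : topologicalType) (K : set T) (P : set T -> Prop) :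
  compact K -> P set0 -> (forall A B, A `<=` B -> P B -> P A) -> (forall A B, P A -> P B -> P (A `|` B)) ->
  (forall x, K x -> exists2 U, nbhs x U & P U) -> P K.
Proof.
move=> cK P0 Psub PU Ploc; pose F : set_system T := [set A | P (K `\` A)].
have FF : Filter F.
  split; rewrite /F /=; first by rewrite setDT.
    by move=> A B /= hA hB; rewrite setDIr; exact: PU.
  by move=> A B AB; apply: Psub; exact: setDS.
have [FP|FP] := pselect (F set0); first by rewrite /F /= setD0 in FP.
have PF : ProperFilter F by split.
have PK : F K by rewrite /F /= setDv.
have [x [Kx clx]] := cK F PF PK.
have [U nU PU'] := Ploc x Kx.
have FU : F (~` U) by apply: Psub PU'; rewrite setDE setCK; exact: subIsetr.
by have [y []] := clx _ _ FU nU.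
Qed.

End CompactInduction.

(** * Normal coordinates and moving charts *)

Section TangentCoordinates.
Context {R : realType} {n : nat}.
Local Notation d := n.+1.
Local Notation E := 'cV[R]_(1 + d).
Local Notation Theta := 'cV[R]_(d + vech_dim d).
Variables (mu0 : E) (J : {linear 'cV[R]_d -> E}).
Hypotheses (hmu0 : hyperboloid mu0) (hJ : tangent_isometry mu0 J).

(** Coordinates of the Riemannian logarithm, obtained by pairing with the images of the basis under
    [J]. The maximum makes them continuous on the whole ambient space, from which the measurability
    of the estimator's coordinates follows. *)
Definition tcoord (mu : E) : 'cV[R]_d :=
  \col_i (Fc (Num.max 1 (- lform mu0 mu)) * lform (J (delta_mx i 0)) mu).

Lemma alpha_ofE mu : hyperboloid mu -> alpha_of mu0 J mu = tcoord mu.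
Proof.
move=> hmu; have c1 := hyp_lform_ge1 hmu0 hmu; have [Jd Jt] := hJ.
have Ja : J (alpha_of mu0 J mu) = logv mu0 mu.
  rewrite /alpha_of; case: xgetP => [a _ /= ->|]; first exact: LogE.
  have [a ea] := (Jt (logv mu0 mu)).1 (logv_tangent mu hmu0).
  by move=> /(_ a); rewrite /= ea LogE.
apply/colP => i; rewrite mxE -dot_delta -Jd Ja /logv max_r//.
rewrite lformZl; congr (_ * _); rewrite lformDl lformNl lformZl.
have -> : lform mu0 (J (delta_mx i 0)) = 0 by have := (Jt (J (delta_mx i 0))).2; apply; exists (delta_mx i 0).
by rewrite mulr0 subr0 lformC.
Qed.

Lemma J_tcoord mu : hyperboloid mu -> J (tcoord mu) = logv mu0 mu.
Proof.
move=> hmu; have [Jd Jt] := hJ; rewrite -alpha_ofE// /alpha_of; case: xgetP => [a _ /= ->|]; first exact: LogE.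
have [a ea] := (Jt (logv mu0 mu)).1 (logv_tangent mu hmu0).
by move=> /(_ a); rewrite /= ea LogE.
Qed.

Lemma Exp_tcoord mu : hyperboloid mu -> Exp mu0 (J (tcoord mu)) = mu.
Proof. by move=> hmu; rewrite J_tcoord// Exp_logv. Qed.

Lemma enorm_tcoord mu : hyperboloid mu -> enorm (tcoord mu) = gdist mu0 mu.
Proof.
move=> hmu; have [Jd _] := hJ.
by rewrite /enorm -Jd J_tcoord// -/(lnorm _) lnorm_logv.
Qed.

Lemma cont_tcoord : continuous tcoord.
Proof.
have cl u : continuous (fun mu : E => lform u mu).
  by have := @cont_lform R n E u (fun mu => mu) (@cont_id E).
apply: continuous_mx => i j; rewrite (ord1 j); under eq_fun do rewrite mxE.
apply: cont_mul; last exact: cl.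
apply: (@cont_comp _ _ _ (fun mu : E => - lform mu0 mu) (fun s => Fc (Num.max 1 s))); last exact: continuous_Fcmax.
by apply: cont_opp; exact: cl.
Qed.

Lemma cont_mu_of : continuous (fun th : Theta => mu_of mu0 J th).
Proof.
have -> : (fun th : Theta => mu_of mu0 J th) = (fun th => cosh (enorm (usubmx th)) *: mu0 + sinhc (enorm (usubmx th)) *: J (usubmx th)).
  by apply/funext => th; exact: mu_ofE.
have cu : continuous (fun th : Theta => usubmx th).
  by apply: continuous_mx => i j; under eq_fun do rewrite mxE; exact: coord_continuous.
apply: cont_addv; apply: cont_scale.
- by apply: (@cont_comp _ _ _ (fun th : Theta => enorm (usubmx th))); [exact: cont_enorm|exact: continuous_cosh].
- exact: cont_cstT.
- exact: cont_sinhc_enorm.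
- have JE (v : 'cV[R]_d) : J v = (\matrix_(i, j) J (delta_mx j 0) i 0) *m v.
    rewrite {1}(matrix_sum_delta v) linear_sum; apply/colP => k; rewrite mxE summxE; apply: eq_bigr => i _.
    by rewrite big_ord1 linearZ !mxE mulrC.
  have -> : (fun th : Theta => J (usubmx th)) = (fun th => (\matrix_(i, j) J (delta_mx j 0) i 0) *m usubmx th).
    by apply/funext => th; exact: JE.
  exact: cont_mulmx.
Qed.

End TangentCoordinates.

Section Frame.
Context {R : realType} {d : nat}.
Local Notation E := 'cV[R]_(1 + d).

(** The transport formula from the origin, written for arbitrary [mu] so that linearity holds
    unconditionally. On the hyperboloid it provides an isometry at every point, hence a chart
    centred there. *)
Definition frame (mu : E) (v : 'cV[R]_d) : E :=
  embed v + (dot (dsubmx mu) v / (1 + mu 0 0)) *: (origin + mu).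

Lemma frame_linear mu : linear (frame mu).
Proof.
move=> k u v; rewrite /frame dotDr dotZr /embed.
have -> : col_mx (0 : 'cV[R]_1) (k *: u + v) = k *: col_mx 0 u + col_mx 0 v.
  by rewrite scale_col_mx add_col_mx scaler0 addr0.
by rewrite mulrDl -mulrA scalerDl addrACA -scalerA -scalerDr.
Qed.

HB.instance Definition _ mu := GRing.isLinear.Build R _ _ _ (frame mu) (frame_linear mu).

Lemma frame_isometry mu : hyperboloid mu -> tangent_isometry mu (frame mu).
Proof.
move=> hmu; have FE v : frame mu v = PT origin mu (embed v) by rewrite PT_embed.
split=> [v w|u].
  have h u : lform (frame mu u) (frame mu u) = dot u u by rewrite FE PT_embed_lform.
  have e : frame mu (v + w) = frame mu v + frame mu w by rewrite linearD.
  have key (a b : E) : lform (a + b) (a + b) = lform a a + 2 * lform a b + lform b b.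
    by rewrite !lformE (lformC b a); ring.
  by have := h (v + w); rewrite e key !h dotDl !dotDr (dotC w v); lra.
split=> [tu|[v <-]]; last by rewrite FE; exact: PT_embed_tangent.
exists (boost mu u); rewrite FE PT_boost//.
by have -> : lform mu u = 0 by []; rewrite scale0r addr0.
Qed.

End Frame.

Section Wald.
Context {R : realType} {n : nat}.
Local Notation d := n.+1.
Local Notation E := 'cV[R]_(1 + d).
Local Notation T := (@borel_mx R (1 + d) 1).
Local Notation p := (d + vech_dim d)%N.
Local Notation Theta := 'cV[R]_p.
Variables (mu0 : E) (S0 : 'M[R]_d) (Q : probability T R) (J : {linear 'cV[R]_d -> E}).
Hypotheses (hmu0 : hyperboloid mu0) (hS0 : spd S0) (hJ : tangent_isometry mu0 J).
Hypothesis lawQ : forall A : set T, measurable A -> hwn mu0 S0 A = Q A.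

Definition contrast (th : Theta) (x : T) : R := mdens (mu_of mu0 J th) (Sigma_of th) x - mdens mu0 S0 x.

Lemma measurable_contrast th : measurable_fun setT (contrast th).
Proof. by apply: measurable_funB; apply: measurable_mdens => //; exact: mu_of_hyp. Qed.

Lemma contrast_bound th : exists C, forall x, `|contrast th x| <= C * growth mu0 x.
Proof.
have [C C0 hC] := logdens_bound hmu0 (mu_of_hyp hmu0 hJ th) (Sigma_of_spd th).
have [C' C0' hC'] := logdens_bound hmu0 hmu0 hS0.
exists (C + C') => x; rewrite mulrDl; apply: le_trans (ler_normB _ _) _; exact: lerD.
Qed.

(* The chart recentred at the parameter turns the third-order expansion at the
   base point into a modulus of continuity at every parameter. *)
Lemma contrast_local th1 : exists C s0, [/\ 0 <= C, 0 < s0 & forall s, 0 < s -> s <= s0 ->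
  nbhs th1 [set th | forall x, contrast th x <= contrast th1 x + C * s * growth mu0 x]].
Proof.
pose mu1 := mu_of mu0 J th1; have hmu1 : hyperboloid mu1 by exact: mu_of_hyp.
have hJ1 := frame_isometry hmu1; set J1 : {linear 'cV[R]_d -> E} := frame mu1 in hJ1.
pose th1' : Theta := col_mx 0 (dsubmx th1).
have u0 : usubmx th1' = 0 by rewrite col_mxKu.
have [de [C [de0 de1 C0 hj]]] := logdens_jet hmu1 hJ1 u0.
have [K K1 hK] := gdist_le hmu0 hmu1.
exists (3 * (C * K ^+ 2)), de; split=> // [|s s0 sde].
  by rewrite mulr_ge0// mulr_ge0// sqr_ge0.
pose h (th : Theta) : Theta := col_mx (tcoord mu1 J1 (mu_of mu0 J th)) (dsubmx th - dsubmx th1).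
have hE th : th1' + h th = col_mx (tcoord mu1 J1 (mu_of mu0 J th)) (dsubmx th).
  by rewrite add_col_mx add0r addrC subrK.
have muE th : mu_of mu1 J1 (th1' + h th) = mu_of mu0 J th.
  by rewrite hE /mu_of col_mxKu Exp_tcoord//; exact: mu_of_hyp.
have SE th : Sigma_of (th1' + h th) = Sigma_of th by rewrite hE /Sigma_of col_mxKd.
have ch : continuous h.
  apply: continuous_mx => i j; rewrite (ord1 j) -(@splitK d (vech_dim d) i); case: (fintype.split i) => k /=.
    under eq_fun do rewrite col_mxEu; apply: cont_coord.
    apply: (cont_compT (h := fun th : Theta => mu_of mu0 J th)); first exact: cont_mu_of.
    exact: cont_tcoord.
  under eq_fun do rewrite col_mxEd !mxE.
  by apply: cont_add; [exact: coord_continuous|exact: cont_cst].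
have h1 : h th1 = 0.
  rewrite /h subrr; have -> : tcoord mu1 J1 (mu_of mu0 J th1) = 0.
    apply/eqP; rewrite -/mu1 -enorm_eq0 (enorm_tcoord hmu1 hJ1 hmu1).
    by rewrite /gdist (hyp_self hmu1) opprK -cosh0 coshK.
  by rewrite col_mx0.
have cn : continuous (fun th => nrm1 (h th)) by apply: (@cont_comp _ _ _ h); last exact: cont_nrm1.
have hn : nrm1 (h th) @[th --> th1] --> (0 : R) by have := cn th1; rewrite /continuous_at h1 nrm10.
have /cvgrPdist_lt /(_ s s0) := hn.
apply: filterS => th /=; rewrite sub0r normrN (ger0_norm (nrm1_ge0 _)) => hs x.
have hx := retr_hyp x; have hj1 := hj (retr x) hx.
have d01 : 0 <= de <= 1 by rewrite (ltW de0).
have := jet_lip d01 hj1 (le_trans (ltW hs) sde); rewrite muE SE.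
have -> : mu_of mu1 J1 (th1' + 0) = mu1 by rewrite addr0 (mu_of_th0 hmu1 hJ1 u0).
have -> : Sigma_of (th1' + 0) = Sigma_of th1 by rewrite addr0 /Sigma_of col_mxKd.
move=> /(le_trans (ler_norm _)) key; rewrite /contrast -/mu1.
have g0 := gdist_ge0 hmu1 hx; have g0' := gdist_ge0 hmu0 hx.
have h2 : 3 * (C * (1 + gdist mu1 (retr x)) ^+ 2) * nrm1 (h th) <= 3 * (C * K ^+ 2) * s * growth mu0 x.
  rewrite [leRHS]mulrAC; apply: ler_pM; rewrite ?nrm1_ge0 ?(ltW hs)//.
    by rewrite mulr_ge0// mulr_ge0// sqr_ge0.
  have -> : 3 * (C * K ^+ 2) * growth mu0 x = 3 * (C * (K * (1 + gdist mu0 (retr x))) ^+ 2) by rewrite /growth exprMn; ring.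
  rewrite ler_wpM2l// ler_wpM2l//; apply: lerXn2r; rewrite ?nnegrE ?addr_ge0//.
    by rewrite mulr_ge0 ?addr_ge0//; exact: le_trans K1.
  exact: hK.
move: {key h2}(le_trans key h2); rewrite /mdens.
move: (logdens (mu_of mu0 J th) (Sigma_of th) (retr x)) (logdens mu1 (Sigma_of th1) (retr x)) (logdens mu0 S0 (retr x)).
by move=> u v w; lra.
Qed.

(** With [v = A *m w] for the square root [A] of [S], this is the Loewner bound tested on [w]. *)
Lemma loewner_invmx (S : 'M[R]_d) lp v : spd S -> loewner S lp%:M -> dot v v <= lp * qform (invmx S) v.
Proof.
move=> hS [_ hl]; have [[sA _] AA] := sqrtmxP (spd_psd hS); set A := sqrtmx S in sA AA.
have uA : A \in unitmx by have : A *m A \in unitmx by [rewrite AA spd_unitmx]; rewrite unitmx_mul => /andP[].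
have [sI _] := spd_invmx hS.
pose w := invmx A *m v; have e : v = A *m w by rewrite mulKVmx.
have e2 : S *m (invmx A *m w) = v by rewrite -AA -mulmxA mulKVmx.
have -> : qform (invmx S) v = dot w w.
  have -> : qform (invmx S) v = dot v (invmx A *m w) by rewrite /qform -{2}e2 mulKmx ?spd_unitmx.
  by rewrite e dotC dot_mulmxr sA mulKVmx.
have e3 : dot w (S *m w) = dot v v by rewrite -AA -mulmxA dot_mulmxr sA -e.
by have := hl w; rewrite /qform mulmxBl dotBr mul_scalar_mx dotZr subr_ge0 e3.
Qed.

(** For [mu] far away the quadratic form is large unless the observation is far from [mu0] too. A
    tangent line replaces the squared distance, so one integrable function, affine in the distance
    of the observation, majorizes all far parameters. *)
Lemma contrast_far lm lp : 0 < lm -> 0 < lp -> exists rho F, [/\ L1 Q F, L1 Q (fun x => F x ^+ 2), Ex Q F < 0 &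
  forall th, covset lm lp (Sigma_of th) -> rho <= enorm (usubmx th) -> forall x, contrast th x <= F x].
Proof.
move=> lm0 lp0; pose b := d%:R * (`|ln lm| + `|ln lp|).
pose c := (2 * lp)^-1; have c0 : 0 < c by rewrite invr_gt0 mulr_gt0.
pose A := d%:R * b / 2 + c * (1 + 2 * ln 4).
pose g (x : T) := gdist mu0 (retr x).
have g0 x : 0 <= g x by apply: gdist_ge0 => //; exact: retr_hyp.
have mg : measurable_fun setT g by apply: measurable_continuous_borel; exact: cont_gdist_retr.
have gN x : `|g x| <= 1 * growth mu0 x.
  by rewrite mul1r ger0_norm// /growth -/(g x); have := g0 x; nra.
have [Lg _] := L1_of_growth hmu0 hS0 lawQ mg gN.
have [C C0 hC] := logdens_bound hmu0 hmu0 hS0.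
have mm := measurable_mdens S0 hmu0.
have [Lm _] := L1_of_growth hmu0 hS0 lawQ mm hC.
(* Solves the equation that the mean of [F] be -1. *)
pose rho := (A + 2 * c * Ex Q g - Ex Q (mdens mu0 S0) + 1) / (2 * c).
pose F x := A - 2 * c * rho + (2 * c * g x - mdens mu0 S0 x).
have LF1 : L1 Q (fun x => 2 * c * g x - mdens mu0 S0 x) by apply: L1B => //; exact: L1Z.
have mF : measurable_fun setT F by apply: measurable_funD => //; exact: L1_meas LF1.
have FN x : `|F x| <= (`|A - 2 * c * rho| + 2 * c + C) * growth mu0 x.
  have -> : (`|A - 2 * c * rho| + 2 * c + C) * growth mu0 x = `|A - 2 * c * rho| * growth mu0 x + (2 * c + C) * growth mu0 x by ring.
  apply: le_trans (ler_normD _ _) _; apply: lerD.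
    by rewrite ler_peMr// growth_ge1.
  have -> : (2 * c + C) * growth mu0 x = 2 * c * growth mu0 x + C * growth mu0 x by ring.
  apply: le_trans (ler_normB _ _) _; apply: lerD => //.
  rewrite normrM (@ger0_norm _ (2 * c)) ?mulr_ge0 ?(ltW c0)// ler_wpM2l ?mulr_ge0 ?(ltW c0)//.
  by have := gN x; rewrite mul1r.
have [LF LF2] := L1_of_growth hmu0 hS0 lawQ mF FN.
exists rho, F; split=> //.
  rewrite /F ExD//; last exact: L1_cst.
  rewrite Ex_cst ExB//; last exact: L1Z.
  rewrite ExZ// /rho mulrC divfK ?gt_eqF ?mulr_gt0//.
  by move: (Ex Q g) (Ex Q (mdens mu0 S0)) => a a'; lra.
move=> th [hS hlm hlp] hrho x; rewrite /contrast /F.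
have hx := retr_hyp x; have hmu := mu_of_hyp hmu0 hJ th.
have := logdens_le (Sigma_of th) hmu hx; rewrite logdens_self//.
set mu := mu_of mu0 J th in hmu *; set m := logdens mu _ _.
have det_b : - 2^-1 * ln (\det (Sigma_of th)) <= d%:R * b / 2.
  rewrite /Sigma_of det_expmx ?mat_sym// expRK.
  have hb i : `|mat (dsubmx th) i i| <= b by apply: expmx_bound; rewrite ?mat_sym.
  have : `|\tr (mat (dsubmx th))| <= d%:R * b.
    apply: le_trans (ler_norm_sum _ _ _) _; rewrite -[d in d%:R * b]card_ord mulr_natl -sumr_const.
    by apply: ler_sum => i _.
  by rewrite ler_norml => /andP[h _]; lra.
have q_b := loewner_invmx (Tmap mu (retr x)) hS hlp.
rewrite -sqr_enorm enorm_Tmap// -/(gdist mu (retr x)) in q_b.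
have g1 := gdist_ge0 hmu hx; set gm := gdist mu (retr x) in q_b g1.
have rE : gdist mu0 mu = enorm (usubmx th).
  by rewrite /gdist lform_mu_of// coshK// enorm_ge0.
have tri : enorm (usubmx th) <= g x + gm + ln 4.
  apply: cosh_mul_le => //; rewrite -(lform_mu_of hmu0 hJ th) -/mu.
  have ch (y z : E) : hyperboloid y -> hyperboloid z -> - lform y z = cosh (gdist y z).
    by move=> hy hz; rewrite /gdist acoshK//; exact: hyp_lform_ge1.
  have := hyp_triangle hx hmu0 hmu; rewrite (lformC (retr x) mu0) (lformC (retr x) mu).
  by rewrite (ch _ _ hmu0 hx) (ch _ _ hmu hx).
have cq : c * gm ^+ 2 <= 2^-1 * qform (invmx (Sigma_of th)) (Tmap mu (retr x)).
  rewrite /c invfM -mulrA ler_wpM2l ?invr_ge0// mulrC ler_pdivrMr// mulrC; exact: q_b.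
rewrite /mdens -/m /A; move: (logdens mu0 S0 (retr x)) det_b cq => m0 det_b cq hm.
have k1 : c * (2 * (rho - g x - ln 4) - 1) <= c * gm ^+ 2.
  rewrite ler_wpM2l ?(ltW c0)//; have := sqr_ge0 (gm - 1); lra.
move: k1 hm det_b cq; move: (qform _ _) (ln (\det _)) (gm ^+ 2) => q l gm2 k1 hm det_b cq; lra.
Qed.

Lemma contrast_th0 th : mu_of mu0 J th = mu0 -> Sigma_of th = S0 -> th = theta0 S0.
Proof.
move=> hm hS; have [sl el] := logmxP hS0.
have eB : mat (dsubmx th) = logmx S0 by apply: expmx_inj; rewrite ?mat_sym// el -hS.
have := lform_mu_of hmu0 hJ th; rewrite hm (hyp_self hmu0) opprK -cosh0 => /cosh_inj.
move=> /(_ (lexx _) (enorm_ge0 _)) /esym/eqP; rewrite enorm_eq0 => /eqP e.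
by rewrite -[th]vsubmxK e /theta0 -eB matK.
Qed.

Section Consistency.
Context {dd : measure_display} {Omega : measurableType dd}.
Variables (P : probability Omega R) (X : nat -> Omega -> T).
Hypothesis mX : forall i, measurable_fun setT (X i).
Hypothesis lawX : forall i A, measurable A -> P (X i @^-1` A) = Q A.
Hypothesis indX : forall (F : {fset nat}) (A : nat -> set T), (forall i, measurable (A i)) ->
  P (\bigcap_(i in [set` F]) (X i @^-1` A i)) = (\prod_(i <- F) P (X i @^-1` A i))%E.

(** The event that some parameter of [A] does at least as well as the true one. It is a union over a
    possibly uncountable set, so it is treated only through [small]. *)
Definition beaten (A : set Theta) (m : nat) := [set w | exists2 th, A th & 0 <= \sum_(i < m) contrast th (X i w)].

Lemma small_beaten (A : set Theta) F : L1 Q F -> L1 Q (fun x => F x ^+ 2) -> Ex Q F < 0 ->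
  (forall th, A th -> forall x, contrast th x <= F x) -> small P (beaten A).
Proof.
move=> LF LF2 EF AF; apply: small_sub (lln_neg mX lawX indX LF LF2 EF).
near=> m => w /= [th Ath h]; apply: le_trans h _; apply: ler_sum => i _; exact: AF.
Unshelve. all: end_near. Qed.

Lemma contrast_wald th1 : th1 <> theta0 S0 -> exists2 U, nbhs th1 U & small P (beaten U).
Proof.
move=> ne; have [C [s0 [C0 s00 hs]]] := contrast_local th1.
have EN := Ex_ge0 Q (f := growth mu0) (fun x => le_trans ler01 (growth_ge1 hmu0 x)).
have ED : Ex Q (contrast th1) < 0.
  apply: (kullback_leibler hmu0 hS0 lawQ) => //; [exact: mu_of_hyp|exact: Sigma_of_spd|].
  by apply/eqP => -[h1 h2]; apply: ne; exact: contrast_th0.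
pose k := C * (Ex Q (growth mu0) + 1) + 1; have k0 : 0 < k by rewrite ltr_wpDl// mulr_ge0// addr_ge0.
(* The neighbourhood is so small that the mean of the added envelope is at most half of the gap, and
   the upper bound keeps a negative mean. *)
pose s := Num.min s0 (- Ex Q (contrast th1) / (2 * k)).
have s1 : 0 < s by rewrite lt_min s00 divr_gt0 ?oppr_gt0 ?mulr_gt0.
have ss0 : s <= s0 by rewrite ge_min lexx.
exists [set th | forall x, contrast th x <= contrast th1 x + C * s * growth mu0 x]; first exact: hs.
have [C' hC'] := contrast_bound th1.
have mF : measurable_fun setT (fun x => contrast th1 x + C * s * growth mu0 x).
  by apply: measurable_funD; [exact: measurable_contrast|apply: measurable_funM => //; exact: measurable_growth].
have [LF LF2] : L1 Q (fun x => contrast th1 x + C * s * growth mu0 x) /\ L1 Q (fun x => (contrast th1 x + C * s * growth mu0 x) ^+ 2).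
  apply: (L1_of_growth hmu0 hS0 lawQ (C := C' + C * s)) => // x.
  have gr1 := le_trans ler01 (growth_ge1 hmu0 x).
  rewrite mulrDl; apply: le_trans (ler_normD _ _) _; apply: lerD => //.
  by rewrite ger0_norm//; apply: mulr_ge0 => //; rewrite mulr_ge0// ltW.
apply: small_beaten LF LF2 _ _ => // .
have [LD _] := L1_of_growth hmu0 hS0 lawQ (measurable_contrast th1) hC'.
have LG : L1 Q (growth mu0) by have := L1_growth_pow hmu0 hS0 lawQ 1; under eq_fun do rewrite expr1.
rewrite ExD//; last exact: L1Z.
rewrite ExZ//; have : s * (2 * k) <= - Ex Q (contrast th1) by rewrite -ler_pdivlMr ?mulr_gt0// ge_min lexx orbT.
have : C * s * Ex Q (growth mu0) <= s * k.
  rewrite /k; have : 0 <= C * s by rewrite mulr_ge0// ltW.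
  by move: (ltW s1) EN; move: (Ex Q (growth mu0)) => e; nra.
by move: (mulr_gt0 s1 k0); lra.
Qed.

Theorem consistency lm lp (thh : nat -> Omega -> Theta) : 0 < lm -> 0 < lp ->
  (forall m w, (0 < m)%N -> covset lm lp (Sigma_of (thh m w))) ->
  (forall m w, (0 < m)%N -> 0 <= \sum_(i < m) contrast (thh m w) (X i w)) ->
  forall eta, 0 < eta -> small P (fun m => [set w | eta <= nrm1 (thh m w - theta0 S0)]).
Proof.
move=> lm0 lp0 hcov hmax eta eta0.
have [rho [F [LF LF2 EF hF]]] := contrast_far lm0 lp0.
(* Outside the far region [rho] bounds the location coordinates, and the covariance constraint
   bounds the logarithmic ones, so the estimator lies in a compact box. *)
pose b : R := Num.max rho (d%:R * (`|ln lm| + `|ln lp|)).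
pose box := [set v : Theta | forall i, `|v i 0| <= b].
pose K := box `&` [set v : Theta | eta <= nrm1 (v - theta0 S0)].
have cbox : compact box.
  have -> : box = trmx @` [set v : 'rV[R]_p | forall i, `[- b, b]%classic (v ord0 i)].
    apply/seteqP; split=> [v hv|_ [v hv <-] i]; last first.
      by rewrite mxE ler_norml; have := hv i; rewrite /= in_itv.
    exists v^T; last exact: trmxK.
    by move=> i; rewrite mxE /= in_itv /= -ler_norml.
  apply: continuous_compact; last by apply: (@rV_compact _ _ (fun=> `[(- b), b]%classic)) => i; exact: segment_compact.
  apply: continuous_subspaceT; apply: continuous_mx => i j; under eq_fun do rewrite mxE; exact: coord_continuous.
have cK : compact K.
  rewrite /K setIC; apply: (subclosed_compact _ cbox); last exact: subIsetr.
  apply: closedI; last exact: compact_closed cbox.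
  have cn : continuous (fun v : Theta => nrm1 (v - theta0 S0)).
    apply: (@cont_comp _ _ _ (fun v : Theta => v - theta0 S0)); last exact: cont_nrm1.
    by apply: cont_addv; [exact: cont_id|exact: cont_cstT].
  by apply: (closed_comp _ (@closed_ge _ eta)) => v _; exact: cn.
have sK : small P (beaten K).
  apply: (compact_ind (P := fun A => small P (beaten A)) cK).
  - by apply: (small_sub (B := fun=> set0)) => [|t t0]; near=> m; [move=> w [th []]|exists set0; rewrite /Pr measure0; split=> //; exact: ltW].
  - by move=> A B AB; apply: small_sub; near=> m => w [th /AB Bth h]; exists th.
  - move=> A B sA sB; apply: small_sub (small_U sA sB); near=> m => w [th [Ath|Bth] h]; by [left; exists th|right; exists th].
  - by move=> th [_ hth]; apply: contrast_wald => e; move: hth; rewrite /= e subrr nrm10 leNgt eta0.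
have sF : small P (beaten [set th | covset lm lp (Sigma_of th) /\ rho <= enorm (usubmx th)]).
  by apply: small_beaten LF LF2 EF _ => th [h1 h2]; exact: hF.
apply: small_sub (small_U sF sK); near=> m => w /= hw.
have m0 : (0 < m)%N by near: m; exists 1%N.
have hc := hcov m w m0; have hm := hmax m w m0.
have [h|h] := leP rho (enorm (usubmx (thh m w))); first by left; exists (thh m w).
right; exists (thh m w) => //; split=> // i; rewrite /b.
rewrite -[thh m w]vsubmxK; case: (split_ordP i) => j ->.
  by rewrite col_mxEu le_max; apply/orP; left; apply: le_trans (ltW h); exact: ler_coord_enorm.
rewrite col_mxEd le_max; apply/orP; right.
have [_ hl hu] := hc; rewrite -[dsubmx _]matK mxE; apply: expmx_bound => //; exact: mat_sym.
Unshelve. all: end_near. Qed.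

End Consistency.
End Wald.

(** * Efficient score and asymptotic normality *)

Section EfficientInformation.
Context {R : realType} {d k : nat}.
Variable I : 'M[R]_(d + k).
Hypothesis hI : spd I.
Let A := ulsubmx I.
Let B := ursubmx I.
Let C := dlsubmx I.
Let D := drsubmx I.
Let S := A - B *m invmx D *m C.

Lemma blockE (u : 'cV[R]_d) (v : 'cV[R]_k) : I *m col_mx u v = col_mx (A *m u + B *m v) (C *m u + D *m v).
Proof. by rewrite -{1}[I]submxK mul_block_col. Qed.

Lemma dot_col_mx (u u' : 'cV[R]_d) (v v' : 'cV[R]_k) : dot (col_mx u v) (col_mx u' v') = dot u u' + dot v v'.
Proof.
rewrite /dot big_split_ord /=; congr (_ + _); apply: eq_bigr => i _; first by rewrite !col_mxEu.
by rewrite !col_mxEd.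
Qed.

Lemma block_trmx : [/\ A^T = A, B^T = C & D^T = D].
Proof.
have [sI _] := hI; rewrite /A /B /C /D; split.
- by rewrite trmx_ulsub sI.
- by rewrite trmx_ursub sI.
- by rewrite trmx_drsub sI.
Qed.

Lemma spd_D : spd D.
Proof.
have [_ _ sD] := block_trmx; split=> // v v0.
have := hI.2 (col_mx 0 v); rewrite col_mx_eq0 negb_and v0 orbT => /(_ isT).
by rewrite /qform blockE !mulmx0 !add0r dot_col_mx dot0l add0r.
Qed.

(** The Schur complement is the form [I] restricted to vectors whose lower block cancels the lower
    block of the image; positivity is inherited. *)
Lemma schur_qform (u : 'cV[R]_d) : qform S u = qform I (col_mx u (- (invmx D *m C *m u))).
Proof.
have uD := spd_unitmx spd_D.
rewrite /qform blockE dot_col_mx !mulmxN -[invmx D *m C *m u]mulmxA mulKVmx// subrr dot0r addr0.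
by rewrite /S mulmxBl !mulmxA.
Qed.

Lemma spd_schur : spd S.
Proof.
have [sA sB sD] := block_trmx; have sC : C^T = B by rewrite -sB trmxK.
split=> [|u u0]; first by rewrite /S linearB /= !trmx_mul trmx_inv sA sB sC sD mulmxA.
by rewrite schur_qform; apply: hI.2; rewrite col_mx_eq0 negb_and u0.
Qed.

(** Eliminating the lower block from [I *m z = s] leaves the Schur complement acting on the upper
    one. With [s] the full score, the bracket is the efficient score. *)
Lemma usubmx_invmx (s : 'cV[R]_(d + k)) :
  usubmx (invmx I *m s) = invmx S *m (usubmx s - B *m invmx D *m dsubmx s).
Proof.
have uI := spd_unitmx hI; have uD := spd_unitmx spd_D; have uS := spd_unitmx spd_schur.
set z := invmx I *m s; have e : I *m z = s by rewrite mulKVmx.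
have := blockE (usubmx z) (dsubmx z); rewrite vsubmxK e -{1}[s]vsubmxK => /eq_col_mx[e1 e2].
rewrite e1 e2 mulmxDr [B *m invmx D *m (D *m _)]mulmxA mulmxKV// opprD addrACA subrr addr0.
by rewrite [B *m invmx D *m (C *m _)]mulmxA -mulmxBl mulKmx.
Qed.

Lemma usubmx_invmx_col (h : 'cV[R]_d) : usubmx (invmx I *m col_mx h 0) = invmx S *m h.
Proof. by rewrite usubmx_invmx col_mxKu col_mxKd mulmx0 subr0. Qed.

End EfficientInformation.

(** * Score and Fisher information as expansion coefficients *)

Section ScoreOfExpansion.
Context {R : realType} {p : nat}.
Local Notation V := 'cV[R]_p.

(** The bridge between expansions and the derivatives in the definition of [score]: along a basis
    vector the difference quotient differs from [a i 0] by at most a constant times the step. *)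
Lemma derive_of_expansion (f : V -> R) (th a : V) (q : 'M[R]_p) (de N : R) (i : 'I_p) : 0 < de ->
  (forall h, nrm1 h <= de -> `|f (th + h) - f th - (dot a h + qform q h)| <= N * nrm1 h ^+ 3) ->
  'D_(delta_mx i 0) f th = a i 0.
Proof.
move=> de0 hf; apply: cvg_lim; first exact: Rhausdorff.
apply/cvgrPdist_le => e e0; pose c := `|q i i| + `|N| + 1.
have c0 : 0 < c by rewrite ltr_wpDl// addr_ge0.
have r0 : 0 < Num.min de (Num.min 1 (e / c)) by rewrite !lt_min de0 ltr01 divr_gt0.
near=> t; have t0 : t != 0 by near: t; exact: nbhs_dnbhs_neq.
have : `|t| < Num.min de (Num.min 1 (e / c)).
  by near: t; exact: dnbhs0_lt.
rewrite !lt_min => /and3P[tde t1 tec].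
have nt : nrm1 (t *: delta_mx i 0 : V) = `|t| by rewrite nrm1Z nrm1_delta mulr1.
have := hf (t *: delta_mx i 0); rewrite nt => /(_ (ltW tde)).
rewrite dotZr dot_delta qform_scale.
have -> : qform q (delta_mx i 0) = q i i by rewrite /qform qform_delta.
rewrite /= [t *: _ + th]addrC; set X := f (th + _) - f th => h.
have -> : a i 0 - t^-1 *: X = - (t^-1 * (X - (t * a i 0 + t ^+ 2 * q i i))) + - (t * q i i).
  by rewrite /GRing.scale /=; field.
have tn : 0 < `|t| by rewrite normr_gt0.
apply: le_trans (ler_normD _ _) _; rewrite !normrN !normrM normfV.
apply: (@le_trans _ _ (`|t| * c)); last by rewrite -ler_pdivlMr// ltW.
have h1 : `|t|^-1 * `|X - (t * a i 0 + t ^+ 2 * q i i)| <= `|t| * `|N|.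
  rewrite ler_pdivrMl//; apply: le_trans h _; apply: (@le_trans _ _ (`|N| * `|t| ^+ 3)).
    by rewrite ler_wpM2r ?exprn_ge0// ler_norm.
  have : `|t| ^+ 2 * (`|N| * `|t|) <= `|t| ^+ 2 * (`|N| * 1).
    by rewrite ler_wpM2l ?exprn_ge0// ler_wpM2l// ltW.
  by rewrite mulr1 !exprS expr0 !mulr1; move: `|N| `|t| => x y; lra.
by rewrite /c !mulrDr mulr1; have := ltW tn; lra.
Unshelve. all: end_near. Qed.

End ScoreOfExpansion.

Section ModelScore.
Context {R : realType} {n : nat}.
Local Notation d := n.+1.
Local Notation E := 'cV[R]_(1 + d).
Local Notation T := (@borel_mx R (1 + d) 1).
Local Notation p := (d + vech_dim d)%N.
Local Notation Theta := 'cV[R]_p.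
Variables (mu0 : E) (S0 : 'M[R]_d) (Q : probability T R) (J : {linear 'cV[R]_d -> E}).
Hypotheses (hmu0 : hyperboloid mu0) (hS0 : spd S0) (hJ : tangent_isometry mu0 J).
Hypothesis lawQ : forall A : set T, measurable A -> hwn mu0 S0 A = Q A.
Let th0 : Theta := theta0 S0.

Lemma usubmx_theta0 : usubmx th0 = 0.
Proof. by rewrite col_mxKu. Qed.

Lemma mu_of_theta0 : mu_of mu0 J th0 = mu0.
Proof. exact: (mu_of_th0 hmu0 hJ usubmx_theta0). Qed.

Lemma Sigma_of_theta0 : Sigma_of th0 = S0.
Proof. by have [sl el] := logmxP hS0; rewrite /Sigma_of col_mxKd vechK. Qed.

Lemma contrast_theta0 x : contrast mu0 S0 J th0 x = 0.
Proof. by rewrite /contrast mu_of_theta0 Sigma_of_theta0 subrr. Qed.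

Lemma contrastE th (x : E) : hyperboloid x ->
  contrast mu0 S0 J th x = logdens (mu_of mu0 J th) (Sigma_of th) x - logdens mu0 S0 x.
Proof. by move=> hx; rewrite /contrast /mdens retrE. Qed.

Lemma contrast_coeffs : exists de C a q, [/\ 0 < de, de <= 1, 0 < C &
  coeffs (fun x => C * growth mu0 x) de (fun h => contrast mu0 S0 J (th0 + h)) a q].
Proof.
have [de [C [de0 de1 C0 hj]]] := logdens_jet hmu0 hJ usubmx_theta0.
have C1 : 0 < C + 1 by rewrite ltr_wpDl.
have g0 x : 0 <= growth mu0 x by apply: le_trans ler01 (growth_ge1 hmu0 x).
have jD x : jet de ((C + 1) * growth mu0 x) (fun h => contrast mu0 S0 J (th0 + h) x).
  have hx := retr_hyp x; have := jet_sub (ltW de0) (hj (retr x) hx).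
  rewrite addr0 mu_of_theta0 Sigma_of_theta0; apply: jet_le => //.
  by apply: (ler_wpM2r (g0 x)); rewrite lerDl.
have N0 x : 0 <= (C + 1) * growth mu0 x by rewrite mulr_ge0// ltW.
have mD h := measurable_contrast S0 hmu0 hJ (th0 + h).
have D0 x : contrast mu0 S0 J (th0 + 0) x = 0 by rewrite addr0 contrast_theta0.
by have [a [q haq]] := coeffs_ex de0 N0 mD D0 jD; exists de, (C + 1), a, q.
Qed.

Section Coefficients.
Variables (de C : R) (a : T -> Theta) (q : T -> 'M[R]_p).
Hypotheses (de0 : 0 < de) (de1 : de <= 1) (C0 : 0 < C).
Hypothesis haq : coeffs (fun x => C * growth mu0 x) de (fun h => contrast mu0 S0 J (th0 + h)) a q.

Lemma score_coeff (x : E) : hyperboloid x -> score mu0 J th0 x = a x.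
Proof.
move=> hx; apply/colP => i; rewrite mxE; have [_ hD] := haq.
apply: (@derive_of_expansion R p (fun th => logdens (mu_of mu0 J th) (Sigma_of th) x) th0 (a x) (q x) de (C * growth mu0 x) i de0) => h hh.
rewrite mu_of_theta0 Sigma_of_theta0 -(contrastE (th0 + h) hx); exact: hD.
Qed.

Lemma L1_coeff_mul i j : L1 Q (fun x => a x i 0 * a x j 0).
Proof.
apply: (L1_le _ (L1Z (C ^+ 2) (L1_growth_pow hmu0 hS0 lawQ 2))) => [|x].
  by apply: measurable_funM; case: haq => -[].
by rewrite normrM -exprMn expr2 ler_pM//; case: haq => -[].
Qed.

Lemma fisher_coeff i j : fisher mu0 J th0 i j = Ex Q (fun x => a x i 0 * a x j 0).
Proof.
rewrite mxE mu_of_theta0 Sigma_of_theta0 unlock.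
rewrite -(Ex_transfer (measurable_hwn S0 hmu0) (lawU lawQ) (L1_coeff_mul i j)).
congr fine; apply: eq_integral => t _ /=.
by rewrite score_coeff//; exact: hwn_hyp.
Qed.

Lemma L1_exp_coeff : exists2 k0, 0 < k0 & L1 Q (fun x => expR (k0 * (C * growth mu0 x))).
Proof.
have [k0 k0p Lk] := L1_growth hmu0 hS0 lawQ; exists (k0 / C); first by rewrite divr_gt0.
by under eq_fun do rewrite mulrA divfK ?gt_eqF//.
Qed.

Lemma mean_ratio h : Ex Q (fun x => expR (contrast mu0 S0 J (th0 + h) x)) = 1.
Proof. by have [_ ->] := likelihood_ratio hmu0 hS0 lawQ (mu_of_hyp hmu0 hJ (th0 + h)) (Sigma_of_spd (th0 + h)). Qed.

End Coefficients.

(** Carries the interiority of the true covariance into the chart: a whole ball of increments is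
    admissible, so the estimator can be compared with the linearized one. *)
Lemma Sigma_of_near (A : set 'M[R]_d) : nbhs S0 A ->
  exists2 r : R, 0 < r & forall h, nrm1 h <= r -> A (Sigma_of (th0 + h)).
Proof.
(* The available expansion is that of the inverse covariance, so it is used at the negated parameter
   and increment. *)
move=> nA; have SE (k : Theta) : expmx (- mat (dsubmx (- th0 + - k))) = Sigma_of (th0 + k).
  rewrite /Sigma_of -opprD linearN; congr expmx; apply/matrixP => i j; rewrite !mxE -sumrN.
  by apply: eq_bigr => l _; rewrite !mxE opprK.
have lim : Sigma_of (th0 + h) @[h --> (0 : Theta)] --> S0.
  apply: (@cvg_mx R _ _ (nbhs_filter (0 : Theta))) => i j; have [de [N [de0 de1 hN]]] := ujet_exp (- th0) i j.
  have jN := hN mu0 hmu0; have N0 := jet_ge0 jN.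
  apply/cvgrPdist_le => e e0; pose r := Num.min de (e / (3 * N + 1)).
  have k0 : 0 < 3 * N + 1 by rewrite ltr_wpDl// mulr_ge0.
  have r0 : 0 < r by rewrite lt_min de0 divr_gt0.
  have cn : nrm1 h @[h --> (0 : Theta)] --> (0 : R) by have := @cont_nrm1 R p 0; rewrite /continuous_at nrm10.
  have /cvgrPdist_lt /(_ r r0) := cn.
  apply: filterS => h /=; rewrite sub0r normrN (ger0_norm (nrm1_ge0 _)) lt_min => /andP[h1 h2].
  have d01 : 0 <= de <= 1 by rewrite (ltW de0).
  have nh : nrm1 (- h) <= de by rewrite nrm1N ltW.
  have := jet_lip d01 jN nh; rewrite SE nrm1N.
  rewrite -{1}oppr0 SE addr0 Sigma_of_theta0 distrC => /le_trans; apply.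
  apply: (@le_trans _ _ ((3 * N + 1) * nrm1 h)); first by rewrite ler_wpM2r ?nrm1_ge0// lerDl.
  by rewrite mulrC -ler_pdivlMr// ltW.
have /nbhs_nrm1 [r r0 hr] : nbhs (0 : Theta) [set h | A (Sigma_of (th0 + h))] by exact: lim.
exists (r / 2) => [|h hh]; first by rewrite divr_gt0.
by apply: hr; rewrite sub0r nrm1N (le_lt_trans hh)//; lra.
Qed.

End ModelScore.

(** * Assembly: linear expansion and limit law of the estimator *)

Section AsymptoticNormality.
Context {R : realType} {n : nat}.
Local Notation d := n.+1.
Local Notation E := 'cV[R]_(1 + d).
Local Notation T := (@borel_mx R (1 + d) 1).
Local Notation p := (d + vech_dim d)%N.
Local Notation Theta := 'cV[R]_p.
Variables (lm lp : R) (dd : measure_display) (Omega : measurableType dd) (P : probability Omega R).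
Variables (mu0 : E) (S0 : 'M[R]_d) (J : {linear 'cV[R]_d -> E}) (X : nat -> Omega -> E).
Variables (muhat : nat -> Omega -> E) (Shat : nat -> Omega -> 'M[R]_d).
Hypotheses (hlm : 0 < lm) (hlmp : lm < lp).
Hypotheses (hmu0 : hyperboloid mu0) (hS0 : covset_int lm lp S0) (hJ : tangent_isometry mu0 J).
Hypothesis mX : forall i, random_mx (X i).
Hypothesis hX : forall i w, hyperboloid (X i w).
Hypothesis lawX : forall i, has_law P (X i) (hwn mu0 S0).
Hypothesis indX : mutually_independent P X.
Hypothesis hI : spd (fisher mu0 J (theta0 S0)).
Hypothesis mmu : forall m, (0 < m)%N -> random_mx (muhat m).
Hypothesis hdom : forall m w, (0 < m)%N -> hyperboloid (muhat m w) /\ covset lm lp (Shat m w).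
Hypothesis hmax : forall m w mu S, (0 < m)%N -> hyperboloid mu -> covset lm lp S ->
  loglik X m mu S w <= loglik X m (muhat m w) (Shat m w) w.
Let th0 : Theta := theta0 S0.
Let V := invmx (eff_info mu0 J th0).
Let Y (m : nat) (w : Omega) : 'cV[R]_d := Num.sqrt m%:R *: alpha_of mu0 J (muhat m w).
Let Z (m : nat) (w : Omega) : 'cV[R]_d := V *m ((Num.sqrt m%:R)^-1 *: \sum_(i < m) eff_score mu0 J th0 (X i w)).

Let sS0 : spd S0. Proof. by case: hS0. Qed.
Let Xmx (i : nat) : {mfun Omega >-> T} := mfun_Sub (mem_set (mX i)).
Let Q : probability T R := distribution P (Xmx 0%N).
Let lawQ (A : set T) : measurable A -> hwn mu0 S0 A = Q A.
Proof. by move=> mA; rewrite -(lawX 0 mA). Qed.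
Let lawXQ i (A : set T) : measurable A -> P (X i @^-1` A) = Q A.
Proof. by move=> mA; rewrite -lawQ// -(lawX i mA). Qed.
Let thhat (m : nat) (w : Omega) : Theta := col_mx (alpha_of mu0 J (muhat m w)) (vech (logmx (Shat m w))).

Let mu_of_thhat m w : (0 < m)%N -> mu_of mu0 J (thhat m w) = muhat m w.
Proof. by move=> m0; have [hm _] := hdom w m0; rewrite /mu_of col_mxKu alpha_ofE// Exp_tcoord. Qed.

Let Sigma_of_thhat m w : (0 < m)%N -> Sigma_of (thhat m w) = Shat m w.
Proof.
move=> m0; have [_ [hs _ _]] := hdom w m0; have [sl el] := logmxP hs.
by rewrite /Sigma_of col_mxKd vechK.
Qed.

Let sum_contrast m w th : \sum_(i < m) contrast mu0 S0 J th (X i w) =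
  loglik X m (mu_of mu0 J th) (Sigma_of th) w - loglik X m mu0 S0 w.
Proof. by rewrite /loglik -sumrB; apply: eq_bigr => i _; rewrite contrastE. Qed.

Let covset0 : covset lm lp S0.
Proof. by case: hS0 => hs; rewrite /within /= => /nbhs_singleton; exact. Qed.

Let measurable_Y m : (0 < m)%N -> mvec (Y m).
Proof.
move=> m0; apply: mvecZ => i.
have -> : (fun w => alpha_of mu0 J (muhat m w) i 0) = (fun w => tcoord mu0 J (muhat m w) i 0).
  by apply/funext => w; rewrite alpha_ofE//; case: (hdom w m0).
have mt : measurable_fun setT ((fun x : E => tcoord mu0 J x i 0) : T -> R).
  by apply: measurable_continuous_borel; apply: cont_coord; exact: cont_tcoord.
exact: (measurableT_comp mt (mmu m0)).
Qed.

Theorem linear_expansion_and_normality : is_op1 P (fun m w => Y m w - Z m w) /\ cvg_to_gaussian P Y V.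
Proof.
have [de [C [a [q [de0 de1 C0 haq0]]]]] := contrast_coeffs hmu0 sS0 hJ.
have [k0 k0p LN] := L1_exp_coeff hmu0 sS0 lawQ C0.
pose N x := C * growth mu0 x.
have [D DE] : exists D : Theta -> T -> R, D = fun h => contrast mu0 S0 J (th0 + h) by eexists.
have haq : coeffs N de D a q by rewrite DE.
have mN : measurable_fun setT N by apply: measurable_funM => //; exact: measurable_growth.
have N0 x : 0 <= N x by rewrite mulr_ge0 ?(ltW C0)//; exact: le_trans ler01 (growth_ge1 hmu0 x).
have mD h : measurable_fun setT (D h) by rewrite DE; exact: measurable_contrast.
have D0 x : D 0 x = 0 by rewrite DE addr0 contrast_theta0.
have ED h : Ex Q (fun x => expR (D h x)) = 1 by rewrite DE; exact: (mean_ratio hmu0 sS0 hJ lawQ h).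
have [[ma mq sq aN qN] hD] := haq.
have jD x : jet de (N x) (fun h => D h x).
  by exists 0, (a x), (q x); rewrite normr0; split=> // h hh; rewrite add0r; exact: hD.
have sid := score_identity k0p de0 mN N0 LN mD D0 jD haq de1 (fun h _ => ED h).
pose I := fisher mu0 J (theta0 S0).
have EI i j : Ex Q (fun x => a x i 0 * a x j 0) = I i j.
  by rewrite /I (fisher_coeff hmu0 sS0 hJ lawQ de0 haq0).
(* The true covariance is interior, so maximality over the constraint set implies maximality against
   every parameter of this ball. *)
have [r r0 hr] : exists2 r : R, 0 < r & forall h, nrm1 h <= r -> covset lm lp (Sigma_of (th0 + h)).
  have [_ hn] := hS0; have [r r0 hr] := Sigma_of_near hmu0 sS0 hn.
  by exists r => // h hh; apply: hr => //; exact: Sigma_of_spd.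
pose thh m w := thhat m w - th0.
have thhE m w : th0 + thh m w = thhat m w by rewrite addrC subrK.
have hmx m w h : (0 < m)%N -> nrm1 h <= r -> \sum_(i < m) D h (X i w) <= \sum_(i < m) D (thh m w) (X i w).
  move=> m0 hh.
  have e1 : \sum_(i < m) D h (X i w) =
    loglik X m (mu_of mu0 J (th0 + h)) (Sigma_of (th0 + h)) w - loglik X m mu0 S0 w.
    by rewrite DE; exact: (sum_contrast m w (th0 + h)).
  have e2 : \sum_(i < m) D (thh m w) (X i w) = loglik X m (muhat m w) (Shat m w) w - loglik X m mu0 S0 w.
    rewrite DE -(mu_of_thhat w m0) -(Sigma_of_thhat w m0) -(sum_contrast m w (thhat m w)).
    by apply: eq_bigr => i _; exact: (congr1 (fun th => contrast mu0 S0 J th (X i w)) (thhE m w)).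
  have e3 := hmax w m0 (mu_of_hyp hmu0 hJ (th0 + h)) (hr h hh).
  by rewrite e1 e2 lerD2r.
have hcons eta : 0 < eta -> small P (fun m => [set w | eta <= nrm1 (thh m w)]).
  apply: (consistency hmu0 sS0 hJ lawQ mX lawXQ indX hlm (lt_trans hlm hlmp)) => m w m0.
    by rewrite (Sigma_of_thhat w m0); case: (hdom w m0).
  by rewrite (sum_contrast m w (thhat m w)) (mu_of_thhat w m0) (Sigma_of_thhat w m0) subr_ge0 (hmax w m0).
have lin e (e0 : 0 < e) := linearization mX lawXQ indX k0p de0 mN N0 LN haq (fun h => (sid h).1) (fun h => (sid h).2) hI EI r0 hmx hcons e0.
pose W x := usubmx (invmx I *m a x).
have effE (x : E) : hyperboloid x -> V *m eff_score mu0 J th0 x = W x.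
  by move=> hx; rewrite /W (usubmx_invmx hI) /eff_score (score_coeff hmu0 sS0 hJ de0 haq0 hx).
have ZE m w : Z m w = (Num.sqrt m%:R)^-1 *: \sum_(i < m) W (X i w).
  by rewrite /Z -scalemxAr mulmx_sumr; congr (_ *: _); apply: eq_bigr => i _; exact: effE.
have key m w : usubmx (Num.sqrt m%:R *: thh m w - invmx I *m scoresum (T := T) X a m w) = Y m w - Z m w.
  rewrite linearB /= linearZ /= linearB /= usubmx_theta0 subr0 col_mxKu ZE; congr (_ - _).
  by rewrite /scoresum -scalemxAr linearZ /= mulmx_sumr linear_sum.
have mW : mvec W.
  move=> i; under eq_fun do rewrite mxE; move: (lshift _ i) => k.
  have : mvec (fun x => invmx I *m a x) by exact: mvec_mulmx.
  exact.
have mZ m : mvec (Z m).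
  have -> : Z m = fun w => (Num.sqrt m%:R)^-1 *: \sum_(i < m) W (X i w) by apply/funext => w; exact: ZE.
  apply: mvecZ; apply: (@mvec_sum _ _ _ _ m (fun i w => W (X i w))) => i; exact: (mvec_comp_fun mW (mX i)).
have mYZ m : (0 < m)%N -> mvec (fun w => Y m w - Z m w).
  by move=> m0; apply: mvecD; [exact: measurable_Y|move=> i; under eq_fun do rewrite mxE; apply: measurableT_comp => //; exact: mZ].
have nu (v : Theta) : nrm1 (usubmx v) <= nrm1 v.
  rewrite /nrm1 big_split_ord /= -[leLHS]addr0 lerD ?sumr_ge0//.
  by apply: ler_sum => i _; rewrite mxE.
have small_YZ e : 0 < e -> small P (fun m => [set w | e < nrm1 (Y m w - Z m w)]).
  move=> e0; apply: small_sub (lin e e0); near=> m => w /= h; apply: lt_le_trans h _.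
  by rewrite -key; exact: nu.
split.
  move=> e e0; have sm : small P (fun m => [set w | e < enorm (Y m w - Z m w)]).
    apply: small_sub (small_YZ e e0); near=> m => w /= h; apply: lt_le_trans h _.
    exact: ler_enorm_sum.
  have mA m : (0 < m)%N -> measurable [set w | e < enorm (Y m w - Z m w)].
    move=> m0; apply: measurable_gt; apply: (mvec_comp (mYZ m m0) (f := fun v => enorm v)).
    by apply: cont_enorm; exact: cont_id.
  apply: cvg_EFin; last exact: Pr_small mA sm.
  by near=> m; apply: fin_num_measure; apply: mA; near: m; exists 1%N.
have pV : spd V by apply: spd_invmx; exact: (spd_schur hI).
move=> f cf [M fM].
have clt M' L g : BL M' L g -> Ex P (fun w => g (Z m w)) @[m --> \oo] --> Ex (stdgauss d) (fun t => g (sqrtmx V *m vecof t)).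
  have LN3 := L1_pow k0p mN N0 LN 3.
  pose c : R := \sum_i \sum_j `|invmx I i j|; have c0 : 0 <= c by apply: sumr_ge0 => i _; exact: sumr_ge0.
  have nW x : nrm1 (W x) <= c * p%:R * N x.
    apply: le_trans (nu _) _; apply: le_trans (nrm1_mulmx _ _) _; rewrite -mulrA ler_wpM2l//.
    rewrite /nrm1; apply: (@le_trans _ _ (\sum_(i < p) N x)); first by apply: ler_sum => i _; exact: aN.
    by rewrite sumr_const card_ord mulr_natl.
  have sI : (invmx I)^T = invmx I by case: (spd_invmx hI).
  (* Testing [W] on [h] is testing the full score on [invmx I *m col_mx h 0]. The variance is then
     the upper left block of [invmx I] at [h], which is the inverse efficient information. *)
  have dW x h : dot (W x) h = dot (a x) (invmx I *m col_mx h 0).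
    rewrite dot_mulmxr sI -[RHS](_ : dot (col_mx (W x) (dsubmx (invmx I *m a x))) (col_mx h 0) = _).
      by rewrite dot_col_mx dot0r addr0.
    by rewrite vsubmxK.
  have LW3 : L1 Q (fun x => nrm1 (W x) ^+ 3).
    apply: (L1_le _ (L1Z ((c * p%:R) ^+ 3) LN3)) => [|x].
      by apply: measurable_funX; apply: (mvec_comp mW (f := fun v => nrm1 v)); exact: cont_nrm1.
    rewrite normrX -exprMn (ger0_norm (nrm1_ge0 _)); apply: lerXn2r; rewrite ?nnegrE ?nrm1_ge0//.
    by rewrite mulr_ge0// mulr_ge0.
  move=> hg; have ZE' m : Z m = fun w => (Num.sqrt m%:R)^-1 *: \sum_(i < m) W (X i w) by apply/funext => w; exact: ZE.
  under eq_fun do rewrite ZE'.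
  apply: (clt_BL mX lawXQ indX mW _ _ LW3 (spd_psd pV) _ _ hg) => h.
  - by under eq_fun do rewrite dW; exact: (L1_dota k0p mN N0 LN haq).
  - by under eq_fun do rewrite dW; exact: (L1_dota_sqr k0p mN N0 LN haq).
  - by under eq_fun do rewrite dW; exact: (sid _).1.
  - under eq_fun do rewrite dW.
    rewrite (Ex_dota_sqr k0p mN N0 LN haq EI) /qform mulKVmx ?(spd_unitmx hI)//.
    by rewrite -{1}[invmx I *m col_mx h 0]vsubmxK dot_col_mx dot0r addr0 (usubmx_invmx_col hI) dotC.
have conv : Ex P (fun w => f (Y m w)) @[m --> \oo] --> Ex (stdgauss d) (fun t => f (sqrtmx V *m vecof t)).
  apply: (weak_of_BL measurable_Y (mvec_gauss (sqrtmx V)) _ cf fM) => M' L g hg.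
  apply: (slutsky_BL measurable_Y (fun m _ => mZ m) _ hg (clt _ _ _ hg)) => e e0.
  apply: Pr_small (small_YZ e e0) => m m0; apply: measurable_gt.
  by apply: (mvec_comp (mYZ m m0) (f := fun v => nrm1 v)); exact: cont_nrm1.
have Lg : L1 (stdgauss d) (fun t => f (sqrtmx V *m vecof t)).
  by apply: (@L1_bounded _ _ _ _ _ M) => //; exact: mvec_comp (mvec_gauss (sqrtmx V)) cf.
have -> : 'E_(stdgauss d)[fun t => f (gauss_vec V t)]%E = (Ex (stdgauss d) (fun t => f (sqrtmx V *m vecof t)))%:E.
  by rewrite unlock EFin_Ex.
rewrite unlock; apply: cvg_EFin; last exact: conv.
near=> m; have m0 : (0 < m)%N by near: m; exists 1%N.
have LY : L1 P (fun w => f (Y m w)).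
  by apply: (@L1_bounded _ _ _ _ _ M) => //; exact: mvec_comp (measurable_Y m0) cf.
by rewrite -(EFin_Ex LY).
Unshelve. all: end_near. Qed.

End AsymptoticNormality.

Theorem corollary5p2 (R : realType) (d : nat) (hd : (2 <= d)%N)
  (lm lp : R) (hlm : 0 < lm) (hlmp : lm < lp)
  (dd : measure_display) (Omega : measurableType dd) (P : probability Omega R)
  (mu0 : 'cV[R]_(1 + d)) (Sigma0 : 'M[R]_d)
  (hmu0 : hyperboloid mu0) (hSigma0 : covset_int lm lp Sigma0)
  (J : {linear 'cV[R]_d -> 'cV[R]_(1 + d)}) (hJ : tangent_isometry mu0 J)
  (X : nat -> Omega -> 'cV[R]_(1 + d))
  (hXmeas : forall i, random_mx (X i))
  (hXhyp : forall i w, hyperboloid (X i w))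
  (hXlaw : forall i, has_law P (X i) (hwn mu0 Sigma0))
  (hXindep : mutually_independent P X)
  (hI : spd (fisher mu0 J (theta0 Sigma0)))
  (muhat : nat -> Omega -> 'cV[R]_(1 + d)) (Sigmahat : nat -> Omega -> 'M[R]_d)
  (hmuhat : forall n, (0 < n)%N -> random_mx (muhat n))
  (hSigmahat : forall n, (0 < n)%N -> random_mx (Sigmahat n))
  (hdom : forall n w, (0 < n)%N ->
     hyperboloid (muhat n w) /\ covset lm lp (Sigmahat n w))
  (hmax : forall n w mu Sigma, (0 < n)%N -> hyperboloid mu -> covset lm lp Sigma ->
     loglik X n mu Sigma w <= loglik X n (muhat n w) (Sigmahat n w) w) :
  let th0 := theta0 Sigma0 in
  let V := invmx (eff_info mu0 J th0) in
  let root_n_alphahat := fun (n : nat) (w : Omega) =>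
    Num.sqrt n%:R *: alpha_of mu0 J (muhat n w) in
  is_op1 P (fun n w => root_n_alphahat n w -
    V *m ((Num.sqrt n%:R)^-1 *: \sum_(i < n) eff_score mu0 J th0 (X i w)))
  /\ cvg_to_gaussian P root_n_alphahat V.
Proof.
case: d hd mu0 Sigma0 hmu0 hSigma0 J hJ X hXmeas hXhyp hXlaw hXindep hI muhat Sigmahat hmuhat hSigmahat hdom hmax => [//|n] _.
move=> mu0 S0 hmu0 hS0 J hJ X mX hX lawX indX hI muhat Shat mmu _ hdom hmax.
exact: (linear_expansion_and_normality hlm hlmp hmu0 hS0 hJ mX hX lawX indX hI mmu hdom hmax).
Qed.
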